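(* Let $N\geq2$, $D,d,R,\mu,\nu,\rho>0$ and let $g$ satisfy (KPP$_g$) and (sKPP$_g$). Consider problem (M). For every non-negative, bounded, continuous initial datum $(u_0,v_0)\not\equiv(0,0)$, the solution converges as $t\to+\infty$ (locally uniformly in each domain) to a positive steady state of (M) if and only if $\frac{g'(0)}{D}>\beta_0^2$; otherwise the solution converges to $(0,0)$ uniformly in each domain. Moreover, if $\frac{g'(0)}{D}>\beta_0^2$, and assuming in addition $N\leq 5$ in case $D<d$, there exists an asymptotic speed of propagation $c^*_m>0$ in the $x$ direction, i.e. for every such initial datum with compact support: for all $c>c^*_m$, $\sup_{|x|\geq ct}(u,v)\to(0,0)$ uniformly in $y$, and for all $0<c<c^*_m$, $\sup_{|x|\leq ct}|(u,v)-(U,V)|\to 0$ locally uniformly in $y$, where $(U,V)$ is the positive limiting steady state.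
   Context: Points of $\mathbb{R}^N$ are written $(x,y)$, $x\in\mathbb{R}$, $y\in\mathbb{R}^{N-1}$; $\Omega:=\mathbb{R}\times B_R(0)$, $B_R(0)$ the ball of radius $R$ in $\mathbb{R}^{N-1}$; $\partial_n$ the outward normal derivative to $\Omega$. Problem (M): $u_t-D\Delta u=g(u)$ in $\Omega\times(0,\infty)$, $v_t-d\Delta v=-\rho v$ in $(\mathbb{R}^N\setminus\overline\Omega)\times(0,\infty)$, $D\partial_nu=\nu v-\mu u$, $-d\partial_nv=\mu u-\nu v$ on $\partial\Omega\times(0,\infty)$. (KPP$_g$): $g$ locally Lipschitz, differentiable at $0$, $g(0)=g(1)=0$, $0<g(s)\leq g'(0)s$ on $(0,1)$, $g(s)<0$ for $s>1$; (sKPP$_g$): $g(s)/s$ decreasing on $(0,\infty)$. Let $\tau=(N-3)/2$, $K_\tau$ the modified Bessel function of the second kind, and $\kappa:=\frac{\mu\sqrt{d\rho}K_{\tau+1}(\sqrt{\rho/d}R)}{\nu K_\tau(\sqrt{\rho/d}R)+\sqrt{d\rho}K_{\tau+1}(\sqrt{\rho/d}R)}>0$. $\beta_0^2$ denotes the principal eigenvalue of $-\Delta_y\phi=\beta_0^2\phi$ in $B_R(0)\subset\mathbb{R}^{N-1}$, $D\partial_n\phi+\kappa\phi=0$ on $\partial B_R(0)$. *)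

(* Defs.v *)
From Stdlib Require Import Reals Lra Lia.
Open Scope R_scope.

(** Points of R^k are represented as z : nat -> R whose coordinates of index
    >= k vanish.  In R^N (cylinder problem) coordinate 0 is x and coordinates
    1..N-1 are y.  In R^(N-1) (cross-section ball) coordinates 0..N-2 are y. *)
Definition pt (k : nat) (z : nat -> R) : Prop := forall j, (k <= j)%nat -> z j = 0.

Fixpoint sumk (n : nat) (f : nat -> R) : R :=
  match n with O => 0 | S m => sumk m f + f m end.

Definition rad (a n : nat) (z : nat -> R) : R :=
  sumk n (fun k => if Nat.ltb k a then 0 else z k ^ 2).

Definition dist (n : nat) (z z' : nat -> R) : R := sqrt (sumk n (fun k => (z k - z' k) ^ 2)).

Definition setc (z : nat -> R) (k : nat) (s : R) : nat -> R :=
  fun j => if Nat.eqb j k then s else z j.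

Definition cont_on (n : nat) (S : (nat -> R) -> R -> Prop) (F : (nat -> R) -> R -> R) : Prop :=
  forall z t, S z t -> forall eps, 0 < eps -> exists del, 0 < del /\
    forall z' t', S z' t' -> dist n z z' < del -> Rabs (t' - t) < del ->
      Rabs (F z' t' - F z t) < eps.

Definition contz_on (n : nat) (S : (nat -> R) -> Prop) (f : (nat -> R) -> R) : Prop :=
  forall z, S z -> forall eps, 0 < eps -> exists del, 0 < del /\
    forall z', S z' -> dist n z z' < del -> Rabs (f z' - f z) < eps.

(** Classical solution regularity for w on (O ∪ B) x [0,oo), O open, B its
    boundary: w continuous on closure x [0,oo), bounded on closure x [0,T];
    wt = time derivative, w1 k = d_k w, w2 k = d_k^2 w exist in O x (0,oo);
    wt, w2 continuous there; gradient w1 continuous up to B for t > 0. *)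
Definition classical (n : nat) (O B : (nat -> R) -> Prop) (w : (nat -> R) -> R -> R)
  (wt : (nat -> R) -> R -> R) (w1 w2 : nat -> (nat -> R) -> R -> R) : Prop :=
  cont_on n (fun z t => (O z \/ B z) /\ 0 <= t) w /\
  (forall T, exists M, forall z t, (O z \/ B z) -> 0 <= t <= T -> Rabs (w z t) <= M) /\
  (forall z t, O z -> 0 < t ->
     derivable_pt_lim (fun s => w z s) t (wt z t) /\
     forall k, (k < n)%nat ->
       derivable_pt_lim (fun s => w (setc z k s) t) (z k) (w1 k z t) /\
       derivable_pt_lim (fun s => w1 k (setc z k s) t) (z k) (w2 k z t)) /\
  cont_on n (fun z t => O z /\ 0 < t) wt /\
  (forall k, (k < n)%nat ->
     cont_on n (fun z t => (O z \/ B z) /\ 0 < t) (w1 k) /\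
     cont_on n (fun z t => O z /\ 0 < t) (w2 k)).

Definition lap (n : nat) (w2 : nat -> (nat -> R) -> R -> R) (z : nat -> R) (t : R) : R :=
  sumk n (fun k => w2 k z t).

(** derivative along the outward unit normal of the ball {rad a n z < Rd^2}
    (radial in coordinates a..n-1) *)
Definition dn (a n : nat) (Rd : R) (w1 : nat -> (nat -> R) -> R -> R) (z : nat -> R) (t : R) : R :=
  sumk n (fun k => if Nat.ltb k a then 0 else z k / Rd * w1 k z t).

Definition Om (N : nat) (Rd : R) (z : nat -> R) : Prop := pt N z /\ rad 1 N z < Rd ^ 2.
Definition Ext (N : nat) (Rd : R) (z : nat -> R) : Prop := pt N z /\ Rd ^ 2 < rad 1 N z.
Definition Bd (N : nat) (Rd : R) (z : nat -> R) : Prop := pt N z /\ rad 1 N z = Rd ^ 2.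

Definition KPP (g : R -> R) (gp0 : R) : Prop :=
  (forall a b, exists L, forall s1 s2, a <= s1 <= b -> a <= s2 <= b ->
      Rabs (g s1 - g s2) <= L * Rabs (s1 - s2)) /\
  derivable_pt_lim g 0 gp0 /\
  g 0 = 0 /\ g 1 = 0 /\
  (forall s, 0 < s < 1 -> 0 < g s <= gp0 * s) /\
  (forall s, 1 < s -> g s < 0).

Definition sKPP (g : R -> R) : Prop :=
  forall s1 s2, 0 < s1 -> s1 < s2 -> g s2 / s2 < g s1 / s1.

Definition BesselK_val (tau z k : R) : Prop :=
  forall eps, 0 < eps -> exists M0, forall M, M0 <= M ->
    exists pr : Riemann_integrable (fun t => exp (- z * cosh t) * cosh (tau * t)) 0 M,
      Rabs (RiemannInt pr - k) < eps.

Definition kappa (d rho mu nu K0 K1 : R) : R :=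
  mu * sqrt (d * rho) * K1 / (nu * K0 + sqrt (d * rho) * K1).

Definition Ball (n : nat) (Rd : R) (z : nat -> R) : Prop := pt n z /\ rad 0 n z < Rd ^ 2.
Definition Sph (n : nat) (Rd : R) (z : nat -> R) : Prop := pt n z /\ rad 0 n z = Rd ^ 2.

(** lam is the principal eigenvalue of -Delta phi = lam phi in B_R(0) ⊂ R^n,
    D d_n phi + kappa phi = 0 on the boundary: the eigenvalue admitting an
    eigenfunction positive on the closed ball (classical, C^2 inside, C^1 up
    to the boundary). *)
Definition principal_eig (n : nat) (D Rd kap lam : R) : Prop :=
  exists (phi : (nat -> R) -> R) ph1 ph2,
    classical n (Ball n Rd) (Sph n Rd) (fun z _ => phi z) (fun _ _ => 0) ph1 ph2 /\
    (forall z, Ball n Rd z \/ Sph n Rd z -> 0 < phi z) /\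
    (forall z t, Ball n Rd z -> 0 < t -> - lap n ph2 z t = lam * phi z) /\
    (forall z t, Sph n Rd z -> 0 < t -> D * dn 0 n Rd ph1 z t + kap * phi z = 0).

Definition solM (N : nat) (D d Rd mu nu rho : R) (g : R -> R)
  (u0 v0 : (nat -> R) -> R) (u v : (nat -> R) -> R -> R) : Prop :=
  exists ut u1 u2 vt v1 v2,
    classical N (Om N Rd) (Bd N Rd) u ut u1 u2 /\
    classical N (Ext N Rd) (Bd N Rd) v vt v1 v2 /\
    (forall z t, Om N Rd z -> 0 < t -> ut z t - D * lap N u2 z t = g (u z t)) /\
    (forall z t, Ext N Rd z -> 0 < t -> vt z t - d * lap N v2 z t = - rho * v z t) /\
    (forall z t, Bd N Rd z -> 0 < t ->
        D * dn 1 N Rd u1 z t = nu * v z t - mu * u z t /\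
        - d * dn 1 N Rd v1 z t = mu * u z t - nu * v z t) /\
    (forall z, Om N Rd z \/ Bd N Rd z -> u z 0 = u0 z) /\
    (forall z, Ext N Rd z \/ Bd N Rd z -> v z 0 = v0 z).

Definition pos_ss (N : nat) (D d Rd mu nu rho : R) (g : R -> R) (U V : (nat -> R) -> R) : Prop :=
  solM N D d Rd mu nu rho g U V (fun z _ => U z) (fun z _ => V z) /\
  (forall z, Om N Rd z -> 0 < U z) /\ (forall z, Ext N Rd z -> 0 < V z).

Definition init_ok (N : nat) (Rd : R) (u0 v0 : (nat -> R) -> R) : Prop :=
  contz_on N (fun z => Om N Rd z \/ Bd N Rd z) u0 /\
  contz_on N (fun z => Ext N Rd z \/ Bd N Rd z) v0 /\
  (forall z, Om N Rd z \/ Bd N Rd z -> 0 <= u0 z) /\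
  (forall z, Ext N Rd z \/ Bd N Rd z -> 0 <= v0 z) /\
  (exists M, (forall z, Om N Rd z \/ Bd N Rd z -> u0 z <= M) /\
             (forall z, Ext N Rd z \/ Bd N Rd z -> v0 z <= M)) /\
  ((exists z, (Om N Rd z \/ Bd N Rd z) /\ u0 z <> 0) \/
   (exists z, (Ext N Rd z \/ Bd N Rd z) /\ v0 z <> 0)).

Definition compact_supp (N : nat) (u0 v0 : (nat -> R) -> R) : Prop :=
  exists r, forall z, pt N z -> r ^ 2 < rad 0 N z -> u0 z = 0 /\ v0 z = 0.

Definition conv_loc (N : nat) (Rd : R) (u v : (nat -> R) -> R -> R) (U V : (nat -> R) -> R) : Prop :=
  forall r eps, 0 < eps -> exists T, forall t z, T <= t -> rad 0 N z <= r ^ 2 ->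
    ((Om N Rd z \/ Bd N Rd z) -> Rabs (u z t - U z) < eps) /\
    ((Ext N Rd z \/ Bd N Rd z) -> Rabs (v z t - V z) < eps).

Definition conv0 (N : nat) (Rd : R) (u v : (nat -> R) -> R -> R) : Prop :=
  forall eps, 0 < eps -> exists T, forall t z, T <= t ->
    ((Om N Rd z \/ Bd N Rd z) -> Rabs (u z t) < eps) /\
    ((Ext N Rd z \/ Bd N Rd z) -> Rabs (v z t) < eps).

Definition spread_out (N : nat) (Rd c : R) (u v : (nat -> R) -> R -> R) : Prop :=
  forall eps, 0 < eps -> exists T, forall t z, T <= t -> c * t <= Rabs (z 0%nat) ->
    ((Om N Rd z \/ Bd N Rd z) -> Rabs (u z t) < eps) /\
    ((Ext N Rd z \/ Bd N Rd z) -> Rabs (v z t) < eps).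

Definition spread_in (N : nat) (Rd c : R) (u v : (nat -> R) -> R -> R) (U V : (nat -> R) -> R) : Prop :=
  forall r eps, 0 < eps -> exists T, forall t z, T <= t -> Rabs (z 0%nat) <= c * t ->
    rad 1 N z <= r ^ 2 ->
    ((Om N Rd z \/ Bd N Rd z) -> Rabs (u z t - U z) < eps) /\
    ((Ext N Rd z \/ Bd N Rd z) -> Rabs (v z t - V z) < eps).

(* Main.v *)
Require Import Defs.
From Stdlib Require Import Reals Lra Lia Psatz Classical ClassicalEpsilon FunctionalExtensionality.
From Coquelicot Require Import Coquelicot.
Import Defs.
Open Scope R_scope.

(** Every convergence statement is reduced to a comparison principle for the coupled
    interior/exterior problem with explicit barriers; no existence or regularity theory is used.

    Outside the cylinder a steady state depending on [q = |y|^2] is a multiple of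
    [psi = q^(-tau/2) K_tau(sqrt(rho q / d))], normalized at the boundary. Eliminating it turns the
    exchange conditions into the Robin condition [D d_n u + kappa u = 0]. Inside, the radial
    solutions [h_a] of [-D Delta h = g(h)], [h(0) = a], have a Robin defect [F(a)], continuous in
    [a], with [F(1) = kappa]. Comparing [h_a], or [h_a] multiplied by a growing exponential, with
    the principal eigenfunction shows that [F(a) <= 0] for some small [a] when
    [beta^2 < g'(0)/D], and that [F > 0] on [(0, 1]] otherwise.

    If [F(a) >= 0], the pair given by [h_a] and [psi], slightly enlarged and multiplied by a number
    decreasing slowly to its final value, is a supersolution; letting [a] tend to [0] gives
    extinction. If [F(a) = 0], the same construction localized by a cosine in [x] gives
    subsolutions increasing to [h_a] on any bounded set as soon as the solution is bounded below on
    a large window, so [h_a] attracts every nontrivial solution, uniformly over all solutions that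
    are not small at a given point and time.

    For the speed, fix one solution [u1] with compactly supported datum. By a Harnack-type bound,
    a solution that is at least [delta] at [(x0, t0)] dominates after a fixed delay [C] a multiple
    of [u1] translated to [x0], possibly reflected; since [g(s)/s] decreases, this multiple persists.
    Hence reaching [x1] from [x0] costs at most the time [u1] needs to travel [|x1 - x0|], plus [C],
    and the speed is the supremum of [|x| / (t + C)] over the points where [u1 >= delta]. *)

(** * Compactness and the first touching time *)

(** The domain is unbounded, so compactness has to be manufactured: a small multiple of a growing
    function forces a first touching point to exist, and its weights in the two phases are balanced
    so that the exchange conditions forbid touching on the common boundary. Only the weak sign of a
    boundary derivative is then needed.

    Every barrier needs room for error terms. It comes from the strict decrease of [g(s)/s]: on the
    compact range of a steady profile, a factor bounded away from 1 leaves a uniform gap. Outside,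
    [psi] has no positive lower bound at infinity, so a constant [eps] is added or subtracted; this
    spoils the Robin condition by a multiple of [eps], which is repaired by a term [e * |y|^2]
    inside.

    Uniformity over solutions is what the speed argument consumes: delays may depend on the bound
    [M] and on the level attained, not on the solution. This is why the Harnack bound is
    quantitative. The speed must be fixed before any datum is given, so the reference solution comes
    from a case distinction on whether one exists. *)

Lemma sumk_ext n f g : (forall k, (k < n)%nat -> f k = g k) -> sumk n f = sumk n g.
Proof. induction n; simpl; intros H; auto. rewrite IHn, H; auto. Qed.

Lemma sumk_plus n f g : sumk n (fun k => f k + g k) = sumk n f + sumk n g.
Proof. induction n; simpl; [lra | rewrite IHn; lra]. Qed.

Lemma sumk_scal n c f : sumk n (fun k => c * f k) = c * sumk n f.
Proof. induction n; simpl; [lra | rewrite IHn; lra]. Qed.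

Lemma sumk_le n f g : (forall k, (k < n)%nat -> f k <= g k) -> sumk n f <= sumk n g.
Proof.
  induction n; simpl; intros H; [lra|].
  apply Rplus_le_compat; [apply IHn; intros; apply H; lia | apply H; lia].
Qed.

Lemma sumk_0 n f : (forall k, (k < n)%nat -> f k = 0) -> sumk n f = 0.
Proof. induction n; simpl; intros H; auto. rewrite IHn, H; auto; lra. Qed.

Lemma sumk_nonneg n f : (forall k, (k < n)%nat -> 0 <= f k) -> 0 <= sumk n f.
Proof.
  intros H. rewrite <- (sumk_0 n (fun _ => 0)) by auto. now apply sumk_le.
Qed.

Lemma sumk_term n f j : (forall k, (k < n)%nat -> 0 <= f k) -> (j < n)%nat -> f j <= sumk n f.
Proof.
  induction n; simpl; intros H Hj; [lia|].
  destruct (Nat.eq_dec j n) as [->|].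
  - assert (0 <= sumk n f) by (apply sumk_nonneg; auto). lra.
  - assert (f j <= sumk n f) by (apply IHn; auto; lia). assert (0 <= f n) by auto. lra.
Qed.

Lemma sumk_const n c : sumk n (fun _ => c) = INR n * c.
Proof. induction n; [simpl; lra|]. rewrite S_INR. simpl. rewrite IHn. lra. Qed.

Lemma sumk_shift n f : sumk (S n) f = f 0%nat + sumk n (fun k => f (S k)).
Proof. induction n; simpl in *; [lra | rewrite IHn; lra]. Qed.

Lemma dist_le_sum n z z' : dist n z z' <= sumk n (fun k => Rabs (z k - z' k)).
Proof.
  unfold dist.
  assert (H0 : 0 <= sumk n (fun k => Rabs (z k - z' k)))
    by (apply sumk_nonneg; intros; apply Rabs_pos).
  rewrite <- (sqrt_pow2 _ H0). apply sqrt_le_1_alt. clear H0.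
  induction n; [simpl; lra|]. cbn [sumk].
  set (a := sumk n (fun k => Rabs (z k - z' k))) in *.
  assert (0 <= a) by (apply sumk_nonneg; intros; apply Rabs_pos).
  rewrite <- (pow2_abs (z n - z' n)).
  assert (0 <= Rabs (z n - z' n)) by apply Rabs_pos. nra.
Qed.

(** Together with [coord_le_dist] this lets neighbourhoods be handled coordinatewise, the form in
    which subsequences converge below. *)
Lemma dist_close n del : 0 < del -> exists r, 0 < r /\ forall z z',
  (forall j, (j < n)%nat -> Rabs (z' j - z j) < r) -> dist n z z' < del.
Proof.
  intros Hd. assert (0 < INR n + 1) by (pose proof (pos_INR n); lra).
  exists (del / (INR n + 1)). split; [apply Rdiv_lt_0_compat; lra|].
  intros z z' Hz. eapply Rle_lt_trans; [apply dist_le_sum|].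
  apply Rle_lt_trans with (sumk n (fun _ => del / (INR n + 1))).
  - apply sumk_le. intros k Hk. rewrite Rabs_minus_sym. now apply Rlt_le, Hz.
  - rewrite sumk_const. apply Rmult_lt_reg_r with (INR n + 1); [lra|]. field_simplify; [|lra]. lra.
Qed.

Lemma coord_le_dist n z z' j : (j < n)%nat -> Rabs (z' j - z j) <= dist n z z'.
Proof.
  intros Hj. unfold dist. rewrite Rabs_minus_sym, <- sqrt_Rsqr_abs. apply sqrt_le_1_alt.
  unfold Rsqr. replace ((z j - z' j) * (z j - z' j)) with ((z j - z' j) ^ 2) by ring.
  apply (sumk_term n (fun k => (z k - z' k) ^ 2)); auto. intros; apply pow2_ge_0.
Qed.

Lemma bolzano_weierstrass_1d (u : nat -> R) B : (forall m, Rabs (u m) <= B) ->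
  exists l (phi : nat -> nat), (forall m, (m <= phi m)%nat) /\
    forall eps, 0 < eps -> exists M, forall m, (M <= m)%nat -> Rabs (u (phi m) - l) < eps.
Proof.
  intros Hu.
  destruct (Bolzano_Weierstrass u (fun x => - B <= x <= B)) as [l Hl].
  - apply compact_P3.
  - intros m. specialize (Hu m). apply Rabs_le_between in Hu. lra.
  - assert (Hex : forall m, exists p, (m <= p)%nat /\ Rabs (u p - l) < / (INR m + 1)).
    { intros m. assert (0 < / (INR m + 1)) by (apply RinvN_pos).
      destruct (Hl (disc l (mkposreal _ H)) m) as [p [Hp Hd]].
      - exists (mkposreal _ H). red; auto.
      - exists p. split; auto. }
    exists l, (fun m => proj1_sig (constructive_indefinite_description _ (Hex m))).
    split.
    + intros m. destruct constructive_indefinite_description; simpl. tauto.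
    + intros eps He. destruct (archimed_cor1 eps He) as [M [HM HM0]]. exists M. intros m Hm.
      destruct constructive_indefinite_description as [p [Hp Hp2]]; simpl.
      apply Rlt_trans with (1 := Hp2). apply Rle_lt_trans with (2 := HM).
      apply Rinv_le_contravar; [apply lt_0_INR; lia|]. apply le_INR in Hm. lra.
Qed.

Lemma bolzano_weierstrass n (zs : nat -> nat -> R) B :
  (forall m j, (j < n)%nat -> Rabs (zs m j) <= B) ->
  exists l (phi : nat -> nat), pt n l /\ (forall m, (m <= phi m)%nat) /\
    forall eps, 0 < eps -> exists M, forall m, (M <= m)%nat ->
      forall j, (j < n)%nat -> Rabs (zs (phi m) j - l j) < eps.
Proof.
  induction n; intros Hz.
  - exists (fun _ => 0), (fun m => m). split; [red; auto|]. split; auto.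
    intros. exists 0%nat. intros; lia.
  - destruct IHn as [l [phi [Hl [Hphi Hc]]]]; [intros; apply Hz; lia|].
    destruct (bolzano_weierstrass_1d (fun m => zs (phi m) n) B) as [a [psi [Hpsi Ha]]];
      [intros; apply Hz; lia|].
    exists (fun j => if Nat.eqb j n then a else l j), (fun m => phi (psi m)).
    split; [|split].
    + intros j Hj. destruct (Nat.eqb_spec j n); [lia|]. apply Hl; lia.
    + intros m. specialize (Hpsi m). specialize (Hphi (psi m)). lia.
    + intros eps He. destruct (Ha eps He) as [M1 H1]. destruct (Hc eps He) as [M2 H2].
      exists (max M1 M2). intros m Hm j Hj. destruct (Nat.eqb_spec j n).
      * subst. apply H1; lia.
      * apply H2; [|lia]. specialize (Hpsi m). lia.
Qed.

(** Closedness is phrased coordinatewise and only for points of R^n, which is what a limit from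
    [bolzano_weierstrass] satisfies. *)
Definition closed_in (n : nat) (K : (nat -> R) -> Prop) : Prop :=
  forall z, pt n z ->
    (forall eps, 0 < eps -> exists z', K z' /\ forall j, (j < n)%nat -> Rabs (z' j - z j) < eps) -> K z.

(** A first time with a nonpositive value exists because all nonpositive values occur in one box, so
    bad points at times tending to the infimum have a convergent subsequence. The boolean separates
    the two phases; they are followed simultaneously because the contradiction in one phase may use
    the nonnegativity of the other. *)
Lemma first_touch N (K : bool -> (nat -> R) -> Prop) t0 t1 (F : bool -> (nat -> R) -> R -> R) B :
  (forall i, closed_in N (K i)) ->
  (forall i, cont_on N (fun z t => K i z /\ t0 <= t <= t1) (F i)) ->
  (forall i z t, K i z -> t0 <= t <= t1 -> F i z t <= 0 -> forall j, (j < N)%nat -> Rabs (z j) <= B) ->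
  (forall i z, K i z -> 0 < F i z t0) ->
  (forall i z t, K i z -> t0 < t <= t1 -> F i z t = 0 ->
     (forall i' z' s, K i' z' -> t0 <= s <= t -> 0 <= F i' z' s) -> False) ->
  forall i z t, K i z -> t0 <= t <= t1 -> 0 < F i z t.
Proof.
  intros Hcl Hcont Hbd Hinit Hnt i z t Hz Ht. apply NNPP. intros Hneg.
  set (bad := fun i t => exists z, K i z /\ t0 <= t <= t1 /\ F i z t <= 0).
  (* The infimum of the bad times, obtained as a supremum of their negatives. *)
  destruct (completeness (fun s => exists i, bad i (- s))) as [m [Hub Hlub]].
  { exists (- t0). intros s [i' [z' [_ [H _]]]]. lra. }
  { exists (- t), i, z. rewrite Ropp_involutive. repeat split; auto; lra. }
  set (ts := - m).
  assert (Hlow : forall i' s, bad i' s -> ts <= s).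
  { intros i' s Hb. assert (- s <= m); [|unfold ts; lra]. apply Hub. exists i'.
    now rewrite Ropp_involutive. }
  assert (Hts0 : t0 <= ts <= t1).
  { split.
    - assert (m <= - t0); [|unfold ts; lra]. apply Hlub. intros s [i' [z' [_ [H _]]]]. lra.
    - apply Rle_trans with t; [|lra]. apply (Hlow i). exists z. repeat split; auto; lra. }
  (* One of the two phases has bad times accumulating at [ts]; otherwise both would leave a gap
     above it. *)
  assert (Hi : exists i, forall eps, 0 < eps -> exists s, s < ts + eps /\ bad i s).
  { apply NNPP. intros Hno.
    assert (Hb : forall i, exists eps, 0 < eps /\ forall s, bad i s -> ts + eps <= s).
    { intros b. apply NNPP. intros Hn. apply Hno. exists b. intros eps He.
      apply NNPP. intros Hn2. apply Hn. exists eps. split; auto. intros s Hs.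
      apply Rnot_lt_le. intros Hlt. apply Hn2. now exists s. }
    destruct (Hb true) as [e1 [He1 H1]]. destruct (Hb false) as [e2 [He2 H2]].
    assert (m <= m - Rmin e1 e2).
    { apply Hlub. intros s [[] Hs].
      - apply H1 in Hs. pose proof (Rmin_l e1 e2). unfold ts in *. lra.
      - apply H2 in Hs. pose proof (Rmin_r e1 e2). unfold ts in *. lra. }
    assert (0 < Rmin e1 e2) by (apply Rmin_glb_lt; auto). lra. }
  destruct Hi as [i0 Hi0].
  assert (Hex : forall k : nat, exists zt : (nat -> R) * R, K i0 (fst zt) /\
     t0 <= snd zt <= t1 /\ F i0 (fst zt) (snd zt) <= 0 /\ Rabs (snd zt - ts) < / (INR k + 1)).
  { intros k. destruct (Hi0 (/ (INR k + 1))) as [s [Hs Hb]]; [apply RinvN_pos|].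
    pose proof (Hlow _ _ Hb). destruct Hb as [z' [H1 [H2 H3]]]. exists (z', s). simpl.
    repeat split; auto; try lra. rewrite Rabs_right; lra. }
  set (zt := fun k => proj1_sig (constructive_indefinite_description _ (Hex k))).
  assert (Hzt : forall k, K i0 (fst (zt k)) /\ t0 <= snd (zt k) <= t1 /\
     F i0 (fst (zt k)) (snd (zt k)) <= 0 /\ Rabs (snd (zt k) - ts) < / (INR k + 1)).
  { intros k. unfold zt. now destruct constructive_indefinite_description. }
  clearbody zt.
  destruct (bolzano_weierstrass N (fun k => fst (zt k)) B) as [zl [phi [Hpt [Hphi Hc]]]].
  { intros k j Hj. destruct (Hzt k) as [H1 [H2 [H3 _]]]. eapply Hbd; eauto. }
  assert (HK : K i0 zl).
  { apply Hcl; auto. intros eps He. destruct (Hc eps He) as [M HM].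
    exists (fst (zt (phi M))). split; [apply Hzt|]. now apply HM. }
  assert (Hle : F i0 zl ts <= 0).
  { apply Rnot_lt_le. intros Hpos.
    destruct (Hcont i0 zl ts (conj HK Hts0) (F i0 zl ts) Hpos) as [del [Hdel Hd]].
    destruct (dist_close N del Hdel) as [r [Hr Hrd]].
    destruct (Hc r Hr) as [M HM].
    destruct (archimed_cor1 del Hdel) as [M2 [HM2 HM20]].
    set (k := max M M2). specialize (HM k ltac:(lia)).
    destruct (Hzt (phi k)) as [H1 [H2 [H3 H4]]].
    specialize (Hd (fst (zt (phi k))) (snd (zt (phi k))) (conj H1 H2) (Hrd _ _ HM)).
    assert (Hlt : Rabs (snd (zt (phi k)) - ts) < del).
    { apply Rlt_trans with (1 := H4). apply Rle_lt_trans with (2 := HM2).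
      apply Rinv_le_contravar; [apply lt_0_INR; lia|].
      assert (M2 <= phi k)%nat by (specialize (Hphi k); lia). apply le_INR in H. lra. }
    specialize (Hd Hlt). apply Rabs_lt_between in Hd. lra. }
  assert (Hgt : t0 < ts).
  { destruct (Rle_lt_or_eq_dec t0 ts ltac:(lra)) as [|He]; auto.
    specialize (Hinit i0 zl HK). rewrite He in Hinit. lra. }
  (* Before [ts] the sign is strict; at [ts] itself it follows by continuity from slightly earlier
     times. *)
  assert (Hpre : forall i' z' s, K i' z' -> t0 <= s <= ts -> 0 <= F i' z' s).
  { assert (Hst : forall i' z' s, K i' z' -> t0 <= s < ts -> 0 < F i' z' s).
    { intros i' z' s Hk Hs. apply Rnot_le_lt. intros Hn.
      assert (ts <= s) by (apply (Hlow i'); exists z'; repeat split; auto; lra). lra. }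
    intros i' z' s Hk Hs. destruct (Rle_lt_or_eq_dec s ts) as [|He]; [lra| |].
    - apply Rlt_le, Hst; auto; lra.
    - subst s. apply Rnot_lt_le. intros Hn.
      destruct (Hcont i' z' ts (conj Hk Hts0) (- F i' z' ts)) as [del [Hdel Hd]]; [lra|].
      set (s := Rmax t0 (ts - del / 2)).
      assert (Hs2 : t0 <= s < ts) by (unfold s; split; [apply Rmax_l | apply Rmax_lub_lt; lra]).
      assert (ts - del / 2 <= s) by apply Rmax_r.
      assert (Hdd : dist N z' z' < del).
      { destruct (dist_close N del Hdel) as [r [Hr Hrd]]. apply Hrd. intros.
        rewrite Rminus_diag, Rabs_R0. auto. }
      specialize (Hd z' s ltac:(split; auto; lra) Hdd).
      assert (Rabs (s - ts) < del) by (rewrite Rabs_left; lra). specialize (Hd H0).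
      specialize (Hst i' z' s Hk Hs2). apply Rabs_lt_between in Hd. lra. }
  apply (Hnt i0 zl ts HK); auto; [lra|].
  specialize (Hpre i0 zl ts HK ltac:(lra)). lra.
Qed.

(* A function of [(z, t)] together with candidates for its time derivative and its pure first and
   second space derivatives; [djet] says that they are the derivatives. *)
Record jet := mkjet {
  jw : (nat -> R) -> R -> R;
  jt : (nat -> R) -> R -> R;
  j1 : nat -> (nat -> R) -> R -> R;
  j2 : nat -> (nat -> R) -> R -> R }.

Definition djet (n : nat) (J : jet) z t : Prop :=
  derivable_pt_lim (fun s => jw J z s) t (jt J z t) /\
  forall k, (k < n)%nat ->
    derivable_pt_lim (fun s => jw J (setc z k s) t) (z k) (j1 J k z t) /\
    derivable_pt_lim (fun s => j1 J k (setc z k s) t) (z k) (j2 J k z t).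

Definition reg (n : nat) (O B : (nat -> R) -> Prop) (T0 : R) (J : jet) : Prop :=
  (forall z t, O z -> T0 < t -> djet n J z t) /\
  forall k, (k < n)%nat -> cont_on n (fun z t => (O z \/ B z) /\ T0 < t) (j1 J k).

Definition near (n : nat) (r : R) (z z' : nat -> R) : Prop :=
  pt n z' /\ forall j, (j < n)%nat -> Rabs (z' j - z j) < r.

Lemma setc_same z k : setc z k (z k) = z.
Proof. apply functional_extensionality. intros j. unfold setc. now destruct (Nat.eqb_spec j k); subst. Qed.

Lemma setc_at z k s : setc z k s k = s.
Proof. unfold setc. now rewrite Nat.eqb_refl. Qed.

Lemma setc_other z k s j : j <> k -> setc z k s j = z j.
Proof. unfold setc. intros H. now destruct (Nat.eqb_spec j k). Qed.

Lemma setc_setc z k s s' : setc (setc z k s) k s' = setc z k s'.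
Proof. apply functional_extensionality. intros j. unfold setc. now destruct (Nat.eqb_spec j k). Qed.

Lemma setc_pt n z k s : pt n z -> (k < n)%nat -> pt n (setc z k s).
Proof. intros H Hk j Hj. rewrite setc_other by lia. auto. Qed.

Lemma setc_near n r z k s : 0 < r -> pt n z -> (k < n)%nat -> Rabs (s - z k) < r -> near n r z (setc z k s).
Proof.
  intros Hr H Hk Hs. split; [now apply setc_pt|]. intros j Hj. unfold setc.
  destruct (Nat.eqb_spec j k); subst; auto. now rewrite Rminus_diag, Rabs_R0.
Qed.

(** * Derivative signs at interior and boundary minima *)

Lemma derivable_sign_right f a l r : derivable_pt_lim f a l -> l < 0 -> 0 < r ->
  exists s, 0 < s < r /\ forall h, 0 < h <= s -> f (a + h) < f a.
Proof.
  intros Hd Hl Hr. destruct (Hd (- l)) as [del Hdel]; [lra|].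
  pose proof (cond_pos del) as Hpos.
  exists (Rmin (del / 2) (r / 2)).
  assert (Rmin (del / 2) (r / 2) <= del / 2) by apply Rmin_l.
  assert (Rmin (del / 2) (r / 2) <= r / 2) by apply Rmin_r.
  assert (0 < Rmin (del / 2) (r / 2)) by (apply Rmin_glb_lt; lra).
  split; [lra|]. intros h Hh.
  specialize (Hdel h). assert (Hh0 : h <> 0) by lra.
  specialize (Hdel Hh0 ltac:(rewrite Rabs_right; lra)).
  apply Rabs_lt_between in Hdel. destruct Hdel as [_ Hdel].
  assert ((f (a + h) - f a) / h < 0) by lra.
  assert (f (a + h) - f a < 0); [|lra].
  replace (f (a + h) - f a) with ((f (a + h) - f a) / h * h) by (field; lra). nra.
Qed.

Lemma derivable_pt_lim_reverse f a l :
  derivable_pt_lim f a l -> derivable_pt_lim (fun x => f (- x)) (- a) (- l).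
Proof.
  intros H. apply is_derive_Reals. apply is_derive_Reals in H.
  replace (- l) with (scal (-1) l) by (unfold scal; simpl; unfold mult; simpl; ring).
  apply (is_derive_comp f (fun x => - x)); [now rewrite Ropp_involutive|].
  auto_derive; auto; ring.
Qed.

Lemma derivable_sign_left f a l r : derivable_pt_lim f a l -> 0 < l -> 0 < r ->
  exists s, 0 < s < r /\ forall h, 0 < h <= s -> f (a - h) < f a.
Proof.
  intros Hd Hl Hr.
  destruct (derivable_sign_right (fun x => f (- x)) (- a) (- l) r) as [s [Hs H]]; auto; [|lra|].
  - now apply derivable_pt_lim_reverse.
  - exists s. split; auto. intros h Hh. specialize (H h Hh). simpl in H.
    rewrite Ropp_involutive in H. now replace (- (- a + h)) with (a - h) in H by ring.
Qed.

(** At a minimum the first derivative vanishes, so a negative second derivative would make [f']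
    negative just to the right, and the mean value theorem would produce a smaller value. *)
Lemma second_derivative_min f f' a l r : 0 < r ->
  (forall s, Rabs (s - a) < r -> derivable_pt_lim f s (f' s)) ->
  derivable_pt_lim f' a l -> (forall s, Rabs (s - a) < r -> f a <= f s) -> 0 <= l.
Proof.
  intros Hr Hf Hf' Hmin. apply Rnot_lt_le. intros Hl.
  assert (Ha : Rabs (a - a) < r) by now rewrite Rminus_diag, Rabs_R0.
  assert (H0 : f' a = 0).
  { destruct (Rtotal_order (f' a) 0) as [H|[H|H]]; auto; exfalso.
    - destruct (derivable_sign_right f a (f' a) r) as [s [Hs Hd]]; auto.
      specialize (Hd s ltac:(lra)). specialize (Hmin (a + s)).
      replace (a + s - a) with s in Hmin by ring. rewrite Rabs_right in Hmin; lra.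
    - destruct (derivable_sign_left f a (f' a) r) as [s [Hs Hd]]; auto.
      specialize (Hd s ltac:(lra)). specialize (Hmin (a - s)).
      replace (a - s - a) with (- s) in Hmin by ring. rewrite Rabs_left in Hmin; lra. }
  destruct (derivable_sign_right f' a l r) as [s [Hs Hd]]; auto.
  destruct (MVT_cor2 f f' a (a + s)) as [c [Hc Hc2]]; [lra| |].
  - intros c Hc. apply Hf. rewrite Rabs_right; lra.
  - specialize (Hd (c - a) ltac:(lra)). replace (a + (c - a)) with c in Hd by ring.
    specialize (Hmin (a + s)). replace (a + s - a) with s in Hmin by ring.
    rewrite Rabs_right in Hmin by lra. specialize (Hmin ltac:(lra)). nra.
Qed.

(** In time the comparison is with the past only, which still fixes the sign of [jt]; in space each
    pure second derivative is nonnegative separately. *)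
Lemma interior_touch n J z t t0 r : 0 < r -> t0 < t -> pt n z ->
  (forall z', near n r z z' -> djet n J z' t /\ jw J z t <= jw J z' t) ->
  (forall s, t0 <= s <= t -> jw J z t <= jw J z s) ->
  jt J z t <= 0 /\ 0 <= lap n (j2 J) z t.
Proof.
  intros Hr Ht Hz Hn Hs.
  assert (Hzz : near n r z z)
    by (split; auto; intros; rewrite Rminus_diag, Rabs_R0; auto).
  split.
  - apply Rnot_lt_le. intros Hlt. destruct (Hn z Hzz) as [[Hd _] _].
    destruct (derivable_sign_left _ _ _ (t - t0) Hd Hlt ltac:(lra)) as [s [Hs1 Hs2]].
    specialize (Hs2 s ltac:(lra)). specialize (Hs (t - s) ltac:(lra)). lra.
  - unfold lap. apply sumk_nonneg. intros k Hk.
    apply (second_derivative_min (fun s => jw J (setc z k s) t) (fun s => j1 J k (setc z k s) t) (z k) _ r Hr).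
    + intros s Hsr. destruct (Hn (setc z k s)) as [[_ Hd] _]; [now apply setc_near|].
      destruct (Hd k Hk) as [Hd1 _]. rewrite setc_at in Hd1.
      eapply derivable_pt_lim_ext; [|exact Hd1]. intros x. simpl. now rewrite setc_setc.
    + destruct (Hn z Hzz) as [[_ Hd] _]. now apply Hd.
    + intros s Hsr. rewrite setc_same. apply Hn. now apply setc_near.
Qed.

(** The corners of a staircase from [a] to [b] that changes one coordinate at a time. *)
Definition mix (j : nat) (a b : nat -> R) : nat -> R := fun i => if Nat.ltb i j then b i else a i.

(** Only partial derivatives along the axes are given, so the increment is split along the staircase
    [mix] and the mean value theorem is applied on each edge. *)
Lemma telescope_le n (w : (nat -> R) -> R) (w1 : nat -> (nat -> R) -> R) a b c :
  (forall j s, (j < n)%nat -> Rmin (a j) (b j) <= s <= Rmax (a j) (b j) ->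
     derivable_pt_lim (fun s => w (setc (mix j a b) j s)) s (w1 j (setc (mix j a b) j s)) /\
     (b j - a j) * w1 j (setc (mix j a b) j s) <= c j) ->
  w (mix n a b) - w a <= sumk n c.
Proof.
  induction n; intros H.
  - replace (mix 0 a b) with a. simpl; lra. reflexivity.
  - assert (H1 : w (mix n a b) - w a <= sumk n c) by (apply IHn; intros; apply H; auto; lia).
    set (f := fun s => w (setc (mix n a b) n s)).
    assert (Ha : f (a n) = w (mix n a b)).
    { unfold f. f_equal. replace (a n) with (mix n a b n). apply setc_same.
      unfold mix. now rewrite Nat.ltb_irrefl. }
    assert (Hb : f (b n) = w (mix (S n) a b)).
    { unfold f. f_equal. apply functional_extensionality. intros i. unfold setc, mix.
      destruct (Nat.eqb_spec i n), (Nat.ltb_spec i (S n)), (Nat.ltb_spec i n); subst; auto; lia. }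
    destruct (MVT_gen f (a n) (b n) (fun s => w1 n (setc (mix n a b) n s))) as [s [Hs He]].
    + intros x Hx. apply is_derive_Reals. apply H; auto; lra.
    + intros x Hx. apply derivable_continuous_pt. exists (w1 n (setc (mix n a b) n x)).
      apply H; auto.
    + destruct (H n s (Nat.lt_succ_diag_r n) Hs) as [_ Hle].
      simpl. rewrite Ha, Hb in He. lra.
Qed.

(* One-sided chain rule at a boundary point, obtained by moving one coordinate at a time
   between two interior points of the ray and then letting the first one tend to the boundary. *)
Lemma boundary_slope n O B T0 J z t d r : reg n O B T0 J -> T0 < t -> B z -> pt n z -> 0 < r ->
  pt n d ->
  (forall h1 h2 z', 0 < h1 -> h1 <= h2 -> h2 < r -> pt n z' ->
     (forall i, (i < n)%nat -> exists h, h1 <= h <= h2 /\ z' i = z i + h * d i) ->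
     O z' /\ jw J z t <= jw J z' t) ->
  cont_on n (fun z' t' => (O z' \/ B z') /\ t' = t) (jw J) ->
  0 <= sumk n (fun k => d k * j1 J k z t).
Proof.
  intros [Hd Hc] Ht HB Hz Hr Hpd HO Hcw. apply Rnot_lt_le. intros HS.
  set (S := sumk n (fun k => d k * j1 J k z t)) in *.
  set (m := sumk n (fun k => Rabs (d k))).
  assert (Hm : 0 <= m) by (apply sumk_nonneg; intros; apply Rabs_pos).
  (* Tolerance for the gradient: an error [e] in each partial derivative changes the slope by at
     most [e * m], so at least half of the negative value [S] remains. *)
  set (e := - S / (2 * (m + 1))).
  assert (He : 0 < e) by (apply Rdiv_lt_0_compat; lra).
  assert (Hem : S + e * m <= S / 2).
  { assert (e * (m + 1) = - S / 2) by (unfold e; field; lra). nra. }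
  assert (Hnear : exists r1, 0 < r1 /\ forall k, (k < n)%nat -> forall z', O z' ->
     (forall j, (j < n)%nat -> Rabs (z' j - z j) < r1) -> Rabs (j1 J k z' t - j1 J k z t) < e).
  { assert (Haux : forall p, (p <= n)%nat -> exists r1, 0 < r1 /\ forall k, (k < p)%nat -> forall z', O z' ->
     (forall j, (j < n)%nat -> Rabs (z' j - z j) < r1) -> Rabs (j1 J k z' t - j1 J k z t) < e).
    { induction p; intros Hp.
      - exists 1. split; [lra|]. intros; lia.
      - destruct IHp as [r1 [Hr1 H1]]; [lia|].
        destruct (Hc p ltac:(lia) z t (conj (or_intror HB) Ht) e He) as [del [Hdel H2]].
        destruct (dist_close n del Hdel) as [r2 [Hr2 H3]].
        exists (Rmin r1 r2). split; [now apply Rmin_glb_lt|]. intros k Hk z' Hz' Hj.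
        destruct (Nat.eq_dec k p) as [->|].
        + apply H2; auto. apply H3. intros; eapply Rlt_le_trans; [apply Hj; auto|apply Rmin_r].
          now rewrite Rminus_diag, Rabs_R0.
        + apply H1; auto; [lia|]. intros; eapply Rlt_le_trans; [apply Hj; auto|apply Rmin_l]. }
    now apply Haux. }
  destruct Hnear as [r1 [Hr1 Hnear]].
  assert (Hdm : forall i, (i < n)%nat -> Rabs (d i) <= m).
  { intros. apply (sumk_term n (fun k => Rabs (d k))); auto. intros; apply Rabs_pos. }
  set (h2 := Rmin (r / 2) (r1 / (2 * (m + 1)))).
  assert (Hr1m : 0 < r1 / (2 * (m + 1))) by (apply Rdiv_lt_0_compat; lra).
  assert (Hh2 : 0 < h2) by (apply Rmin_glb_lt; lra).
  assert (Hh2r : h2 < r) by (pose proof (Rmin_l (r / 2) (r1 / (2 * (m + 1)))); fold h2 in H; lra).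
  assert (Hh2m : h2 * m < r1).
  { assert (h2 * (2 * (m + 1)) <= r1); [|nra].
    pose proof (Rmin_r (r / 2) (r1 / (2 * (m + 1)))) as H. fold h2 in H.
    replace r1 with (r1 / (2 * (m + 1)) * (2 * (m + 1))) by (field; lra). nra. }
  set (ray := fun h i => z i + h * d i).
  assert (Hray : forall h, pt n (ray h)).
  { intros h j Hj. unfold ray. rewrite (Hz j Hj), (Hpd j Hj). ring. }
  assert (Hdiff : forall h1, 0 < h1 <= h2 -> jw J (ray h2) t - jw J (ray h1) t <= (h2 - h1) * (S / 2)).
  { intros h1 Hh1.
    (* Points of the staircase have coordinates [z i + h * d i] with [h] depending on [i]; this is
       why the hypothesis on [O] allows a different [h] for each coordinate. *)
    assert (Hbox : forall j s, (j < n)%nat -> Rmin (ray h1 j) (ray h2 j) <= s <= Rmax (ray h1 j) (ray h2 j) ->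
      O (setc (mix j (ray h1) (ray h2)) j s) /\
      (forall i, (i < n)%nat -> Rabs (setc (mix j (ray h1) (ray h2)) j s i - z i) < r1)).
    { intros j s Hj Hs. set (z' := setc (mix j (ray h1) (ray h2)) j s).
      assert (Hp : forall i, (i < n)%nat -> exists h, h1 <= h <= h2 /\ z' i = z i + h * d i).
      { intros i Hi. unfold z', setc, mix. destruct (Nat.eqb_spec i j).
        - subst i. destruct (Req_dec (d j) 0) as [H0|H0].
          + exists h1. split; [lra|]. unfold ray in Hs. rewrite H0 in *.
            replace (z j + h1 * 0) with (z j) in * by ring. replace (z j + h2 * 0) with (z j) in * by ring.
            rewrite Rmin_left, Rmax_left in Hs; lra.
          + exists ((s - z j) / d j). split; [|field; auto].
            unfold ray in Hs. destruct (Rtotal_order (d j) 0) as [H1|[H1|H1]]; [|lra|].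
            * rewrite Rmin_right, Rmax_left in Hs by nra.
              split; apply Rmult_le_reg_r with (- d j); try lra;
                replace ((s - z j) / d j * - d j) with (- (s - z j)) by (field; lra); nra.
            * rewrite Rmin_left, Rmax_right in Hs by nra.
              split; apply Rmult_le_reg_r with (d j); try lra;
                replace ((s - z j) / d j * d j) with (s - z j) by (field; lra); nra.
        - destruct (Nat.ltb i j); [exists h2|exists h1]; split; auto; lra. }
      split.
      - apply (HO h1 h2); auto; try lra. intros i Hi. unfold z', setc, mix.
        destruct (Nat.eqb_spec i j); [lia|]. destruct (Nat.ltb i j); apply Hray; auto.
      - intros i Hi. destruct (Hp i Hi) as [h [Hh ->]]. replace (z i + h * d i - z i) with (h * d i) by ring.
        rewrite Rabs_mult. specialize (Hdm i Hi). pose proof (Rabs_pos (d i)). rewrite (Rabs_right h) by lra.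
        nra. }
    replace (ray h2) with (mix n (ray h1) (ray h2)).
    2:{ apply functional_extensionality. intros i. unfold mix. destruct (Nat.ltb_spec i n); auto.
        now rewrite (Hray h1 i), (Hray h2 i). }
    eapply Rle_trans.
    - apply (telescope_le n (fun z' => jw J z' t) (fun k z' => j1 J k z' t) (ray h1) (ray h2)
        (fun k => (h2 - h1) * (d k * j1 J k z t + e * Rabs (d k)))).
      intros j s Hj Hs. destruct (Hbox j s Hj Hs) as [HOz Hnz]. split.
      + destruct (Hd _ t HOz Ht) as [_ Hk]. destruct (Hk j Hj) as [Hk1 _]. rewrite setc_at in Hk1.
        eapply derivable_pt_lim_ext; [|exact Hk1]. intros; simpl. now rewrite setc_setc.
      + unfold ray at 1 2. replace (z j + h2 * d j - (z j + h1 * d j)) with ((h2 - h1) * d j) by ring.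
        rewrite Rmult_assoc. apply Rmult_le_compat_l; [lra|].
        specialize (Hnear j Hj _ HOz Hnz). set (X := j1 J j (setc _ j s) t) in *.
        assert (d j * (X - j1 J j z t) <= e * Rabs (d j)); [|lra].
        apply Rle_trans with (Rabs (d j * (X - j1 J j z t))); [apply Rle_abs|].
        rewrite Rabs_mult. pose proof (Rabs_pos (d j)). nra.
    - rewrite sumk_scal, sumk_plus, sumk_scal. fold S m. apply Rmult_le_compat_l; lra. }
  (* Near [z] the value at the first point of the ray exceeds that at [z] by less than
     [- h2 * S / 4], while the drop along the ray is at least [- h2 * S / 4] because [h1 <= h2 / 2].
     The far end would then lie below the minimum. *)
  destruct (Hcw z t (conj (or_intror HB) eq_refl) (- (h2 * S / 4))) as [del [Hdel Hcz]]; [nra|].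
  destruct (dist_close n del Hdel) as [r2 [Hr2 Hcl]].
  set (h1 := Rmin (h2 / 2) (r2 / (2 * (m + 1)))).
  assert (Hr2m : 0 < r2 / (2 * (m + 1))) by (apply Rdiv_lt_0_compat; lra).
  assert (Hh1 : 0 < h1) by (apply Rmin_glb_lt; lra).
  assert (Hh12 : h1 <= h2 / 2) by apply Rmin_l.
  assert (Hh1m : h1 * m < r2).
  { assert (h1 * (2 * (m + 1)) <= r2); [|nra].
    pose proof (Rmin_r (h2 / 2) (r2 / (2 * (m + 1)))) as H. fold h1 in H.
    replace r2 with (r2 / (2 * (m + 1)) * (2 * (m + 1))) by (field; lra). nra. }
  specialize (Hdiff h1 ltac:(lra)).
  assert (HOr : forall h, 0 < h -> h < r -> O (ray h) /\ jw J z t <= jw J (ray h) t).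
  { intros h Hh Hhr. apply (HO h h); auto; try lra. intros i Hi. exists h. split; [lra|]. reflexivity. }
  destruct (HOr h1 ltac:(lra) ltac:(lra)) as [HO1 _]. destruct (HOr h2 ltac:(lra) ltac:(lra)) as [_ HO2].
  specialize (Hcz (ray h1) t). assert (Hdd : dist n z (ray h1) < del).
  { apply Hcl. intros j Hj. unfold ray. replace (z j + h1 * d j - z j) with (h1 * d j) by ring.
    rewrite Rabs_mult, (Rabs_right h1) by lra. specialize (Hdm j Hj). pose proof (Rabs_pos (d j)). nra. }
  specialize (Hcz ltac:(auto) Hdd ltac:(rewrite Rminus_diag, Rabs_R0; auto)).
  apply Rabs_lt_between in Hcz. nra.
Qed.

(** * Space-time jets *)

(** Continuity on a set in filter form, so that sums, products and compositions are covered by the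
    general theory of limits. *)
Definition within_at n (S : (nat -> R) -> R -> Prop) z t (A : (nat -> R) * R -> Prop) : Prop :=
  exists del, 0 < del /\ forall z' t', S z' t' -> dist n z z' < del -> Rabs (t' - t) < del -> A (z', t').

Global Instance within_at_filter n S z t : Filter (within_at n S z t).
Proof.
  constructor.
  - exists 1. split; [lra|auto].
  - intros A B [d1 [H1 H1']] [d2 [H2 H2']]. exists (Rmin d1 d2).
    split; [now apply Rmin_glb_lt|]. intros z' t' Hs Hd Ht.
    pose proof (Rmin_l d1 d2). pose proof (Rmin_r d1 d2).
    split; [apply H1'|apply H2']; auto; lra.
  - intros A B HAB [d1 [H1 H1']]. exists d1. split; auto.
Qed.

Lemma cont_on_filterlim n S F : cont_on n S F <-> forall z t, S z t ->
  filterlim (fun p => F (fst p) (snd p)) (within_at n S z t) (locally (F z t)).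
Proof.
  split.
  - intros H z t Hs A [eps He]. destruct (H z t Hs eps (cond_pos eps)) as [del [Hd Hd2]].
    exists del. split; auto. intros. apply He. now apply Hd2.
  - intros H z t Hs eps He.
    destruct (H z t Hs (fun y => Rabs (y - F z t) < eps)) as [del [Hd Hd2]].
    + exists (mkposreal _ He). intros y Hy. exact Hy.
    + exists del. split; auto.
Qed.

Lemma cont_on_subset n (S S' : (nat -> R) -> R -> Prop) F :
  cont_on n S F -> (forall z t, S' z t -> S z t) -> cont_on n S' F.
Proof.
  intros H Hsub z t Hs eps He. destruct (H z t (Hsub z t Hs) eps He) as [del [Hd Hd2]].
  exists del. split; auto.
Qed.

Lemma cont_on_const n S c : cont_on n S (fun _ _ => c).
Proof. intros z t Hs eps He. exists 1. split; [lra|]. intros. now rewrite Rminus_diag, Rabs_R0. Qed.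

Lemma cont_on_coord n S i : (i < n)%nat -> cont_on n S (fun z _ => z i).
Proof.
  intros Hi z t Hs eps He. exists eps. split; auto. intros z' t' _ Hd _.
  eapply Rle_lt_trans; [now apply (coord_le_dist n)|auto].
Qed.

Lemma cont_on_plus n S F G : cont_on n S F -> cont_on n S G -> cont_on n S (fun z t => F z t + G z t).
Proof.
  rewrite !cont_on_filterlim. intros HF HG z t Hs.
  eapply filterlim_comp_2; [apply HF, Hs|apply HG, Hs|]. apply (filterlim_plus (F z t) (G z t)).
Qed.

Lemma cont_on_mult n S F G : cont_on n S F -> cont_on n S G -> cont_on n S (fun z t => F z t * G z t).
Proof.
  rewrite !cont_on_filterlim. intros HF HG z t Hs.
  eapply filterlim_comp_2; [apply HF, Hs|apply HG, Hs|]. apply (filterlim_mult (F z t) (G z t)).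
Qed.

Lemma cont_on_comp n S F f : cont_on n S F -> (forall z t, S z t -> continuity_pt f (F z t)) ->
  cont_on n S (fun z t => f (F z t)).
Proof.
  rewrite !cont_on_filterlim. intros HF Hf z t Hs.
  eapply filterlim_comp; [apply HF, Hs|]. apply continuity_pt_filterlim, Hf, Hs.
Qed.

Lemma cont_on_time n S f : (forall z t, S z t -> continuity_pt f t) -> cont_on n S (fun _ t => f t).
Proof.
  intros Hf. apply (cont_on_comp n S (fun _ t => t) f); auto.
  intros z t Hs eps He. exists eps. auto.
Qed.

Lemma cont_on_scal n S c F : cont_on n S F -> cont_on n S (fun z t => c * F z t).
Proof. intros. apply cont_on_mult; auto. apply cont_on_const. Qed.

Lemma cont_on_sumk n S m (F : nat -> (nat -> R) -> R -> R) :
  (forall k, (k < m)%nat -> cont_on n S (F k)) -> cont_on n S (fun z t => sumk m (fun k => F k z t)).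
Proof.
  induction m; intros H; simpl; [apply cont_on_const|].
  apply cont_on_plus; auto.
Qed.

Lemma cont_on_rad a n S : cont_on n S (fun z _ => rad a n z).
Proof.
  apply (cont_on_sumk n S n (fun k z _ => if Nat.ltb k a then 0 else z k ^ 2)).
  intros k Hk. destruct (Nat.ltb k a); [apply cont_on_const|].
  apply cont_on_mult; [now apply cont_on_coord|]. apply cont_on_mult; [now apply cont_on_coord|apply cont_on_const].
Qed.

(** * Jet combinators for barriers, with their Laplacians, gradients and normal derivatives *)

Definition jconst c : jet := mkjet (fun _ _ => c) (fun _ _ => 0) (fun _ _ _ => 0) (fun _ _ _ => 0).
Definition jtime (f f' : R -> R) : jet :=
  mkjet (fun _ t => f t) (fun _ t => f' t) (fun _ _ _ => 0) (fun _ _ _ => 0).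
Definition jcoord i : jet :=
  mkjet (fun z _ => z i) (fun _ _ => 0) (fun k _ _ => if Nat.eqb k i then 1 else 0) (fun _ _ _ => 0).
Definition jadd A B : jet :=
  mkjet (fun z t => jw A z t + jw B z t) (fun z t => jt A z t + jt B z t)
    (fun k z t => j1 A k z t + j1 B k z t) (fun k z t => j2 A k z t + j2 B k z t).
Definition jscal c A : jet :=
  mkjet (fun z t => c * jw A z t) (fun z t => c * jt A z t)
    (fun k z t => c * j1 A k z t) (fun k z t => c * j2 A k z t).
Definition jmul A B : jet :=
  mkjet (fun z t => jw A z t * jw B z t) (fun z t => jt A z t * jw B z t + jw A z t * jt B z t)
    (fun k z t => j1 A k z t * jw B z t + jw A z t * j1 B k z t)
    (fun k z t => j2 A k z t * jw B z t + 2 * (j1 A k z t * j1 B k z t) + jw A z t * j2 B k z t).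
Definition jcomp (f f1 f2 : R -> R) A : jet :=
  mkjet (fun z t => f (jw A z t)) (fun z t => f1 (jw A z t) * jt A z t)
    (fun k z t => f1 (jw A z t) * j1 A k z t)
    (fun k z t => f2 (jw A z t) * (j1 A k z t * j1 A k z t) + f1 (jw A z t) * j2 A k z t).
Definition jq N : jet :=
  mkjet (fun z _ => rad 1 N z) (fun _ _ => 0)
    (fun k z _ => if Nat.ltb k 1 then 0 else 2 * z k) (fun k _ _ => if Nat.ltb k 1 then 0 else 2).
Definition jdist2 N (c : nat -> R) : jet :=
  mkjet (fun z _ => sumk N (fun k => (z k - c k) ^ 2)) (fun _ _ => 0)
    (fun k z _ => 2 * (z k - c k)) (fun _ _ _ => 2).
Definition jsub A B : jet := jadd A (jscal (-1) B).

Lemma djet_const n c z t : djet n (jconst c) z t.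
Proof. split; [apply derivable_pt_lim_const|]. split; apply derivable_pt_lim_const. Qed.

Lemma djet_time n f f' z t : derivable_pt_lim f t (f' t) -> djet n (jtime f f') z t.
Proof. split; auto. split; apply derivable_pt_lim_const. Qed.

Lemma derivable_setc z k i : derivable_pt_lim (fun s => setc z k s i) (z k) (if Nat.eqb i k then 1 else 0).
Proof.
  unfold setc. destruct (Nat.eqb i k); [apply derivable_pt_lim_id|apply derivable_pt_lim_const].
Qed.

Lemma djet_coord n i z t : djet n (jcoord i) z t.
Proof.
  split; [apply derivable_pt_lim_const|]. intros k Hk. split; [|apply derivable_pt_lim_const].
  simpl. rewrite Nat.eqb_sym. apply derivable_setc.
Qed.

Lemma djet_add n A B z t : djet n A z t -> djet n B z t -> djet n (jadd A B) z t.
Proof.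
  intros [HA HA1] [HB HB1]. split; [now apply derivable_pt_lim_plus|].
  intros k Hk. destruct (HA1 k Hk), (HB1 k Hk). split; apply derivable_pt_lim_plus; auto.
Qed.

Lemma djet_scal n c A z t : djet n A z t -> djet n (jscal c A) z t.
Proof.
  intros [HA HA1]. split; [now apply derivable_pt_lim_scal|].
  intros k Hk. destruct (HA1 k Hk). split; apply derivable_pt_lim_scal; auto.
Qed.

Lemma derivable_pt_lim_eq f x l l' : derivable_pt_lim f x l -> l = l' -> derivable_pt_lim f x l'.
Proof. now intros H <-. Qed.

Lemma djet_mul n A B z t : djet n A z t -> djet n B z t -> djet n (jmul A B) z t.
Proof.
  intros [HA HA1] [HB HB1]. split; [now apply (derivable_pt_lim_mult (fun s => jw A z s) (fun s => jw B z s))|].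
  intros k Hk. destruct (HA1 k Hk), (HB1 k Hk). split.
  - eapply derivable_pt_lim_eq.
    + apply (derivable_pt_lim_mult (fun s => jw A (setc z k s) t) (fun s => jw B (setc z k s) t)); eauto.
    + simpl. now rewrite setc_same.
  - eapply derivable_pt_lim_eq.
    + apply (derivable_pt_lim_plus (fun s => j1 A k (setc z k s) t * jw B (setc z k s) t)
        (fun s => jw A (setc z k s) t * j1 B k (setc z k s) t)).
      * apply (derivable_pt_lim_mult (fun s => j1 A k (setc z k s) t) (fun s => jw B (setc z k s) t)); eauto.
      * apply (derivable_pt_lim_mult (fun s => jw A (setc z k s) t) (fun s => j1 B k (setc z k s) t)); eauto.
    + simpl. rewrite setc_same. ring.
Qed.

Lemma djet_comp n f f1 f2 A z t : djet n A z t ->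
  derivable_pt_lim f (jw A z t) (f1 (jw A z t)) -> derivable_pt_lim f1 (jw A z t) (f2 (jw A z t)) ->
  djet n (jcomp f f1 f2 A) z t.
Proof.
  intros [HA HA1] Hf Hf1. split; [now apply (derivable_pt_lim_comp (fun s => jw A z s) f)|].
  intros k Hk. destruct (HA1 k Hk) as [H1 H2]. split.
  - apply (derivable_pt_lim_comp (fun s => jw A (setc z k s) t) f); auto. now rewrite setc_same.
  - eapply derivable_pt_lim_eq.
    + apply (derivable_pt_lim_mult (fun s => f1 (jw A (setc z k s) t)) (fun s => j1 A k (setc z k s) t)); eauto.
      apply (derivable_pt_lim_comp (fun s => jw A (setc z k s) t) f1); eauto. cbv beta. rewrite ?setc_same. exact Hf1.
    + simpl. rewrite setc_same. ring.
Qed.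

Lemma derivable_pt_lim_sumk m (f : nat -> R -> R) x l :
  (forall k, (k < m)%nat -> derivable_pt_lim (f k) x (l k)) ->
  derivable_pt_lim (fun s => sumk m (fun k => f k s)) x (sumk m l).
Proof.
  induction m; intros H; simpl; [apply derivable_pt_lim_const|].
  apply (derivable_pt_lim_plus (fun s => sumk m (fun k => f k s)) (f m)); auto.
Qed.

Lemma sumk_single m k c : (k < m)%nat -> sumk m (fun i => if Nat.eqb i k then c else 0) = c.
Proof.
  induction m; intros H; [lia|]. simpl. destruct (Nat.eqb_spec m k).
  - subst. rewrite sumk_0; [ring|]. intros i Hi. destruct (Nat.eqb_spec i k); [lia|auto].
  - rewrite IHm by lia. ring.
Qed.

Lemma djet_dist2 n c z t : djet n (jdist2 n c) z t.
Proof.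
  split; [apply derivable_pt_lim_const|]. intros k Hk. split.
  - simpl. eapply derivable_pt_lim_eq.
    + apply (derivable_pt_lim_sumk n (fun i s => (setc z k s i - c i) ^ 2)
        _ (fun i => if Nat.eqb i k then 2 * (z k - c k) else 0)).
      intros i Hi. unfold setc. destruct (Nat.eqb_spec i k).
      * subst. apply is_derive_Reals. auto_derive; auto; ring.
      * apply derivable_pt_lim_const.
    + now apply sumk_single.
  - simpl. apply is_derive_Reals.
    apply is_derive_ext with (fun s => 2 * (s - c k)); [intros; now rewrite setc_at|].
    auto_derive; auto; ring.
Qed.

Lemma djet_q n z t : djet n (jq n) z t.
Proof.
  split; [apply derivable_pt_lim_const|]. intros k Hk. split.
  - simpl. unfold rad. eapply derivable_pt_lim_eq.
    + apply (derivable_pt_lim_sumk n (fun i s => if Nat.ltb i 1 then 0 else (setc z k s i) ^ 2)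
        _ (fun i => if Nat.eqb i k then (if Nat.ltb k 1 then 0 else 2 * z k) else 0)).
      intros i Hi. unfold setc. destruct (Nat.eqb_spec i k); [subst; destruct (Nat.ltb k 1)|destruct (Nat.ltb i 1)];
        try apply derivable_pt_lim_const.
      apply is_derive_Reals. auto_derive; auto; ring.
    + now apply sumk_single.
  - simpl. destruct (Nat.ltb k 1); [apply derivable_pt_lim_const|].
    apply is_derive_Reals. apply is_derive_ext with (fun s => 2 * s); [intros; now rewrite setc_at|].
    auto_derive; auto; ring.
Qed.

(** The scalar product of the spatial gradients, the cross term in the Laplacian of a product or of
    a composition. *)
Definition gg n A B z t : R := sumk n (fun k => j1 A k z t * j1 B k z t).
Notation jlap n A := (lap n (j2 A)).

Lemma lap_const n c z t : jlap n (jconst c) z t = 0.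
Proof. apply sumk_0. auto. Qed.
Lemma lap_time n f f' z t : jlap n (jtime f f') z t = 0.
Proof. apply sumk_0. auto. Qed.
Lemma lap_coord n i z t : jlap n (jcoord i) z t = 0.
Proof. apply sumk_0. auto. Qed.
Lemma lap_add n A B z t : jlap n (jadd A B) z t = jlap n A z t + jlap n B z t.
Proof. apply sumk_plus. Qed.
Lemma lap_scal n c A z t : jlap n (jscal c A) z t = c * jlap n A z t.
Proof. apply sumk_scal. Qed.
Lemma lap_sub n A B z t : jlap n (jsub A B) z t = jlap n A z t - jlap n B z t.
Proof. unfold jsub. rewrite lap_add, lap_scal. ring. Qed.
Lemma lap_mul n A B z t : jlap n (jmul A B) z t =
  jlap n A z t * jw B z t + 2 * gg n A B z t + jw A z t * jlap n B z t.
Proof.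
  unfold lap, gg. rewrite <- !sumk_scal, (Rmult_comm _ (jw B z t)), <- !sumk_scal, <- !sumk_plus.
  apply sumk_ext. intros; simpl; ring.
Qed.
Lemma lap_comp n f f1 f2 A z t : jlap n (jcomp f f1 f2 A) z t =
  f2 (jw A z t) * gg n A A z t + f1 (jw A z t) * jlap n A z t.
Proof. unfold lap, gg. rewrite <- !sumk_scal, <- sumk_plus. now apply sumk_ext. Qed.
Lemma lap_dist2 n c z t : jlap n (jdist2 n c) z t = 2 * INR n.
Proof. unfold lap. simpl. rewrite sumk_const. ring. Qed.
Lemma lap_q n z t : (1 <= n)%nat -> jlap n (jq n) z t = 2 * INR (n - 1).
Proof.
  intros H. unfold lap. destruct n; [lia|]. rewrite sumk_shift. simpl.
  rewrite Nat.sub_0_r, sumk_const. ring.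
Qed.

Lemma gg_sym n A B z t : gg n A B z t = gg n B A z t.
Proof. apply sumk_ext. intros; ring. Qed.
Lemma gg_const n c B z t : gg n (jconst c) B z t = 0.
Proof. apply sumk_0. intros; simpl; ring. Qed.
Lemma gg_time n f f' B z t : gg n (jtime f f') B z t = 0.
Proof. apply sumk_0. intros; simpl; ring. Qed.
Lemma gg_coord n i B z t : (i < n)%nat -> gg n (jcoord i) B z t = j1 B i z t.
Proof.
  intros Hi. rewrite <- (sumk_single n i (j1 B i z t) Hi). apply sumk_ext. intros k Hk. simpl.
  destruct (Nat.eqb_spec k i); subst; ring.
Qed.
Lemma gg_add n A A' B z t : gg n (jadd A A') B z t = gg n A B z t + gg n A' B z t.
Proof. unfold gg. rewrite <- sumk_plus. apply sumk_ext; intros; simpl; ring. Qed.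
Lemma gg_scal n c A B z t : gg n (jscal c A) B z t = c * gg n A B z t.
Proof. unfold gg. rewrite <- sumk_scal. apply sumk_ext; intros; simpl; ring. Qed.
Lemma gg_mul n A A' B z t : gg n (jmul A A') B z t = jw A' z t * gg n A B z t + jw A z t * gg n A' B z t.
Proof. unfold gg. rewrite <- !sumk_scal, <- sumk_plus. apply sumk_ext; intros; simpl; ring. Qed.
Lemma gg_comp n f f1 f2 A B z t : gg n (jcomp f f1 f2 A) B z t = f1 (jw A z t) * gg n A B z t.
Proof. unfold gg. rewrite <- sumk_scal. apply sumk_ext; intros; simpl; ring. Qed.
Lemma gg_q n z t : gg n (jq n) (jq n) z t = 4 * rad 1 n z.
Proof.
  unfold gg, rad. rewrite <- sumk_scal. apply sumk_ext. intros; simpl.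
  destruct (Nat.ltb k 1); ring.
Qed.
Lemma gg_dist2 n c z t : gg n (jdist2 n c) (jdist2 n c) z t = 4 * jw (jdist2 n c) z t.
Proof. unfold gg. simpl. rewrite <- sumk_scal. apply sumk_ext. intros; ring. Qed.

Notation jdn n Rd A := (dn 1 n Rd (j1 A)).

Lemma dn_const n Rd c z t : jdn n Rd (jconst c) z t = 0.
Proof. apply sumk_0. intros; simpl. destruct (Nat.ltb k 1); ring. Qed.
Lemma dn_time n Rd f f' z t : jdn n Rd (jtime f f') z t = 0.
Proof. apply sumk_0. intros; simpl. destruct (Nat.ltb k 1); ring. Qed.
Lemma dn_coord0 n Rd z t : jdn n Rd (jcoord 0) z t = 0.
Proof. apply sumk_0. intros k Hk; simpl. destruct k; simpl; ring. Qed.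
Lemma dn_add n Rd A B z t : jdn n Rd (jadd A B) z t = jdn n Rd A z t + jdn n Rd B z t.
Proof. unfold dn. rewrite <- sumk_plus. apply sumk_ext; intros; simpl. destruct (Nat.ltb k 1); ring. Qed.
Lemma dn_scal n Rd c A z t : jdn n Rd (jscal c A) z t = c * jdn n Rd A z t.
Proof. unfold dn. rewrite <- sumk_scal. apply sumk_ext; intros; simpl. destruct (Nat.ltb k 1); ring. Qed.
Lemma dn_sub n Rd A B z t : jdn n Rd (jsub A B) z t = jdn n Rd A z t - jdn n Rd B z t.
Proof. unfold jsub. rewrite dn_add, dn_scal. ring. Qed.
Lemma dn_mul n Rd A B z t : jdn n Rd (jmul A B) z t =
  jdn n Rd A z t * jw B z t + jw A z t * jdn n Rd B z t.
Proof.
  unfold dn. rewrite (Rmult_comm _ (jw B z t)), <- !sumk_scal, <- sumk_plus.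
  apply sumk_ext; intros; simpl. destruct (Nat.ltb k 1); ring.
Qed.
Lemma dn_comp n Rd f f1 f2 A z t : jdn n Rd (jcomp f f1 f2 A) z t = f1 (jw A z t) * jdn n Rd A z t.
Proof. unfold dn. rewrite <- sumk_scal. apply sumk_ext; intros; simpl. destruct (Nat.ltb k 1); ring. Qed.
Lemma dn_q n Rd z t : 0 < Rd -> Bd n Rd z -> jdn n Rd (jq n) z t = 2 * Rd.
Proof.
  intros HR [_ Hz]. unfold dn. simpl. replace (2 * Rd) with (2 / Rd * rad 1 n z) by (rewrite Hz; field; lra).
  unfold rad. rewrite <- sumk_scal. apply sumk_ext; intros. destruct (Nat.ltb k 1); field; lra.
Qed.

(** With [c'] the y-part of [c], polarization gives [2 y.(y - c') = |y|^2 - |c'|^2 + |y - c'|^2],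
    and the outward normal at the boundary is [y / Rd]. *)
Lemma dn_dist2 n Rd c z t : 0 < Rd -> Bd n Rd z -> (1 <= n)%nat ->
  jdn n Rd (jdist2 n c) z t =
  (Rd ^ 2 - rad 1 n c + (jw (jdist2 n c) z t - (z 0%nat - c 0%nat) ^ 2)) / Rd.
Proof.
  intros HR [_ Hz] Hn. rewrite <- Hz. unfold dn, rad. cbn [jw jdist2].
  apply Rmult_eq_reg_l with Rd; [|lra]. rewrite <- sumk_scal.
  destruct n; [lia|]. rewrite !sumk_shift. cbn [Nat.ltb Nat.leb].
  assert (H : forall m, sumk m (fun k => Rd * (z (S k) / Rd * j1 (jdist2 (S n) c) (S k) z t)) =
     sumk m (fun k => z (S k) ^ 2) - sumk m (fun k => c (S k) ^ 2) + sumk m (fun k => (z (S k) - c (S k)) ^ 2)).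
  { induction m; cbn [sumk]; [ring|]. rewrite IHm. simpl j1. field. lra. }
  rewrite H. field. lra.
Qed.

(** Regularity of explicit barriers; unlike [reg] it includes continuity of the function itself.
    [T0] is taken below the initial time, so that continuity at that time is covered. *)
Definition creg n O B T0 J : Prop :=
  (forall z t, O z -> T0 < t -> djet n J z t) /\
  cont_on n (fun z t => (O z \/ B z) /\ T0 < t) (jw J) /\
  forall k, (k < n)%nat -> cont_on n (fun z t => (O z \/ B z) /\ T0 < t) (j1 J k).

Lemma creg_reg n O B T0 J : creg n O B T0 J -> reg n O B T0 J.
Proof. intros [H1 [_ H2]]. now split. Qed.

Lemma reg_sub n (O B O' B' : (nat -> R) -> Prop) T0 T1 J : reg n O B T0 J ->
  (forall z, O' z -> O z) -> (forall z, B' z -> O z \/ B z) -> T0 <= T1 -> reg n O' B' T1 J.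
Proof.
  intros [H1 H2] HO HB HT. split.
  - intros. apply H1; auto; lra.
  - intros k Hk. apply cont_on_subset with (1 := H2 k Hk). intros z t [[]]; split; auto; lra.
Qed.

Lemma creg_cont n O B T0 J (S : (nat -> R) -> R -> Prop) : creg n O B T0 J ->
  (forall z t, S z t -> (O z \/ B z) /\ T0 < t) -> cont_on n S (jw J).
Proof. intros [_ [H _]] HS. now apply cont_on_subset with (1 := H). Qed.

Lemma reg_add n O B T0 J K : reg n O B T0 J -> reg n O B T0 K -> reg n O B T0 (jadd J K).
Proof.
  intros [H1 H2] [H3 H4]. split; [intros; apply djet_add; auto|].
  intros k Hk. now apply (cont_on_plus n _ (j1 J k) (j1 K k)); auto.
Qed.
Lemma reg_scal n O B T0 c J : reg n O B T0 J -> reg n O B T0 (jscal c J).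
Proof.
  intros [H1 H2]. split; [intros; apply djet_scal; auto|].
  intros k Hk. now apply (cont_on_scal n _ c (j1 J k)); auto.
Qed.
Lemma reg_jsub n O B T0 J K : reg n O B T0 J -> reg n O B T0 K -> reg n O B T0 (jsub J K).
Proof. intros. apply reg_add; auto. now apply reg_scal. Qed.

Lemma creg_const n O B T0 c : creg n O B T0 (jconst c).
Proof.
  split; [intros; apply djet_const|].
  split; [exact (cont_on_const n _ c)|intros k Hk; exact (cont_on_const n _ 0)].
Qed.
Lemma creg_time n O B T0 f f' : (forall t, T0 < t -> derivable_pt_lim f t (f' t)) ->
  creg n O B T0 (jtime f f').
Proof.
  intros H. split; [intros; apply djet_time; auto|]. split; [|intros k Hk; exact (cont_on_const n _ 0)].
  apply (cont_on_time n _ f). intros z t [_ Ht]. apply derivable_continuous_pt. exists (f' t). now apply H.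
Qed.
Lemma creg_coord n O B T0 i : (i < n)%nat -> creg n O B T0 (jcoord i).
Proof.
  intros Hi. split; [intros; apply djet_coord|]. split; [exact (cont_on_coord n _ i Hi)|].
  intros k Hk; exact (cont_on_const n _ (if Nat.eqb k i then 1 else 0)).
Qed.
Lemma creg_add n O B T0 J K : creg n O B T0 J -> creg n O B T0 K -> creg n O B T0 (jadd J K).
Proof.
  intros [H1 [H1' H2]] [H3 [H3' H4]]. split; [intros; apply djet_add; auto|].
  split; [exact (cont_on_plus n _ _ _ H1' H3')|]. intros k Hk. now apply (cont_on_plus n _ (j1 J k) (j1 K k)); auto.
Qed.
Lemma creg_scal n O B T0 c J : creg n O B T0 J -> creg n O B T0 (jscal c J).
Proof.
  intros [H1 [H1' H2]]. split; [intros; apply djet_scal; auto|].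
  split; [exact (cont_on_scal n _ c _ H1')|]. intros k Hk. now apply (cont_on_scal n _ c (j1 J k)); auto.
Qed.
Lemma creg_jsub n O B T0 J K : creg n O B T0 J -> creg n O B T0 K -> creg n O B T0 (jsub J K).
Proof. intros. apply creg_add; auto. now apply creg_scal. Qed.
Lemma creg_mul n O B T0 J K : creg n O B T0 J -> creg n O B T0 K -> creg n O B T0 (jmul J K).
Proof.
  intros [H1 [H1' H2]] [H3 [H3' H4]]. split; [intros; apply djet_mul; auto|].
  split; [exact (cont_on_mult n _ _ _ H1' H3')|]. intros k Hk.
  apply (cont_on_plus n _ (fun z t => j1 J k z t * jw K z t) (fun z t => jw J z t * j1 K k z t));
    now apply cont_on_mult; auto.
Qed.
Lemma creg_comp n O B T0 f f1 f2 J : creg n O B T0 J ->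
  (forall z t, O z \/ B z -> T0 < t -> derivable_pt_lim f (jw J z t) (f1 (jw J z t)) /\
     derivable_pt_lim f1 (jw J z t) (f2 (jw J z t))) -> creg n O B T0 (jcomp f f1 f2 J).
Proof.
  intros [H1 [H1' H2]] Hf. split; [intros; apply djet_comp; auto; apply Hf; auto|].
  split.
  - apply (cont_on_comp n _ (jw J) f); auto. intros z t [Hz Ht].
    apply derivable_continuous_pt. eexists. now apply Hf.
  - intros k Hk. apply (cont_on_mult n _ (fun z t => f1 (jw J z t)) (j1 J k)); auto.
    apply (cont_on_comp n _ (jw J) f1); auto. intros z t [Hz Ht].
    apply derivable_continuous_pt. eexists. now apply Hf.
Qed.
Lemma creg_q n O B T0 : creg n O B T0 (jq n).
Proof.
  split; [intros; apply djet_q|]. split; [exact (cont_on_rad 1 n _)|]. intros k Hk. cbn [j1 jq].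
  destruct (Nat.ltb k 1); [exact (cont_on_const n _ 0)|].
  exact (cont_on_scal n _ 2 _ (cont_on_coord n _ k Hk)).
Qed.
Lemma creg_dist2 n O B T0 c : creg n O B T0 (jdist2 n c).
Proof.
  assert (Hc : forall S k, (k < n)%nat -> cont_on n S (fun z (_ : R) => z k - c k)).
  { intros S k Hk. apply (cont_on_plus n S (fun z _ => z k) (fun _ _ => - c k)); [now apply cont_on_coord|apply cont_on_const]. }
  split; [intros; apply djet_dist2|]. split.
  - apply (cont_on_sumk n _ n (fun k z _ => (z k - c k) ^ 2)). intros k Hk. simpl.
    apply cont_on_mult; auto. apply cont_on_mult; auto. apply cont_on_const.
  - intros k Hk. exact (cont_on_scal n _ 2 _ (Hc _ k Hk)).
Qed.

Lemma lt_near n f z : cont_on n (fun _ _ => True) (fun z _ => f z) -> 0 < f z ->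
  exists r, 0 < r /\ forall z', near n r z z' -> 0 < f z'.
Proof.
  intros Hc Hf. destruct (Hc z 0 I (f z) Hf) as [del [Hd Hd2]].
  destruct (dist_close n del Hd) as [r [Hr Hr2]]. exists r. split; auto. intros z' [_ Hz'].
  specialize (Hd2 z' 0 I (Hr2 _ _ Hz') ltac:(rewrite Rminus_diag, Rabs_R0; auto)).
  apply Rabs_lt_between in Hd2. lra.
Qed.

Lemma closed_nonneg n f : cont_on n (fun _ _ => True) (fun z _ => f z) ->
  closed_in n (fun z => pt n z /\ 0 <= f z).
Proof.
  intros Hc z Hz H. split; auto. apply Rnot_lt_le. intros Hf.
  destruct (Hc z 0 I (- f z) ltac:(lra)) as [del [Hd Hd2]].
  destruct (dist_close n del Hd) as [r [Hr Hr2]]. destruct (H r Hr) as [z' [[_ Hz'] Hn]].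
  specialize (Hd2 z' 0 I (Hr2 _ _ Hn) ltac:(rewrite Rminus_diag, Rabs_R0; auto)).
  apply Rabs_lt_between in Hd2. lra.
Qed.

(** * The closed cylinder, the closed exterior and their topology *)

Definition clO N Rd z := Om N Rd z \/ Bd N Rd z.
Definition clE N Rd z := Ext N Rd z \/ Bd N Rd z.

Lemma clO_iff N Rd z : clO N Rd z <-> pt N z /\ rad 1 N z <= Rd ^ 2.
Proof.
  unfold clO, Om, Bd. split.
  - intros [[]|[]]; split; auto; lra.
  - intros [H1 H2]. destruct (Rle_lt_or_eq_dec _ _ H2); auto.
Qed.

Lemma clE_iff N Rd z : clE N Rd z <-> pt N z /\ Rd ^ 2 <= rad 1 N z.
Proof.
  unfold clE, Ext, Bd. split.
  - intros [[]|[]]; split; auto; lra.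
  - intros [H1 H2]. destruct (Rle_lt_or_eq_dec _ _ H2); auto.
Qed.

Lemma clO_pt N Rd z : clO N Rd z -> pt N z.
Proof. rewrite clO_iff; tauto. Qed.
Lemma clE_pt N Rd z : clE N Rd z -> pt N z.
Proof. rewrite clE_iff; tauto. Qed.

Lemma cont_on_affine_rad N S a b : cont_on N S (fun z _ => a + b * rad 1 N z).
Proof. apply cont_on_plus; [apply cont_on_const|]. apply cont_on_scal, cont_on_rad. Qed.

Lemma Om_open N Rd z : Om N Rd z -> exists r, 0 < r /\ forall z', near N r z z' -> Om N Rd z'.
Proof.
  intros [Hp Hz]. destruct (lt_near N (fun z => Rd ^ 2 + (-1) * rad 1 N z) z) as [r [Hr H]].
  - apply cont_on_affine_rad.
  - lra.
  - exists r. split; auto. intros z' Hn. specialize (H z' Hn). destruct Hn. split; auto; lra.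
Qed.

Lemma Ext_open N Rd z : Ext N Rd z -> exists r, 0 < r /\ forall z', near N r z z' -> Ext N Rd z'.
Proof.
  intros [Hp Hz]. destruct (lt_near N (fun z => - Rd ^ 2 + 1 * rad 1 N z) z) as [r [Hr H]].
  - apply cont_on_affine_rad.
  - lra.
  - exists r. split; auto. intros z' Hn. specialize (H z' Hn). destruct Hn. split; auto; lra.
Qed.

Lemma clO_closed N Rd : closed_in N (clO N Rd).
Proof.
  intros z Hz H. apply clO_iff. split; auto.
  destruct (closed_nonneg N (fun z => Rd ^ 2 + (-1) * rad 1 N z)) with z; auto; [|intros eps He|lra].
  - apply cont_on_affine_rad.
  - destruct (H eps He) as [z' [Hz' Hn]]. exists z'. split; auto. apply clO_iff in Hz'. split; [tauto|lra].
Qed.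

Lemma clE_closed N Rd : closed_in N (clE N Rd).
Proof.
  intros z Hz H. apply clE_iff. split; auto.
  destruct (closed_nonneg N (fun z => - Rd ^ 2 + 1 * rad 1 N z)) with z; auto; [|intros eps He|lra].
  - apply cont_on_affine_rad.
  - destruct (H eps He) as [z' [Hz' Hn]]. exists z'. split; auto. apply clE_iff in Hz'. split; [tauto|lra].
Qed.

Lemma closed_in_and n (K K' : (nat -> R) -> Prop) : closed_in n K -> closed_in n (fun z => pt n z /\ K' z) ->
  (forall z, K z -> pt n z) -> closed_in n (fun z => K z /\ K' z).
Proof.
  intros H1 H2 Hp z Hz H. split.
  - apply H1; auto. intros eps He. destruct (H eps He) as [z' [[]]]. exists z'. auto.
  - apply H2; auto. intros eps He. destruct (H eps He) as [z' [[]]]. exists z'. auto.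
Qed.

Lemma rad_nonneg a N z : 0 <= rad a N z.
Proof. apply sumk_nonneg. intros. destruct (Nat.ltb k a); [lra|apply pow2_ge_0]. Qed.

Lemma coord_sq_le_rad N z j : (1 <= j < N)%nat -> z j ^ 2 <= rad 1 N z.
Proof.
  intros Hj. unfold rad.
  pose proof (sumk_term N (fun k => if Nat.ltb k 1 then 0 else z k ^ 2) j) as H. cbv beta in H.
  destruct (Nat.ltb_spec j 1); [lia|]. apply H; [|lia].
  intros. destruct (Nat.ltb k 1); [lra|apply pow2_ge_0].
Qed.

(** * Growth functions controlling the behaviour at infinity *)

Definition jx2 : jet := jadd (jconst 1) (jcomp (fun s => s ^ 2) (fun s => 2 * s) (fun _ => 2) (jcoord 0)).
(** These are [(1 + x^2)(1 + |y|^2)] inside and [K2 (1 + x^2) + (|y|^2 - R^2)^2] outside. The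
    Laplacian of each is at most a constant times the function. The outer one has zero normal
    derivative, and both traces on the boundary are constant multiples of the same [1 + x^2], so
    that the single constant [K2] balances the exchange. *)
Definition grow_u N : jet := jmul jx2 (jadd (jconst 1) (jq N)).
Definition grow_v N Rd K2 : jet := jadd (jscal K2 jx2)
  (jcomp (fun q => (q - Rd ^ 2) ^ 2) (fun q => 2 * (q - Rd ^ 2)) (fun _ => 2) (jq N)).

Lemma derivable_sq a x : derivable_pt_lim (fun q => (q - a) ^ 2) x (2 * (x - a)).
Proof. apply is_derive_Reals. auto_derive; auto; ring. Qed.
Lemma derivable_lin a x : derivable_pt_lim (fun q => 2 * (q - a)) x 2.
Proof. apply is_derive_Reals. auto_derive; auto; ring. Qed.

Lemma creg_x2 n O B T0 : (1 <= n)%nat -> creg n O B T0 jx2.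
Proof.
  intros. apply creg_add; [apply creg_const|]. apply creg_comp; [apply creg_coord; lia|].
  intros; split; apply is_derive_Reals; auto_derive; auto; ring.
Qed.
Lemma creg_grow_u n O B T0 : (1 <= n)%nat -> creg n O B T0 (grow_u n).
Proof.
  intros. apply creg_mul; [now apply creg_x2|]. apply creg_add; [apply creg_const|apply creg_q].
Qed.
Lemma creg_grow_v n Rd K2 O B T0 : (1 <= n)%nat -> creg n O B T0 (grow_v n Rd K2).
Proof.
  intros. apply creg_add; [apply creg_scal; now apply creg_x2|].
  apply creg_comp; [apply creg_q|]. intros; split; [apply derivable_sq|apply derivable_lin].
Qed.

Global Hint Rewrite lap_const lap_time lap_coord lap_add lap_scal lap_sub lap_mul lap_comp lap_dist2
  gg_const gg_time gg_add gg_scal gg_mul gg_comp dn_const dn_time dn_coord0 dn_add dn_scal dn_sub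
  dn_mul dn_comp : jets.

Lemma lap_x2 N z t : (1 <= N)%nat -> jlap N jx2 z t = 2.
Proof. intros. unfold jx2. autorewrite with jets. rewrite gg_coord by lia. simpl. ring. Qed.
Lemma gg_x2_q N z t : (1 <= N)%nat -> gg N jx2 (jq N) z t = 0.
Proof. intros. unfold jx2. autorewrite with jets. rewrite gg_coord by lia. simpl. ring. Qed.
Lemma dn_x2 N Rd z t : jdn N Rd jx2 z t = 0.
Proof. unfold jx2. autorewrite with jets. ring. Qed.

Lemma lap_grow_u N z t : (1 <= N)%nat ->
  jlap N (grow_u N) z t <= (2 + 2 * INR N) * jw (grow_u N) z t.
Proof.
  intros HN. unfold grow_u. rewrite lap_mul, lap_x2, lap_add, lap_const, lap_q, gg_sym, gg_add, gg_const,
    gg_sym, gg_x2_q by auto. simpl.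
  pose proof (rad_nonneg 1 N z). pose proof (pow2_ge_0 (z 0%nat)). simpl in H0.
  assert (INR (N - 1) <= INR N) by (apply le_INR; lia). pose proof (pos_INR (N - 1)).
  set (X := z 0%nat * (z 0%nat * 1)) in *. set (q := rad 1 N z) in *.
  set (c := INR (N - 1)) in *. set (c' := INR N) in *.
  assert (0 <= X * q) by nra. assert (0 <= c' * X * q) by (apply Rmult_le_pos; nra).
  assert (0 <= (c' - c) * X) by nra. assert (0 <= c' * q) by nra. nra.
Qed.

Lemma lap_grow_v N Rd K2 z t : (1 <= N)%nat -> 0 < K2 ->
  jlap N (grow_v N Rd K2) z t <=
  (2 + (8 * Rd ^ 2 + 8 + 4 * INR N) / K2 + (8 + 4 * INR N)) * jw (grow_v N Rd K2) z t.
Proof.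
  intros HN HK. unfold grow_v. rewrite lap_add, lap_scal, lap_x2, lap_comp, lap_q, gg_q by auto.
  cbn [jw jadd jscal jcomp jconst jcoord jq jx2].
  pose proof (rad_nonneg 1 N z). pose proof (pow2_ge_0 (z 0%nat)) as HX. pose proof (pow2_ge_0 Rd) as HR.
  assert (Hn : INR (N - 1) <= INR N) by (apply le_INR; lia). pose proof (pos_INR (N - 1)).
  set (X := z 0%nat ^ 2) in *. set (q := rad 1 N z) in *. set (r := Rd ^ 2) in *.
  set (c := INR N) in *. set (c' := INR (N - 1)) in *.
  set (s := q - r). replace q with (s + r) by (unfold s; ring).
  set (a := (8 * r + 8 + 4 * c) / K2).
  assert (Ha : a * K2 = 8 * r + 8 + 4 * c) by (unfold a; field; lra).
  assert (Ha0 : 0 <= a) by (unfold a; apply Rdiv_le_0_compat; lra).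
  pose proof (pow2_ge_0 s) as Hs2. set (S2 := s ^ 2) in *.
  assert (Hs : s <= 1 + S2) by (unfold S2; nra).
  assert (H4 : 4 * c' * s <= 4 * c * (1 + S2)).
  { destruct (Rle_lt_dec 0 s); [|nra]. apply Rle_trans with (4 * c * s); nra. }
  assert (K2 * (2 * (1 + X)) >= K2 * 2) by nra.
  assert (0 <= a * (K2 * X)) by (apply Rmult_le_pos; [auto|nra]).
  assert (0 <= a * S2) by nra. assert (0 <= c * (K2 * X)) by (apply Rmult_le_pos; [lra|nra]).
  assert (0 <= c * K2) by nra. assert (0 <= K2 * X) by nra.
  nra.
Qed.

Lemma dn_grow_u N Rd z t : 0 < Rd -> Bd N Rd z ->
  jdn N Rd (grow_u N) z t = (1 + z 0%nat ^ 2) * (2 * Rd) /\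
  jw (grow_u N) z t = (1 + z 0%nat ^ 2) * (1 + Rd ^ 2).
Proof.
  intros HR HB. unfold grow_u. rewrite dn_mul, dn_x2, dn_add, dn_const, dn_q by auto.
  cbn [jw jadd jmul jscal jcomp jconst jcoord jq jx2]. destruct HB as [_ ->]. split; ring.
Qed.

Lemma dn_grow_v N Rd K2 z t : 0 < Rd -> Bd N Rd z ->
  jdn N Rd (grow_v N Rd K2) z t = 0 /\ jw (grow_v N Rd K2) z t = (1 + z 0%nat ^ 2) * K2.
Proof.
  intros HR HB. unfold grow_v. rewrite dn_add, dn_scal, dn_x2, dn_comp, dn_q by auto.
  cbn [jw jadd jmul jscal jcomp jconst jcoord jq jx2]. destruct HB as [_ ->]. split; ring.
Qed.

(** A bound on the growth function bounds every coordinate; this and its exterior analogue supply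
    the box required by [first_touch]. *)
Lemma grow_u_coord N z t j : (j < N)%nat -> 1 <= jw (grow_u N) z t /\ Rabs (z j) <= jw (grow_u N) z t.
Proof.
  intros Hj. cbn [grow_u jw jadd jmul jscal jcomp jconst jcoord jq jx2].
  pose proof (rad_nonneg 1 N z). pose proof (pow2_ge_0 (z 0%nat)).
  split; [nra|]. assert (Rabs (z j) <= 1 + z j ^ 2).
  { rewrite <- (pow2_abs (z j)). pose proof (Rabs_pos (z j)). nra. }
  destruct j; [nra|]. pose proof (coord_sq_le_rad N z (S j) ltac:(lia)). nra.
Qed.

Lemma grow_v_coord N Rd K2 z t j : 0 < K2 -> (j < N)%nat -> K2 <= jw (grow_v N Rd K2) z t /\
  Rabs (z j) <= 2 + Rd ^ 2 + jw (grow_v N Rd K2) z t * (1 + / K2).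
Proof.
  intros HK Hj. cbn [grow_v jw jadd jmul jscal jcomp jconst jcoord jq jx2].
  pose proof (pow2_ge_0 (z 0%nat)). pose proof (pow2_ge_0 (rad 1 N z - Rd ^ 2)). pose proof (pow2_ge_0 Rd).
  set (w := K2 * (1 + z 0%nat ^ 2) + (rad 1 N z - Rd ^ 2) ^ 2).
  assert (Hw : K2 * (1 + z 0%nat ^ 2) <= w) by (unfold w; lra).
  assert (HK' : 0 < / K2) by now apply Rinv_0_lt_compat.
  assert (Hw0 : 0 <= w) by (unfold w; nra).
  split; [nra|]. assert (Rabs (z j) <= 1 + z j ^ 2).
  { rewrite <- (pow2_abs (z j)). pose proof (Rabs_pos (z j)). nra. }
  assert (0 <= w * / K2) by (apply Rmult_le_pos; lra).
  destruct j.
  - assert (1 + z 0%nat ^ 2 <= w * / K2); [|lra].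
    apply Rmult_le_reg_l with K2; auto. replace (K2 * (w * / K2)) with w by (field; lra). auto.
  - pose proof (coord_sq_le_rad N z (S j) ltac:(lia)).
    assert (rad 1 N z - Rd ^ 2 <= 1 + (rad 1 N z - Rd ^ 2) ^ 2) by nra.
    assert ((rad 1 N z - Rd ^ 2) ^ 2 <= w) by (unfold w; nra). lra.
Qed.

(** * Boundary minima tested along radial rays *)

Lemma rad_ray (N : nat) z z' (c : R) : (forall i, (1 <= i < N)%nat -> z' i ^ 2 <= c * z i ^ 2) ->
  rad 1 N z' <= c * rad 1 N z.
Proof.
  intros H. unfold rad. rewrite <- sumk_scal. apply sumk_le. intros k Hk.
  destruct (Nat.ltb_spec k 1); [lra|]. apply H; lia.
Qed.

(** The vector [s (0, y)]: inward for [s = -1], outward for [s = 1], and of length [Rd] on the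
    boundary in both cases. *)
Definition radial (s : R) N (z : nat -> R) : nat -> R :=
  fun i => if Nat.ltb i 1 then 0 else if Nat.ltb i N then s * z i else 0.

Lemma radial_sum s N Rd J z t : 0 < Rd ->
  sumk N (fun k => radial s N z k * j1 J k z t) = s * Rd * dn 1 N Rd (j1 J) z t.
Proof.
  intros HR. unfold dn. rewrite <- sumk_scal. apply sumk_ext. intros k Hk. unfold radial.
  destruct (Nat.ltb k 1); [ring|]. destruct (Nat.ltb_spec k N); [field; lra|lia].
Qed.

Lemma ray_near (N : nat) (d : nat -> R) r : 0 < r -> exists h0, 0 < h0 < 1 /\
  forall j h, (j < N)%nat -> 0 < h < h0 -> Rabs (h * d j) < r.
Proof.
  intros Hr. set (m := sumk N (fun k => Rabs (d k))).
  assert (Hm : 0 <= m) by (apply sumk_nonneg; intros; apply Rabs_pos).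
  assert (Hp : 0 < r / (m + 1)) by (apply Rdiv_lt_0_compat; lra).
  exists (Rmin (1 / 2) (r / (m + 1))). split.
  - split; [apply Rmin_glb_lt; lra|]. pose proof (Rmin_l (1 / 2) (r / (m + 1))). lra.
  - intros j h Hj Hh. rewrite Rabs_mult, (Rabs_right h) by lra.
    assert (Rabs (d j) <= m) by (apply (sumk_term N (fun k => Rabs (d k))); auto; intros; apply Rabs_pos).
    pose proof (Rmin_r (1 / 2) (r / (m + 1))). pose proof (Rabs_pos (d j)).
    assert (h * (m + 1) < r); [|nra].
    replace r with (r / (m + 1) * (m + 1)) by (field; lra). nra.
Qed.

(** The inward ray is admissible for [boundary_slope]: if each coordinate of y is shrunk by its own
    factor of at most [1 - h1], the point is in the open cylinder. *)
Lemma boundary_touch_in N Rd (Wo : (nat -> R) -> Prop) T0 J z t r : 0 < Rd -> 0 < r ->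
  (forall z', near N r z z' -> Wo z') -> Bd N Rd z -> T0 < t ->
  reg N (fun z => Om N Rd z /\ Wo z) (fun z => Bd N Rd z /\ Wo z) T0 J ->
  cont_on N (fun z' t' => ((Om N Rd z' /\ Wo z') \/ (Bd N Rd z' /\ Wo z')) /\ t' = t) (jw J) ->
  (forall z', Om N Rd z' -> Wo z' -> jw J z t <= jw J z' t) ->
  dn 1 N Rd (j1 J) z t <= 0.
Proof.
  intros HR Hr HW HB Ht Hreg Hc Hmin. set (d := radial (-1) N z).
  destruct (ray_near N d r Hr) as [h0 [Hh0 Hray]].
  assert (Hz : near N r z z) by (split; [apply HB|intros; rewrite Rminus_diag, Rabs_R0; auto]).
  assert (H : 0 <= sumk N (fun k => d k * j1 J k z t)).
  { apply (boundary_slope N _ _ T0 J z t d h0 Hreg Ht); auto; try apply HB; try lra.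
    - intros i Hi. unfold d, radial. destruct (Nat.ltb i 1); auto. destruct (Nat.ltb_spec i N); [lia|auto].
    - intros h1 h2 z' Hh1 Hh12 Hh2 Hp Hz'.
      assert (HW' : Wo z').
      { apply HW. split; auto. intros j Hj. destruct (Hz' j Hj) as [h [Hh ->]].
        replace (z j + h * d j - z j) with (h * d j) by ring. apply Hray; auto; lra. }
      assert (HO' : Om N Rd z').
      { split; auto. apply Rle_lt_trans with ((1 - h1) ^ 2 * rad 1 N z).
        - apply rad_ray. intros i Hi. destruct (Hz' i ltac:(lia)) as [h [Hh ->]].
          unfold d, radial. destruct (Nat.ltb_spec i 1); [lia|]. destruct (Nat.ltb_spec i N); [|lia].
          replace ((z i + h * (-1 * z i)) ^ 2) with ((1 - h) ^ 2 * z i ^ 2) by ring.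
          apply Rmult_le_compat_r; [apply pow2_ge_0|]. nra.
        - destruct HB as [_ ->]. assert ((1 - h1) ^ 2 < 1) by nra. assert (0 < Rd ^ 2) by nra.
          rewrite <- (Rmult_1_l (Rd ^ 2)) at 2. now apply Rmult_lt_compat_r. }
      split; auto. }
  unfold d in H. rewrite (radial_sum (-1) N Rd J z t HR) in H. nra.
Qed.

(** Dually, if each coordinate of y is stretched by its own factor of at least [1 + h1], then
    [|y|^2] exceeds [Rd^2]. *)
Lemma boundary_touch_out N Rd (Wo : (nat -> R) -> Prop) T0 J z t r : 0 < Rd -> 0 < r ->
  (forall z', near N r z z' -> Wo z') -> Bd N Rd z -> T0 < t ->
  reg N (fun z => Ext N Rd z /\ Wo z) (fun z => Bd N Rd z /\ Wo z) T0 J ->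
  cont_on N (fun z' t' => ((Ext N Rd z' /\ Wo z') \/ (Bd N Rd z' /\ Wo z')) /\ t' = t) (jw J) ->
  (forall z', Ext N Rd z' -> Wo z' -> jw J z t <= jw J z' t) ->
  0 <= dn 1 N Rd (j1 J) z t.
Proof.
  intros HR Hr HW HB Ht Hreg Hc Hmin. set (d := radial 1 N z).
  destruct (ray_near N d r Hr) as [h0 [Hh0 Hray]].
  assert (Hz : near N r z z) by (split; [apply HB|intros; rewrite Rminus_diag, Rabs_R0; auto]).
  assert (H : 0 <= sumk N (fun k => d k * j1 J k z t)).
  { apply (boundary_slope N _ _ T0 J z t d h0 Hreg Ht); auto; try apply HB; try lra.
    - intros i Hi. unfold d, radial. destruct (Nat.ltb i 1); auto. destruct (Nat.ltb_spec i N); [lia|auto].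
    - intros h1 h2 z' Hh1 Hh12 Hh2 Hp Hz'.
      assert (HW' : Wo z').
      { apply HW. split; auto. intros j Hj. destruct (Hz' j Hj) as [h [Hh ->]].
        replace (z j + h * d j - z j) with (h * d j) by ring. apply Hray; auto; lra. }
      assert (HO' : Ext N Rd z').
      { split; auto. apply Rlt_le_trans with ((1 + h1) ^ 2 * Rd ^ 2).
        - assert (1 < (1 + h1) ^ 2) by nra. assert (0 < Rd ^ 2) by nra.
          rewrite <- (Rmult_1_l (Rd ^ 2)) at 1. now apply Rmult_lt_compat_r.
        - assert (rad 1 N z <= / (1 + h1) ^ 2 * rad 1 N z').
          { apply rad_ray. intros i Hi. destruct (Hz' i ltac:(lia)) as [h [Hh ->]].
            unfold d, radial. destruct (Nat.ltb_spec i 1); [lia|]. destruct (Nat.ltb_spec i N); [|lia].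
            replace ((z i + h * (1 * z i)) ^ 2) with ((1 + h) ^ 2 * z i ^ 2) by ring.
            assert (0 < (1 + h1) ^ 2) by nra.
            apply Rmult_le_reg_l with ((1 + h1) ^ 2); auto.
            rewrite <- !Rmult_assoc, Rinv_r, Rmult_1_l by lra.
            apply Rmult_le_compat_r; [apply pow2_ge_0|]. nra. }
          destruct HB as [_ HB]. rewrite HB in H. assert (0 < (1 + h1) ^ 2) by nra.
          apply Rmult_le_reg_l with (/ (1 + h1) ^ 2); [now apply Rinv_0_lt_compat|].
          rewrite <- Rmult_assoc, Rinv_l; lra. }
      split; auto. }
  unfold d in H. rewrite (radial_sum 1 N Rd J z t HR) in H. nra.
Qed.

(** * Two-phase comparison *)

(* [P = upper - lower] in the cylinder and [Q] outside; the differential inequalities are only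
   needed where [P] or [Q] is negative, which makes truncated barriers [max(s, 0)] admissible.
   The window [W] localizes the comparison; a negative value may only occur in its interior [Wo]. *)
Lemma comparison N D d Rd mu nu C M t0 t1 (W Wo : (nat -> R) -> Prop) (P Q : jet) :
  (1 <= N)%nat -> 0 < D -> 0 < d -> 0 < Rd -> 0 < mu -> 0 < nu -> 0 <= C ->
  closed_in N (fun z => pt N z /\ W z) ->
  (forall z, Wo z -> W z) ->
  (forall z, pt N z -> Wo z -> exists r, 0 < r /\ forall z', near N r z z' -> Wo z') ->
  cont_on N (fun z t => (clO N Rd z /\ W z) /\ t0 <= t <= t1) (jw P) ->
  cont_on N (fun z t => (clE N Rd z /\ W z) /\ t0 <= t <= t1) (jw Q) ->
  reg N (fun z => Om N Rd z /\ Wo z) (fun z => Bd N Rd z /\ Wo z) t0 P ->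
  reg N (fun z => Ext N Rd z /\ Wo z) (fun z => Bd N Rd z /\ Wo z) t0 Q ->
  (forall z t, clO N Rd z -> W z -> t0 <= t <= t1 -> - M <= jw P z t) ->
  (forall z t, clE N Rd z -> W z -> t0 <= t <= t1 -> - M <= jw Q z t) ->
  (forall z, clO N Rd z -> W z -> 0 <= jw P z t0) ->
  (forall z, clE N Rd z -> W z -> 0 <= jw Q z t0) ->
  (forall z t, clO N Rd z -> W z -> t0 < t <= t1 -> jw P z t < 0 -> Wo z) ->
  (forall z t, clE N Rd z -> W z -> t0 < t <= t1 -> jw Q z t < 0 -> Wo z) ->
  (forall z t, Om N Rd z -> Wo z -> t0 < t <= t1 -> jw P z t < 0 ->
     C * jw P z t <= jt P z t - D * jlap N P z t) ->
  (forall z t, Bd N Rd z -> Wo z -> t0 < t <= t1 -> jw P z t < 0 ->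
     nu * Rmin (jw Q z t) 0 <= D * jdn N Rd P z t + mu * jw P z t) ->
  (forall z t, Ext N Rd z -> Wo z -> t0 < t <= t1 -> jw Q z t < 0 ->
     C * jw Q z t <= jt Q z t - d * jlap N Q z t) ->
  (forall z t, Bd N Rd z -> Wo z -> t0 < t <= t1 -> jw Q z t < 0 ->
     mu * Rmin (jw P z t) 0 <= - d * jdn N Rd Q z t + nu * jw Q z t) ->
  (forall z t, clO N Rd z -> W z -> t0 <= t <= t1 -> 0 <= jw P z t) /\
  (forall z t, clE N Rd z -> W z -> t0 <= t <= t1 -> 0 <= jw Q z t).
Proof.
  intros HN HD Hd HR Hmu Hnu HC HW HWoW HWo HcP HcQ HrP HrQ HMP HMQ H0P H0Q HWP HWQ HiP HbP HiQ HbQ.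
  (* [nu * K2] has to lie strictly between [mu * (1 + Rd ^ 2)] and [mu * (1 + Rd ^ 2) + 2 * D * Rd]:
     the lower bound excludes a touch of the exterior function on the boundary, the upper one a
     touch of the interior function. The midpoint is taken. *)
  set (K2 := (mu * (1 + Rd ^ 2) + D * Rd) / nu).
  assert (HR2 : 0 < Rd ^ 2) by nra.
  assert (HK2 : 0 < K2) by (apply Rdiv_lt_0_compat; nra).
  assert (HK2n : nu * K2 = mu * (1 + Rd ^ 2) + D * Rd) by (unfold K2; field; lra).
  set (CV := 2 + (8 * Rd ^ 2 + 8 + 4 * INR N) / K2 + (8 + 4 * INR N)).
  assert (HCV : 0 <= CV).
  { unfold CV. pose proof (pos_INR N).
    assert (0 <= (8 * Rd ^ 2 + 8 + 4 * INR N) / K2) by (apply Rdiv_le_0_compat; lra). lra. }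
  (* The growth rate exceeds the zeroth-order constant and both Laplacian ratios by 1, which
     excludes touching in the open sets. *)
  set (K := C + D * (2 + 2 * INR N) + d * CV + 1).
  pose proof (pos_INR N) as HNn.
  assert (HK : 0 < K) by (unfold K; assert (0 <= D * (2 + 2 * INR N)) by nra; nra).
  (* Strict positivity of the perturbed pair for every [eps]; a negative value of [P] or [Q] is
     refuted afterwards by an [eps] adapted to that point. *)
  assert (Hmain : forall eps, 0 < eps ->
    (forall z t, clO N Rd z -> W z -> t0 <= t <= t1 ->
        0 < jw P z t + eps * exp (K * (t - t0)) * jw (grow_u N) z t) /\
    (forall z t, clE N Rd z -> W z -> t0 <= t <= t1 ->
        0 < jw Q z t + eps * exp (K * (t - t0)) * jw (grow_v N Rd K2) z t)).
  { intros eps Heps.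
    set (f := fun t => eps * exp (K * (t - t0))).
    set (E := jtime f (fun t => K * (eps * exp (K * (t - t0))))).
    assert (HE : forall O B, creg N O B (t0 - 1) E).
    { intros. apply creg_time. intros t _. unfold f. apply is_derive_Reals. auto_derive; auto. unfold Rminus; ring. }
    assert (HEpos : forall t, 0 < f t) by (intros; unfold f; apply Rmult_lt_0_compat; auto; apply exp_pos).
    set (Pe := jadd P (jmul E (grow_u N))). set (Qe := jadd Q (jmul E (grow_v N Rd K2))).
    set (Ki := fun i : bool => if i then (fun z => clO N Rd z /\ W z) else (fun z => clE N Rd z /\ W z)).
    set (F := fun i : bool => if i then jw Pe else jw Qe).
    assert (HcG : forall (S : (nat -> R) -> R -> Prop), (forall z t, S z t -> t0 <= t) -> cont_on N S (jw (jmul E (grow_u N))) /\ cont_on N S (jw (jmul E (grow_v N Rd K2)))).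
    { intros S HS. split.
      - apply (creg_cont N (fun _ => True) (fun _ => True) (t0 - 1)).
        + apply creg_mul; [apply HE|now apply creg_grow_u].
        + intros z t Hs. specialize (HS z t Hs). split; auto; lra.
      - apply (creg_cont N (fun _ => True) (fun _ => True) (t0 - 1)).
        + apply creg_mul; [apply HE|now apply creg_grow_v].
        + intros z t Hs. specialize (HS z t Hs). split; auto; lra. }
    assert (HcPe : cont_on N (fun z t => (clO N Rd z /\ W z) /\ t0 <= t <= t1) (jw Pe)).
    { apply (cont_on_plus N _ (jw P) _ HcP). apply HcG. intros; lra. }
    assert (HcQe : cont_on N (fun z t => (clE N Rd z /\ W z) /\ t0 <= t <= t1) (jw Qe)).
    { apply (cont_on_plus N _ (jw Q) _ HcQ). apply HcG. intros; lra. }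
    assert (HrPe : reg N (fun z => Om N Rd z /\ Wo z) (fun z => Bd N Rd z /\ Wo z) t0 Pe).
    { apply reg_add; auto. apply (reg_sub N (fun _ => True) (fun _ => True) _ _ (t0 - 1)); auto; [|lra].
      apply creg_reg, creg_mul; [apply HE|now apply creg_grow_u]. }
    assert (HrQe : reg N (fun z => Ext N Rd z /\ Wo z) (fun z => Bd N Rd z /\ Wo z) t0 Qe).
    { apply reg_add; auto. apply (reg_sub N (fun _ => True) (fun _ => True) _ _ (t0 - 1)); auto; [|lra].
      apply creg_reg, creg_mul; [apply HE|now apply creg_grow_v]. }
    set (M' := Rmax M 0).
    assert (HM' : M <= M' /\ 0 <= M') by (split; [apply Rmax_l|apply Rmax_r]).
    assert (Hf1 : forall t, t0 <= t -> eps <= f t).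
    { intros t Ht. unfold f. assert (1 <= exp (K * (t - t0))); [|nra].
      pose proof (exp_ineq1_le (K * (t - t0))). nra. }
    assert (Hgu : forall z t, (1 <= jw (grow_u N) z t)).
    { intros z t. now apply (grow_u_coord N z t 0). }
    assert (Hgv : forall z t, (K2 <= jw (grow_v N Rd K2) z t)).
    { intros z t. now apply (grow_v_coord N Rd K2 z t 0). }
    assert (Hall : forall i z t, Ki i z -> t0 <= t <= t1 -> 0 < F i z t).
    { apply (first_touch N Ki t0 t1 F (M' / eps + (2 + Rd ^ 2 + M' / eps * (1 + / K2)))).
      - intros []; apply closed_in_and; auto;
          [apply clO_closed|apply clO_pt|apply clE_closed|apply clE_pt].
      - intros []; assumption.
      - assert (H1 : 0 <= M' / eps) by (apply Rdiv_le_0_compat; lra).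
        assert (H2 : 0 < / K2) by now apply Rinv_0_lt_compat.
        assert (Hdivle : forall g t, t0 <= t -> 0 <= g -> f t * g <= M' -> g <= M' / eps).
        { intros g t Ht Hg Hle. specialize (Hf1 t Ht). apply Rmult_le_reg_r with eps; auto.
          unfold Rdiv. rewrite Rmult_assoc, Rinv_l, Rmult_1_r by lra.
          apply Rle_trans with (f t * g); [rewrite Rmult_comm; now apply Rmult_le_compat_r|auto]. }
        intros [] z t [Hz Hw] Ht Hle j Hj.
        + change (jw P z t + f t * jw (grow_u N) z t <= 0) in Hle. specialize (HMP z t Hz Hw Ht). destruct (grow_u_coord N z t j Hj) as [G1 G2].
          assert (jw (grow_u N) z t <= M' / eps).
          { apply (Hdivle _ t); lra. }
          assert (0 <= M' / eps * (1 + / K2)) by nra. lra.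
        + change (jw Q z t + f t * jw (grow_v N Rd K2) z t <= 0) in Hle. specialize (HMQ z t Hz Hw Ht). destruct (grow_v_coord N Rd K2 z t j HK2 Hj) as [G1 G2].
          assert (jw (grow_v N Rd K2) z t <= M' / eps).
          { apply (Hdivle _ t); lra. }
          assert (jw (grow_v N Rd K2) z t * (1 + / K2) <= M' / eps * (1 + / K2)) by (apply Rmult_le_compat_r; lra).
          lra.
      - intros [] z [Hz Hw].
        + change (0 < jw P z t0 + f t0 * jw (grow_u N) z t0). specialize (H0P z Hz Hw). specialize (Hgu z t0). specialize (HEpos t0). nra.
        + change (0 < jw Q z t0 + f t0 * jw (grow_v N Rd K2) z t0). specialize (H0Q z Hz Hw). specialize (Hgv z t0). specialize (HEpos t0). nra.
      - intros [] z t [Hz Hw] Ht H0 Hpre.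
        + change (jw P z t + f t * jw (grow_u N) z t = 0) in H0.
          pose proof (Hgu z t) as Hg. pose proof (HEpos t) as HEt.
          assert (Hneg : jw P z t < 0) by nra.
          pose proof (HWP z t Hz Hw Ht Hneg) as Hwo.
          destruct (HWo z (clO_pt _ _ _ Hz) Hwo) as [r [Hr Hrn]].
          assert (Hpos : forall z', clO N Rd z' -> Wo z' -> 0 <= jw Pe z' t).
          { intros z' H1 H2. apply (Hpre true z' t); [split; auto|lra]. }
          destruct Hz as [Hz|Hz].
          * destruct (Om_open N Rd z Hz) as [r' [Hr' Hrn']].
            destruct (interior_touch N Pe z t t0 (Rmin r r')) as [Hjt Hlap].
            -- now apply Rmin_glb_lt.
            -- lra.
            -- apply Hz.
            -- intros z' [Hp Hn].
               assert (HO' : Om N Rd z') by (apply Hrn'; split; auto; intros; eapply Rlt_le_trans; [now apply Hn|apply Rmin_r]).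
               assert (HW' : Wo z') by (apply Hrn; split; auto; intros; eapply Rlt_le_trans; [now apply Hn|apply Rmin_l]).
               split; [apply HrPe; [auto|lra]|]. change (jw Pe z t) with (jw P z t + f t * jw (grow_u N) z t).
               rewrite H0. apply Hpos; auto. now left.
            -- intros s Hs. change (jw Pe z t) with (jw P z t + f t * jw (grow_u N) z t). rewrite H0.
               apply (Hpre true z s); [split; auto; now left|lra].
            -- specialize (HiP z t Hz Hwo Ht Hneg).
               unfold Pe in Hlap. rewrite lap_add, lap_mul in Hlap.
               unfold E in Hlap at 1 2. rewrite lap_time, gg_time in Hlap.
               pose proof (lap_grow_u N z t HN) as HG.
               assert (Hjt' : jt Pe z t = jt P z t + K * (f t * jw (grow_u N) z t)).
               { unfold f. simpl. ring. }
               rewrite Hjt' in Hjt. change (jw E z t) with (f t) in Hlap.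
               replace (jw P z t) with (- (f t * jw (grow_u N) z t)) in HiP by lra.
               set (a := f t) in *. set (g := jw (grow_u N) z t) in *.
               set (l := jlap N (grow_u N) z t) in *. set (lp := jlap N P z t) in *.
               assert (0 < a * g) by nra.
               assert (Hl : D * (a * l) <= D * (2 + 2 * INR N) * (a * g)).
               { replace (D * (2 + 2 * INR N) * (a * g)) with (D * (a * ((2 + 2 * INR N) * g))) by ring.
                 repeat apply Rmult_le_compat_l; lra. }
               assert (0 <= D * (lp + a * l)) by (apply Rmult_le_pos; lra).
               unfold K in Hjt. assert (0 <= d * CV * (a * g)) by (apply Rmult_le_pos; nra). nra.
          * pose proof (HbP z t Hz Hwo Ht Hneg) as Hb.
            assert (Hdn : jdn N Rd Pe z t <= 0).
            { apply (boundary_touch_in N Rd Wo t0 Pe z t r); auto; [lra| |].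
              - apply cont_on_subset with (1 := HcPe). intros z' t' [[[]|[]] ->]; repeat split; auto; try lra;
                  [now left|now right].
              - intros z' H1 H2. change (jw Pe z t) with (jw P z t + f t * jw (grow_u N) z t). rewrite H0.
                apply Hpos; auto. now left. }
            (* The perturbed exterior function is still nonnegative at this point, so [Q] is at
               least minus its perturbation there and the exchange term is bounded below. *)
            assert (HQe : 0 <= jw Qe z t).
            { apply (Hpre false z t); [split; auto; now right|lra]. }
            change (jw Qe z t) with (jw Q z t + f t * jw (grow_v N Rd K2) z t) in HQe.
            unfold Pe in Hdn. rewrite dn_add, dn_mul in Hdn. unfold E in Hdn at 1. rewrite dn_time in Hdn.
            change (jw E z t) with (f t) in Hdn.
            destruct (dn_grow_u N Rd z t HR Hz) as [G1 G2]. destruct (dn_grow_v N Rd K2 z t HR Hz) as [G3 G4].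
            rewrite G1 in Hdn. rewrite G2 in H0. rewrite G4 in HQe.
            set (X := z 0%nat ^ 2) in *. assert (HX : 0 <= X) by apply pow2_ge_0.
            set (a := f t) in *.
            assert (HaX : 0 < a * (1 + X)) by nra.
            assert (Hmin : - (a * ((1 + X) * K2)) <= Rmin (jw Q z t) 0).
            { apply Rmin_glb; [lra|]. assert (0 < a * (1 + X) * K2) by now apply Rmult_lt_0_compat. nra. }
            assert (Hmin2 : nu * - (a * ((1 + X) * K2)) <= nu * Rmin (jw Q z t) 0) by (apply Rmult_le_compat_l; lra).
            assert (Hx : nu * - (a * ((1 + X) * K2)) = - (a * (1 + X)) * (mu * (1 + Rd ^ 2) + D * Rd)).
            { rewrite <- HK2n. ring. }
            assert (Hy : mu * jw P z t = - (a * (1 + X)) * (mu * (1 + Rd ^ 2))).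
            { replace (jw P z t) with (- (a * ((1 + X) * (1 + Rd ^ 2)))) by lra. ring. }
            assert (Hz2 : D * jdn N Rd P z t <= - (a * (1 + X)) * (2 * (D * Rd))).
            { replace (- (a * (1 + X)) * (2 * (D * Rd))) with (D * - (a * ((1 + X) * (2 * Rd)))) by ring.
              apply Rmult_le_compat_l; lra. }
            assert (0 < a * (1 + X) * (D * Rd)) by (apply Rmult_lt_0_compat; nra). lra.
        + change (jw Q z t + f t * jw (grow_v N Rd K2) z t = 0) in H0.
          pose proof (Hgv z t) as Hg. pose proof (HEpos t) as HEt.
          assert (Hneg : jw Q z t < 0) by nra.
          pose proof (HWQ z t Hz Hw Ht Hneg) as Hwo.
          destruct (HWo z (clE_pt _ _ _ Hz) Hwo) as [r [Hr Hrn]].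
          assert (Hpos : forall z', clE N Rd z' -> Wo z' -> 0 <= jw Qe z' t).
          { intros z' H1 H2. apply (Hpre false z' t); [split; auto|lra]. }
          destruct Hz as [Hz|Hz].
          * destruct (Ext_open N Rd z Hz) as [r' [Hr' Hrn']].
            destruct (interior_touch N Qe z t t0 (Rmin r r')) as [Hjt Hlap].
            -- now apply Rmin_glb_lt.
            -- lra.
            -- apply Hz.
            -- intros z' [Hp Hn].
               assert (HO' : Ext N Rd z') by (apply Hrn'; split; auto; intros; eapply Rlt_le_trans; [now apply Hn|apply Rmin_r]).
               assert (HW' : Wo z') by (apply Hrn; split; auto; intros; eapply Rlt_le_trans; [now apply Hn|apply Rmin_l]).
               split; [apply HrQe; [auto|lra]|]. change (jw Qe z t) with (jw Q z t + f t * jw (grow_v N Rd K2) z t).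
               rewrite H0. apply Hpos; auto. now left.
            -- intros s Hs. change (jw Qe z t) with (jw Q z t + f t * jw (grow_v N Rd K2) z t). rewrite H0.
               apply (Hpre false z s); [split; auto; now left|lra].
            -- specialize (HiQ z t Hz Hwo Ht Hneg).
               unfold Qe in Hlap. rewrite lap_add, lap_mul in Hlap.
               unfold E in Hlap at 1 2. rewrite lap_time, gg_time in Hlap.
               pose proof (lap_grow_v N Rd K2 z t HN HK2) as HG. fold CV in HG.
               assert (Hjt' : jt Qe z t = jt Q z t + K * (f t * jw (grow_v N Rd K2) z t)).
               { unfold f. simpl. ring. }
               rewrite Hjt' in Hjt. change (jw E z t) with (f t) in Hlap.
               replace (jw Q z t) with (- (f t * jw (grow_v N Rd K2) z t)) in HiQ by lra.
               set (a := f t) in *. set (g := jw (grow_v N Rd K2) z t) in *.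
               set (l := jlap N (grow_v N Rd K2) z t) in *. set (lp := jlap N Q z t) in *.
               assert (0 < a * g) by nra.
               assert (Hl : d * (a * l) <= d * CV * (a * g)).
               { replace (d * CV * (a * g)) with (d * (a * (CV * g))) by ring.
                 repeat apply Rmult_le_compat_l; lra. }
               assert (0 <= d * (lp + a * l)) by (apply Rmult_le_pos; lra).
               unfold K in Hjt. assert (0 <= D * (2 + 2 * INR N) * (a * g)) by (apply Rmult_le_pos; nra). nra.
          * pose proof (HbQ z t Hz Hwo Ht Hneg) as Hb.
            assert (Hdn : 0 <= jdn N Rd Qe z t).
            { apply (boundary_touch_out N Rd Wo t0 Qe z t r); auto; [lra| |].
              - apply cont_on_subset with (1 := HcQe). intros z' t' [[[]|[]] ->]; repeat split; auto; try lra;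
                  [now left|now right].
              - intros z' H1 H2. change (jw Qe z t) with (jw Q z t + f t * jw (grow_v N Rd K2) z t). rewrite H0.
                apply Hpos; auto. now left. }
            assert (HPe : 0 <= jw Pe z t).
            { apply (Hpre true z t); [split; auto; now right|lra]. }
            change (jw Pe z t) with (jw P z t + f t * jw (grow_u N) z t) in HPe.
            unfold Qe in Hdn. rewrite dn_add, dn_mul in Hdn. unfold E in Hdn at 1. rewrite dn_time in Hdn.
            change (jw E z t) with (f t) in Hdn.
            destruct (dn_grow_u N Rd z t HR Hz) as [G1 G2]. destruct (dn_grow_v N Rd K2 z t HR Hz) as [G3 G4].
            rewrite G3 in Hdn. rewrite G4 in H0. rewrite G2 in HPe.
            set (X := z 0%nat ^ 2) in *. assert (HX : 0 <= X) by apply pow2_ge_0.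
            set (a := f t) in *.
            assert (HaX : 0 < a * (1 + X)) by nra.
            assert (Hmin : - (a * ((1 + X) * (1 + Rd ^ 2))) <= Rmin (jw P z t) 0).
            { apply Rmin_glb; [lra|]. assert (0 < a * (1 + X) * (1 + Rd ^ 2)) by (apply Rmult_lt_0_compat; lra). nra. }
            assert (Hmin2 : mu * - (a * ((1 + X) * (1 + Rd ^ 2))) <= mu * Rmin (jw P z t) 0) by (apply Rmult_le_compat_l; lra).
            assert (Hx : nu * jw Q z t = - (a * (1 + X)) * (mu * (1 + Rd ^ 2) + D * Rd)).
            { rewrite <- HK2n. replace (jw Q z t) with (- (a * ((1 + X) * K2))) by lra. ring. }
            assert (Hz2 : 0 <= d * jdn N Rd Q z t) by (apply Rmult_le_pos; lra).
            assert (0 < a * (1 + X) * (D * Rd)) by (apply Rmult_lt_0_compat; nra). lra. }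
    split; intros z t Hz Hw Ht; [apply (Hall true z t)|apply (Hall false z t)]; auto; split; auto. }
  split; intros z t Hz Hw Ht; apply Rnot_lt_le; intros Hneg.
  - set (G := exp (K * (t - t0)) * jw (grow_u N) z t).
    assert (HG : 0 < G).
    { apply Rmult_lt_0_compat; [apply exp_pos|]. destruct (grow_u_coord N z t 0); [lia|lra]. }
    destruct (Hmain (- jw P z t / G)) as [H _]; [apply Rdiv_lt_0_compat; lra|].
    specialize (H z t Hz Hw Ht). rewrite Rmult_assoc in H. fold G in H.
    replace (- jw P z t / G * G) with (- jw P z t) in H by (field; lra). lra.
  - set (G := exp (K * (t - t0)) * jw (grow_v N Rd K2) z t).
    assert (HG : 0 < G).
    { apply Rmult_lt_0_compat; [apply exp_pos|]. destruct (grow_v_coord N Rd K2 z t 0); [lra|lia|lra]. }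
    destruct (Hmain (- jw Q z t / G)) as [_ H]; [apply Rdiv_lt_0_compat; lra|].
    specialize (H z t Hz Hw Ht). rewrite Rmult_assoc in H. fold G in H.
    replace (- jw Q z t / G * G) with (- jw Q z t) in H by (field; lra). lra.
Qed.

(** * Solutions of the coupled problem *)

(* The fields are [N, D, d, R, mu, nu, rho, g, g'(0)]. *)
Record model := Model {
  dimN : nat; difD : R; difd : R; radR : R; exmu : R; exnu : R; decay : R;
  reac : R -> R; slope : R }.

Definition model_ok (m : model) : Prop :=
  (2 <= dimN m)%nat /\ 0 < difD m /\ 0 < difd m /\ 0 < radR m /\ 0 < exmu m /\ 0 < exnu m /\
  0 < decay m /\ KPP (reac m) (slope m) /\ sKPP (reac m).

Notation inO m := (clO (dimN m) (radR m)).
Notation inE m := (clE (dimN m) (radR m)).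
Notation mOm m := (Om (dimN m) (radR m)).
Notation mExt m := (Ext (dimN m) (radR m)).
Notation mBd m := (Bd (dimN m) (radR m)).
Notation mlap m J := (lap (dimN m) (j2 J)).
Notation mdn m J := (dn 1 (dimN m) (radR m) (j1 J)).

Definition sol (m : model) (U V : jet) : Prop :=
  cont_on (dimN m) (fun z t => inO m z /\ 0 <= t) (jw U) /\
  cont_on (dimN m) (fun z t => inE m z /\ 0 <= t) (jw V) /\
  reg (dimN m) (mOm m) (mBd m) 0 U /\ reg (dimN m) (mExt m) (mBd m) 0 V /\
  (forall z t, mOm m z -> 0 < t -> jt U z t - difD m * mlap m U z t = reac m (jw U z t)) /\
  (forall z t, mExt m z -> 0 < t -> jt V z t - difd m * mlap m V z t = - decay m * jw V z t) /\
  (forall z t, mBd m z -> 0 < t ->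
     difD m * mdn m U z t = exnu m * jw V z t - exmu m * jw U z t /\
     - difd m * mdn m V z t = exmu m * jw U z t - exnu m * jw V z t) /\
  (forall T, exists M, (forall z t, inO m z -> 0 <= t <= T -> Rabs (jw U z t) <= M) /\
     (forall z t, inE m z -> 0 <= t <= T -> Rabs (jw V z t) <= M)).

Lemma solM_sol N D d Rd mu nu rho g gp0 u0 v0 u v : solM N D d Rd mu nu rho g u0 v0 u v ->
  let m := Model N D d Rd mu nu rho g gp0 in
  exists U V, sol m U V /\ jw U = u /\ jw V = v /\
   (forall z, inO m z -> u z 0 = u0 z) /\ (forall z, inE m z -> v z 0 = v0 z).
Proof.
  intros [ut [u1 [u2 [vt [v1 [v2 [HU [HV [E1 [E2 [E3 [I1 I2]]]]]]]]]]]] m.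
  exists (mkjet u ut u1 u2), (mkjet v vt v1 v2).
  destruct HU as [U1 [U2 [U3 [U4 U5]]]]. destruct HV as [V1 [V2 [V3 [V4 V5]]]].
  split; [|auto].
  split; [exact U1|]. split; [exact V1|].
  split; [split; [exact U3|intros; now apply U5]|].
  split; [split; [exact V3|intros; now apply V5]|].
  split; [exact E1|]. split; [exact E2|]. split; [exact E3|].
  intros T. destruct (U2 T) as [M1 H1]. destruct (V2 T) as [M2 H2].
  exists (Rmax M1 M2). pose proof (Rmax_l M1 M2). pose proof (Rmax_r M1 M2).
  split; intros z t Hz Ht; [specialize (H1 z t Hz Ht)|specialize (H2 z t Hz Ht)]; simpl; lra.
Qed.

(** * Consequences of the assumptions on the reaction *)

Section ModelReaction.
Context (m : model) (Hm : model_ok m).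
Let g := reac m.

Lemma model_KPP : KPP (reac m) (slope m) /\ sKPP (reac m).
Proof. unfold model_ok in Hm. tauto. Qed.

Lemma reac_0 : reac m 0 = 0.
Proof. apply model_KPP. Qed.

Lemma reac_lipschitz B : exists L, 0 <= L /\ forall s1 s2, - B <= s1 <= B -> - B <= s2 <= B ->
  Rabs (g s1 - g s2) <= L * Rabs (s1 - s2).
Proof.
  destruct model_KPP as [[Hl _] _]. destruct (Hl (- B) B) as [L HL].
  exists (Rmax L 0). split; [apply Rmax_r|]. intros s1 s2 H1 H2.
  eapply Rle_trans; [now apply HL|]. apply Rmult_le_compat_r; [apply Rabs_pos|apply Rmax_l].
Qed.

Lemma slope_pos : 0 < slope m.
Proof.
  destruct model_KPP as [[_ [_ [_ [_ [H _]]]]] _].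
  specialize (H (1 / 2) ltac:(lra)). lra.
Qed.

Lemma reac_pos s : 0 < s < 1 -> 0 < reac m s.
Proof. intros. destruct model_KPP as [[_ [_ [_ [_ [H1 _]]]]] _]. now apply H1. Qed.

Lemma reac_le_slope s : 0 <= s -> reac m s <= slope m * s.
Proof.
  intros Hs. pose proof slope_pos.
  destruct model_KPP as [[_ [_ [H0 [H1 [H2 H3]]]]] _].
  destruct (Rle_lt_or_eq_dec 0 s Hs) as [Hp|<-]; [|rewrite H0; lra].
  destruct (Rtotal_order s 1) as [Hlt|[->|Hgt]].
  - now apply H2.
  - rewrite H1; lra.
  - specialize (H3 s Hgt). nra.
Qed.

Lemma reac_nonpos s : 1 <= s -> reac m s <= 0.
Proof.
  intros Hs. destruct model_KPP as [[_ [_ [H0 [H1 [H2 H3]]]]] _].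
  destruct (Rle_lt_or_eq_dec 1 s Hs) as [Hp|<-]; [apply Rlt_le; auto|lra].
Qed.

Lemma reac_ratio s1 s2 : 0 < s1 -> s1 < s2 -> reac m s2 / s2 < reac m s1 / s1.
Proof. destruct model_KPP as [_ H]. apply H. Qed.

(** Since [g(s)/s] decreases, a multiple at most 1 of a nonnegative solution is a subsolution;
    [reac_scale_up] is the dual fact for supersolutions. *)
Lemma reac_scale k s : 0 < k <= 1 -> 0 <= s -> k * reac m s <= reac m (k * s).
Proof.
  intros Hk Hs. destruct (Rle_lt_or_eq_dec 0 s Hs) as [Hp|<-]; [|rewrite Rmult_0_r, reac_0; lra].
  destruct (Rle_lt_or_eq_dec k 1 ltac:(lra)) as [Hk1| ->]; [|rewrite !Rmult_1_l; lra].
  assert (0 < k * s) by nra.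
  pose proof (reac_ratio (k * s) s ltac:(auto) ltac:(nra)) as H1.
  replace (k * reac m s) with (reac m s / s * (k * s)) by (field; lra).
  replace (reac m (k * s)) with (reac m (k * s) / (k * s) * (k * s)) by (field; lra). nra.
Qed.

Lemma reac_scale_up k s : 1 <= k -> 0 <= s -> reac m (k * s) <= k * reac m s.
Proof.
  intros Hk Hs. assert (0 < / k) by (apply Rinv_0_lt_compat; lra).
  pose proof (reac_scale (/ k) (k * s)) as H1.
  replace (/ k * (k * s)) with s in H1 by (field; lra).
  assert (/ k * reac m (k * s) <= reac m s).
  { apply H1; [|nra]. split; auto. rewrite <- Rinv_1. apply Rinv_le_contravar; lra. }
  replace (reac m (k * s)) with (k * (/ k * reac m (k * s))) by (field; lra). nra.
Qed.

Lemma reac_continuous x : continuity_pt (reac m) x.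
Proof.
  destruct (reac_lipschitz (Rabs x + 1)) as [L [HL HLip]]. intros eps He.
  exists (Rmin 1 (eps / (L + 1))). assert (0 < eps / (L + 1)) by (apply Rdiv_lt_0_compat; lra).
  split; [apply Rmin_glb_lt; lra|]. intros y [_ Hy]. simpl in *. unfold R_dist in *.
  pose proof (Rmin_l 1 (eps / (L + 1))). pose proof (Rmin_r 1 (eps / (L + 1))).
  assert (Hx : - (Rabs x + 1) <= x <= Rabs x + 1) by (apply Rabs_le_between; lra).
  assert (Hy2 : - (Rabs x + 1) <= y <= Rabs x + 1).
  { apply Rabs_le_between. replace y with (x + (y - x)) by ring.
    eapply Rle_trans; [apply Rabs_triang|]. lra. }
  eapply Rle_lt_trans; [apply HLip; auto|]. pose proof (Rabs_pos (y - x)).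
  apply Rle_lt_trans with ((L + 1) * Rabs (y - x)); [nra|].
  apply Rlt_le_trans with ((L + 1) * (eps / (L + 1))); [apply Rmult_lt_compat_l; lra|].
  right; field; lra.
Qed.

(** One-sided Lipschitz bounds in the shape required by [comparison], where [a - b] is the negative
    difference of two functions. *)
Lemma reac_lip_lower B : exists L, 0 <= L /\ forall a b, - B <= a -> a <= b -> b <= B ->
  L * (a - b) <= reac m a - reac m b /\ L * (a - b) <= reac m b - reac m a.
Proof.
  destruct (reac_lipschitz B) as [L [HL H]]. exists L. split; auto. intros a b Ha Hab Hb.
  specialize (H a b ltac:(lra) ltac:(lra)). rewrite (Rabs_left1 (a - b)) in H by lra.
  apply Rabs_le_between in H. unfold g in H. lra.
Qed.
End ModelReaction.

Definition full (z : nat -> R) : Prop := True.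

Lemma full_closed N : closed_in N (fun z => pt N z /\ full z).
Proof. intros z Hz _. now split. Qed.

Lemma full_open N z : pt N z -> full z -> exists r, 0 < r /\ forall z', near N r z z' -> full z'.
Proof. exists 1. split; [lra|]. intros; exact I. Qed.

Lemma jsub_cont N S A B : cont_on N S (jw A) -> cont_on N S (jw B) -> cont_on N S (jw (jsub A B)).
Proof.
  intros HA HB. apply (cont_on_plus N S (jw A) (jw (jscal (-1) B)) HA).
  exact (cont_on_scal N S (-1) _ HB).
Qed.

Lemma jw_sub A B z t : jw (jsub A B) z t = jw A z t - jw B z t.
Proof. simpl. ring. Qed.
Lemma jt_sub A B z t : jt (jsub A B) z t = jt A z t - jt B z t.
Proof. simpl. ring. Qed.

Section Comparisons.
Context (m : model) (Hm : model_ok m).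

(** Where the nonnegative barrier [S] lies below [U], both have values in the range of [U], so the
    Lipschitz constant of the reaction on that range is enough. *)
Lemma super_comparison U V t0 t1 S T : sol m U V -> 0 <= t0 <= t1 ->
  creg (dimN m) (mOm m) (mBd m) (t0 - 1) S -> creg (dimN m) (mExt m) (mBd m) (t0 - 1) T ->
  (forall z t, inO m z -> t0 <= t <= t1 -> 0 <= jw S z t) ->
  (forall z t, inE m z -> t0 <= t <= t1 -> 0 <= jw T z t) ->
  (forall z, inO m z -> jw U z t0 <= jw S z t0) ->
  (forall z, inE m z -> jw V z t0 <= jw T z t0) ->
  (forall z t, mOm m z -> t0 < t <= t1 -> reac m (jw S z t) <= jt S z t - difD m * mlap m S z t) ->
  (forall z t, mBd m z -> t0 < t <= t1 ->
     exnu m * jw T z t <= difD m * mdn m S z t + exmu m * jw S z t) ->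
  (forall z t, mExt m z -> t0 < t <= t1 -> - decay m * jw T z t <= jt T z t - difd m * mlap m T z t) ->
  (forall z t, mBd m z -> t0 < t <= t1 ->
     exmu m * jw S z t <= - difd m * mdn m T z t + exnu m * jw T z t) ->
  (forall z t, inO m z -> t0 <= t <= t1 -> jw U z t <= jw S z t) /\
  (forall z t, inE m z -> t0 <= t <= t1 -> jw V z t <= jw T z t).
Proof.
  intros [cU [cV [rU [rV [eU [eV [eB bd]]]]]]] Ht HS HT S0 T0 IS IT ES BS ET BT.
  destruct (bd t1) as [M [bU bV]].
  destruct (reac_lip_lower m Hm M) as [L [HL HLip]].
  destruct Hm as [HN [HD [Hd [HR [Hmu [Hnu [Hrho _]]]]]]].
  destruct (comparison (dimN m) (difD m) (difd m) (radR m) (exmu m) (exnu m) L M t0 t1 full full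
    (jsub S U) (jsub T V)) as [H1 H2]; auto; try lia; try lra.
  - apply full_closed.
  - apply full_open.
  - apply jsub_cont.
    + apply (creg_cont _ _ _ _ _ _ HS). intros z t [[Hz _] Ht']. split; auto; lra.
    + apply cont_on_subset with (1 := cU). intros z t [[Hz _] Ht']; split; auto; lra.
  - apply jsub_cont.
    + apply (creg_cont _ _ _ _ _ _ HT). intros z t [[Hz _] Ht']. split; auto; lra.
    + apply cont_on_subset with (1 := cV). intros z t [[Hz _] Ht']; split; auto; lra.
  - apply reg_jsub; [apply creg_reg in HS; apply reg_sub with (1 := HS)|apply reg_sub with (1 := rU)];
      try lra; intros z [Hz _]; auto.
  - apply reg_jsub; [apply creg_reg in HT; apply reg_sub with (1 := HT)|apply reg_sub with (1 := rV)];
      try lra; intros z [Hz _]; auto.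
  - intros z t Hz _ Ht'. rewrite jw_sub. specialize (bU z t Hz ltac:(lra)). apply Rabs_le_between in bU.
    specialize (S0 z t Hz ltac:(lra)). lra.
  - intros z t Hz _ Ht'. rewrite jw_sub. specialize (bV z t Hz ltac:(lra)). apply Rabs_le_between in bV.
    specialize (T0 z t Hz ltac:(lra)). lra.
  - intros z Hz _. rewrite jw_sub. specialize (IS z Hz). lra.
  - intros z Hz _. rewrite jw_sub. specialize (IT z Hz). lra.
  - intros z t Hz _ Ht' Hneg. rewrite jw_sub in *. rewrite jt_sub, lap_sub.
    specialize (eU z t Hz ltac:(lra)). specialize (ES z t Hz Ht').
    specialize (bU z t (or_introl Hz) ltac:(lra)). apply Rabs_le_between in bU.
    specialize (S0 z t (or_introl Hz) ltac:(lra)).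
    destruct (HLip (jw S z t) (jw U z t)) as [Hl _]; lra.
  - intros z t Hz _ Ht' Hneg. rewrite !jw_sub in *. rewrite dn_sub.
    destruct (eB z t Hz ltac:(lra)) as [e1 _]. specialize (BS z t Hz Ht').
    apply Rle_trans with (exnu m * (jw T z t - jw V z t)); [|lra].
    apply Rmult_le_compat_l; [lra|apply Rmin_l].
  - intros z t Hz _ Ht' Hneg. rewrite jw_sub in *. rewrite jt_sub, lap_sub.
    specialize (eV z t Hz ltac:(lra)). specialize (ET z t Hz Ht'). nra.
  - intros z t Hz _ Ht' Hneg. rewrite !jw_sub in *. rewrite dn_sub.
    destruct (eB z t Hz ltac:(lra)) as [_ e1]. specialize (BT z t Hz Ht').
    apply Rle_trans with (exmu m * (jw S z t - jw U z t)); [|lra].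
    apply Rmult_le_compat_l; [lra|apply Rmin_l].
  - split; intros z t Hz Ht'; [specialize (H1 z t Hz I Ht')|specialize (H2 z t Hz I Ht')];
      rewrite jw_sub in *; lra.
Qed.

Lemma sol_nonneg U V : sol m U V -> (forall z, inO m z -> 0 <= jw U z 0) ->
  (forall z, inE m z -> 0 <= jw V z 0) ->
  (forall z t, inO m z -> 0 <= t -> 0 <= jw U z t) /\ (forall z t, inE m z -> 0 <= t -> 0 <= jw V z t).
Proof.
  intros [cU [cV [rU [rV [eU [eV [eB bd]]]]]]] IU IV.
  assert (H : forall t1, 0 <= t1 -> (forall z t, inO m z -> 0 <= t <= t1 -> 0 <= jw U z t) /\
    (forall z t, inE m z -> 0 <= t <= t1 -> 0 <= jw V z t)).
  { intros t1 Ht1. destruct (bd t1) as [M [bU bV]].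
    destruct (reac_lip_lower m Hm M) as [L [HL HLip]].
    pose proof (reac_0 m Hm) as Hg0.
    destruct Hm as [HN [HD [Hd [HR [Hmu [Hnu [Hrho _]]]]]]].
    destruct (comparison (dimN m) (difD m) (difd m) (radR m) (exmu m) (exnu m) L M 0 t1 full full U V)
      as [H1 H2]; auto; try lia; try lra.
    - apply full_closed.
    - apply full_open.
    - apply cont_on_subset with (1 := cU). intros z t [[Hz _] Ht']; split; auto; lra.
    - apply cont_on_subset with (1 := cV). intros z t [[Hz _] Ht']; split; auto; lra.
    - apply reg_sub with (1 := rU); try lra; intros z [Hz _]; auto.
    - apply reg_sub with (1 := rV); try lra; intros z [Hz _]; auto.
    - intros z t Hz _ Ht'. specialize (bU z t Hz ltac:(lra)). apply Rabs_le_between in bU. lra.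
    - intros z t Hz _ Ht'. specialize (bV z t Hz ltac:(lra)). apply Rabs_le_between in bV. lra.
    - intros z t Hz _ Ht' Hneg. rewrite (eU z t Hz) by lra.
      specialize (bU z t (or_introl Hz) ltac:(lra)). apply Rabs_le_between in bU.
      destruct (HLip (jw U z t) 0) as [Hl _]; lra.
    - intros z t Hz _ Ht' Hneg. destruct (eB z t Hz ltac:(lra)) as [e1 _].
      apply Rle_trans with (exnu m * jw V z t); [|lra].
      apply Rmult_le_compat_l; [lra|apply Rmin_l].
    - intros z t Hz _ Ht' Hneg. rewrite (eV z t Hz) by lra. nra.
    - intros z t Hz _ Ht' Hneg. destruct (eB z t Hz ltac:(lra)) as [_ e1].
      apply Rle_trans with (exmu m * jw U z t); [|lra].
      apply Rmult_le_compat_l; [lra|apply Rmin_l].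
    - split; intros; [apply (H1 z t)|apply (H2 z t)]; auto; exact I. }
  split; intros z t Hz Ht; [apply (H t Ht)|apply (H t Ht)]; auto; lra.
Qed.

Definition bsol M U V : Prop := sol m U V /\
  (forall z t, inO m z -> 0 <= t -> 0 <= jw U z t <= M) /\
  (forall z t, inE m z -> 0 <= t -> 0 <= jw V z t <= M).

Lemma sol_bounded U V B : sol m U V ->
  (forall z, inO m z -> 0 <= jw U z 0 <= B) -> (forall z, inE m z -> 0 <= jw V z 0 <= B) ->
  exists M, 0 < M /\ bsol M U V.
Proof.
  intros Hs IU IV.
  destruct (sol_nonneg U V Hs) as [pU pV]; [intros; now apply IU|intros; now apply IV|].
  pose proof Hm as [HN [HD [Hd [HR [Hmu [Hnu [Hrho _]]]]]]].
  (* Constants in exchange equilibrium, [exmu * A' = exnu * A], both above the data; [A'] is at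
     least 1, where the reaction is nonpositive. *)
  set (A := Rmax B (exmu m / exnu m * Rmax B 1)).
  assert (HB1 : 1 <= Rmax B 1) by apply Rmax_r. assert (HBB : B <= Rmax B 1) by apply Rmax_l.
  assert (Hr : 0 < exmu m / exnu m) by now apply Rdiv_lt_0_compat.
  assert (HA1 : B <= A) by apply Rmax_l. assert (HA2 : exmu m / exnu m * Rmax B 1 <= A) by apply Rmax_r.
  assert (HA : 0 < A) by nra.
  assert (Hr2 : 0 < exnu m / exmu m) by now apply Rdiv_lt_0_compat.
  set (A' := exnu m / exmu m * A).
  assert (HA' : Rmax B 1 <= A').
  { unfold A'. replace (Rmax B 1) with (exnu m / exmu m * (exmu m / exnu m * Rmax B 1)) by (field; lra).
    apply Rmult_le_compat_l; lra. }
  assert (HAA : exmu m * A' = exnu m * A) by (unfold A'; field; lra).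
  assert (H : forall t1, 0 <= t1 -> (forall z t, inO m z -> 0 <= t <= t1 -> jw U z t <= A') /\
     (forall z t, inE m z -> 0 <= t <= t1 -> jw V z t <= A)).
  { intros t1 Ht1. apply (super_comparison U V 0 t1 (jconst A') (jconst A)); auto; try lra.
    - apply creg_const.
    - apply creg_const.
    - simpl; intros; lra.
    - simpl; intros; lra.
    - intros z Hz. specialize (IU z Hz). simpl. lra.
    - intros z Hz. specialize (IV z Hz). simpl. lra.
    - intros. rewrite lap_const. simpl. pose proof (reac_nonpos m Hm A'). lra.
    - intros. rewrite dn_const. simpl. lra.
    - intros. rewrite lap_const. simpl. nra.
    - intros. rewrite dn_const. simpl. lra. }
  exists (Rmax A A'). pose proof (Rmax_l A A'). pose proof (Rmax_r A A').
  split; [lra|]. split; auto. split; intros z t Hz Ht; destruct (H t Ht) as [K1 K2].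
  - specialize (K1 z t Hz ltac:(lra)). specialize (pU z t Hz Ht). lra.
  - specialize (K2 z t Hz ltac:(lra)). specialize (pV z t Hz Ht). lra.
Qed.

(** As [U] and [V] are nonnegative, a violation can occur only where the barrier is positive, so the
    inequalities are required only there. The [Rmax] in the boundary conditions allows the exchange
    to be fed by the actual solution: one component of the barrier may be the trivial constant
    -1. *)
Lemma sub_comparison M U V t0 t1 (W Wo : (nat -> R) -> Prop) S T B : bsol M U V -> 0 <= t0 <= t1 ->
  closed_in (dimN m) (fun z => pt (dimN m) z /\ W z) -> (forall z, Wo z -> W z) ->
  (forall z, pt (dimN m) z -> Wo z -> exists r, 0 < r /\ forall z', near (dimN m) r z z' -> Wo z') ->
  creg (dimN m) (mOm m) (mBd m) (t0 - 1) S -> creg (dimN m) (mExt m) (mBd m) (t0 - 1) T ->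
  (forall z t, inO m z -> W z -> t0 <= t <= t1 -> jw S z t <= B) ->
  (forall z t, inE m z -> W z -> t0 <= t <= t1 -> jw T z t <= B) ->
  (forall z, inO m z -> W z -> jw S z t0 <= jw U z t0) ->
  (forall z, inE m z -> W z -> jw T z t0 <= jw V z t0) ->
  (forall z t, inO m z -> W z -> t0 < t <= t1 -> jw U z t < jw S z t -> Wo z) ->
  (forall z t, inE m z -> W z -> t0 < t <= t1 -> jw V z t < jw T z t -> Wo z) ->
  (forall z t, mOm m z -> Wo z -> t0 < t <= t1 -> 0 < jw S z t ->
     jt S z t - difD m * mlap m S z t <= reac m (jw S z t)) ->
  (forall z t, mBd m z -> Wo z -> t0 < t <= t1 -> 0 < jw S z t ->
     difD m * mdn m S z t + exmu m * jw S z t <= exnu m * Rmax (jw V z t) (jw T z t)) ->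
  (forall z t, mExt m z -> Wo z -> t0 < t <= t1 -> 0 < jw T z t ->
     jt T z t - difd m * mlap m T z t <= - decay m * jw T z t) ->
  (forall z t, mBd m z -> Wo z -> t0 < t <= t1 -> 0 < jw T z t ->
     - difd m * mdn m T z t + exnu m * jw T z t <= exmu m * Rmax (jw U z t) (jw S z t)) ->
  (forall z t, inO m z -> W z -> t0 <= t <= t1 -> jw S z t <= jw U z t) /\
  (forall z t, inE m z -> W z -> t0 <= t <= t1 -> jw T z t <= jw V z t).
Proof.
  intros [[cU [cV [rU [rV [eU [eV [eB _]]]]]]] [bU bV]] Ht HW HWW HWo HS HT BSd BTd IS IT LS LT ES BS ET BT.
  destruct (reac_lip_lower m Hm (Rmax M B)) as [L [HL HLip]].
  pose proof (Rmax_l M B) as HM1. pose proof (Rmax_r M B) as HM2.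
  destruct Hm as [HN [HD [Hd [HR [Hmu [Hnu [Hrho _]]]]]]].
  assert (Hmaxmin : forall k a b, 0 < k -> k * Rmin (a - b) 0 + k * Rmax a b <= k * a).
  { intros k a b Hk. rewrite <- Rmult_plus_distr_l. apply Rmult_le_compat_l; [lra|].
    unfold Rmin, Rmax. destruct (Rle_dec (a - b) 0), (Rle_dec a b); lra. }
  destruct (comparison (dimN m) (difD m) (difd m) (radR m) (exmu m) (exnu m) L B t0 t1 W Wo
    (jsub U S) (jsub V T)) as [H1 H2]; auto; try lia; try lra.
  - apply jsub_cont.
    + apply cont_on_subset with (1 := cU). intros z t [[Hz _] Ht']; split; auto; lra.
    + apply (creg_cont _ _ _ _ _ _ HS). intros z t [[Hz _] Ht']. split; auto; lra.
  - apply jsub_cont.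
    + apply cont_on_subset with (1 := cV). intros z t [[Hz _] Ht']; split; auto; lra.
    + apply (creg_cont _ _ _ _ _ _ HT). intros z t [[Hz _] Ht']. split; auto; lra.
  - apply reg_jsub; [apply reg_sub with (1 := rU)|apply creg_reg in HS; apply reg_sub with (1 := HS)];
      try lra; intros z [Hz _]; auto.
  - apply reg_jsub; [apply reg_sub with (1 := rV)|apply creg_reg in HT; apply reg_sub with (1 := HT)];
      try lra; intros z [Hz _]; auto.
  - intros z t Hz Hw Ht'. rewrite jw_sub. specialize (bU z t Hz ltac:(lra)).
    specialize (BSd z t Hz Hw ltac:(lra)). lra.
  - intros z t Hz Hw Ht'. rewrite jw_sub. specialize (bV z t Hz ltac:(lra)).
    specialize (BTd z t Hz Hw ltac:(lra)). lra.
  - intros z Hz Hw. rewrite jw_sub. specialize (IS z Hz Hw). lra.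
  - intros z Hz Hw. rewrite jw_sub. specialize (IT z Hz Hw). lra.
  - intros z t Hz Hw Ht' Hneg. rewrite jw_sub in *. apply (LS z t); auto. lra.
  - intros z t Hz Hw Ht' Hneg. rewrite jw_sub in *. apply (LT z t); auto. lra.
  - intros z t Hz Hw Ht' Hneg. rewrite jw_sub in *. rewrite jt_sub, lap_sub.
    specialize (eU z t Hz ltac:(lra)). specialize (bU z t (or_introl Hz) ltac:(lra)).
    specialize (ES z t Hz Hw Ht' ltac:(lra)).
    specialize (BSd z t (or_introl Hz) (HWW z Hw) ltac:(lra)).
    destruct (HLip (jw U z t) (jw S z t)) as [Hl _]; lra.
  - intros z t Hz Hw Ht' Hneg. rewrite !jw_sub in *. rewrite dn_sub.
    destruct (eB z t Hz ltac:(lra)) as [e1 _]. specialize (bU z t (or_intror Hz) ltac:(lra)).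
    specialize (BS z t Hz Hw Ht' ltac:(lra)). specialize (Hmaxmin (exnu m) (jw V z t) (jw T z t) Hnu). lra.
  - intros z t Hz Hw Ht' Hneg. rewrite jw_sub in *. rewrite jt_sub, lap_sub.
    specialize (eV z t Hz ltac:(lra)). specialize (bV z t (or_introl Hz) ltac:(lra)).
    specialize (ET z t Hz Hw Ht' ltac:(lra)). nra.
  - intros z t Hz Hw Ht' Hneg. rewrite !jw_sub in *. rewrite dn_sub.
    destruct (eB z t Hz ltac:(lra)) as [_ e1]. specialize (bV z t (or_intror Hz) ltac:(lra)).
    specialize (BT z t Hz Hw Ht' ltac:(lra)). specialize (Hmaxmin (exmu m) (jw U z t) (jw S z t) Hmu). lra.
  - split; intros z t Hz Hw Ht'; [specialize (H1 z t Hz Hw Ht')|specialize (H2 z t Hz Hw Ht')];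
      rewrite jw_sub in *; lra.
Qed.

(** By [reac_scale] the multiple [k (U', V')] is a subsolution; the linear parts of the system are
    unaffected by the factor. *)
Lemma bsol_scaled_comparison M M' U V U' V' k : bsol M U V -> bsol M' U' V' -> 0 < k <= 1 ->
  (forall z, inO m z -> k * jw U' z 0 <= jw U z 0) -> (forall z, inE m z -> k * jw V' z 0 <= jw V z 0) ->
  forall t, 0 <= t -> (forall z, inO m z -> k * jw U' z t <= jw U z t) /\
    (forall z, inE m z -> k * jw V' z t <= jw V z t).
Proof.
  intros [[cU [cV [rU [rV [eU [eV [eB _]]]]]]] [bU bV]] [[cU' [cV' [rU' [rV' [eU' [eV' [eB' _]]]]]]] [bU' bV']] Hk IU IV t1 Ht1.
  destruct (reac_lip_lower m Hm (Rmax M M')) as [L [HL HLip]].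
  pose proof (Rmax_l M M') as HM1. pose proof (Rmax_r M M') as HM2.
  pose proof (reac_scale m Hm k) as Hgs.
  destruct Hm as [HN [HD [Hd [HR [Hmu [Hnu [Hrho _]]]]]]].
  destruct (comparison (dimN m) (difD m) (difd m) (radR m) (exmu m) (exnu m) L M' 0 t1 full full
    (jsub U (jscal k U')) (jsub V (jscal k V'))) as [H1 H2]; auto; try lia; try lra.
  - apply full_closed.
  - apply full_open.
  - apply jsub_cont; [|apply (cont_on_scal _ _ k (jw U'))].
    + apply cont_on_subset with (1 := cU). intros z t [[Hz _] Ht']; split; auto; lra.
    + apply cont_on_subset with (1 := cU'). intros z t [[Hz _] Ht']; split; auto; lra.
  - apply jsub_cont; [|apply (cont_on_scal _ _ k (jw V'))].
    + apply cont_on_subset with (1 := cV). intros z t [[Hz _] Ht']; split; auto; lra.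
    + apply cont_on_subset with (1 := cV'). intros z t [[Hz _] Ht']; split; auto; lra.
  - apply reg_jsub; [|apply reg_scal]; [apply reg_sub with (1 := rU)|apply reg_sub with (1 := rU')];
      try lra; intros z [Hz _]; auto.
  - apply reg_jsub; [|apply reg_scal]; [apply reg_sub with (1 := rV)|apply reg_sub with (1 := rV')];
      try lra; intros z [Hz _]; auto.
  - intros z t Hz _ Ht'. rewrite jw_sub. specialize (bU z t Hz ltac:(lra)). specialize (bU' z t Hz ltac:(lra)).
    simpl. nra.
  - intros z t Hz _ Ht'. rewrite jw_sub. specialize (bV z t Hz ltac:(lra)). specialize (bV' z t Hz ltac:(lra)).
    simpl. nra.
  - intros z Hz _. rewrite jw_sub. specialize (IU z Hz). simpl. lra.
  - intros z Hz _. rewrite jw_sub. specialize (IV z Hz). simpl. lra.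
  - intros z t Hz _ Ht' Hneg. rewrite jw_sub in *. rewrite jt_sub, lap_sub, lap_scal. cbn [jw jt jscal] in *.
    specialize (eU z t Hz ltac:(lra)). specialize (eU' z t Hz ltac:(lra)).
    specialize (bU z t (or_introl Hz) ltac:(lra)). specialize (bU' z t (or_introl Hz) ltac:(lra)).
    specialize (Hgs (jw U' z t) Hk ltac:(lra)).
    destruct (HLip (jw U z t) (k * jw U' z t)) as [Hl _]; try lra; nra.
  - intros z t Hz _ Ht' Hneg. rewrite !jw_sub in *. rewrite dn_sub, dn_scal. cbn [jw jt jscal] in *.
    destruct (eB z t Hz ltac:(lra)) as [e1 _]. destruct (eB' z t Hz ltac:(lra)) as [e1' _].
    apply Rle_trans with (exnu m * (jw V z t - k * jw V' z t)).
    + apply Rmult_le_compat_l; [lra|apply Rmin_l].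
    + right. replace (difD m * (mdn m U z t - k * mdn m U' z t)) with
        (difD m * mdn m U z t - k * (difD m * mdn m U' z t)) by ring. rewrite e1, e1'. ring.
  - intros z t Hz _ Ht' Hneg. rewrite jw_sub in *. rewrite jt_sub, lap_sub, lap_scal. cbn [jw jt jscal] in *.
    specialize (eV z t Hz ltac:(lra)). specialize (eV' z t Hz ltac:(lra)).
    replace (jt V z t - k * jt V' z t - difd m * (mlap m V z t - k * mlap m V' z t)) with
      ((jt V z t - difd m * mlap m V z t) - k * (jt V' z t - difd m * mlap m V' z t)) by ring.
    rewrite eV, eV'. nra.
  - intros z t Hz _ Ht' Hneg. rewrite !jw_sub in *. rewrite dn_sub, dn_scal. cbn [jw jt jscal] in *.
    destruct (eB z t Hz ltac:(lra)) as [_ e1]. destruct (eB' z t Hz ltac:(lra)) as [_ e1'].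
    apply Rle_trans with (exmu m * (jw U z t - k * jw U' z t)).
    + apply Rmult_le_compat_l; [lra|apply Rmin_l].
    + right. replace (- difd m * (mdn m V z t - k * mdn m V' z t)) with
        (- difd m * mdn m V z t - k * (- difd m * mdn m V' z t)) by ring. rewrite e1, e1'. ring.
  - split; intros z Hz; [specialize (H1 z t1 Hz I ltac:(lra))|specialize (H2 z t1 Hz I ltac:(lra))];
      rewrite jw_sub in *; simpl in *; lra.
Qed.
End Comparisons.

(** * Translations and reflections in x, shifts in time *)

Definition xmap (s a : R) (z : nat -> R) : nat -> R := fun j => if Nat.eqb j 0 then s * z 0%nat + a else z j.
Definition xsg (s : R) (k : nat) : R := if Nat.eqb k 0 then s else 1.
Definition jmove (s a t0 : R) (J : jet) : jet :=
  mkjet (fun z t => jw J (xmap s a z) (t0 + t)) (fun z t => jt J (xmap s a z) (t0 + t))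
    (fun k z t => xsg s k * j1 J k (xmap s a z) (t0 + t)) (fun k z t => j2 J k (xmap s a z) (t0 + t)).

Lemma xmap_pt s a N z : (1 <= N)%nat -> pt N z -> pt N (xmap s a z).
Proof. intros HN H j Hj. unfold xmap. destruct (Nat.eqb_spec j 0); [lia|auto]. Qed.

Lemma xmap_rad s a N z : rad 1 N (xmap s a z) = rad 1 N z.
Proof.
  apply sumk_ext. intros k _. unfold xmap. destruct (Nat.ltb_spec k 1); auto.
  destruct (Nat.eqb_spec k 0); [lia|auto].
Qed.

Lemma xmap_dist s a N z z' : s = 1 \/ s = -1 -> dist N (xmap s a z) (xmap s a z') = dist N z z'.
Proof.
  intros Hs. unfold dist. f_equal. apply sumk_ext. intros k _. unfold xmap.
  destruct (Nat.eqb_spec k 0); auto. subst. destruct Hs; subst; ring.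
Qed.

Lemma xmap_setc s a z k r : xmap s a (setc z k r) =
  setc (xmap s a z) k (if Nat.eqb k 0 then s * r + a else r).
Proof.
  apply functional_extensionality. intros j. unfold xmap, setc.
  destruct (Nat.eqb_spec j 0), (Nat.eqb_spec j k), (Nat.eqb_spec k 0), (Nat.eqb_spec 0 k); subst; auto; lia.
Qed.

Lemma cont_on_move N s a t0 (S S' : (nat -> R) -> R -> Prop) F : s = 1 \/ s = -1 -> cont_on N S F ->
  (forall z t, S' z t -> S (xmap s a z) (t0 + t)) -> cont_on N S' (fun z t => F (xmap s a z) (t0 + t)).
Proof.
  intros Hs Hc HS z t Hz eps He. destruct (Hc _ _ (HS z t Hz) eps He) as [del [Hd H]].
  exists del. split; auto. intros z' t' Hz' Hdz Hdt. apply H; auto.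
  - now rewrite xmap_dist.
  - now replace (t0 + t' - (t0 + t)) with (t' - t) by ring.
Qed.

Lemma derivable_affine f s a x l : derivable_pt_lim f (s * x + a) l ->
  derivable_pt_lim (fun r => f (s * r + a)) x (s * l).
Proof.
  intros H. apply is_derive_Reals. apply is_derive_Reals in H.
  apply (is_derive_comp f (fun r => s * r + a) x l s H). auto_derive; auto; ring.
Qed.

Lemma djet_move n s a t0 J z t : s = 1 \/ s = -1 -> djet n J (xmap s a z) (t0 + t) ->
  djet n (jmove s a t0 J) z t.
Proof.
  intros Hs [H1 H2]. split.
  - simpl. replace (jt J (xmap s a z) (t0 + t)) with (1 * jt J (xmap s a z) (t0 + t)) by ring.
    apply derivable_pt_lim_ext with (fun r => jw J (xmap s a z) (1 * r + t0)); [intros; f_equal; ring|].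
    apply derivable_affine. now replace (1 * t + t0) with (t0 + t) by ring.
  - intros k Hk. destruct (H2 k Hk) as [H3 H4]. cbn [jw j1 j2 jmove].
    unfold xsg.
    destruct (Nat.eqb_spec k 0) as [->|Hk0].
    + split.
      * eapply derivable_pt_lim_ext; [|exact (derivable_affine _ s a (z 0%nat) _ H3)].
        intros r. cbv beta. rewrite xmap_setc. reflexivity.
      * replace (j2 J 0%nat (xmap s a z) (t0 + t)) with (s * (s * j2 J 0%nat (xmap s a z) (t0 + t)))
          by (destruct Hs; subst; ring).
        apply (derivable_pt_lim_scal (fun r => j1 J 0%nat (xmap s a (setc z 0 r)) (t0 + t))).
        eapply derivable_pt_lim_ext; [|exact (derivable_affine _ s a (z 0%nat) _ H4)].
        intros r. cbv beta. rewrite xmap_setc. reflexivity.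
    + assert (Hz : xmap s a z k = z k) by (unfold xmap; destruct (Nat.eqb_spec k 0); [lia|auto]).
      rewrite Hz in H3, H4.
      assert (Hx : forall r, xmap s a (setc z k r) = setc (xmap s a z) k r).
      { intros r. rewrite xmap_setc. destruct (Nat.eqb_spec k 0); [lia|auto]. }
      split.
      * rewrite Rmult_1_l. eapply derivable_pt_lim_ext; [|exact H3]. intros r. cbv beta. now rewrite Hx.
      * eapply derivable_pt_lim_ext; [|exact H4]. intros r. cbv beta. rewrite Hx. ring.
Qed.

Lemma lap_move n s a t0 J z t : jlap n (jmove s a t0 J) z t = jlap n J (xmap s a z) (t0 + t).
Proof. reflexivity. Qed.

Lemma dn_move n Rd s a t0 J z t : jdn n Rd (jmove s a t0 J) z t = jdn n Rd J (xmap s a z) (t0 + t).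
Proof.
  apply sumk_ext. intros k _. cbn [j1 jmove]. unfold xsg, xmap at 2.
  destruct (Nat.ltb_spec k 1); auto. destruct (Nat.eqb_spec k 0); [lia|ring].
Qed.

(** The system is invariant under isometries of the x-axis and under time shifts, so the state at
    time [t0] becomes the datum of a new solution with the same bound. *)
Lemma bsol_move m M U V s a t0 : model_ok m -> bsol m M U V -> s = 1 \/ s = -1 -> 0 <= t0 ->
  bsol m M (jmove s a t0 U) (jmove s a t0 V).
Proof.
  intros Hm [[cU [cV [rU [rV [eU [eV [eB bd]]]]]]] [bU bV]] Hs Ht0.
  destruct Hm as [HN _].
  assert (HO : forall z, inO m z -> inO m (xmap s a z)).
  { intros z. rewrite !clO_iff, xmap_rad. intros []; split; auto. apply xmap_pt; auto; lia. }
  assert (HE : forall z, inE m z -> inE m (xmap s a z)).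
  { intros z. rewrite !clE_iff, xmap_rad. intros []; split; auto. apply xmap_pt; auto; lia. }
  assert (HOm : forall z, mOm m z -> mOm m (xmap s a z)).
  { intros z []. split; [apply xmap_pt; auto; lia|]. now rewrite xmap_rad. }
  assert (HEx : forall z, mExt m z -> mExt m (xmap s a z)).
  { intros z []. split; [apply xmap_pt; auto; lia|]. now rewrite xmap_rad. }
  assert (HBd : forall z, mBd m z -> mBd m (xmap s a z)).
  { intros z []. split; [apply xmap_pt; auto; lia|]. now rewrite xmap_rad. }
  assert (Hreg : forall O B J, reg (dimN m) O B 0 J -> (forall z, O z -> O (xmap s a z)) ->
     (forall z, B z -> B (xmap s a z)) -> reg (dimN m) O B 0 (jmove s a t0 J)).
  { intros O B J [R1 R2] H1 H2. split.
    - intros z t Hz Ht. apply djet_move; auto. apply R1; auto; lra.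
    - intros k Hk. apply cont_on_scal.
      apply (cont_on_move _ s a t0 _ _ (j1 J k) Hs (R2 k Hk)). intros z t [[]]; split; auto; lra. }
  split; [|split].
  - refine (conj _ (conj _ (conj _ (conj _ (conj _ (conj _ (conj _ _))))))).
    + apply (cont_on_move _ s a t0 _ _ (jw U) Hs cU). intros z t []; split; auto; lra.
    + apply (cont_on_move _ s a t0 _ _ (jw V) Hs cV). intros z t []; split; auto; lra.
    + now apply (Hreg _ _ _ rU).
    + now apply (Hreg _ _ _ rV).
    + intros z t Hz Ht. rewrite lap_move. apply eU; auto; lra.
    + intros z t Hz Ht. rewrite lap_move. apply eV; auto; lra.
    + intros z t Hz Ht. rewrite !dn_move. apply (eB (xmap s a z)); auto; lra.
    + intros T. exists M. split; intros z t Hz Ht; cbn [jw jmove]; rewrite Rabs_right.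
      * apply bU; auto; lra.
      * apply Rle_ge, bU; auto; lra.
      * apply bV; auto; lra.
      * apply Rle_ge, bV; auto; lra.
  - intros z t Hz Ht. apply bU; auto; lra.
  - intros z t Hz Ht. apply bV; auto; lra.
Qed.

(** * Steady profiles as limits from above *)

(* [h] and [psi] are radial profiles in the variable [q = |y|^2]; [F] is the defect in the Robin
   condition: zero for a steady state, positive for a supersolution. *)
Record profile (m : model) (H : jet) (h psi psi1 psi2 : R -> R) (theta F : R) : Prop := {
  pr_theta : 0 < theta;
  pr_creg : forall T0, creg (dimN m) (mOm m) (mBd m) T0 H;
  pr_val : forall z t, jw H z t = h (rad 1 (dimN m) z);
  pr_static : forall z t, jt H z t = 0;
  pr_flat : forall z t, j1 H 0%nat z t = 0;
  pr_eq : forall z t, mOm m z -> - difD m * mlap m H z t = reac m (h (rad 1 (dimN m) z));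
  pr_bd : forall z t, mBd m z ->
    difD m * mdn m H z t + exmu m * theta / (exnu m + theta) * h (radR m ^ 2) = F;
  pr_pos : 0 < h (radR m ^ 2);
  pr_range : forall q, 0 <= q <= radR m ^ 2 -> h (radR m ^ 2) <= h q <= 1;
  pr_psi1 : forall q, 0 < q -> derivable_pt_lim psi q (psi1 q);
  pr_psi2 : forall q, 0 < q -> derivable_pt_lim psi1 q (psi2 q);
  pr_psi_eq : forall q, 0 < q -> difd m * (4 * q * psi2 q + 2 * INR (dimN m - 1) * psi1 q) = decay m * psi q;
  pr_psi_R : psi (radR m ^ 2) = 1;
  pr_psi_range : forall q, radR m ^ 2 <= q -> 0 < psi q <= 1;
  pr_psi_bd : - difd m * (psi1 (radR m ^ 2) * (2 * radR m)) = theta }.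

(** Several smallness conditions on one parameter are met at once by summing their coefficients into
    [A]. *)
Lemma small_factor A B : 0 <= A -> 0 < B -> exists e, 0 < e /\ e * A <= B.
Proof.
  intros HA HB. exists (B / (A + 1)). split; [apply Rdiv_lt_0_compat; lra|].
  apply Rmult_le_reg_r with (A + 1); [lra|]. replace (B / (A + 1) * A * (A + 1)) with (B * A) by (field; lra). nra.
Qed.

Lemma le_mult_ge1 L x : 1 <= L -> 0 <= x -> x <= L * x.
Proof. intros. nra. Qed.

Lemma mult_le_1 x y : 0 <= x -> y <= 1 -> x * y <= x.
Proof. intros. nra. Qed.

Section Profiles.
Context (m : model) (Hm : model_ok m).
Context (H : jet) (h psi psi1 psi2 : R -> R) (theta F : R)
  (Hpr : profile m H h psi psi1 psi2 theta F).
Local Notation N := (dimN m).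
Local Notation Rq := (radR m ^ 2).
Local Notation n1 := (INR (dimN m - 1)).
Local Notation kap := (exmu m * theta / (exnu m + theta)).
Local Notation hR := (h (radR m ^ 2)).

Definition jpsi : jet := jcomp psi psi1 psi2 (jq (dimN m)).

Lemma model_pos : (1 <= dimN m)%nat /\ 0 < difD m /\ 0 < difd m /\ 0 < radR m /\ 0 < exmu m /\
  0 < exnu m /\ 0 < decay m /\ 0 < radR m ^ 2 /\ 0 < theta.
Proof.
  pose proof (pr_theta _ _ _ _ _ _ _ _ Hpr). destruct Hm as [HN [HD [Hd [HR [Hmu [Hnu [Hrho _]]]]]]].
  repeat split; auto; try lia. nra.
Qed.

Lemma jpsi_creg T0 : creg (dimN m) (mExt m) (mBd m) T0 jpsi.
Proof.
  destruct model_pos as [HN [HD [Hd [HR [Hmu [Hnu [Hrho [HR2 Hth]]]]]]]].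
  apply creg_comp; [apply creg_q|]. intros z t Hz _.
  assert (Hq : 0 < rad 1 (dimN m) z) by (apply clE_iff in Hz; lra).
  split; [now apply (pr_psi1 _ _ _ _ _ _ _ _ Hpr)|now apply (pr_psi2 _ _ _ _ _ _ _ _ Hpr)].
Qed.

Lemma jpsi_lap z t : mExt m z -> difd m * mlap m jpsi z t = decay m * psi (rad 1 (dimN m) z).
Proof.
  destruct model_pos as [HN [HD [Hd [HR [Hmu [Hnu [Hrho [HR2 Hth]]]]]]]].
  intros [_ Hz]. rewrite <- (pr_psi_eq _ _ _ _ _ _ _ _ Hpr) by lra.
  unfold jpsi. rewrite lap_comp, gg_q, lap_q by auto. simpl. ring.
Qed.

Lemma jpsi_dn z t : mBd m z -> - difd m * mdn m jpsi z t = theta.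
Proof.
  destruct model_pos as [HN [HD [Hd [HR [Hmu [Hnu [Hrho [HR2 Hth]]]]]]]].
  intros Hz. rewrite <- (pr_psi_bd _ _ _ _ _ _ _ _ Hpr).
  unfold jpsi. rewrite dn_comp, dn_q by auto. destruct Hz as [_ Hz]. simpl jw. now rewrite Hz.
Qed.

Lemma rad_in z : inO m z -> 0 <= rad 1 (dimN m) z <= radR m ^ 2.
Proof. rewrite clO_iff. intros []. split; auto. apply rad_nonneg. Qed.

Lemma hR_range : 0 < hR <= 1.
Proof.
  destruct model_pos as [HN [HD [Hd [HR [Hmu [Hnu [Hrho [HR2 Hth]]]]]]]].
  split; [apply (pr_pos _ _ _ _ _ _ _ _ Hpr)|]. apply (pr_range _ _ _ _ _ _ _ _ Hpr). lra.
Qed.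

(** Strict decrease of [g(s)/s] and compactness of [[hR, 1]] give a positive minimum of the gap at
    [k = lam]; [reac_scale_up] carries it to larger [k]. The gap [s1] pays for the error terms of
    the supersolution. *)
Lemma reac_gap_up lam : 1 < lam -> exists s1, 0 < s1 /\ forall s k, hR <= s <= 1 -> lam <= k ->
  reac m (k * s) <= k * (reac m s - s1).
Proof.
  intros Hlam. destruct hR_range as [H0 H1].
  set (f := fun s => reac m s - reac m (lam * s) / lam).
  destruct (continuity_ab_min f hR 1) as [s0 [Hs0 Hs1]]; auto.
  { intros c _. unfold f, Rdiv. apply continuity_pt_minus; [apply reac_continuous; auto|].
    apply continuity_pt_mult; [|apply continuity_pt_const; red; auto].
    apply (continuity_pt_comp (fun s => lam * s) (reac m)); [|apply reac_continuous; auto].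
    apply derivable_continuous_pt. apply derivable_pt_mult; [apply derivable_pt_const|apply derivable_pt_id]. }
  exists (f s0). split.
  - unfold f. assert (Hs : 0 < s0) by lra.
    pose proof (reac_ratio m Hm s0 (lam * s0) Hs ltac:(nra)) as Hr.
    replace (reac m (lam * s0) / lam) with (reac m (lam * s0) / (lam * s0) * s0) by (field; lra).
    replace (reac m s0) with (reac m s0 / s0 * s0) by (field; lra). nra.
  - intros s k Hs Hk. specialize (Hs0 s Hs).
    pose proof (reac_scale_up m Hm (k / lam) (lam * s)) as Hu.
    replace (k / lam * (lam * s)) with (k * s) in Hu by (field; lra).
    assert (Hk1 : 1 <= k / lam).
    { apply Rmult_le_reg_r with lam; [lra|]. replace (k / lam * lam) with k by (field; lra). lra. }
    specialize (Hu Hk1 ltac:(nra)).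
    replace (k / lam * reac m (lam * s)) with (k * (reac m (lam * s) / lam)) in Hu by (field; lra).
    fold f in Hs0. unfold f at 2 in Hs0. nra.
Qed.

(* The constant [eps] in the exterior component costs a Robin defect at most [exmu * eps]. *)
Lemma kap_gap eps : 0 < eps ->
  kap - exmu m * eps <= exmu m * theta / (theta + exnu m * (1 + eps)) <= kap.
Proof.
  intros He. destruct model_pos as [HN [HD [Hd [HR [Hmu [Hnu [Hrho [HR2 Hth]]]]]]]].
  set (nu := exnu m) in *. set (mu := exmu m) in *.
  assert (0 < nu * eps) by nra. set (ne := nu * eps) in *.
  replace (nu * (1 + eps)) with (nu + ne) by (unfold ne; ring).
  assert (Hd1 : 0 < (nu + theta) * (theta + (nu + ne))) by nra.
  split.
  - assert (E : mu * theta / (nu + theta) - mu * theta / (theta + (nu + ne)) =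
      mu * (theta * ne) / ((nu + theta) * (theta + (nu + ne)))) by (field; split; lra).
    assert (mu * (theta * ne) / ((nu + theta) * (theta + (nu + ne))) <= mu * eps); [|lra].
    apply Rmult_le_reg_r with ((nu + theta) * (theta + (nu + ne))); auto.
    replace (mu * (theta * ne) / ((nu + theta) * (theta + (nu + ne))) * ((nu + theta) * (theta + (nu + ne))))
      with (mu * eps * (theta * nu)) by (transitivity (mu * (theta * ne)); [unfold ne; ring|field; split; lra]).
    apply Rmult_le_compat_l; nra.
  - unfold Rdiv. apply Rmult_le_compat_l; [nra|]. apply Rinv_le_contravar; lra.
Qed.

(** The supersolution is [l(t) (h + e q)] inside and [l(t) b (psi + eps)] outside, with [l] affine
    and nonincreasing. The choice of [b] makes the exterior exchange condition an equality. The term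
    [e q] adds [2 R D e = exmu * eps] to the flux and so pays for the Robin defect caused by [eps];
    in turn [eps] keeps the exterior part bounded below at infinity, and the decay acting on it pays
    for [c]. Inside, the errors are covered by [reac_gap_up]. The admissible [c0] does not depend on
    [lam0]. *)
Lemma upper_step lam1 : 1 < lam1 -> 0 <= F -> exists e0, 0 < e0 /\ forall e, 0 < e <= e0 ->
  let eps := 2 * radR m * difD m * e / exmu m in
  let b := exmu m * (hR + e * Rq) / (theta + exnu m * (1 + eps)) in
  exists c0, 0 < c0 /\ forall U V M c lam0 t0 t1, bsol m M U V -> 0 <= c <= c0 -> 0 <= t0 <= t1 ->
    lam1 <= lam0 - c * (t1 - t0) ->
    (forall z, inO m z -> jw U z t0 <= lam0 * (h (rad 1 N z) + e * rad 1 N z)) ->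
    (forall z, inE m z -> jw V z t0 <= lam0 * (b * (psi (rad 1 N z) + eps))) ->
    forall t, t0 <= t <= t1 ->
    (forall z, inO m z -> jw U z t <= (lam0 - c * (t - t0)) * (h (rad 1 N z) + e * rad 1 N z)) /\
    (forall z, inE m z -> jw V z t <= (lam0 - c * (t - t0)) * (b * (psi (rad 1 N z) + eps))).
Proof.
  intros Hlam HF. destruct model_pos as [HN [HD [Hd [HR [Hmu [Hnu [Hrho [HR2 Hth]]]]]]]].
  destruct (reac_gap_up lam1 Hlam) as [s1 [Hs1 Hgap]].
  destruct hR_range as [HhR0 HhR1].
  pose proof (slope_pos m Hm) as Hgp. pose proof (pos_INR (dimN m - 1)) as Hn1.
  destruct (small_factor (2 * n1 * difD m + Rq * slope m) (s1 / 2)) as [e0 [He0 He0']];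
    [nra|lra|].
  exists e0. split; auto. intros e He eps b.
  assert (Heps : 0 < eps) by (unfold eps; apply Rdiv_lt_0_compat; auto; repeat apply Rmult_lt_0_compat; lra).
  assert (Hepsm : exmu m * eps = 2 * radR m * difD m * e) by (unfold eps; field; lra).
  assert (Hden : 0 < theta + exnu m * (1 + eps)) by nra.
  assert (Hb : 0 < b) by (unfold b; apply Rdiv_lt_0_compat; auto; apply Rmult_lt_0_compat; auto; nra).
  assert (Hbd : b * (theta + exnu m * (1 + eps)) = exmu m * (hR + e * Rq)) by (unfold b; field; lra).
  destruct (small_factor (1 + e * Rq) (s1 / 2)) as [c1 [Hc1 Hc1']]; [nra|lra|].
  destruct (small_factor (1 + eps) (decay m * eps)) as [c2 [Hc2 Hc2']]; [lra|nra|].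
  exists (Rmin c1 c2). split; [now apply Rmin_glb_lt|].
  intros U V M c lam0 t0 t1 Hbs Hc Ht Hl IU IV.
  assert (Hc1x : c * (1 + e * Rq) <= s1 / 2).
  { pose proof (Rmin_l c1 c2). apply Rle_trans with (c1 * (1 + e * Rq)); auto.
    apply Rmult_le_compat_r; [nra|lra]. }
  assert (Hc2x : c * (1 + eps) <= decay m * eps).
  { pose proof (Rmin_r c1 c2). apply Rle_trans with (c2 * (1 + eps)); auto.
    apply Rmult_le_compat_r; lra. }
  set (l := fun t => lam0 - c * (t - t0)).
  assert (Hl1 : forall t, t0 <= t <= t1 -> lam1 <= l t) by (intros t Ht'; unfold l; nra).
  assert (Hdl : forall t, derivable_pt_lim l t (- c)).
  { intros. apply is_derive_Reals. unfold l. auto_derive; auto; ring. }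
  set (LT := jtime l (fun _ => - c)).
  set (S := jmul LT (jadd H (jscal e (jq (dimN m))))).
  set (T := jmul LT (jscal b (jadd jpsi (jconst eps)))).
  assert (HhQ : forall z, inO m z -> hR <= h (rad 1 N z) <= 1).
  { intros z Hz. apply (pr_range _ _ _ _ _ _ _ _ Hpr). now apply rad_in. }
  assert (HpQ : forall z, inE m z -> 0 < psi (rad 1 N z) <= 1).
  { intros z Hz. apply (pr_psi_range _ _ _ _ _ _ _ _ Hpr). now apply clE_iff in Hz. }
  assert (HSv : forall z t, jw S z t = l t * (h (rad 1 N z) + e * rad 1 N z)).
  { intros. simpl. now rewrite (pr_val _ _ _ _ _ _ _ _ Hpr). }
  assert (HTv : forall z t, jw T z t = l t * (b * (psi (rad 1 N z) + eps))) by reflexivity.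
  destruct (super_comparison m Hm U V t0 t1 S T) as [C1 C2]; auto.
  - apply Hbs.
  - apply creg_mul; [apply creg_time; auto|]. apply creg_add; [apply (pr_creg _ _ _ _ _ _ _ _ Hpr)|].
    apply creg_scal, creg_q.
  - apply creg_mul; [apply creg_time; auto|]. apply creg_scal, creg_add; [apply jpsi_creg|apply creg_const].
  - intros z t Hz Ht'. rewrite HSv. specialize (Hl1 t Ht'). specialize (HhQ z Hz).
    destruct (rad_in z Hz). apply Rmult_le_pos; [lra|]. nra.
  - intros z t Hz Ht'. rewrite HTv. specialize (Hl1 t Ht'). specialize (HpQ z Hz).
    apply Rmult_le_pos; [lra|]. nra.
  - intros z Hz. rewrite HSv. unfold l. rewrite Rminus_diag, Rmult_0_r, Rminus_0_r. auto.
  - intros z Hz. rewrite HTv. unfold l. rewrite Rminus_diag, Rmult_0_r, Rminus_0_r. auto.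
  - intros z t Hz Ht'. rewrite HSv. unfold S. rewrite lap_mul. unfold LT at 2 3. rewrite lap_time, gg_time.
    rewrite lap_add, lap_scal, lap_q by auto.
    pose proof (pr_eq _ _ _ _ _ _ _ _ Hpr z t Hz) as Heq.
    cbn [jt jmul LT jtime jw jadd jscal jq]. rewrite (pr_static _ _ _ _ _ _ _ _ Hpr), (pr_val _ _ _ _ _ _ _ _ Hpr).
 specialize (HhQ z (or_introl Hz)). destruct (rad_in z (or_introl Hz)) as [Hq0 Hq1].
    specialize (Hl1 t ltac:(lra)). set (q := rad 1 N z) in *. set (s := h q) in *. set (L := l t) in *.
    assert (Hlap : difD m * mlap m H z t = - reac m s) by lra.
    specialize (Hgap s L HhQ Hl1).
    assert (Heq0 : 0 <= e * q / s) by (apply Rdiv_le_0_compat; nra).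
    pose proof (reac_scale_up m Hm ((s + e * q) / s) (L * s)) as Hu.
    replace ((s + e * q) / s * (L * s)) with (L * (s + e * q)) in Hu by (field; lra).
    replace ((s + e * q) / s) with (1 + e * q / s) in Hu by (field; lra).
    specialize (Hu ltac:(lra) ltac:(nra)).
    pose proof (reac_le_slope m Hm (L * s) ltac:(nra)) as Hsl.
    assert (Hsl2 : e * q / s * reac m (L * s) <= L * (e * q * slope m)).
    { replace (L * (e * q * slope m)) with (e * q / s * (slope m * (L * s))) by (field; lra).
      now apply Rmult_le_compat_l. }
    assert (e * q * slope m <= e * (Rq * slope m))
      by (rewrite Rmult_assoc; apply Rmult_le_compat_l; [lra|apply Rmult_le_compat_r; lra]).
    assert (Hq2 : c * (s + e * q) <= s1 / 2).
    { apply Rle_trans with (c * (1 + e * Rq)); auto. apply Rmult_le_compat_l; [lra|].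
      apply Rplus_le_compat; [lra|apply Rmult_le_compat_l; lra]. }
    assert (He1 : e * (2 * n1 * difD m + Rq * slope m) <= s1 / 2).
    { apply Rle_trans with (e0 * (2 * n1 * difD m + Rq * slope m)); auto.
      apply Rmult_le_compat_r; [apply Rplus_le_le_0_compat; repeat apply Rmult_le_pos; lra|lra]. }
    assert (HL : 0 <= L * (s1 - s1 / 2 - e * (2 * n1 * difD m + Rq * slope m)) ) by (apply Rmult_le_pos; lra).
    assert (HLe : L * (e * q * slope m) <= L * (e * (Rq * slope m))) by (apply Rmult_le_compat_l; lra).
    assert (Hs1L : s1 / 2 <= L * (s1 / 2)) by (apply le_mult_ge1; lra).
    replace (difD m * (0 * (s + e * q) + 2 * 0 + L * (mlap m H z t + e * (2 * n1)))) with
      (L * (difD m * mlap m H z t) + L * (e * (2 * n1 * difD m))) by ring.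
    rewrite Hlap. lra.
  - intros z t Hz Ht'. rewrite HSv, HTv. unfold S. rewrite dn_mul. unfold LT at 1. rewrite dn_time.
    rewrite dn_add, dn_scal, dn_q by auto.
    pose proof (pr_bd _ _ _ _ _ _ _ _ Hpr z t Hz) as Hb1.
    cbn [jw LT jtime]. destruct Hz as [_ Hz]. rewrite Hz, (pr_psi_R _ _ _ _ _ _ _ _ Hpr).
    specialize (Hl1 t ltac:(lra)). set (L := l t) in *.
    destruct (kap_gap eps Heps) as [Hg1 _].
    set (ke := exmu m * theta / (theta + exnu m * (1 + eps))) in *.
    assert (Hkb : exmu m * (hR + e * Rq) - exnu m * b * (1 + eps) = ke * (hR + e * Rq)).
    { unfold ke, b. field. lra. }
    assert (Hke : 0 <= ke * (e * Rq)).
    { apply Rmult_le_pos; [unfold ke; apply Rlt_le, Rdiv_lt_0_compat; auto; now apply Rmult_lt_0_compat|].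
      apply Rmult_le_pos; lra. }
    assert ((kap - exmu m * eps) * hR <= ke * hR) by (apply Rmult_le_compat_r; lra).
    assert (exmu m * eps * hR <= exmu m * eps) by (apply mult_le_1; [apply Rmult_le_pos; lra|lra]).
    assert (0 <= L * (difD m * mdn m H z t + 2 * radR m * difD m * e + exmu m * (hR + e * Rq) - exnu m * b * (1 + eps))).
    { apply Rmult_le_pos; lra. }
    replace (difD m * (0 * jw (jadd H (jscal e (jq (dimN m)))) z t + L * (mdn m H z t + e * (2 * radR m))))
      with (L * (difD m * mdn m H z t + 2 * radR m * difD m * e)) by ring.
    lra.
  - intros z t Hz Ht'. rewrite HTv. unfold T. rewrite lap_mul. unfold LT at 2 3. rewrite lap_time, gg_time.
    rewrite lap_scal, lap_add, lap_const. cbn [jt jmul LT jtime jw jadd jscal jconst].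
    pose proof (jpsi_lap z t Hz) as Hlp. specialize (HpQ z (or_introl Hz)).
    specialize (Hl1 t ltac:(lra)). set (L := l t) in *.
    replace (jt jpsi z t) with 0 by (simpl; ring). change (jw jpsi z t) with (psi (rad 1 N z)).
    set (p := psi (rad 1 N z)) in *.
    replace (difd m * (0 * (b * (p + eps)) + 2 * 0 + L * (b * (mlap m jpsi z t + 0)))) with
      (L * b * (difd m * mlap m jpsi z t)) by ring. rewrite Hlp.
    assert (c * (p + eps) <= decay m * eps).
    { apply Rle_trans with (c * (1 + eps)); auto. apply Rmult_le_compat_l; lra. }
    assert (decay m * eps <= L * (decay m * eps)) by (apply le_mult_ge1; [lra|apply Rmult_le_pos; lra]).
    assert (0 <= b * (L * (decay m * eps) - c * (p + eps))) by (apply Rmult_le_pos; lra). lra.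
  - intros z t Hz Ht'. rewrite HSv, HTv. unfold T. rewrite dn_mul. unfold LT at 1. rewrite dn_time.
    rewrite dn_scal, dn_add, dn_const.
    pose proof (jpsi_dn z t Hz) as Hb1. cbn [jw LT jtime].
    destruct Hz as [_ Hz]. rewrite Hz, (pr_psi_R _ _ _ _ _ _ _ _ Hpr).
    set (L := l t) in *.
    replace (- difd m * (0 * jw (jscal b (jadd jpsi (jconst eps))) z t + L * (b * (mdn m jpsi z t + 0))))
      with (L * b * (- difd m * mdn m jpsi z t)) by ring. rewrite Hb1.
    right. replace (exmu m * (L * (hR + e * Rq))) with (L * (exmu m * (hR + e * Rq))) by ring.
    rewrite <- Hbd. ring.
  - intros t Ht'. change (lam0 - c * (t - t0)) with (l t).
    split; intros z Hz; [rewrite <- HSv|rewrite <- HTv]; auto.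
Qed.

Lemma upper_limit : 0 <= F -> forall M eta, 0 < eta -> exists T, 0 < T /\ forall U V, bsol m M U V ->
  forall t, T <= t -> (forall z, inO m z -> jw U z t <= h (rad 1 N z) + eta) /\
    (forall z, inE m z -> jw V z t <= exmu m * hR / (theta + exnu m) * psi (rad 1 N z) + eta).
Proof.
  intros HF M eta Heta. destruct model_pos as [HN [HD [Hd [HR [Hmu [Hnu [Hrho [HR2 Hth]]]]]]]].
  destruct hR_range as [HhR0 HhR1].
  set (w := exmu m / (theta + exnu m)).
  assert (Hw : 0 < w) by (apply Rdiv_lt_0_compat; lra).
  set (del := Rmin 1 (eta / (4 * (1 + w)))).
  assert (Hdel : 0 < del) by (apply Rmin_glb_lt; [lra|apply Rdiv_lt_0_compat; lra]).
  assert (Hdel1 : del <= 1) by apply Rmin_l.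
  assert (Hdel2 : del * (1 + w) <= eta / 4).
  { apply Rle_trans with (eta / (4 * (1 + w)) * (1 + w)); [apply Rmult_le_compat_r; [lra|apply Rmin_r]|].
    right; field; lra. }
  destruct (upper_step (1 + del) ltac:(lra) HF) as [e0 [He0 Hstep]].
  (* The summand [1 / e0] enforces [e <= e0]; the others keep the corrections in the final bound
     below [eta]. *)
  destruct (small_factor (1 / e0 + (2 * Rq + 2 * w * Rq) + Rq / 1 + 4 * w * (2 * radR m * difD m / exmu m)) (Rmin 1 (eta / 4)))
    as [e [He Hee]].
  { assert (0 <= 1 / e0) by (apply Rdiv_le_0_compat; lra).
    assert (0 <= 2 * radR m * difD m / exmu m) by (apply Rdiv_le_0_compat; nra). nra. }
  { apply Rmin_glb_lt; lra. }
  pose proof (Rmin_l 1 (eta / 4)) as Hm1. pose proof (Rmin_r 1 (eta / 4)) as Hm2.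
  assert (A1 : 0 <= e * (1 / e0)) by (apply Rmult_le_pos; [lra|apply Rdiv_le_0_compat; lra]).
  assert (A2 : 0 <= e * Rq) by (nra).
  assert (A3 : 0 <= w * (e * Rq)) by nra.
  set (eps := 2 * radR m * difD m * e / exmu m).
  assert (Heps : 0 < eps) by (unfold eps; apply Rdiv_lt_0_compat; auto; repeat apply Rmult_lt_0_compat; lra).
  assert (A4 : 0 <= w * eps) by nra.
  replace (e * (1 / e0 + (2 * Rq + 2 * w * Rq) + Rq / 1 + 4 * w * (2 * radR m * difD m / exmu m))) with
    (e * (1 / e0) + 2 * (e * Rq) + 2 * (w * (e * Rq)) + e * Rq + 4 * (w * eps)) in Hee
    by (unfold eps; field; split; lra).
  assert (Hee0 : e <= e0).
  { replace e with (e * (1 / e0) * e0) by (field; lra). apply Rle_trans with (1 * e0); [|lra].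
    apply Rmult_le_compat_r; lra. }
  destruct (Hstep e (conj He Hee0)) as [c0 [Hc0 Hrun]]. fold eps in Hrun.
  set (b := exmu m * (hR + e * Rq) / (theta + exnu m * (1 + eps))) in *.
  assert (Hden : 0 < theta + exnu m * (1 + eps)) by nra.
  assert (Hb : 0 < b) by (unfold b; apply Rdiv_lt_0_compat; auto; apply Rmult_lt_0_compat; lra).
  assert (Hbw : b <= w * (hR + e * Rq)).
  { unfold b, w. replace (exmu m / (theta + exnu m) * (hR + e * Rq)) with
      (exmu m * (hR + e * Rq) * / (theta + exnu m)) by (unfold Rdiv; ring).
    apply Rmult_le_compat_l; [nra|]. apply Rinv_le_contravar; nra. }
  set (M' := Rmax M 0). assert (HM' : M <= M' /\ 0 <= M') by (split; [apply Rmax_l|apply Rmax_r]).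
  (* Large enough for both barriers to start above the bound [M]; outside this is possible because
     of [eps]. *)
  set (lam0 := 3 + M' / hR + M' / (b * eps)).
  assert (B1 : 0 <= M' / hR) by (apply Rdiv_le_0_compat; lra).
  assert (Hbe : 0 < b * eps) by nra.
  assert (B2 : 0 <= M' / (b * eps)) by (apply Rdiv_le_0_compat; lra).
  set (T1 := (lam0 - (1 + del)) / c0).
  assert (HT1 : 0 < T1) by (apply Rdiv_lt_0_compat; unfold lam0; lra).
  assert (HhQ : forall z, inO m z -> hR <= h (rad 1 N z) <= 1).
  { intros z Hz. apply (pr_range _ _ _ _ _ _ _ _ Hpr). now apply rad_in. }
  assert (HpQ : forall z, inE m z -> 0 < psi (rad 1 N z) <= 1).
  { intros z Hz. apply (pr_psi_range _ _ _ _ _ _ _ _ Hpr). now apply clE_iff in Hz. }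
  exists T1. split; auto. intros U V Hbs t Ht.
  destruct (Hrun U V M c0 lam0 0 T1 Hbs) with (t := T1) as [R1 R2]; try lra.
  - unfold T1. replace (c0 * ((lam0 - (1 + del)) / c0 - 0)) with (lam0 - (1 + del)) by (field; lra). lra.
  - intros z Hz. destruct Hbs as [_ [bU _]]. specialize (bU z 0 Hz ltac:(lra)).
    specialize (HhQ z Hz). destruct (rad_in z Hz) as [Hq _].
    assert (M' = M' / hR * hR) by (field; lra).
    assert (M' / hR * hR <= lam0 * (h (rad 1 N z) + e * rad 1 N z)); [|lra].
    apply Rmult_le_compat; try lra; [unfold lam0; lra|].
    assert (0 <= e * rad 1 N z) by (apply Rmult_le_pos; lra). lra.
  - intros z Hz. destruct Hbs as [_ [_ bV]]. specialize (bV z 0 Hz ltac:(lra)). specialize (HpQ z Hz).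
    assert (M' = M' / (b * eps) * (b * eps)) by (field; lra).
    assert (M' / (b * eps) * (b * eps) <= lam0 * (b * (psi (rad 1 N z) + eps))); [|lra].
    apply Rmult_le_compat; try lra; [unfold lam0; lra|]. apply Rmult_le_compat_l; lra.
  - assert (Hend : lam0 - c0 * (T1 - 0) = 1 + del).
    { unfold T1. replace (c0 * ((lam0 - (1 + del)) / c0 - 0)) with (lam0 - (1 + del)) by (field; lra). ring. }
    rewrite Hend in R1, R2.
    (* A second run with [c = 0] preserves the bound for all later times. *)
    destruct (Hrun U V M 0 (1 + del) T1 t Hbs) with (t := t) as [R3 R4]; auto; try lra.
    replace (1 + del - 0 * (t - T1)) with (1 + del) in R3, R4 by ring.
    split; intros z Hz.
    + specialize (R3 z Hz). specialize (HhQ z Hz). destruct (rad_in z Hz) as [Hq0 Hq1].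
      assert (e * rad 1 N z <= e * Rq) by (apply Rmult_le_compat_l; lra).
      assert (del * h (rad 1 N z) <= del * 1) by (apply Rmult_le_compat_l; lra).
      assert (del <= del * (1 + w)) by nra.
      assert ((1 + del) * (e * rad 1 N z) <= 2 * (e * Rq)).
      { apply Rmult_le_compat; try lra. apply Rmult_le_pos; lra. }
      lra.
    + specialize (R4 z Hz). specialize (HpQ z Hz). set (p := psi (rad 1 N z)) in *.
      assert (Hbx : b * (p + eps) <= w * (hR + e * Rq) * (p + eps)) by (apply Rmult_le_compat_r; lra).
      replace (exmu m * hR / (theta + exnu m)) with (w * hR) by (unfold w; field; lra).
      assert (C1 : (1 + del) * (b * (p + eps)) <= (1 + del) * (w * (hR + e * Rq) * (p + eps)))
        by (apply Rmult_le_compat_l; lra).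
      assert (C2 : del * (w * hR * p) <= del * w).
      { apply Rmult_le_compat_l; [lra|]. rewrite <- (Rmult_1_r w) at 2. rewrite Rmult_assoc.
        apply Rmult_le_compat_l; [lra|]. nra. }
      assert (C3 : (1 + del) * (w * (e * Rq) * p) <= 2 * (w * (e * Rq))).
      { apply Rmult_le_compat; try nra. }
      assert (C4 : (1 + del) * (w * (hR + e * Rq) * eps) <= 4 * (w * eps)).
      { replace (w * (hR + e * Rq) * eps) with ((hR + e * Rq) * (w * eps)) by ring.
        assert ((1 + del) * (hR + e * Rq) <= 4) by (apply Rle_trans with (2 * 2); [apply Rmult_le_compat; lra|lra]).
        rewrite <- Rmult_assoc. apply Rmult_le_compat_r; lra. }
      lra.
Qed.
End Profiles.

(** * Steady profiles as limits from below *)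

Definition strip x0 w (z : nat -> R) : Prop := Rabs (z 0%nat - x0) <= w.
Definition ostrip x0 w (z : nat -> R) : Prop := Rabs (z 0%nat - x0) < w.

Lemma strip_closed N x0 w : (1 <= N)%nat -> closed_in N (fun z => pt N z /\ strip x0 w z).
Proof.
  intros HN z Hz Hc. split; auto. unfold strip. apply Rnot_lt_le. intros Hlt.
  destruct (Hc (Rabs (z 0%nat - x0) - w)) as [z' [[_ Hs] Hn]]; [lra|]. specialize (Hn 0%nat ltac:(lia)).
  unfold strip in Hs. assert (Rabs (z 0%nat - x0) <= Rabs (z' 0%nat - x0) + Rabs (z' 0%nat - z 0%nat)); [|lra].
  rewrite (Rabs_minus_sym (z' 0%nat) (z 0%nat)).
  replace (z 0%nat - x0) with ((z' 0%nat - x0) + (z 0%nat - z' 0%nat)) by ring. apply Rabs_triang.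
Qed.

Lemma ostrip_open N x0 w z : (1 <= N)%nat -> ostrip x0 w z ->
  exists r, 0 < r /\ forall z', near N r z z' -> ostrip x0 w z'.
Proof.
  intros HN Hs. unfold ostrip in *. exists (w - Rabs (z 0%nat - x0)). split; [lra|].
  intros z' [_ Hn]. specialize (Hn 0%nat ltac:(lia)).
  apply Rle_lt_trans with (Rabs (z 0%nat - x0) + Rabs (z' 0%nat - z 0%nat)); [|lra].
  replace (z' 0%nat - x0) with ((z 0%nat - x0) + (z' 0%nat - z 0%nat)) by ring. apply Rabs_triang.
Qed.

(** A localizing factor in x: an eigenfunction of the second derivative that is positive in the open
    strip of half-width [PI / 2 / om] and vanishes on its faces, so that a truncated barrier cannot
    be violated at the edge of the window. *)
Definition jcos om x0 : jet := jcomp (fun x => cos (om * (x - x0))) (fun x => - om * sin (om * (x - x0)))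
  (fun x => - (om * om) * cos (om * (x - x0))) (jcoord 0).

Lemma jcos_creg n O B T0 om x0 : (1 <= n)%nat -> creg n O B T0 (jcos om x0).
Proof.
  intros. apply creg_comp; [apply creg_coord; lia|]. intros z t _ _.
  split; apply is_derive_Reals; auto_derive; auto; unfold Rminus; ring.
Qed.

Lemma jcos_lap n om x0 z t : (1 <= n)%nat -> jlap n (jcos om x0) z t = - (om * om) * jw (jcos om x0) z t.
Proof. intros. unfold jcos. rewrite lap_comp, gg_coord, lap_coord by lia. simpl. ring. Qed.

Lemma jcos_gg n om x0 B z t : (1 <= n)%nat -> j1 B 0%nat z t = 0 -> gg n (jcos om x0) B z t = 0.
Proof. intros. unfold jcos. rewrite gg_comp, gg_coord, H0 by lia. ring. Qed.

Lemma jcos_dn n Rd om x0 z t : jdn n Rd (jcos om x0) z t = 0.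
Proof. unfold jcos. rewrite dn_comp, dn_coord0. ring. Qed.

Lemma jcos_range om x0 z t : 0 < om -> strip x0 (PI / 2 / om) z ->
  0 <= jw (jcos om x0) z t <= 1 /\
  (0 < jw (jcos om x0) z t -> ostrip x0 (PI / 2 / om) z).
Proof.
  intros Hom Hs. unfold strip, ostrip in *. cbn [jw jcos jcomp jcoord].
  pose proof (COS_bound (om * (z 0%nat - x0))) as Hb. pose proof PI_RGT_0 as Hpi.
  assert (Ha : Rabs (om * (z 0%nat - x0)) <= PI / 2).
  { rewrite Rabs_mult, (Rabs_right om) by lra. replace (PI / 2) with (om * (PI / 2 / om)) by (field; lra).
    apply Rmult_le_compat_l; lra. }
  apply Rabs_le_between in Ha. split.
  - split; [apply cos_ge_0; lra|lra].
  - intros Hc. destruct (Rle_lt_or_eq_dec _ _ Hs) as [|He]; auto. exfalso.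
    assert (H : cos (om * (z 0%nat - x0)) = cos (Rabs (om * (z 0%nat - x0)))).
    { unfold Rabs. destruct Rcase_abs; auto. now rewrite cos_neg. }
    rewrite Rabs_mult, (Rabs_right om), He in H by lra.
    replace (om * (PI / 2 / om)) with (PI / 2) in H by (field; lra). rewrite cos_PI2 in H. lra.
Qed.

Section Lower.
Context (m : model) (Hm : model_ok m).
Context (H : jet) (h psi psi1 psi2 : R -> R) (theta F : R)
  (Hpr : profile m H h psi psi1 psi2 theta F).
Local Notation N := (dimN m).
Local Notation Rq := (radR m ^ 2).
Local Notation n1 := (INR (dimN m - 1)).
Local Notation kap := (exmu m * theta / (exnu m + theta)).
Local Notation hR := (h (radR m ^ 2)).
Local Notation Jpsi := (jpsi m psi psi1 psi2).

(** Dual of [reac_gap_up] for factors below 1. The gap is proportional to [k], hence still useful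
    for arbitrarily small multiples. *)
Lemma reac_gap_low lam : 0 < lam < 1 -> exists s2, 0 < s2 /\ forall s k, hR <= s <= 1 -> 0 < k <= lam ->
  k * (reac m s + s2) <= reac m (k * s).
Proof.
  intros Hlam. destruct (hR_range m Hm _ _ _ _ _ _ _ Hpr) as [H0 H1].
  set (f := fun s => reac m (lam * s) / lam - reac m s).
  destruct (continuity_ab_min f hR 1) as [s0 [Hs0 Hs1]]; auto.
  { intros c _. unfold f, Rdiv. apply continuity_pt_minus; [|apply reac_continuous; auto].
    apply continuity_pt_mult; [|apply continuity_pt_const; red; auto].
    apply (continuity_pt_comp (fun s => lam * s) (reac m)); [|apply reac_continuous; auto].
    apply derivable_continuous_pt. apply derivable_pt_mult; [apply derivable_pt_const|apply derivable_pt_id]. }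
  exists (f s0). split.
  - unfold f. assert (Hs : 0 < s0) by lra.
    pose proof (reac_ratio m Hm (lam * s0) s0 ltac:(nra) ltac:(nra)) as Hr.
    replace (reac m (lam * s0) / lam) with (reac m (lam * s0) / (lam * s0) * s0) by (field; lra).
    replace (reac m s0) with (reac m s0 / s0 * s0) by (field; lra). nra.
  - intros s k Hs Hk. specialize (Hs0 s Hs).
    pose proof (reac_scale m Hm (k / lam) (lam * s)) as Hu.
    replace (k / lam * (lam * s)) with (k * s) in Hu by (field; lra).
    assert (Hk1 : 0 < k / lam <= 1).
    { split; [apply Rdiv_lt_0_compat; lra|].
      apply Rmult_le_reg_r with lam; [lra|]. replace (k / lam * lam) with k by (field; lra). lra. }
    specialize (Hu Hk1 ltac:(nra)).
    replace (k / lam * reac m (lam * s)) with (k * (reac m (lam * s) / lam)) in Hu by (field; lra).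
    apply Rle_trans with (2 := Hu). apply Rmult_le_compat_l; [lra|]. unfold f in *. lra.
Qed.

(** As in [kap_gap], with the constant subtracted; [eps <= 1 / 2] keeps the denominator at least
    [theta + exnu / 2]. *)
Lemma kap_gap_low eps : 0 < eps <= 1 / 2 ->
  exmu m * theta / (theta + exnu m * (1 - eps)) <= kap + exmu m * eps.
Proof.
  intros He. destruct (model_pos m Hm _ _ _ _ _ _ _ Hpr) as [HN [HD [Hd [HR [Hmu [Hnu [Hrho [HR2 Hth]]]]]]]].
  set (nu := exnu m) in *. set (mu := exmu m) in *.
  assert (0 < nu * eps <= nu / 2) by nra. set (ne := nu * eps) in *.
  replace (nu * (1 - eps)) with (nu - ne) by (unfold ne; ring).
  assert (Hd1 : 0 < (nu + theta) * (theta + (nu - ne))) by nra.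
  assert (E : mu * theta / (theta + (nu - ne)) - mu * theta / (nu + theta) =
      mu * (theta * ne) / ((nu + theta) * (theta + (nu - ne)))) by (field; split; lra).
  assert (mu * (theta * ne) / ((nu + theta) * (theta + (nu - ne))) <= mu * eps); [|lra].
  apply Rmult_le_reg_r with ((nu + theta) * (theta + (nu - ne))); auto.
  replace (mu * (theta * ne) / ((nu + theta) * (theta + (nu - ne))) * ((nu + theta) * (theta + (nu - ne))))
    with (mu * eps * (theta * nu)) by (transitivity (mu * (theta * ne)); [unfold ne; ring|field; split; lra]).
  apply Rmult_le_compat_l; [nra|]. assert (nu / 2 <= nu - ne) by lra.
  assert (theta * nu <= (nu + theta) * (theta + nu / 2)) by nra.
  apply Rle_trans with (1 := H2). apply Rmult_le_compat_l; lra.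
Qed.

(** The barrier is a cosine times [psi - e(t)], with [e] decaying from 1 to [eps]. It starts
    nonpositive because [psi <= 1], so only nonnegativity of [V] is used at the start, and it is fed
    by the boundary values of [U] alone. The rate of [e] is half of [decay]; the other half absorbs
    the curvature [difd * om^2] of the cosine. *)
Lemma exterior_lift eps om : 0 < eps < 1 -> 0 < om -> difd m * (om * om) <= decay m * eps / 2 ->
  let T7 := 2 / decay m * ln (/ eps) in 0 < T7 /\
  forall U V M t0 x0 delta, bsol m M U V -> 0 <= t0 -> 0 < delta ->
    (forall z t, mBd m z -> strip x0 (PI / 2 / om) z -> t0 <= t <= t0 + T7 -> delta <= jw U z t) ->
    forall z, inE m z -> strip x0 (PI / 2 / om) z ->
      exmu m * delta / (theta + exnu m) * (jw (jcos om x0) z 0 * (psi (rad 1 N z) - eps)) <= jw V z (t0 + T7).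
Proof.
  intros He Hom Hom2 T7.
  destruct (model_pos m Hm _ _ _ _ _ _ _ Hpr) as [HN [HD [Hd [HR [Hmu [Hnu [Hrho [HR2 Hth]]]]]]]].
  assert (HT7 : 0 < T7).
  { apply Rmult_lt_0_compat; [apply Rdiv_lt_0_compat; lra|]. rewrite <- ln_1. apply ln_increasing; [lra|].
    rewrite <- Rinv_1. apply Rinv_lt_contravar; lra. }
  split; auto. intros U V M t0 x0 delta Hbs Ht0 Hdel HU.
  set (w := PI / 2 / om) in *.
  set (c7 := exmu m * delta / (theta + exnu m)).
  assert (Hc7 : 0 < c7) by (apply Rdiv_lt_0_compat; [now apply Rmult_lt_0_compat|lra]).
  set (e := fun t => exp (- (decay m / 2) * (t - t0))).
  assert (Hder : forall t, derivable_pt_lim e t (- (decay m / 2) * e t)).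
  { intros t. unfold e. apply is_derive_Reals. auto_derive; auto. unfold Rminus. ring. }
  assert (Heend : e (t0 + T7) = eps).
  { unfold e, T7. replace (- (decay m / 2) * (t0 + 2 / decay m * ln (/ eps) - t0)) with (- ln (/ eps)) by (field; lra).
    rewrite exp_Ropp, exp_ln, Rinv_inv; auto. apply Rinv_0_lt_compat; lra. }
  assert (Herange : forall t, t0 <= t <= t0 + T7 -> eps <= e t <= 1).
  { intros t Ht. split.
    - rewrite <- Heend. unfold e. destruct (Rle_lt_or_eq_dec t (t0 + T7)) as [Hl| ->]; try lra.
      apply Rlt_le, exp_increasing. nra.
    - unfold e. rewrite <- exp_0. destruct (Rle_lt_or_eq_dec t0 t) as [Hl| <-]; try lra.
      + apply Rlt_le, exp_increasing. nra.
      + rewrite Rminus_diag, Rmult_0_r. lra. }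
  set (T := jmul (jscal c7 (jcos om x0)) (jsub Jpsi (jtime e (fun t => - (decay m / 2) * e t)))).
  assert (HTv : forall z t, jw T z t = c7 * (jw (jcos om x0) z t * (psi (rad 1 N z) - e t))).
  { intros. simpl. ring. }
  assert (HpQ : forall z, inE m z -> 0 < psi (rad 1 N z) <= 1).
  { intros z Hz. apply (pr_psi_range _ _ _ _ _ _ _ _ Hpr). now apply clE_iff in Hz. }
  destruct (sub_comparison m Hm M U V t0 (t0 + T7) (strip x0 w) (ostrip x0 w) (jconst (-1)) T c7) as [_ C]; auto; try lra.
  - apply strip_closed; auto.
  - unfold ostrip, strip. intros; lra.
  - intros; now apply ostrip_open.
  - apply creg_const.
  - apply creg_mul; [apply creg_scal, jcos_creg; auto|]. apply creg_jsub; [|apply creg_time; auto].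
    eapply jpsi_creg; eauto.
  - simpl; intros; lra.
  - intros z t Hz Hw Ht. rewrite HTv. destruct (jcos_range om x0 z t Hom Hw) as [Hc _].
    specialize (HpQ z Hz). specialize (Herange t Ht). rewrite <- (Rmult_1_r c7) at 2.
    apply Rmult_le_compat_l; [lra|]. nra.
  - intros z Hz _. destruct Hbs as [_ [bU _]]. specialize (bU z t0 Hz Ht0). simpl. lra.
  - intros z Hz Hw. rewrite HTv. destruct (jcos_range om x0 z t0 Hom Hw) as [Hc _].
    specialize (HpQ z Hz). destruct Hbs as [_ [_ bV]]. specialize (bV z t0 Hz Ht0).
    assert (e t0 = 1) by (unfold e; rewrite Rminus_diag, Rmult_0_r; apply exp_0). rewrite H0.
    assert (0 <= c7 * (jw (jcos om x0) z t0 * (1 - psi (rad 1 N z)))); [|lra].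
    apply Rmult_le_pos; [lra|]. apply Rmult_le_pos; lra.
  - intros z t Hz Hw Ht Hlt. destruct Hbs as [_ [bU _]]. specialize (bU z t Hz ltac:(lra)). simpl in Hlt. lra.
  - intros z t Hz Hw Ht Hlt. rewrite HTv in Hlt. destruct (jcos_range om x0 z t Hom Hw) as [Hc Hc2].
    apply Hc2. destruct Hbs as [_ [_ bV]]. specialize (bV z t Hz ltac:(lra)).
    destruct (Rle_lt_or_eq_dec _ _ (proj1 Hc)) as [|H0]; auto. rewrite <- H0 in Hlt. lra.
  - simpl; intros; lra.
  - simpl; intros; lra.
  - intros z t Hz Hw Ht Hpos. rewrite HTv in *. unfold T. rewrite lap_mul, lap_scal, jcos_lap, gg_scal, jcos_gg; auto.
    2:{ simpl. ring. }
    rewrite lap_sub, lap_time. cbn [jt jmul jscal jcos jcomp jcoord jsub jadd jtime].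
    replace (jt Jpsi z t) with 0 by (simpl; ring).
    rewrite jw_sub. change (jw Jpsi z t) with (psi (rad 1 N z)). cbn [jw jtime].
    change (jw (jscal c7 (jcos om x0)) z t) with (c7 * jw (jcos om x0) z t).
    pose proof (jpsi_lap m Hm _ _ _ _ _ _ _ Hpr z t Hz) as Hlp.
    assert (Hw' : strip x0 w z) by (unfold ostrip, strip in *; lra).
    destruct (jcos_range om x0 z t Hom Hw') as [Hc _]. set (C := jw (jcos om x0) z t) in *.
    specialize (Herange t ltac:(lra)). set (E := e t) in *. specialize (HpQ z (or_introl Hz)).
    set (p := psi (rad 1 N z)) in *. set (lp := mlap m Jpsi z t) in *.
    assert (Hkey : difd m * (om * om) * (p - E) <= decay m / 2 * E).
    { destruct (Rle_lt_dec (p - E) 0).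
      - assert (0 <= difd m * (om * om)) by (apply Rmult_le_pos; [lra|apply Rmult_le_pos; lra]). nra.
      - apply Rle_trans with (decay m * eps / 2 * 1); [|nra].
        apply Rmult_le_compat; try lra. apply Rmult_le_pos; nra. }
    assert (0 <= c7 * C * (decay m / 2 * E - difd m * (om * om) * (p - E))).
    { apply Rmult_le_pos; [apply Rmult_le_pos; lra|lra]. }
    match goal with |- ?L <= ?R => replace L with
      (c7 * C * (decay m / 2 * E) - c7 * C * (difd m * lp) + c7 * C * (difd m * (om * om) * (p - E))) by ring end.
    rewrite Hlp. lra.
  - intros z t Hz Hw Ht Hpos. rewrite HTv in *. unfold T. rewrite dn_mul, dn_scal, jcos_dn, dn_sub, dn_time.
    pose proof (jpsi_dn m Hm _ _ _ _ _ _ _ Hpr z t Hz) as Hb1.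
    assert (Hw' : strip x0 w z) by (unfold ostrip, strip in *; lra).
    destruct (jcos_range om x0 z t Hom Hw') as [Hc _].
    specialize (HU z t Hz Hw' ltac:(lra)). destruct Hz as [_ Hz]. rewrite Hz in *.
    rewrite (pr_psi_R _ _ _ _ _ _ _ _ Hpr) in *.
    change (jw (jscal c7 (jcos om x0)) z t) with (c7 * jw (jcos om x0) z t).
    set (C := jw (jcos om x0) z t) in *. specialize (Herange t ltac:(lra)). set (E := e t) in *.
    match goal with |- ?L <= ?R => replace L with
      (c7 * C * (- difd m * mdn m Jpsi z t + exnu m * (1 - E))) by ring end.
    rewrite Hb1. apply Rle_trans with (exmu m * delta).
    + replace (exmu m * delta) with (c7 * 1 * (theta + exnu m)) by (unfold c7; field; lra).
      apply Rmult_le_compat; try nra.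
    + apply Rmult_le_compat_l; [lra|]. apply Rle_trans with (1 := HU). apply Rmax_l.
  - intros z Hz Hw. specialize (C z (t0 + T7) Hz Hw ltac:(lra)). rewrite HTv, Heend in C. exact C.
Qed.

(** The subsolution is [l(t) cos(om (x - x0)) (h - e q)] inside, with [b (psi - eps)] in place of
    the last factor outside. Because the gap of [reac_gap_low] is proportional to the multiple, [l]
    may grow exponentially, up to [lam1 < 1]. The conclusion is drawn at [x = x0], where the cosine
    is 1. The window [w] and the time [T7] depend on [eta] only, so that one lower bound on a longer
    window serves all nearby centres. *)
Lemma lower_limit : F <= 0 -> forall eta, 0 < eta -> exists w T7, 0 < w /\ 0 < T7 /\
  forall M delta, 0 < delta -> exists T, 0 < T /\ forall U V t0 x0, bsol m M U V -> 0 <= t0 ->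
    (forall z t, inO m z -> strip x0 w z -> t0 <= t <= t0 + T7 -> delta <= jw U z t) ->
    forall t, t0 + T <= t ->
      (forall z, inO m z -> z 0%nat = x0 -> h (rad 1 N z) - eta <= jw U z t) /\
      (forall z, inE m z -> z 0%nat = x0 ->
         exmu m * hR / (theta + exnu m) * psi (rad 1 N z) - eta <= jw V z t).
Proof.
  intros HF eta Heta.
  destruct (model_pos m Hm _ _ _ _ _ _ _ Hpr) as [HN [HD [Hd [HR [Hmu [Hnu [Hrho [HR2 Hth]]]]]]]].
  destruct (hR_range m Hm _ _ _ _ _ _ _ Hpr) as [HhR0 HhR1].
  pose proof (slope_pos m Hm) as Hgp. pose proof (pos_INR (dimN m - 1)) as Hn1.
  set (wt := exmu m / (theta + exnu m)).
  assert (Hwt : 0 < wt) by (apply Rdiv_lt_0_compat; lra).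
  destruct (small_factor (1 + wt) (Rmin (1 / 2) (eta / 4))) as [d1 [Hd1 Hd1']]; [lra|apply Rmin_glb_lt; lra|].
  pose proof (Rmin_l (1 / 2) (eta / 4)) as Hq1. pose proof (Rmin_r (1 / 2) (eta / 4)) as Hq2.
  assert (Hd1w : 0 <= d1 * wt) by nra.
  set (lam1 := 1 - d1). assert (Hlam1 : 0 < lam1 < 1) by (unfold lam1; lra).
  destruct (reac_gap_low lam1 Hlam1) as [s2 [Hs2 Hgap]].
  set (k0 := 2 * radR m * difD m / exmu m).
  assert (Hk0 : 0 < k0) by (apply Rdiv_lt_0_compat; auto; repeat apply Rmult_lt_0_compat; lra).
  assert (Hk0m : exmu m * k0 = 2 * radR m * difD m) by (unfold k0; field; lra). clearbody k0.
  destruct (small_factor ((2 * n1 * difD m + Rq * slope m) + Rq + wt * Rq + k0 + wt * k0)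
    (Rmin (s2 / 4) (Rmin (hR / 2) (Rmin (1 / 2) (eta / 4))))) as [e [He He']].
  { assert (0 <= n1 * difD m) by (apply Rmult_le_pos; lra).
    assert (0 <= Rq * slope m) by (apply Rmult_le_pos; lra).
    assert (0 <= wt * Rq) by (apply Rmult_le_pos; lra).
    assert (0 <= wt * k0) by (apply Rmult_le_pos; lra). lra. }
  { repeat apply Rmin_glb_lt; lra. }
  assert (Hbd4 : forall x, x <= Rmin (s2 / 4) (Rmin (hR / 2) (Rmin (1 / 2) (eta / 4))) ->
    x <= s2 / 4 /\ x <= hR / 2 /\ x <= 1 / 2 /\ x <= eta / 4).
  { intros x Hx. pose proof (Rmin_l (s2 / 4) (Rmin (hR / 2) (Rmin (1 / 2) (eta / 4)))).
    pose proof (Rmin_r (s2 / 4) (Rmin (hR / 2) (Rmin (1 / 2) (eta / 4)))).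
    pose proof (Rmin_l (hR / 2) (Rmin (1 / 2) (eta / 4))). pose proof (Rmin_r (hR / 2) (Rmin (1 / 2) (eta / 4))). lra. }
  apply Hbd4 in He'. clear Hbd4.
  assert (A1 : 0 <= e * (2 * n1 * difD m + Rq * slope m))
    by (apply Rmult_le_pos; [lra|apply Rplus_le_le_0_compat; repeat apply Rmult_le_pos; lra]).
  assert (A2 : 0 <= e * Rq) by (apply Rmult_le_pos; lra).
  assert (A3 : 0 <= wt * (e * Rq)) by (apply Rmult_le_pos; lra).
  set (eps := e * k0).
  assert (Heps : 0 < eps) by (unfold eps; apply Rmult_lt_0_compat; lra).
  assert (A4 : 0 <= wt * eps) by (apply Rmult_le_pos; lra).
  replace (e * (2 * n1 * difD m + Rq * slope m + Rq + wt * Rq + k0 + wt * k0)) with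
    (e * (2 * n1 * difD m + Rq * slope m) + e * Rq + wt * (e * Rq) + eps + wt * eps) in He' by (unfold eps; ring).
  assert (Hepsm : exmu m * eps = 2 * radR m * difD m * e) by (unfold eps; rewrite <- Hk0m; ring).
  set (X := hR - e * Rq). assert (HX : 0 < X <= hR) by (unfold X; lra).
  assert (Hden0 : exnu m * eps <= exnu m * (1 / 2)) by (apply Rmult_le_compat_l; lra).
  assert (Hden1 : 0 < exnu m * eps) by (apply Rmult_lt_0_compat; lra).
  assert (Hden : 0 < theta + exnu m * (1 - eps)) by lra.
  set (b := exmu m * X / (theta + exnu m * (1 - eps))).
  assert (Hb : 0 < b) by (apply Rdiv_lt_0_compat; auto; apply Rmult_lt_0_compat; lra).
  assert (Hbd : b * (theta + exnu m * (1 - eps)) = exmu m * X) by (unfold b; field; lra).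
  assert (Hbw : wt * X <= b).
  { unfold b, wt. replace (exmu m / (theta + exnu m) * X) with (exmu m * X * / (theta + exnu m)) by (unfold Rdiv; ring).
    apply Rmult_le_compat_l; [apply Rmult_le_pos; lra|]. apply Rinv_le_contravar; lra. }
  assert (Hre : 0 < decay m * eps) by (apply Rmult_lt_0_compat; lra).
  set (c0 := Rmin (s2 / 4) (decay m * eps / 2)).
  assert (Hc0 : 0 < c0) by (apply Rmin_glb_lt; lra).
  assert (Hc01 : c0 <= s2 / 4) by apply Rmin_l. assert (Hc02 : c0 <= decay m * eps / 2) by apply Rmin_r.
  (* The cosine may cost at most a quarter of the gap inside and half of [decay * eps] outside. *)
  destruct (small_factor (difD m + difd m + 1) (Rmin 1 c0)) as [om [Hom Hom']]; [lra|apply Rmin_glb_lt; lra|].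
  pose proof (Rmin_l 1 c0) as Hq3. pose proof (Rmin_r 1 c0) as Hq4.
  assert (B1 : 0 < om * difD m) by (apply Rmult_lt_0_compat; lra).
  assert (B2 : 0 < om * difd m) by (apply Rmult_lt_0_compat; lra).
  assert (Hom1 : om * om <= om) by (apply mult_le_1; lra).
  assert (HDo : difD m * (om * om) <= s2 / 4)
    by (apply Rle_trans with (difD m * om); [apply Rmult_le_compat_l; lra|lra]).
  assert (Hdo : difd m * (om * om) <= decay m * eps / 2)
    by (apply Rle_trans with (difd m * om); [apply Rmult_le_compat_l; lra|lra]).
  destruct (exterior_lift eps om ltac:(lra) Hom Hdo) as [HT7 Hlift].
  set (T7 := 2 / decay m * ln (/ eps)) in *.
  set (w := PI / 2 / om) in *.
  assert (Hw : 0 < w) by (unfold w; pose proof PI_RGT_0; apply Rdiv_lt_0_compat; lra).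
  assert (HhQ : forall z, inO m z -> hR <= h (rad 1 N z) <= 1).
  { intros z Hz. apply (pr_range _ _ _ _ _ _ _ _ Hpr). now apply rad_in. }
  assert (HpQ : forall z, inE m z -> 0 < psi (rad 1 N z) <= 1).
  { intros z Hz. apply (pr_psi_range _ _ _ _ _ _ _ _ Hpr). now apply clE_iff in Hz. }
  assert (Hrun : forall U V M c lam0 t0 t1 x0, bsol m M U V -> 0 <= c <= c0 -> 0 <= t0 <= t1 -> 0 < lam0 ->
    lam0 * exp (c * (t1 - t0)) <= lam1 ->
    (forall z, inO m z -> strip x0 w z ->
       lam0 * (jw (jcos om x0) z 0 * (h (rad 1 N z) - e * rad 1 N z)) <= jw U z t0) ->
    (forall z, inE m z -> strip x0 w z ->
       lam0 * (jw (jcos om x0) z 0 * (b * (psi (rad 1 N z) - eps))) <= jw V z t0) ->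
    (forall z, inO m z -> strip x0 w z ->
       lam0 * exp (c * (t1 - t0)) * (jw (jcos om x0) z 0 * (h (rad 1 N z) - e * rad 1 N z)) <= jw U z t1) /\
    (forall z, inE m z -> strip x0 w z ->
       lam0 * exp (c * (t1 - t0)) * (jw (jcos om x0) z 0 * (b * (psi (rad 1 N z) - eps))) <= jw V z t1)).
  { intros U V M c lam0 t0 t1 x0 Hbs Hc Ht Hlam0 Hl IU IV.
    set (l := fun t => lam0 * exp (c * (t - t0))).
    assert (Hl0 : forall t, 0 < l t) by (intros; apply Rmult_lt_0_compat; [auto|apply exp_pos]).
    assert (Hl1 : forall t, t0 <= t <= t1 -> l t <= lam1).
    { intros t Ht'. apply Rle_trans with (2 := Hl). unfold l. apply Rmult_le_compat_l; [lra|].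
      destruct (Req_dec (c * (t - t0)) (c * (t1 - t0))) as [-> | Hne]; [lra|].
      apply Rlt_le, exp_increasing. assert (c * (t - t0) <= c * (t1 - t0)) by (apply Rmult_le_compat_l; lra). lra. }
    assert (Hdl : forall t, derivable_pt_lim l t (c * l t)).
    { intros. apply is_derive_Reals. unfold l. auto_derive; auto. unfold Rminus. ring. }
    set (LT := jmul (jtime l (fun t => c * l t)) (jcos om x0)).
    set (S := jmul LT (jsub H (jscal e (jq N)))).
    set (T := jmul LT (jscal b (jsub Jpsi (jconst eps)))).
    assert (HLv : forall z t, jw LT z t = l t * jw (jcos om x0) z t) by reflexivity.
    assert (HLt : forall z t, jt LT z t = c * jw LT z t) by (intros; simpl; ring).
    assert (HLl : forall z t, mlap m LT z t = - (om * om) * jw LT z t).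
    { intros. unfold LT. rewrite lap_mul, lap_time, gg_time, jcos_lap by auto. simpl. ring. }
    assert (HLg : forall B z t, j1 B 0%nat z t = 0 -> gg N LT B z t = 0).
    { intros. unfold LT. rewrite gg_mul, gg_time, jcos_gg by auto. ring. }
    assert (HLd : forall z t, mdn m LT z t = 0).
    { intros. unfold LT. rewrite dn_mul, dn_time, jcos_dn. ring. }
    assert (HSv : forall z t, jw S z t = jw LT z t * (h (rad 1 N z) - e * rad 1 N z)).
    { intros. simpl. rewrite (pr_val _ _ _ _ _ _ _ _ Hpr). ring. }
    assert (HTv : forall z t, jw T z t = jw LT z t * (b * (psi (rad 1 N z) - eps))).
    { intros. simpl. ring. }
    assert (HLr : forall z t, strip x0 w z -> t0 <= t <= t1 -> 0 <= jw LT z t <= lam1 /\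
       (0 < jw LT z t -> ostrip x0 w z)).
    { intros z t Hz Ht'. destruct (jcos_range om x0 z t Hom Hz) as [Hc1 Hc2]. rewrite HLv.
      specialize (Hl0 t). specialize (Hl1 t Ht').
      split; [split; [apply Rmult_le_pos; lra|apply Rle_trans with (l t); [apply mult_le_1; lra|auto]]|].
      intros Hp. apply Hc2. destruct (Rle_lt_or_eq_dec _ _ (proj1 Hc1)) as [|H0]; auto.
      rewrite <- H0 in Hp. lra. }
    assert (HkQ : forall z, inO m z -> 0 < h (rad 1 N z) - e * rad 1 N z <= 1 /\ 0 <= e * rad 1 N z <= e * Rq).
    { intros z Hz. specialize (HhQ z Hz). destruct (rad_in m z Hz) as [Hr0 Hr1].
      assert (e * rad 1 N z <= e * Rq) by (apply Rmult_le_compat_l; lra).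
      assert (0 <= e * rad 1 N z) by (apply Rmult_le_pos; lra). lra. }
    assert (HLTc : forall O B, creg N O B (t0 - 1) LT).
    { intros. apply creg_mul; [apply creg_time; auto|apply jcos_creg; auto]. }
    destruct (sub_comparison m Hm M U V t0 t1 (strip x0 w) (ostrip x0 w) S T (1 + b)) as [C1 C2]; auto.
    - apply strip_closed; auto.
    - unfold ostrip, strip. intros; lra.
    - intros; now apply ostrip_open.
    - apply creg_mul; auto. apply creg_jsub; [apply (pr_creg _ _ _ _ _ _ _ _ Hpr)|apply creg_scal, creg_q].
    - apply creg_mul; auto. apply creg_scal, creg_jsub; [eapply jpsi_creg; eauto|apply creg_const].
    - intros z t Hz Hs Ht'. rewrite HSv. destruct (HLr z t Hs Ht') as [Hr _]. destruct (HkQ z Hz) as [Hk _].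
      assert (jw LT z t * (h (rad 1 N z) - e * rad 1 N z) <= 1 * 1); [|lra]. apply Rmult_le_compat; lra.
    - intros z t Hz Hs Ht'. rewrite HTv. destruct (HLr z t Hs Ht') as [Hr _]. specialize (HpQ z Hz).
      apply Rle_trans with (jw LT z t * (b * 1)).
      + apply Rmult_le_compat_l; [lra|]. apply Rmult_le_compat_l; lra.
      + assert (jw LT z t * b <= 1 * b) by (apply Rmult_le_compat_r; lra). lra.
    - intros z Hz Hs. rewrite HSv, HLv. unfold l. rewrite Rminus_diag, Rmult_0_r, exp_0, Rmult_1_r, Rmult_assoc.
      apply IU; auto.
    - intros z Hz Hs. rewrite HTv, HLv. unfold l. rewrite Rminus_diag, Rmult_0_r, exp_0, Rmult_1_r, Rmult_assoc.
      apply IV; auto.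
    - intros z t Hz Hs Ht' Hlt. rewrite HSv in Hlt. destruct (HLr z t Hs ltac:(lra)) as [Hr Hr2]. apply Hr2.
      destruct Hbs as [_ [bU _]]. specialize (bU z t Hz ltac:(lra)).
      destruct (Rle_lt_or_eq_dec _ _ (proj1 Hr)) as [|H0]; auto. rewrite <- H0 in Hlt. lra.
    - intros z t Hz Hs Ht' Hlt. rewrite HTv in Hlt. destruct (HLr z t Hs ltac:(lra)) as [Hr Hr2]. apply Hr2.
      destruct Hbs as [_ [_ bV]]. specialize (bV z t Hz ltac:(lra)).
      destruct (Rle_lt_or_eq_dec _ _ (proj1 Hr)) as [|H0]; auto. rewrite <- H0 in Hlt. lra.
    - intros z t Hz Hs Ht' Hpos. rewrite HSv in *. unfold S. rewrite lap_mul, HLl, HLg.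
      2:{ simpl. rewrite (pr_flat _ _ _ _ _ _ _ _ Hpr). ring. }
      rewrite lap_sub, lap_scal, lap_q by auto. cbn [jmul jt]. rewrite HLt, !jw_sub, jt_sub.
      cbn [jt jw jscal jq]. rewrite (pr_static _ _ _ _ _ _ _ _ Hpr), (pr_val _ _ _ _ _ _ _ _ Hpr).
      pose proof (pr_eq _ _ _ _ _ _ _ _ Hpr z t Hz) as Heq.
      assert (Hs' : strip x0 w z) by (unfold ostrip, strip in *; lra).
      destruct (HLr z t Hs' ltac:(lra)) as [Hr _]. destruct (HkQ z (or_introl Hz)) as [Hk Hk2].
      specialize (HhQ z (or_introl Hz)).
      set (q := rad 1 N z) in *. set (s := h q) in *. set (L := jw LT z t) in *.
      assert (HL : 0 < L) by (destruct (Rle_lt_or_eq_dec _ _ (proj1 Hr)) as [|H0]; auto; rewrite <- H0 in Hpos; lra).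
      specialize (Hgap s L HhQ ltac:(lra)).
      assert (Hqs : 0 <= e * q / s) by (apply Rdiv_le_0_compat; lra).
      assert (Hqs1 : 1 - e * q / s = (s - e * q) / s) by (field; lra).
      assert (Hqs2 : 0 < (s - e * q) / s) by (apply Rdiv_lt_0_compat; lra).
      pose proof (reac_scale m Hm (1 - e * q / s) (L * s) ltac:(lra) ltac:(apply Rmult_le_pos; lra)) as Hu.
      replace ((1 - e * q / s) * (L * s)) with (L * (s - e * q)) in Hu by (field; lra).
      pose proof (reac_le_slope m Hm (L * s) ltac:(apply Rmult_le_pos; lra)) as Hsl.
      assert (Hsl2 : e * q / s * reac m (L * s) <= L * (e * q * slope m)).
      { replace (L * (e * q * slope m)) with (e * q / s * (slope m * (L * s))) by (field; lra).
        now apply Rmult_le_compat_l. }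
      assert (Hsl3 : e * q * slope m <= e * Rq * slope m) by (apply Rmult_le_compat_r; lra).
      assert (Hcd : (c + difD m * (om * om)) * (s - e * q) <= s2 / 2).
      { apply Rle_trans with (s2 / 2 * 1); [|lra]. apply Rmult_le_compat; try lra.
        assert (0 <= difD m * (om * om)) by (apply Rmult_le_pos; [lra|apply Rmult_le_pos; lra]). lra. }
      assert (Hfin : 0 <= L * (s2 - e * q * slope m - (c + difD m * (om * om)) * (s - e * q) - e * (2 * n1 * difD m))).
      { apply Rmult_le_pos; lra. }
      match goal with |- ?A <= _ => replace A with
        (L * ((c + difD m * (om * om)) * (s - e * q)) + L * (- difD m * mlap m H z t) + L * (e * (2 * n1 * difD m))) by ring end.
      rewrite Heq. lra.
    - intros z t Hz Hs Ht' Hpos. apply Rle_trans with (exnu m * jw T z t).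
      2:{ apply Rmult_le_compat_l; [lra|apply Rmax_r]. }
      rewrite HSv, HTv in *. unfold S. rewrite dn_mul, HLd, dn_sub, dn_scal, dn_q by auto.
      pose proof (pr_bd _ _ _ _ _ _ _ _ Hpr z t Hz) as Hb1.
      assert (Hs' : strip x0 w z) by (unfold ostrip, strip in *; lra).
      destruct (HLr z t Hs' ltac:(lra)) as [Hr _].
      destruct Hz as [_ Hz]. rewrite Hz in *. rewrite (pr_psi_R _ _ _ _ _ _ _ _ Hpr). fold X in Hpos |- *.
      set (L := jw LT z t) in *.
      pose proof (kap_gap_low eps ltac:(lra)) as Hg1.
      set (ke := exmu m * theta / (theta + exnu m * (1 - eps))) in *.
      assert (Hkb : exmu m * X - exnu m * (b * (1 - eps)) = ke * X) by (unfold ke, b; field; lra).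
      assert (Hke : 0 < ke) by (unfold ke; apply Rdiv_lt_0_compat; auto; now apply Rmult_lt_0_compat).
      assert (ke * X <= ke * hR) by (apply Rmult_le_compat_l; lra).
      assert (ke * hR <= (kap + exmu m * eps) * hR) by (apply Rmult_le_compat_r; lra).
      assert (exmu m * eps * hR <= exmu m * eps) by (apply mult_le_1; [apply Rmult_le_pos; lra|lra]).
      assert (0 <= L * (exnu m * (b * (1 - eps)) - exmu m * X - difD m * mdn m H z t + 2 * radR m * difD m * e)).
      { apply Rmult_le_pos; lra. }
      match goal with |- ?A <= _ => replace A with
        (L * (difD m * mdn m H z t - 2 * radR m * difD m * e + exmu m * X)) by ring end.
      lra.
    - intros z t Hz Hs Ht' Hpos. rewrite HTv in *. unfold T. rewrite lap_mul, HLl, HLg.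
      2:{ simpl. ring. }
      rewrite lap_scal, lap_sub, lap_const. cbn [jmul jt jscal jw]. rewrite HLt, !jw_sub, jt_sub.
      cbn [jt jw jconst]. replace (jt Jpsi z t) with 0 by (simpl; ring). change (jw Jpsi z t) with (psi (rad 1 N z)).
      pose proof (jpsi_lap m Hm _ _ _ _ _ _ _ Hpr z t Hz) as Hlp.
      assert (Hs' : strip x0 w z) by (unfold ostrip, strip in *; lra).
      destruct (HLr z t Hs' ltac:(lra)) as [Hr _]. specialize (HpQ z (or_introl Hz)).
      set (p := psi (rad 1 N z)) in *. set (L := jw LT z t) in *.
      assert (HL : 0 < L) by (destruct (Rle_lt_or_eq_dec _ _ (proj1 Hr)) as [|H0]; auto; rewrite <- H0 in Hpos; lra).
      assert (Hpe : 0 < p - eps).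
      { apply Rnot_le_lt. intros Hn. assert (0 <= L * (b * (eps - p))); [|lra].
        apply Rmult_le_pos; [lra|apply Rmult_le_pos; lra]. }
      assert ((c + difd m * (om * om)) * (p - eps) <= decay m * eps).
      { apply Rle_trans with (decay m * eps * 1); [|lra]. apply Rmult_le_compat; try lra.
        assert (0 <= difd m * (om * om)) by (apply Rmult_le_pos; [lra|apply Rmult_le_pos; lra]). lra. }
      assert (0 <= L * (b * (decay m * eps - (c + difd m * (om * om)) * (p - eps)))).
      { apply Rmult_le_pos; [lra|apply Rmult_le_pos; lra]. }
      match goal with |- ?A <= _ => replace A with
        (L * (b * ((c + difd m * (om * om)) * (p - eps))) - L * (b * (difd m * mlap m Jpsi z t))) by ring end.
      rewrite Hlp. lra.
    - intros z t Hz Hs Ht' Hpos. apply Rle_trans with (exmu m * jw S z t).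
      2:{ apply Rmult_le_compat_l; [lra|apply Rmax_r]. }
      rewrite HSv, HTv in *. unfold T. rewrite dn_mul, HLd, dn_scal, dn_sub, dn_const.
      pose proof (jpsi_dn m Hm _ _ _ _ _ _ _ Hpr z t Hz) as Hb1.
      destruct Hz as [_ Hz]. rewrite Hz in *. rewrite (pr_psi_R _ _ _ _ _ _ _ _ Hpr). fold X.
      set (L := jw LT z t) in *.
      match goal with |- ?A <= _ => replace A with
        (L * (b * (- difd m * mdn m Jpsi z t + exnu m * (1 - eps)))) by ring end.
      rewrite Hb1, Hbd. lra.
    - split; intros z Hz Hs.
      + specialize (C1 z t1 Hz Hs ltac:(lra)). rewrite HSv, HLv, Rmult_assoc in C1. exact C1.
      + specialize (C2 z t1 Hz Hs ltac:(lra)). rewrite HTv, HLv, Rmult_assoc in C2. exact C2. }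
  exists w, T7. split; auto. split; auto. intros M delta Hdel.
  set (c7 := exmu m * delta / (theta + exnu m)).
  assert (Hc7 : 0 < c7) by (apply Rdiv_lt_0_compat; [now apply Rmult_lt_0_compat|lra]).
  (* [delta] keeps the barrier below the solution inside, and [c7 / b] below the exterior bound
     produced by [exterior_lift]. *)
  set (lam0 := Rmin lam1 (Rmin delta (c7 / b))).
  assert (Hc7b : 0 < c7 / b) by (apply Rdiv_lt_0_compat; lra).
  assert (Hlam0 : 0 < lam0) by (repeat apply Rmin_glb_lt; lra).
  assert (Hlam01 : lam0 <= lam1) by apply Rmin_l.
  assert (Hlam02 : lam0 <= delta) by (eapply Rle_trans; [apply Rmin_r|apply Rmin_l]).
  assert (Hlam03 : lam0 * b <= c7).
  { replace c7 with (c7 / b * b) by (field; lra). apply Rmult_le_compat_r; [lra|].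
    eapply Rle_trans; [apply Rmin_r|apply Rmin_r]. }
  (* The time needed to climb from [lam0] to [lam1] at rate [c0]. *)
  set (T8 := ln (lam1 / lam0) / c0).
  assert (Hr1 : 1 <= lam1 / lam0).
  { apply Rmult_le_reg_r with lam0; auto. replace (lam1 / lam0 * lam0) with lam1 by (field; lra). lra. }
  assert (HT8 : 0 <= T8).
  { apply Rdiv_le_0_compat; [|auto]. destruct (Rle_lt_or_eq_dec _ _ Hr1) as [Hl|Hl].
    - rewrite <- ln_1. apply Rlt_le, ln_increasing; lra.
    - rewrite <- Hl, ln_1. lra. }
  assert (Hexp : lam0 * exp (c0 * T8) = lam1).
  { unfold T8. replace (c0 * (ln (lam1 / lam0) / c0)) with (ln (lam1 / lam0)) by (field; lra).
    rewrite exp_ln by lra. field. lra. }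
  exists (T7 + T8). split; [lra|]. intros U V t0 x0 Hbs Ht0 HU t Ht.
  destruct (Hrun U V M c0 lam0 (t0 + T7) (t0 + T7 + T8) x0 Hbs) as [R1 R2]; try lra.
  - replace (t0 + T7 + T8 - (t0 + T7)) with T8 by ring. lra.
  - intros z Hz Hs. specialize (HU z (t0 + T7) Hz Hs ltac:(lra)). specialize (HhQ z Hz).
    destruct (jcos_range om x0 z 0 Hom Hs) as [Hc _].
    destruct (rad_in m z Hz) as [Hr0 Hr2].
    assert (e * rad 1 N z <= e * Rq) by (apply Rmult_le_compat_l; lra).
    assert (0 <= e * rad 1 N z) by (apply Rmult_le_pos; lra).
    apply Rle_trans with (lam0 * (1 * 1)); [|lra]. apply Rmult_le_compat_l; [lra|]. apply Rmult_le_compat; lra.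
  - intros z Hz Hs.
    assert (HUb : forall z t, mBd m z -> strip x0 w z -> t0 <= t <= t0 + T7 -> delta <= jw U z t).
    { intros z' t' Hz' Hs' Ht'. apply HU; auto. now right. }
    specialize (Hlift U V M t0 x0 delta Hbs Ht0 Hdel HUb z Hz Hs). fold c7 in Hlift.
    destruct (jcos_range om x0 z 0 Hom Hs) as [Hc _].
    set (C := jw (jcos om x0) z 0) in *. set (p := psi (rad 1 N z)) in *.
    destruct (Rle_lt_dec (p - eps) 0) as [Hn|Hp].
    + destruct Hbs as [_ [_ bV]]. specialize (bV z (t0 + T7) Hz ltac:(lra)).
      assert (0 <= lam0 * (C * (b * (eps - p)))); [|lra].
      apply Rmult_le_pos; [lra|]. apply Rmult_le_pos; [lra|]. apply Rmult_le_pos; lra.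
    + apply Rle_trans with (2 := Hlift).
      replace (lam0 * (C * (b * (p - eps)))) with (lam0 * b * (C * (p - eps))) by ring.
      apply Rmult_le_compat_r; [apply Rmult_le_pos; lra|lra].
  - replace (t0 + T7 + T8 - (t0 + T7)) with T8 in R1, R2 by ring. rewrite Hexp in R1, R2.
    assert (H1 : lam1 * exp (0 * (t - (t0 + T7 + T8))) = lam1) by (rewrite Rmult_0_l, exp_0; ring).
    (* Afterwards the barrier is kept stationary, which covers all later times. *)
    destruct (Hrun U V M 0 lam1 (t0 + T7 + T8) t x0 Hbs) as [R3 R4]; auto; try lra.
    rewrite H1 in R3, R4.
    assert (Hx0 : forall z, z 0%nat = x0 -> strip x0 w z /\ jw (jcos om x0) z 0 = 1).
    { intros z Hz. unfold strip. cbn [jw jcos jcomp jcoord]. rewrite Hz, Rminus_diag, Rabs_R0, Rmult_0_r, cos_0. lra. }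
    split; intros z Hz Hx; destruct (Hx0 z Hx) as [Hs Hc1].
    + specialize (R3 z Hz Hs). rewrite Hc1 in R3. specialize (HhQ z Hz). destruct (rad_in m z Hz) as [Hr0 Hr2].
      assert (e * rad 1 N z <= e * Rq) by (apply Rmult_le_compat_l; lra).
      assert (0 <= e * rad 1 N z) by (apply Rmult_le_pos; lra).
      apply Rle_trans with (2 := R3). unfold lam1.
      assert (d1 * (h (rad 1 N z) - e * rad 1 N z) <= d1 * 1) by (apply Rmult_le_compat_l; lra). lra.
    + specialize (R4 z Hz Hs). rewrite Hc1 in R4. specialize (HpQ z Hz).
      replace (exmu m * hR / (theta + exnu m)) with (wt * hR) by (unfold wt; field; lra).
      set (p := psi (rad 1 N z)) in *.
      assert (Hwh : wt * hR <= wt * 1) by (apply Rmult_le_compat_l; lra).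
      assert (Hwh0 : 0 < wt * hR) by (apply Rmult_lt_0_compat; lra).
      destruct (Rle_lt_dec (p - eps) 0) as [Hn|Hp].
      * destruct Hbs as [_ [_ bV]]. specialize (bV z t Hz ltac:(lra)).
        assert (wt * hR * p <= wt * eps) by (apply Rmult_le_compat; lra). lra.
      * apply Rle_trans with (2 := R4). unfold lam1.
        assert (G1 : (1 - d1) * (wt * X * (p - eps)) <= (1 - d1) * (1 * (b * (p - eps)))).
        { apply Rmult_le_compat_l; [lra|]. rewrite Rmult_1_l. apply Rmult_le_compat_r; lra. }
        assert (G2 : d1 * (wt * X * (p - eps)) <= d1 * wt).
        { apply Rmult_le_compat_l; [lra|]. rewrite <- (Rmult_1_r wt) at 2. rewrite Rmult_assoc.
          apply Rmult_le_compat_l; [lra|]. apply Rle_trans with (1 * 1); [apply Rmult_le_compat; lra|lra]. }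
        assert (G3 : wt * X * (p - eps) = wt * hR * p - wt * (e * Rq) * (p - eps) - wt * hR * eps) by (unfold X; ring).
        assert (G4 : wt * (e * Rq) * (p - eps) <= wt * (e * Rq)) by (apply mult_le_1; lra).
        assert (G5 : wt * hR * eps <= wt * eps) by (apply Rmult_le_compat_r; lra).
        lra.
Qed.
End Lower.

(** * Propagation of positivity *)

(** Two regimes for [exp(be p) - 1], where [A - p] is the squared distance to the centre. For
    [p <= r2 / 2] the gradient term [4 (A - p)] beats the expansion and dimension terms. For larger
    [p] the exponential [E] is at least 2, so [E <= 2 (E - 1)] and the damping [2 be (c + 2 nn D)]
    absorbs them. *)
Lemma ball_barrier_ineq D L c nn r2 be A p : 0 < D -> 0 <= L -> 0 <= c -> 0 <= nn -> 0 < r2 -> 0 < be ->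
  c + 2 * nn * D <= 2 * D * be * r2 -> 2 <= be * r2 -> r2 <= A -> 0 < p <= A ->
  - (L + 2 * be * (c + 2 * nn * D)) * (exp (be * p) - 1) + be * exp (be * p) * c -
    D * (be * be * exp (be * p) * (4 * (A - p)) + be * exp (be * p) * (- (2 * nn))) <=
  - L * (exp (be * p) - 1).
Proof.
  intros HD HL Hc Hn Hr2 Hbe H1 H2 HA Hp.
  pose proof (exp_ineq1_le (be * p)) as He. set (E := exp (be * p)) in *.
  assert (Hbp : 0 < be * p) by nra.
  set (k := c + 2 * nn * D) in *. assert (Hk : 0 <= k) by (unfold k; assert (0 <= nn * D) by nra; lra).
  assert (Hgoal : be * E * (k - 4 * D * be * (A - p)) <= 2 * be * k * (E - 1)).
  { assert (HDb : 0 < D * be) by nra. destruct (Rle_lt_dec p (r2 / 2)).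
    - assert (H3 : 2 * D * be * r2 <= 4 * D * be * (A - p)).
      { replace (2 * D * be * r2) with (4 * D * be * (r2 / 2)) by field.
        apply Rmult_le_compat_l; lra. }
      assert (0 <= 2 * be * k * (E - 1)) by (apply Rmult_le_pos; [apply Rmult_le_pos|]; lra).
      assert (0 <= be * E * (4 * D * be * (A - p) - k)) by (apply Rmult_le_pos; [apply Rmult_le_pos|]; lra).
      lra.
    - assert (be * (r2 / 2) <= be * p) by (apply Rmult_le_compat_l; lra).
      assert (HE : E <= 2 * (E - 1)) by lra.
      assert (0 <= 4 * D * be * (A - p)) by (apply Rmult_le_pos; lra).
      apply Rle_trans with (be * E * k); [apply Rmult_le_compat_l; [apply Rmult_le_pos|]; lra|].
      replace (be * E * k) with (be * k * E) by ring. replace (2 * be * k * (E - 1)) with (be * k * (2 * (E - 1))) by ring.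
      apply Rmult_le_compat_l; [apply Rmult_le_pos|]; lra. }
  match goal with |- ?X <= ?Y => assert (Y - X = 2 * be * k * (E - 1) - be * E * (k - 4 * D * be * (A - p))) by (unfold k; ring) end.
  lra.
Qed.

Definition jball N z0 A c t0 : jet := jsub (jtime (fun t => A + c * (t - t0)) (fun _ => c)) (jdist2 N z0).
(** A bump, positive exactly inside a ball of squared radius [A + c (t - t0)], which expands while
    the amplitude is damped at rate [K]. *)
Definition jbar N z0 A c t0 K be k : jet :=
  jmul (jtime (fun t => k * exp (- K * (t - t0))) (fun t => - K * (k * exp (- K * (t - t0)))))
    (jcomp (fun p => exp (be * p) - 1) (fun p => be * exp (be * p)) (fun p => be * be * exp (be * p))
       (jball N z0 A c t0)).

Lemma jball_creg n O B T0 z0 A c t0 : creg n O B T0 (jball n z0 A c t0).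
Proof.
  apply creg_jsub; [|apply creg_dist2]. apply creg_time. intros.
  apply is_derive_Reals. auto_derive; auto; ring.
Qed.

Lemma jbar_creg n O B T0 z0 A c t0 K be k : creg n O B T0 (jbar n z0 A c t0 K be k).
Proof.
  apply creg_mul.
  - apply creg_time. intros. apply is_derive_Reals. auto_derive; auto. unfold Rminus. ring.
  - apply creg_comp; [apply jball_creg|]. intros.
    split; apply is_derive_Reals; auto_derive; auto; ring.
Qed.

Lemma jball_val n z0 A c t0 z t : jw (jball n z0 A c t0) z t = A + c * (t - t0) - jw (jdist2 n z0) z t.
Proof. unfold jball. rewrite jw_sub. reflexivity. Qed.

Lemma jball_lap n z0 A c t0 z t : jlap n (jball n z0 A c t0) z t = - (2 * INR n).
Proof. unfold jball. rewrite lap_sub, lap_time, lap_dist2. ring. Qed.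

Lemma jball_gg n z0 A c t0 z t : gg n (jball n z0 A c t0) (jball n z0 A c t0) z t = 4 * jw (jdist2 n z0) z t.
Proof.
  rewrite <- gg_dist2. unfold gg. apply sumk_ext. intros. simpl. ring.
Qed.

Lemma jball_dn n Rd z0 A c t0 z t : jdn n Rd (jball n z0 A c t0) z t = - jdn n Rd (jdist2 n z0) z t.
Proof. unfold jball. rewrite dn_sub, dn_time. ring. Qed.

Lemma jdist2_nonneg n z0 z t : 0 <= jw (jdist2 n z0) z t.
Proof. apply sumk_nonneg. intros. apply pow2_ge_0. Qed.

Lemma jbar_val n z0 A c t0 K be k z t : jw (jbar n z0 A c t0 K be k) z t =
  k * exp (- K * (t - t0)) * (exp (be * jw (jball n z0 A c t0) z t) - 1).
Proof. reflexivity. Qed.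

Lemma jbar_pos n z0 A c t0 K be k z t : 0 < k -> 0 < be -> 0 < jw (jbar n z0 A c t0 K be k) z t ->
  0 < jw (jball n z0 A c t0) z t.
Proof.
  intros Hk Hb H. rewrite jbar_val in H. apply Rnot_le_lt. intros Hn.
  assert (Hf : 0 < k * exp (- K * (t - t0))) by (apply Rmult_lt_0_compat; [auto|apply exp_pos]).
  assert (exp (be * jw (jball n z0 A c t0) z t) <= 1); [|nra].
  rewrite <- exp_0. destruct (Req_dec (be * jw (jball n z0 A c t0) z t) 0) as [-> |]; [lra|].
  apply Rlt_le, exp_increasing. nra.
Qed.

Lemma jbar_pde n D L z0 A c t0 be k z t : 0 < D -> 0 <= L -> 0 <= c -> 0 < A -> 0 < be -> 0 < k -> t0 <= t ->
  c + 2 * INR n * D <= 2 * D * be * A -> 2 <= be * A ->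
  let J := jbar n z0 A c t0 (L + 2 * be * (c + 2 * INR n * D)) be k in
  0 < jw J z t -> jt J z t - D * jlap n J z t <= - L * jw J z t.
Proof.
  intros HD HL Hc HA Hbe Hk Ht H1 H2 J Hpos.
  set (K := L + 2 * be * (c + 2 * INR n * D)) in *.
  pose proof (jbar_pos _ _ _ _ _ _ _ _ _ _ Hk Hbe Hpos) as Hp.
  unfold J, jbar. rewrite lap_mul, lap_time, gg_time, lap_comp, jball_gg, jball_lap.
  set (P := jw (jball n z0 A c t0) z t) in *.
  pose proof (jball_val n z0 A c t0 z t) as HPv. fold P in HPv.
  pose proof (jdist2_nonneg n z0 z t) as Hd2. set (d2 := jw (jdist2 n z0) z t) in *.
  assert (Hct : 0 <= c * (t - t0)) by (apply Rmult_le_pos; lra).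
  pose proof (ball_barrier_ineq D L c (INR n) A be (A + c * (t - t0)) P HD HL Hc (pos_INR n) HA Hbe H1 H2
    ltac:(lra) ltac:(lra)) as HI. fold K in HI.
  cbn [jt jmul jtime jcomp jw]. fold P.
  replace (jt (jball n z0 A c t0) z t) with c by (simpl; ring).
  set (f := k * exp (- K * (t - t0))). assert (Hf : 0 < f) by (apply Rmult_lt_0_compat; [auto|apply exp_pos]).
  replace (A + c * (t - t0) - P) with d2 in HI by lra.
  set (E := exp (be * P)) in *.
  match type of HI with ?X <= ?Y => assert (HI2 : f * X <= f * Y) by (apply Rmult_le_compat_l; lra) end.
  match goal with |- ?X <= ?Y => match type of HI2 with ?X' <= ?Y' =>
    replace X with X' by ring; replace Y with Y' by ring end end.
  exact HI2.
Qed.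

Lemma jbar_dn n Rd z0 A c t0 K be k z t : 0 < Rd -> (1 <= n)%nat -> Bd n Rd z ->
  jdn n Rd (jbar n z0 A c t0 K be k) z t =
  - (k * exp (- K * (t - t0)) * (be * exp (be * jw (jball n z0 A c t0) z t)) *
     ((Rd ^ 2 - rad 1 n z0 + (jw (jdist2 n z0) z t - (z 0%nat - z0 0%nat) ^ 2)) / Rd)).
Proof.
  intros HR Hn HB. unfold jbar. rewrite dn_mul, dn_time, dn_comp, jball_dn, dn_dist2 by auto. cbn [jw jtime]. ring.
Qed.

Lemma jdist2_split n z0 z t : (1 <= n)%nat ->
  (z 0%nat - z0 0%nat) ^ 2 <= jw (jdist2 n z0) z t <= (z 0%nat - z0 0%nat) ^ 2 + 2 * (rad 1 n z + rad 1 n z0).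
Proof.
  intros Hn. cbn [jw jdist2]. destruct n; [lia|]. rewrite sumk_shift. split.
  - assert (0 <= sumk n (fun k => (z (S k) - z0 (S k)) ^ 2)) by (apply sumk_nonneg; intros; apply pow2_ge_0). lra.
  - unfold rad. rewrite !sumk_shift. cbn [Nat.ltb Nat.leb]. rewrite !Rplus_0_l, <- sumk_plus, <- sumk_scal.
    apply Rplus_le_compat_l, sumk_le. intros. assert (0 <= (z (S k) + z0 (S k)) ^ 2) by apply pow2_ge_0. lra.
Qed.

Lemma near_of_dist2 n z0 z t r : 0 < r -> jw (jdist2 n z0) z t <= (r / 2) ^ 2 ->
  forall j, (j < n)%nat -> Rabs (z j - z0 j) < r.
Proof.
  intros Hr Hd j Hj. assert (H : (z j - z0 j) ^ 2 <= (r / 2) ^ 2).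
  { apply Rle_trans with (2 := Hd). apply (sumk_term n (fun k => (z k - z0 k) ^ 2)); auto. intros; apply pow2_ge_0. }
  assert (Rabs (z j - z0 j) <= r / 2); [|lra]. rewrite <- pow2_abs in H.
  apply Rsqr_incr_0_var; [|lra]. unfold Rsqr. lra.
Qed.

Section Positivity.
Context (m : model) (Hm : model_ok m).
Local Notation N := (dimN m).
Local Notation Rq := (radR m ^ 2).

(** The bump [jbar] expands until it covers all cross-sections within [Lw] of the centre. As the
    centre is strictly inside, the outward derivative of the bump is negative on the boundary, and
    for large [be] this outweighs the loss with coefficient [exmu]; of the exterior phase only
    nonnegativity is used. *)
Lemma positivity_spreads M eta q0 r2 Lw T : 0 < eta -> q0 < Rq -> 0 < r2 -> 0 <= Lw -> 0 <= T ->
  exists delta, 0 < delta /\ forall U V t0 z0, bsol m M U V -> 0 <= t0 -> rad 1 N z0 <= q0 ->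
    (forall z, inO m z -> jw (jdist2 N z0) z 0 <= r2 -> eta <= jw U z t0) ->
    forall z t, inO m z -> Rabs (z 0%nat - z0 0%nat) <= Lw -> t0 + 1 <= t <= t0 + 1 + T -> delta <= jw U z t.
Proof.
  intros Heta Hq0 Hr2 HLw HT.
  pose proof Hm as [HN2 [HD [Hd [HR [Hmu [Hnu [Hrho _]]]]]]]. assert (HN : (1 <= N)%nat) by lia.
  (* From time [t0 + 1] on the squared radius exceeds by at least 1 the largest squared distance in
     question, [Lw^2 + 4 R^2]. *)
  set (c := Lw ^ 2 + 4 * Rq + 1).
  assert (Hc : 1 <= c) by (unfold c; pose proof (pow2_ge_0 Lw); pose proof (pow2_ge_0 (radR m)); lra).
  pose proof (pos_INR N) as HNr.
  set (kk := c + 2 * INR N * difD m).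
  assert (Hkk : 0 < kk) by (unfold kk; assert (0 <= INR N * difD m) by (apply Rmult_le_pos; lra); lra).
  (* [b1] and [b2] serve the differential inequality of the bump, [b3] the boundary condition. *)
  set (b1 := kk / (2 * difD m * r2)). set (b2 := 2 / r2).
  set (b3 := exmu m * radR m / (difD m * (Rq - q0))).
  assert (Hb1 : 0 < b1) by (apply Rdiv_lt_0_compat; auto; repeat apply Rmult_lt_0_compat; lra).
  assert (Hb2 : 0 < b2) by (apply Rdiv_lt_0_compat; lra).
  assert (Hb3 : 0 < b3) by (apply Rdiv_lt_0_compat; apply Rmult_lt_0_compat; lra).
  set (be := b1 + b2 + b3). assert (Hbe : 0 < be) by (unfold be; lra).
  assert (E1 : kk <= 2 * difD m * be * r2).
  { replace kk with (2 * difD m * b1 * r2) by (unfold b1; field; lra).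
    apply Rmult_le_compat_r; [lra|]. apply Rmult_le_compat_l; [lra|]. unfold be. lra. }
  assert (E2 : 2 <= be * r2).
  { replace 2 with (b2 * r2) by (unfold b2; field; lra). apply Rmult_le_compat_r; [lra|]. unfold be. lra. }
  assert (E3 : exmu m <= difD m * be * ((Rq - q0) / radR m)).
  { replace (exmu m) with (difD m * b3 * ((Rq - q0) / radR m)) by (unfold b3; field; lra).
    apply Rmult_le_compat_r; [apply Rlt_le, Rdiv_lt_0_compat; lra|]. apply Rmult_le_compat_l; [lra|]. unfold be. lra. }
  (* Normalized so that the initial bump is at most [eta]. *)
  set (k := eta * exp (- (be * r2))).
  assert (Hk : 0 < k) by (apply Rmult_lt_0_compat; [auto|apply exp_pos]).
  set (Bm := k * exp (be * (r2 + c * (1 + T)))).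
  assert (HBm : 0 < Bm) by (apply Rmult_lt_0_compat; [auto|apply exp_pos]).
  destruct (reac_lip_lower m Hm Bm) as [L [HL HLip]].
  set (K := L + 2 * be * kk).
  assert (HK : 0 <= K) by (unfold K; assert (0 <= be * kk) by (apply Rmult_le_pos; lra); lra).
  exists (k * exp (- K * (1 + T)) * be). split.
  { apply Rmult_lt_0_compat; auto. apply Rmult_lt_0_compat; [auto|apply exp_pos]. }
  intros U V t0 z0 Hbs Ht0 Hz0 Hinit z1 t1 Hz1 Hx1 Ht1.
  set (J := jbar N z0 r2 c t0 K be k).
  assert (HJb : forall z t, t0 <= t <= t0 + 1 + T -> jw J z t <= Bm).
  { intros z t Ht. unfold J. rewrite jbar_val, jball_val.
    pose proof (jdist2_nonneg N z0 z t). set (d2 := jw (jdist2 N z0) z t) in *.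
    unfold Bm. rewrite Rmult_assoc. apply Rmult_le_compat_l; [lra|].
    assert (Ha : exp (- K * (t - t0)) <= 1).
    { rewrite <- exp_0. assert (0 <= K * (t - t0)) by (apply Rmult_le_pos; lra).
      destruct (Req_dec (- K * (t - t0)) 0) as [-> |]; [lra|]. apply Rlt_le, exp_increasing. lra. }
    pose proof (exp_pos (- K * (t - t0))).
    assert (Hb : exp (be * (r2 + c * (t - t0) - d2)) <= exp (be * (r2 + c * (1 + T)))).
    { assert (be * (r2 + c * (t - t0) - d2) <= be * (r2 + c * (1 + T))).
      { apply Rmult_le_compat_l; [lra|]. assert (c * (t - t0) <= c * (1 + T)) by (apply Rmult_le_compat_l; lra). lra. }
      destruct (Req_dec (be * (r2 + c * (t - t0) - d2)) (be * (r2 + c * (1 + T)))) as [-> |]; [lra|].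
      apply Rlt_le, exp_increasing. lra. }
    pose proof (exp_pos (be * (r2 + c * (t - t0) - d2))).
    apply Rle_trans with (exp (- K * (t - t0)) * exp (be * (r2 + c * (t - t0) - d2))).
    { apply Rmult_le_compat_l; lra. }
    rewrite <- (Rmult_1_l (exp (be * (r2 + c * (1 + T))))). apply Rmult_le_compat; lra. }
  destruct (sub_comparison m Hm M U V t0 (t0 + 1 + T) full full J (jconst (-1)) Bm) as [C _]; auto; try lra.
  - apply full_closed.
  - apply full_open.
  - apply jbar_creg.
  - apply creg_const.
  - simpl; intros; lra.
  - intros z Hz _. destruct Hbs as [_ [bU _]]. specialize (bU z t0 Hz Ht0).
    destruct (Rle_lt_dec (jw J z t0) 0) as [Hn|Hp]; [lra|].
    pose proof (jbar_pos _ _ _ _ _ _ _ _ _ _ Hk Hbe Hp) as Hp2. rewrite jball_val in Hp2.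
    rewrite Rminus_diag, Rmult_0_r, Rplus_0_r in Hp2.
    change (jw (jdist2 N z0) z t0) with (jw (jdist2 N z0) z 0) in Hp2.
    specialize (Hinit z Hz ltac:(lra)). apply Rle_trans with (2 := Hinit).
    unfold J. rewrite jbar_val, jball_val, Rminus_diag, !Rmult_0_r, exp_0, Rmult_1_r, Rplus_0_r.
    pose proof (jdist2_nonneg N z0 z t0). set (d2 := jw (jdist2 N z0) z t0) in *.
    assert (exp (be * (r2 - d2)) <= exp (be * r2)).
    { assert (be * (r2 - d2) <= be * r2) by (apply Rmult_le_compat_l; lra).
      destruct (Req_dec (be * (r2 - d2)) (be * r2)) as [-> |]; [lra|]. apply Rlt_le, exp_increasing. lra. }
    apply Rle_trans with (k * exp (be * r2)); [apply Rmult_le_compat_l; lra|].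
    unfold k. rewrite Rmult_assoc, <- exp_plus, Rplus_opp_l, exp_0. lra.
  - intros z Hz _. destruct Hbs as [_ [_ bV]]. specialize (bV z t0 Hz Ht0). simpl. lra.
  - intros z t Hz _ Ht Hpos.
    pose proof (jbar_pde N (difD m) L z0 r2 c t0 be k z t HD HL ltac:(lra) Hr2 Hbe Hk ltac:(lra) E1 E2 Hpos) as Hpde.
    fold kk in Hpde. fold K in Hpde. change (jbar N z0 r2 c t0 K be k) with J in Hpde.
    apply Rle_trans with (1 := Hpde). specialize (HJb z t ltac:(lra)).
    destruct (HLip 0 (jw J z t)) as [_ H1]; try lra. rewrite (reac_0 m Hm) in H1. lra.
  - intros z t Hz _ Ht Hpos. apply Rle_trans with 0.
    2:{ apply Rmult_le_pos; [lra|]. destruct Hbs as [_ [_ bV]].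
        specialize (bV z t (or_intror Hz) ltac:(lra)). apply Rle_trans with (2 := Rmax_l _ _). lra. }
    pose proof (jbar_pos _ _ _ _ _ _ _ _ _ _ Hk Hbe Hpos) as Hp.
    unfold J. rewrite jbar_dn by auto. rewrite jbar_val.
    set (P := jw (jball N z0 r2 c t0) z t) in *. set (f := k * exp (- K * (t - t0))).
    assert (Hf : 0 < f) by (apply Rmult_lt_0_compat; [auto|apply exp_pos]).
    destruct (jdist2_split N z0 z t HN) as [Hs _].
    set (X := Rq - rad 1 N z0 + (jw (jdist2 N z0) z t - (z 0%nat - z0 0%nat) ^ 2)).
    pose proof (exp_pos (be * P)) as HE. set (E := exp (be * P)) in *.
    assert (HX : (Rq - q0) / radR m <= X / radR m).
    { apply Rmult_le_compat_r; [apply Rlt_le, Rinv_0_lt_compat; lra|]. unfold X. lra. }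
    assert (difD m * be * ((Rq - q0) / radR m) <= difD m * be * (X / radR m)).
    { apply Rmult_le_compat_l; [apply Rmult_le_pos; lra|lra]. }
    assert (0 <= f * E * (difD m * be * (X / radR m) - exmu m)).
    { apply Rmult_le_pos; [apply Rmult_le_pos|]; lra. }
    assert (0 <= exmu m * f) by (apply Rmult_le_pos; lra).
    replace (difD m * - (f * (be * E) * (X / radR m)) + exmu m * (f * (E - 1))) with
      (- (f * E * (difD m * be * (X / radR m) - exmu m)) - exmu m * f) by ring. lra.
  - simpl; intros; lra.
  - simpl; intros; lra.
  - specialize (C z1 t1 Hz1 I ltac:(lra)). apply Rle_trans with (2 := C).
    unfold J. rewrite jbar_val, jball_val.
    destruct (jdist2_split N z0 z1 t1 HN) as [_ Hs]. apply clO_iff in Hz1. destruct Hz1 as [_ Hz1].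
    assert (Hx2 : (z1 0%nat - z0 0%nat) ^ 2 <= Lw ^ 2).
    { rewrite <- (pow2_abs (z1 0%nat - z0 0%nat)). apply pow_incr. split; [apply Rabs_pos|auto]. }
    assert (Hct : c * 1 <= c * (t1 - t0)) by (apply Rmult_le_compat_l; lra).
    set (P := r2 + c * (t1 - t0) - jw (jdist2 N z0) z1 t1).
    assert (HP : 1 <= P) by (unfold P, c in *; lra).
    rewrite !Rmult_assoc. apply Rmult_le_compat_l; [lra|]. apply Rmult_le_compat; try lra.
    + apply Rlt_le, exp_pos.
    + assert (K * (t1 - t0) <= K * (1 + T)) by (apply Rmult_le_compat_l; lra).
      destruct (Req_dec (- K * (1 + T)) (- K * (t1 - t0))) as [-> |]; [lra|]. apply Rlt_le, exp_increasing. lra.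
    + pose proof (exp_ineq1_le (be * P)). assert (be * 1 <= be * P) by (apply Rmult_le_compat_l; lra). lra.
Qed.

(* A quadratic barrier in the collar q0 <= |y|^2 <= R^2: a thin collar cannot carry values that are
   not already present on its inner side. *)
Lemma reach_interior M eta : 0 < M -> 0 < eta -> exists q0, 0 <= q0 < Rq /\ forall U V t0 z0, bsol m M U V -> 1 <= t0 ->
  inO m z0 -> eta <= jw U z0 t0 ->
  exists z1 t1, t0 - 1 <= t1 <= t0 /\ inO m z1 /\ rad 1 N z1 <= q0 /\ Rabs (z1 0%nat - z0 0%nat) <= 1 /\
    eta / 2 <= jw U z1 t1.
Proof.
  intros HM Heta.
  pose proof Hm as [HN2 [HD [Hd [HR [Hmu [Hnu [Hrho _]]]]]]]. assert (HN : (1 <= N)%nat) by lia.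
  assert (HR2 : 0 < Rq) by nra. pose proof (slope_pos m Hm) as Hgp.
  set (n1 := INR (N - 1)). assert (Hn1 : 1 <= n1) by (unfold n1; apply (le_INR 1); lia).
  (* For [q >= R^2 / 2] the concavity of the barrier contributes at least [4 R^2], while its
     first-order part takes away at most [4 n1 Qc = 2 R^2]. *)
  set (Qc := Rq / (2 * n1)). assert (HQc : 0 < Qc) by (apply Rdiv_lt_0_compat; lra).
  assert (HQn : 2 * n1 * Qc = Rq) by (unfold Qc; field; lra). clearbody Qc.
  (* [A1] pays for the sources inside the collar, [A2] for the inflow [exnu * M] through the
     boundary. *)
  set (A1 := (M + 2 * M * difD m + slope m * M) / (2 * Rq * difD m)).
  set (A2 := exnu m * M / (2 * radR m * difD m * Qc)).
  assert (HA1 : 0 <= A1).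
  { apply Rdiv_le_0_compat; [|repeat apply Rmult_lt_0_compat; lra].
    assert (0 <= M * difD m) by (apply Rmult_le_pos; lra). assert (0 <= slope m * M) by (apply Rmult_le_pos; lra). lra. }
  assert (HA2 : 0 <= A2).
  { apply Rdiv_le_0_compat; [apply Rmult_le_pos; lra|repeat apply Rmult_lt_0_compat; lra]. }
  set (A := A1 + A2). assert (HA : 0 <= A) by (unfold A; lra).
  assert (HA1e : M + 2 * M * difD m + slope m * M <= A * (2 * Rq * difD m)).
  { replace (M + 2 * M * difD m + slope m * M) with (A1 * (2 * Rq * difD m)) by (unfold A1; field; lra).
    apply Rmult_le_compat_r; [repeat apply Rmult_le_pos; lra|unfold A; lra]. }
  assert (HA2e : exnu m * M <= A * (2 * radR m * difD m * Qc)).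
  { replace (exnu m * M) with (A2 * (2 * radR m * difD m * Qc)) by (unfold A2; field; lra).
    apply Rmult_le_compat_r; [repeat apply Rmult_le_pos; lra|unfold A; lra]. }
  destruct (small_factor (1 + A * (2 * Qc)) (Rmin (Qc / 2) (Rmin (Rq / 2) (eta / 4)))) as [l [Hl Hl']].
  { assert (0 <= A * (2 * Qc)) by (apply Rmult_le_pos; lra). lra. }
  { repeat apply Rmin_glb_lt; lra. }
  assert (Hl3 : l * (1 + A * (2 * Qc)) <= Qc / 2 /\ l * (1 + A * (2 * Qc)) <= Rq / 2 /\ l * (1 + A * (2 * Qc)) <= eta / 4).
  { pose proof (Rmin_l (Qc / 2) (Rmin (Rq / 2) (eta / 4))). pose proof (Rmin_r (Qc / 2) (Rmin (Rq / 2) (eta / 4))).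
    pose proof (Rmin_l (Rq / 2) (eta / 4)). pose proof (Rmin_r (Rq / 2) (eta / 4)). lra. }
  assert (HlA : 0 <= l * (A * (2 * Qc))) by (apply Rmult_le_pos; [|apply Rmult_le_pos]; lra).
  set (q0 := Rq - l).
  exists q0. split; [unfold q0; lra|]. intros U V t0 z0 Hbs Ht0 Hz0 HU0.
  apply NNPP. intros Hno.
  assert (Hsmall : forall z t, t0 - 1 <= t <= t0 -> inO m z -> rad 1 N z <= q0 -> strip (z0 0%nat) 1 z -> jw U z t < eta / 2).
  { intros z t Ht Hz Hq Hs. apply Rnot_le_lt. intros Hn. apply Hno. exists z, t. auto. }
  set (x0 := z0 0%nat) in *.
  set (f := fun q => 2 * Qc * (q - q0) - (q - q0) ^ 2).
  (* The paraboloid [M ((x - x0)^2 + t0 - t)] lifts the barrier above [M] on the lateral faces and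
     at time [t0 - 1]; on the inner face [eta / 2] suffices by the assumption to be refuted. *)
  set (S := jadd (jconst (eta / 2)) (jadd (jscal A (jcomp f (fun q => 2 * Qc - 2 * (q - q0)) (fun _ => -2) (jq N)))
    (jscal M (jadd (jcomp (fun x => (x - x0) ^ 2) (fun x => 2 * (x - x0)) (fun _ => 2) (jcoord 0))
       (jtime (fun t => t0 - t) (fun _ => -1)))))).
  assert (HSv : forall z t, jw S z t = eta / 2 + (A * f (rad 1 N z) + M * ((z 0%nat - x0) ^ 2 + (t0 - t)))) by reflexivity.
  assert (HSc : forall O B T, creg N O B T S).
  { intros. apply creg_add; [apply creg_const|]. apply creg_add.
    - apply creg_scal, creg_comp; [apply creg_q|]. intros. unfold f.
      split; apply is_derive_Reals; auto_derive; auto; ring.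
    - apply creg_scal, creg_add.
      + apply creg_comp; [apply creg_coord; lia|]. intros; split; [apply derivable_sq|apply derivable_lin].
      + apply creg_time. intros. apply is_derive_Reals. auto_derive; auto; ring. }
  assert (Hf : forall q, q0 <= q <= Rq -> 0 <= f q <= 2 * Qc * l).
  { intros q Hq. unfold f. assert (0 <= q - q0 <= l) by (unfold q0 in *; lra). set (s := q - q0) in *.
    assert (0 <= s * (2 * Qc - s)) by (apply Rmult_le_pos; lra).
    assert (0 <= s ^ 2) by apply pow2_ge_0. assert (2 * Qc * s <= 2 * Qc * l) by (apply Rmult_le_compat_l; lra). lra. }
  set (W := fun z => strip x0 1 z /\ q0 <= rad 1 N z).
  set (Wo := fun z => ostrip x0 1 z /\ q0 < rad 1 N z).
  assert (HbU : forall z t, inO m z -> t0 - 1 <= t <= t0 -> 0 <= jw U z t <= M).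
  { intros. destruct Hbs as [_ [bU _]]. apply bU; auto; lra. }
  assert (HSb : forall z t, inO m z -> W z -> t0 - 1 <= t <= t0 -> eta / 2 + M * ((z 0%nat - x0) ^ 2 + (t0 - t)) <= jw S z t).
  { intros z t Hz [_ Hq] Ht. rewrite HSv. destruct (rad_in m z Hz) as [_ Hq2].
    destruct (Hf (rad 1 N z) ltac:(lra)) as [Hf0 _]. assert (0 <= A * f (rad 1 N z)) by (apply Rmult_le_pos; lra). lra. }
  destruct Hbs as [[cU [cV [rU [rV [eU [eV [eB _]]]]]]] [bU bV]].
  destruct (comparison N (difD m) (difd m) (radR m) (exmu m) (exnu m) 0 M (t0 - 1) t0 W Wo (jsub S U) (jconst 0)) as [C _]; auto; try lra.
  - intros z Hz Hc. split; auto. split.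
    + apply (strip_closed N x0 1 HN z Hz). intros eps He. destruct (Hc eps He) as [z' [[H1 [H2 _]] H3]]. exists z'; auto.
    + destruct (closed_nonneg N (fun z => - q0 + 1 * rad 1 N z)) with z; auto; [apply cont_on_affine_rad| |lra].
      intros eps He. destruct (Hc eps He) as [z' [[H1 [_ H2]] H3]]. exists z'. split; auto. split; auto. lra.
  - unfold W, Wo, strip, ostrip. intros z []; lra.
  - intros z Hz [H1 H2]. destruct (ostrip_open N x0 1 z HN H1) as [r [Hr Hr']].
    destruct (lt_near N (fun z => - q0 + 1 * rad 1 N z) z) as [r' [Hr1 Hr1']]; [apply cont_on_affine_rad|lra|].
    exists (Rmin r r'). split; [now apply Rmin_glb_lt|]. intros z' [Hp Hn]. split.
    + apply Hr'. split; auto. intros; eapply Rlt_le_trans; [now apply Hn|apply Rmin_l].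
    + assert (0 < - q0 + 1 * rad 1 N z'); [|lra]. apply Hr1'. split; auto.
      intros; eapply Rlt_le_trans; [now apply Hn|apply Rmin_r].
  - apply jsub_cont.
    + apply (creg_cont _ _ _ _ _ _ (HSc (mOm m) (mBd m) (t0 - 2))). intros z t [[Hz _] Ht']. split; auto; lra.
    + apply cont_on_subset with (1 := cU). intros z t [[Hz _] Ht']; split; auto; lra.
  - exact (cont_on_const N _ 0).
  - apply reg_jsub; [apply creg_reg, HSc|]. apply reg_sub with (1 := rU); try lra; intros z [Hz _]; auto.
  - apply creg_reg, creg_const.
  - intros z t Hz Hw Ht. rewrite jw_sub. specialize (HSb z t Hz Hw Ht). specialize (HbU z t Hz Ht).
    assert (0 <= M * ((z 0%nat - x0) ^ 2 + (t0 - t))).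
    { apply Rmult_le_pos; [lra|]. pose proof (pow2_ge_0 (z 0%nat - x0)). lra. } lra.
  - simpl; intros; lra.
  - intros z Hz Hw. rewrite jw_sub. specialize (HSb z (t0 - 1) Hz Hw ltac:(lra)). specialize (HbU z (t0 - 1) Hz ltac:(lra)).
    pose proof (pow2_ge_0 (z 0%nat - x0)).
    assert (M * 1 <= M * ((z 0%nat - x0) ^ 2 + (t0 - (t0 - 1)))) by (apply Rmult_le_compat_l; lra). lra.
  - simpl; intros; lra.
  - intros z t Hz Hw Ht Hneg. rewrite jw_sub in Hneg. specialize (HSb z t Hz Hw ltac:(lra)).
    specialize (HbU z t Hz ltac:(lra)). destruct Hw as [Hw1 Hw2].
    assert (Hpos : 0 <= M * ((z 0%nat - x0) ^ 2 + (t0 - t))).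
    { apply Rmult_le_pos; [lra|]. pose proof (pow2_ge_0 (z 0%nat - x0)). lra. }
    split.
    + unfold ostrip, strip in *. destruct (Rle_lt_or_eq_dec _ _ Hw1) as [|He]; auto. exfalso.
      rewrite <- (pow2_abs (z 0%nat - x0)), He in HSb.
      assert (M * 1 <= M * (1 ^ 2 + (t0 - t))) by (apply Rmult_le_compat_l; lra). lra.
    + destruct (Rle_lt_or_eq_dec _ _ Hw2) as [|He]; auto. exfalso.
      specialize (Hsmall z t ltac:(lra) Hz ltac:(lra) Hw1). lra.
  - simpl; intros; lra.
  - intros z t Hz [Hw1 Hw2] Ht Hneg. rewrite jt_sub, lap_sub, Rmult_0_l.
    specialize (eU z t Hz ltac:(lra)). specialize (HbU z t (or_introl Hz) ltac:(lra)).
    pose proof (reac_le_slope m Hm (jw U z t) ltac:(lra)) as Hg.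
    assert (slope m * jw U z t <= slope m * M) by (apply Rmult_le_compat_l; lra).
    unfold S. rewrite !lap_add, !lap_scal, !lap_comp, lap_const, lap_add, lap_comp, lap_time, gg_q, gg_coord, lap_coord, lap_q by lia.
    cbn [jt jadd jscal jcomp jconst jcoord jtime jq jw j1]. fold n1. cbn [Nat.eqb].
    assert (Hq : q0 <= rad 1 N z <= Rq) by (destruct (rad_in m z (or_introl Hz)); lra). set (q := rad 1 N z) in *.
    assert (Hkey : 2 * Rq <= - (-2 * (4 * q) + (2 * Qc - 2 * (q - q0)) * (2 * n1))).
    { assert (0 <= (q - q0) * n1) by (apply Rmult_le_pos; lra). unfold q0 in *. lra. }
    assert (HAk : A * difD m * (2 * Rq) <= A * difD m * - (-2 * (4 * q) + (2 * Qc - 2 * (q - q0)) * (2 * n1))).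
    { apply Rmult_le_compat_l; [apply Rmult_le_pos; lra|lra]. }
    match goal with |- 0 <= ?X => replace X with
      (- M - 2 * M * difD m + A * difD m * - (-2 * (4 * q) + (2 * Qc - 2 * (q - q0)) * (2 * n1))
        - (jt U z t - difD m * mlap m U z t)) by ring end.
    rewrite eU. lra.
  - intros z t Hz [Hw1 Hw2] Ht Hneg. change (jw (jconst 0) z t) with 0. rewrite Rmin_left, Rmult_0_r by lra.
    rewrite dn_sub, jw_sub. destruct (eB z t Hz ltac:(lra)) as [e1 _].
    assert (Hin : inO m z) by now right. assert (Hex : inE m z) by now right.
    specialize (bV z t Hex ltac:(lra)). assert (HWz : W z) by (unfold W, strip, ostrip in *; lra).
    specialize (HSb z t Hin HWz ltac:(lra)).
    assert (Hpos : 0 <= M * ((z 0%nat - x0) ^ 2 + (t0 - t))).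
    { apply Rmult_le_pos; [lra|]. pose proof (pow2_ge_0 (z 0%nat - x0)). lra. }
    unfold S at 1. rewrite !dn_add, !dn_scal, !dn_comp, dn_const, dn_add, dn_comp, dn_coord0, dn_time, dn_q by auto.
    cbn [jw jq]. destruct Hz as [_ Hz]. rewrite Hz.
    assert (HX : Qc <= 2 * Qc - 2 * (Rq - q0)) by (unfold q0; lra).
    assert (A * difD m * (2 * radR m) * Qc <= A * difD m * (2 * radR m) * (2 * Qc - 2 * (Rq - q0))).
    { apply Rmult_le_compat_l; [repeat apply Rmult_le_pos; lra|lra]. }
    assert (exnu m * jw V z t <= exnu m * M) by (apply Rmult_le_compat_l; lra).
    assert (0 <= exmu m * jw S z t) by (apply Rmult_le_pos; lra). lra.
  - simpl; intros; lra.
  - simpl; intros; lra.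
  - destruct (Rle_lt_dec (rad 1 N z0) q0) as [Hq|Hq].
    + apply Hno. exists z0, t0. repeat split; auto; try lra. unfold x0. rewrite Rminus_diag, Rabs_R0. lra.
    + assert (HWz : W z0). { split; [|lra]. unfold strip, x0. rewrite Rminus_diag, Rabs_R0. lra. }
      specialize (C z0 t0 Hz0 HWz ltac:(lra)). rewrite jw_sub, HSv in C.
      destruct (rad_in m z0 Hz0) as [_ Hq2]. destruct (Hf (rad 1 N z0) ltac:(lra)) as [_ Hf2].
      assert (A * f (rad 1 N z0) <= A * (2 * Qc * l)) by (apply Rmult_le_compat_l; lra).
      unfold x0 in C. rewrite !Rminus_diag in C. lra.
Qed.
End Positivity.

(** * Interior modulus of continuity by reflection, and the Harnack-type bound *)

Definition refl k c (z : nat -> R) : nat -> R := setc z k (2 * c - z k).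
Definition rsg (k j : nat) : R := if Nat.eqb j k then -1 else 1.
Definition jrefl k c (J : jet) : jet :=
  mkjet (fun z t => jw J (refl k c z) t) (fun z t => jt J (refl k c z) t)
    (fun j z t => rsg k j * j1 J j (refl k c z) t) (fun j z t => j2 J j (refl k c z) t).

Lemma refl_at k c z : refl k c z k = 2 * c - z k.
Proof. apply setc_at. Qed.
Lemma refl_other k c z j : j <> k -> refl k c z j = z j.
Proof. apply setc_other. Qed.

Lemma refl_setc k c z j s : refl k c (setc z j s) =
  setc (refl k c z) j (if Nat.eqb j k then 2 * c - s else s).
Proof.
  apply functional_extensionality. intros i. unfold refl, setc.
  destruct (Nat.eqb_spec i k), (Nat.eqb_spec i j), (Nat.eqb_spec j k), (Nat.eqb_spec k j); subst; auto; try lia; try lra.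
Qed.

Lemma refl_dist N k c z z' : dist N (refl k c z) (refl k c z') = dist N z z'.
Proof.
  unfold dist. f_equal. apply sumk_ext. intros j _. unfold refl, setc.
  destruct (Nat.eqb_spec j k); auto. subst. ring.
Qed.

Lemma refl_dist2 N k (c z : nat -> R) t : jw (jdist2 N c) (refl k (c k) z) t = jw (jdist2 N c) z t.
Proof.
  apply sumk_ext. intros j _. unfold refl, setc. destruct (Nat.eqb_spec j k); auto. subst. ring.
Qed.

Lemma djet_refl n k c J z t : djet n J (refl k c z) t -> djet n (jrefl k c J) z t.
Proof.
  intros [H1 H2]. split; [exact H1|].
  intros j Hj. destruct (H2 j Hj) as [H3 H4]. cbn [jw j1 j2 jrefl]. unfold rsg.
  destruct (Nat.eqb_spec j k) as [->|Hjk].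
  - rewrite refl_at in H3, H4.
    replace (2 * c - z k) with (-1 * z k + 2 * c) in H3, H4 by ring. split.
    + eapply derivable_pt_lim_ext; [|exact (derivable_affine _ (-1) (2 * c) (z k) _ H3)].
      intros r. cbv beta. rewrite refl_setc, Nat.eqb_refl. do 2 f_equal. ring.
    + replace (j2 J k (refl k c z) t) with (-1 * (-1 * j2 J k (refl k c z) t)) by ring.
      apply (derivable_pt_lim_scal (fun r => j1 J k (refl k c (setc z k r)) t)).
      eapply derivable_pt_lim_ext; [|exact (derivable_affine _ (-1) (2 * c) (z k) _ H4)].
      intros r. cbv beta. rewrite refl_setc, Nat.eqb_refl. do 2 f_equal. ring.
  - rewrite refl_other in H3, H4 by auto.
    assert (Hx : forall r, refl k c (setc z j r) = setc (refl k c z) j r).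
    { intros r. rewrite refl_setc. destruct (Nat.eqb_spec j k); [lia|auto]. }
    split.
    + rewrite Rmult_1_l. eapply derivable_pt_lim_ext; [|exact H3]. intros r. cbv beta. now rewrite Hx.
    + eapply derivable_pt_lim_ext; [|exact H4]. intros r. cbv beta. rewrite Hx. ring.
Qed.

Lemma cont_on_refl N k c (S S' : (nat -> R) -> R -> Prop) F : cont_on N S F ->
  (forall z t, S' z t -> S (refl k c z) t) -> cont_on N S' (fun z t => F (refl k c z) t).
Proof.
  intros Hc HS z t Hz eps He. destruct (Hc _ _ (HS z t Hz) eps He) as [del [Hd H]].
  exists del. split; auto. intros z' t' Hz' Hdz Hdt. apply H; auto. now rewrite refl_dist.
Qed.

Section Harnack.
Context (m : model) (Hm : model_ok m).
Local Notation N := (dimN m).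
Local Notation Rq := (radR m ^ 2).

(* [U] minus its reflection across z_k = c_k vanishes on the hyperplane, so a concave barrier bounds it linearly. *)
Lemma reflection_bound M r : 0 < M -> 0 < r -> exists C, 0 < C /\ forall U V t1 (c : nat -> R) k sg zeta,
  bsol m M U V -> 1 <= t1 -> (k < N)%nat -> pt N c ->
  (forall z, pt N z -> jw (jdist2 N c) z 0 <= r ^ 2 -> mOm m z) -> sg = 1 \/ sg = -1 -> 0 <= zeta <= r ->
  sg * (jw U (setc c k (c k + zeta)) t1 - jw U (setc c k (c k - zeta)) t1) <= C * zeta.
Proof.
  intros HM Hr.
  pose proof Hm as [HN2 [HD [Hd [HR [Hmu [Hnu [Hrho _]]]]]]]. assert (HN : (1 <= N)%nat) by lia.
  destruct (reac_lipschitz m Hm M) as [L [HL HLip]].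
  pose proof (pos_INR N) as HNr.
  assert (Hr2 : 0 < r ^ 2) by nra.
  (* The paraboloid with factor [B] dominates the oscillation [M] both at time [t1 - 1] and on the
     sphere of radius [r]. *)
  set (B := M + M / r ^ 2). assert (HMr : 0 < M / r ^ 2) by (apply Rdiv_lt_0_compat; lra).
  assert (HB1 : M <= B) by (unfold B; lra).
  assert (HB2 : M <= B * r ^ 2).
  { replace M with (M / r ^ 2 * r ^ 2) at 1 by (field; lra). apply Rmult_le_compat_r; [lra|unfold B; lra]. }
  clearbody B.
  (* Concavity in the reflected coordinate pays for the paraboloid and for the difference of the two
     reactions, which is at most [L * M]. *)
  set (A := (B + 2 * INR N * difD m * B + L * M) / (2 * difD m)).
  assert (HA0 : 0 <= 2 * INR N * difD m * B) by (repeat apply Rmult_le_pos; lra).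
  assert (HLM : 0 <= L * M) by (apply Rmult_le_pos; lra).
  assert (HA : 0 <= A) by (apply Rdiv_le_0_compat; lra).
  assert (HAe : 2 * difD m * A = B + 2 * INR N * difD m * B + L * M) by (unfold A; field; lra).
  clearbody A.
  exists (A * (2 * r) + B * r). split; [assert (0 <= A * (2 * r)) by (apply Rmult_le_pos; lra); nra|].
  intros U V t1 c k sg zeta Hbs Ht1 Hk Hc Hball Hsg Hz.
  destruct Hbs as [[cU [cV [rU [rV [eU [eV [eB _]]]]]]] [bU bV]].
  set (ck := c k) in *.
  set (Rf := jrefl k ck U).
  set (S := jadd (jscal A (jcomp (fun x => (x - ck) * (2 * r - (x - ck))) (fun x => 2 * r - 2 * (x - ck)) (fun _ => -2) (jcoord k)))
     (jscal B (jadd (jdist2 N c) (jtime (fun t => t1 - t) (fun _ => -1))))).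
  assert (HSv : forall z t, jw S z t = A * ((z k - ck) * (2 * r - (z k - ck))) + B * (jw (jdist2 N c) z t + (t1 - t))) by reflexivity.
  assert (HSc : forall O B T, creg N O B T S).
  { intros. apply creg_add; apply creg_scal.
    - apply creg_comp; [now apply creg_coord|]. intros.
      split; apply is_derive_Reals; auto_derive; auto; ring.
    - apply creg_add; [apply creg_dist2|]. apply creg_time. intros. apply is_derive_Reals. auto_derive; auto; ring. }
  set (W := fun z => ck <= z k /\ jw (jdist2 N c) z 0 <= r ^ 2).
  set (Wo := fun z => ck < z k /\ jw (jdist2 N c) z 0 < r ^ 2).
  assert (HWball : forall z, pt N z -> W z -> mOm m z /\ mOm m (refl k ck z) /\ z k - ck <= r).
  { intros z Hp [H1 H2]. split; [now apply Hball|]. split.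
    - apply Hball; [now apply setc_pt|]. unfold ck. now rewrite refl_dist2.
    - assert ((z k - ck) ^ 2 <= r ^ 2).
      { apply Rle_trans with (2 := H2). apply (sumk_term N (fun j => (z j - c j) ^ 2)); auto. intros; apply pow2_ge_0. }
      nra. }
  assert (HWoW : forall z, Wo z -> W z) by (unfold W, Wo; intros z []; lra).
  assert (Hcd : forall S', cont_on N S' (fun z (_ : R) => jw (jdist2 N c) z 0)).
  { intros S'. destruct (creg_dist2 N (fun _ => True) (fun _ => True) (-1) c) as [_ [Hcd _]].
    intros z t Hs eps He. destruct (Hcd z 0 ltac:(split; [auto|lra]) eps He) as [del [Hdl H]].
    exists del. split; auto. intros z' t' _ Hd1 _. apply (H z' 0); auto; [split; [auto|lra]|].
    now rewrite Rminus_diag, Rabs_R0. }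
  assert (HbU : forall z t, mOm m z -> t1 - 1 <= t <= t1 -> 0 <= jw U z t <= M).
  { intros z t Hz1 Ht. apply bU; [now left|lra]. }
  assert (HSb : forall z t, pt N z -> W z -> t <= t1 -> 0 <= A * ((z k - ck) * (2 * r - (z k - ck))) /\
     B * (jw (jdist2 N c) z 0 + (t1 - t)) <= jw S z t).
  { intros z t Hp Hw Ht. destruct (HWball z Hp Hw) as [_ [_ H3]]. rewrite HSv.
    assert (0 <= A * ((z k - ck) * (2 * r - (z k - ck)))).
    { apply Rmult_le_pos; [lra|]. destruct Hw. apply Rmult_le_pos; lra. }
    change (jw (jdist2 N c) z t) with (jw (jdist2 N c) z 0). lra. }
  assert (HP : forall z t, jw (jsub S (jscal sg (jsub U Rf))) z t = jw S z t - sg * (jw U z t - jw U (refl k ck z) t)).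
  { intros. rewrite jw_sub. change (jw (jscal sg (jsub U Rf)) z t) with (sg * jw (jsub U Rf) z t). now rewrite jw_sub. }
  assert (Hosc : forall z t, pt N z -> W z -> t1 - 1 <= t <= t1 -> sg * (jw U z t - jw U (refl k ck z) t) <= M).
  { intros z t Hp Hw Ht. destruct (HWball z Hp Hw) as [H1 [H2 _]].
    pose proof (HbU z t H1 Ht). pose proof (HbU _ t H2 Ht). destruct Hsg; subst sg; lra. }
  assert (Hd2p : forall z, 0 <= jw (jdist2 N c) z 0) by (intros; apply jdist2_nonneg).
  destruct (comparison N (difD m) (difd m) (radR m) (exmu m) (exnu m) 0 M (t1 - 1) t1 W Wo
    (jsub S (jscal sg (jsub U Rf))) (jconst 0)) as [C _]; auto; try lra.
  - intros z Hp Hcl. split; auto. split.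
    + destruct (closed_nonneg N (fun z => - ck + z k)) with z; auto; [| |lra].
      * apply cont_on_plus; [apply cont_on_const|now apply cont_on_coord].
      * intros eps He. destruct (Hcl eps He) as [z' [[H1 [H2 _]] H3]]. exists z'. repeat split; auto; lra.
    + destruct (closed_nonneg N (fun z => r ^ 2 + (-1) * jw (jdist2 N c) z 0)) with z; auto; [| |lra].
      * apply cont_on_plus; [apply cont_on_const|apply cont_on_scal, Hcd].
      * intros eps He. destruct (Hcl eps He) as [z' [[H1 [_ H2]] H3]]. exists z'. repeat split; auto; lra.
  - intros z Hp [H1 H2]. destruct (lt_near N (fun z => - ck + z k) z) as [e1 [He1 H3]]; [|lra|].
    { apply cont_on_plus; [apply cont_on_const|now apply cont_on_coord]. }
    destruct (lt_near N (fun z => r ^ 2 + (-1) * jw (jdist2 N c) z 0) z) as [e2 [He2 H4]]; [|lra|].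
    { apply cont_on_plus; [apply cont_on_const|apply cont_on_scal, Hcd]. }
    exists (Rmin e1 e2). split; [now apply Rmin_glb_lt|]. intros z' [Hp' Hn]. split.
    + assert (0 < - ck + z' k); [|lra]. apply H3. split; auto. intros; eapply Rlt_le_trans; [now apply Hn|apply Rmin_l].
    + assert (0 < r ^ 2 + (-1) * jw (jdist2 N c) z' 0); [|lra].
      apply H4. split; auto. intros; eapply Rlt_le_trans; [now apply Hn|apply Rmin_r].
  - apply jsub_cont.
    + apply (creg_cont _ _ _ _ _ _ (HSc (mOm m) (mBd m) (t1 - 2))). intros z t [[Hz1 _] Ht']. split; auto; lra.
    + apply (cont_on_scal N _ sg (jw (jsub U Rf))). apply jsub_cont.
      * apply cont_on_subset with (1 := cU). intros z t [[Hz1 _] Ht']; split; auto; lra.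
      * apply (cont_on_refl N k ck _ _ (jw U) cU). intros z t [[Hz1 Hw] Ht'].
        destruct (HWball z (clO_pt _ _ _ Hz1) Hw) as [_ [H2 _]]. split; [now left|lra].
  - exact (cont_on_const N _ 0).
  - apply reg_jsub; [apply creg_reg, HSc|]. apply reg_scal, reg_jsub.
    + apply reg_sub with (1 := rU); try lra; intros z [Hz1 _]; auto.
    + split.
      * intros z t [Hz1 Hw] Ht. apply djet_refl. apply rU; [|lra].
        now apply HWball; [apply Hz1|apply HWoW].
      * intros j Hj. apply (cont_on_scal N _ (rsg k j)). destruct rU as [_ rU].
        apply (cont_on_refl N k ck _ _ (j1 U j) (rU j Hj)).
        intros z t [Hz1 Ht]. split; [left|lra].
        destruct Hz1 as [[Hz1 Hw]|[Hz1 Hw]]; apply HWball; auto; apply Hz1.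
  - apply creg_reg, creg_const.
  - intros z t Hz1 Hw Ht. rewrite HP. pose proof (clO_pt _ _ _ Hz1) as Hp.
    destruct (HSb z t Hp Hw ltac:(lra)) as [H1 H2]. specialize (Hosc z t Hp Hw Ht). specialize (Hd2p z).
    assert (0 <= B * (jw (jdist2 N c) z 0 + (t1 - t))) by (apply Rmult_le_pos; lra). lra.
  - simpl; intros; lra.
  - intros z Hz1 Hw. rewrite HP. pose proof (clO_pt _ _ _ Hz1) as Hp.
    destruct (HSb z (t1 - 1) Hp Hw ltac:(lra)) as [H1 H2]. specialize (Hosc z (t1 - 1) Hp Hw ltac:(lra)). specialize (Hd2p z).
    assert (B * 1 <= B * (jw (jdist2 N c) z 0 + (t1 - (t1 - 1)))) by (apply Rmult_le_compat_l; lra). lra.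
  - simpl; intros; lra.
  - intros z t Hz1 Hw Ht Hneg. rewrite HP in Hneg. pose proof (clO_pt _ _ _ Hz1) as Hp.
    destruct (HSb z t Hp Hw ltac:(lra)) as [H1 H2]. specialize (Hosc z t Hp Hw ltac:(lra)). specialize (Hd2p z).
    destruct Hw as [Hw1 Hw2]. split.
    + destruct (Rle_lt_or_eq_dec _ _ Hw1) as [|He]; auto. exfalso.
      assert (Hfix : refl k ck z = z).
      { unfold refl. replace (2 * ck - z k) with (z k) by lra. apply setc_same. }
      rewrite Hfix, Rminus_diag, Rmult_0_r in Hneg.
      assert (0 <= B * (jw (jdist2 N c) z 0 + (t1 - t))) by (apply Rmult_le_pos; lra). lra.
    + destruct (Rle_lt_or_eq_dec _ _ Hw2) as [|He]; auto. exfalso. rewrite He in H2.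
      assert (B * r ^ 2 <= B * (r ^ 2 + (t1 - t))) by (apply Rmult_le_compat_l; lra). lra.
  - simpl; intros; lra.
  - intros z t Hz1 Hw Ht Hneg. rewrite Rmult_0_l.
    destruct (HWball z (proj1 Hz1) (HWoW z Hw)) as [H1 [H2 _]].
    pose proof (eU z t H1 ltac:(lra)) as E1. pose proof (eU _ t H2 ltac:(lra)) as E2.
    pose proof (HbU z t H1 ltac:(lra)) as b1. pose proof (HbU _ t H2 ltac:(lra)) as b2.
    assert (Hg : Rabs (reac m (jw U z t) - reac m (jw U (refl k ck z) t)) <= L * M).
    { eapply Rle_trans; [apply HLip; lra|]. apply Rmult_le_compat_l; [lra|]. apply Rabs_le; lra. }
    apply Rabs_le_between in Hg.
    rewrite jt_sub, lap_sub, lap_scal, lap_sub.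
    change (jt (jscal sg (jsub U Rf)) z t) with (sg * jt (jsub U Rf) z t). rewrite jt_sub.
    change (jt Rf z t) with (jt U (refl k ck z) t). change (mlap m Rf z t) with (mlap m U (refl k ck z) t).
    unfold S. rewrite lap_add, !lap_scal, lap_comp, lap_add, lap_dist2, lap_time, lap_coord, gg_coord by auto.
    cbn [jt jadd jscal jcomp jcoord jdist2 jtime j1]. rewrite Nat.eqb_refl.
    match goal with |- 0 <= ?X => replace X with
      (2 * difD m * A - B - 2 * INR N * difD m * B -
        sg * ((jt U z t - difD m * mlap m U z t) - (jt U (refl k ck z) t - difD m * mlap m U (refl k ck z) t))) by ring end.
    rewrite E1, E2. destruct Hsg; subst sg; lra.
  - intros z t Hz1 Hw Ht Hneg. exfalso. destruct (HWball z (proj1 Hz1) (HWoW z Hw)) as [[_ H1] _].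
    destruct Hz1 as [_ Hz1]. lra.
  - simpl; intros; lra.
  - simpl; intros; lra.
  - set (z := setc c k (ck + zeta)). assert (Hzk : z k = ck + zeta) by apply setc_at.
    assert (Hd2 : jw (jdist2 N c) z 0 = zeta ^ 2).
    { cbn [jw jdist2]. rewrite <- (sumk_single N k (zeta ^ 2) Hk). apply sumk_ext. intros i Hi. unfold z, setc.
      destruct (Nat.eqb_spec i k); [subst; unfold ck; ring|ring]. }
    assert (Hp : pt N z) by now apply setc_pt.
    assert (Hw : W z). { split; [lra|]. rewrite Hd2. apply pow_incr; lra. }
    destruct (HWball z Hp Hw) as [H1 _].
    specialize (C z t1 (or_introl H1) Hw ltac:(lra)). rewrite HP, HSv in C.
    change (jw (jdist2 N c) z t1) with (jw (jdist2 N c) z 0) in C. rewrite Hd2, Hzk in C.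
    assert (Hre : refl k ck z = setc c k (ck - zeta)).
    { unfold refl, z. rewrite setc_at, setc_setc. f_equal. ring. }
    rewrite Hre in C. replace (ck + zeta - ck) with zeta in C by ring.
    assert (0 <= A * (zeta * zeta)) by (apply Rmult_le_pos; [|apply Rmult_le_pos]; lra).
    assert (B * (zeta * zeta) <= B * (r * zeta)).
    { apply Rmult_le_compat_l; [lra|]. apply Rmult_le_compat_r; lra. }
    lra.
Qed.

(** Young's inequality with parameter [tau], applied in each transversal coordinate. *)
Lemma rad_perturb n z0 z tau : 0 < tau ->
  rad 1 n z <= (1 + tau) * rad 1 n z0 + (1 + / tau) * sumk n (fun j => (z j - z0 j) ^ 2).
Proof.
  intros Ht. unfold rad. rewrite <- !sumk_scal, <- sumk_plus. apply sumk_le. intros j _.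
  assert (Hi : 0 < / tau) by now apply Rinv_0_lt_compat.
  set (a := z0 j). set (b := z j - a). destruct (Nat.ltb j 1).
  - assert (0 <= b ^ 2) by apply pow2_ge_0. nra.
  - replace (z j) with (a + b) by (unfold b; ring).
    assert (H : 0 <= (tau * a - b) ^ 2 * / tau) by (apply Rmult_le_pos; [apply pow2_ge_0|lra]).
    replace ((tau * a - b) ^ 2 * / tau) with (tau * a ^ 2 - 2 * a * b + / tau * b ^ 2) in H by (field; lra).
    lra.
Qed.

(** The points [z0] and [z] are joined one coordinate at a time. The ends of each edge are mirror
    images about its midpoint, so [reflection_bound] applies with half the edge length. The
    constants do not depend on the solution. *)
Lemma interior_modulus M q0 : 0 < M -> 0 <= q0 < Rq -> exists r C, 0 < r /\ 0 < C /\ forall U V t1 z0 z,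
  bsol m M U V -> 1 <= t1 -> pt N z0 -> rad 1 N z0 <= q0 -> pt N z ->
  (forall j, (j < N)%nat -> Rabs (z j - z0 j) <= r) ->
  jw U z0 t1 - C * sumk N (fun j => Rabs (z j - z0 j)) <= jw U z t1.
Proof.
  intros HM Hq0. pose proof Hm as [HN2 [HD [Hd [HR [Hmu [Hnu [Hrho _]]]]]]].
  assert (HRq : 0 < Rq) by nra. pose proof (pos_INR N) as HNr.
  (* This keeps [(1 + tau) * q0] below [Rq] by half of [Rq - q0]; the rest is reserved for the ball
     around the midpoint of an edge. *)
  set (tau := (Rq - q0) / (2 * Rq)). assert (Htau : 0 < tau) by (apply Rdiv_lt_0_compat; lra).
  assert (Htq : tau * q0 <= (Rq - q0) / 2).
  { replace ((Rq - q0) / 2) with (tau * Rq) by (unfold tau; field; lra). apply Rmult_le_compat_l; lra. }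
  assert (Hit : 0 < / tau) by now apply Rinv_0_lt_compat.
  destruct (small_factor ((1 + / tau) * (2 * (INR N + 1)) + 1) (Rmin 1 ((Rq - q0) / 4))) as [r [Hr Hr']].
  { assert (0 <= (1 + / tau) * (2 * (INR N + 1))) by (apply Rmult_le_pos; lra). lra. }
  { apply Rmin_glb_lt; lra. }
  pose proof (Rmin_l 1 ((Rq - q0) / 4)). pose proof (Rmin_r 1 ((Rq - q0) / 4)).
  set (kk := (1 + / tau) * (2 * (INR N + 1))) in *.
  assert (Hkk : 0 <= kk) by (apply Rmult_le_pos; lra).
  assert (Hr1 : r <= 1) by (assert (0 <= r * kk) by (apply Rmult_le_pos; lra); lra).
  assert (Hrk : kk * r ^ 2 < (Rq - q0) / 2).
  { assert (kk * r ^ 2 <= kk * r). { apply Rmult_le_compat_l; [lra|]. simpl. rewrite Rmult_1_r. apply mult_le_1; lra. } nra. }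
  destruct (reflection_bound M r HM Hr) as [C [HC Hbd]].
  exists r, C. split; auto. split; auto. intros U V t1 z0 z Hbs Ht1 Hp0 Hz0 Hp Hz.
  assert (Hmix : forall j, pt N (mix j z0 z)).
  { intros j i Hi. unfold mix. destruct (Nat.ltb i j); auto. }
  assert (Hstep : forall j, (j <= N)%nat -> jw U z0 t1 - C * sumk j (fun j => Rabs (z j - z0 j)) <= jw U (mix j z0 z) t1).
  { induction j; intros Hj.
    - replace (mix 0 z0 z) with z0 by reflexivity. simpl. lra.
    - specialize (IHj ltac:(lia)). cbn [sumk].
      assert (jw U (mix j z0 z) t1 - C * Rabs (z j - z0 j) <= jw U (mix (S j) z0 z) t1); [|lra].
      set (c := setc (mix j z0 z) j ((z0 j + z j) / 2)).
      assert (Hcp : pt N c) by (apply setc_pt; auto; lia).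
      assert (Hck : c j = (z0 j + z j) / 2) by apply setc_at.
      assert (Hball : forall z', pt N z' -> jw (jdist2 N c) z' 0 <= r ^ 2 -> mOm m z').
      { intros z' Hp' Hd'. split; auto. pose proof (rad_perturb N z0 z' tau Htau) as Hrp.
        assert (Hs : sumk N (fun j => (z' j - z0 j) ^ 2) <= 2 * (INR N + 1) * r ^ 2).
        { apply Rle_trans with (2 * jw (jdist2 N c) z' 0 + 2 * sumk N (fun _ => r ^ 2)).
          - cbn [jw jdist2]. rewrite <- !sumk_scal, <- sumk_plus. apply sumk_le. intros i Hi.
            assert (Hci : (c i - z0 i) ^ 2 <= r ^ 2).
            { rewrite <- (pow2_abs (c i - z0 i)). apply pow_incr. split; [apply Rabs_pos|].
              specialize (Hz i Hi). unfold c, setc, mix. destruct (Nat.eqb_spec i j).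
              - subst. replace ((z0 j + z j) / 2 - z0 j) with ((z j - z0 j) * / 2) by field.
                rewrite Rabs_mult, (Rabs_right (/ 2)) by lra. pose proof (Rabs_pos (z j - z0 j)). lra.
              - destruct (Nat.ltb i j); auto. rewrite Rminus_diag, Rabs_R0. lra. }
            assert (0 <= ((z' i - c i) - (c i - z0 i)) ^ 2) by apply pow2_ge_0. lra.
          - rewrite sumk_const. lra. }
        assert ((1 + / tau) * sumk N (fun j => (z' j - z0 j) ^ 2) <= (1 + / tau) * (2 * (INR N + 1) * r ^ 2))
          by (apply Rmult_le_compat_l; lra).
        assert ((1 + tau) * rad 1 N z0 <= (1 + tau) * q0) by (apply Rmult_le_compat_l; lra).
        replace ((1 + / tau) * (2 * (INR N + 1) * r ^ 2)) with (kk * r ^ 2) in H1 by (unfold kk; ring). lra. }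
      specialize (Hz j ltac:(lia)).
      set (zeta := Rabs (z j - z0 j) / 2).
      assert (Hzeta : 0 <= zeta <= r) by (unfold zeta; pose proof (Rabs_pos (z j - z0 j)); lra).
      assert (Hm0 : mix j z0 z = setc c j (z0 j)).
      { unfold c. rewrite setc_setc. replace (z0 j) with (mix j z0 z j). now rewrite setc_same.
        unfold mix. now rewrite Nat.ltb_irrefl. }
      assert (Hm1 : mix (S j) z0 z = setc c j (z j)).
      { unfold c. rewrite setc_setc. apply functional_extensionality. intros i. unfold mix, setc.
        destruct (Nat.eqb_spec i j), (Nat.ltb_spec i (S j)), (Nat.ltb_spec i j); subst; auto; lia. }
      rewrite Hm0, Hm1. unfold zeta in *. clear zeta.
      assert (HR0 : C * (Rabs (z j - z0 j) / 2) <= C * Rabs (z j - z0 j)).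
      { apply Rmult_le_compat_l; [lra|]. pose proof (Rabs_pos (z j - z0 j)). lra. }
      destruct (Rle_lt_dec 0 (z j - z0 j)) as [Hs|Hs].
      + pose proof (Hbd U V t1 c j (-1) _ Hbs Ht1 ltac:(lia) Hcp Hball (or_intror eq_refl) Hzeta) as Hb.
        rewrite Hck, (Rabs_right (z j - z0 j)) in Hb by lra. rewrite (Rabs_right (z j - z0 j)) in * by lra.
        replace ((z0 j + z j) / 2 + (z j - z0 j) / 2) with (z j) in Hb by field.
        replace ((z0 j + z j) / 2 - (z j - z0 j) / 2) with (z0 j) in Hb by field. lra.
      + pose proof (Hbd U V t1 c j 1 _ Hbs Ht1 ltac:(lia) Hcp Hball (or_introl eq_refl) Hzeta) as Hb.
        rewrite Hck, (Rabs_left (z j - z0 j)) in Hb by lra. rewrite (Rabs_left (z j - z0 j)) in * by lra.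
        replace ((z0 j + z j) / 2 + - (z j - z0 j) / 2) with (z0 j) in Hb by field.
        replace ((z0 j + z j) / 2 - - (z j - z0 j) / 2) with (z j) in Hb by field. lra. }
  assert (Hmz : mix N z0 z = z).
  { apply functional_extensionality. intros i. unfold mix. destruct (Nat.ltb_spec i N); auto. rewrite Hp, Hp0; auto. }
  specialize (Hstep N (le_n N)). now rewrite Hmz in Hstep.
Qed.

(** [reach_interior] steps back by at most 1 in time and 1 in x to a point away from the boundary,
    [interior_modulus] thickens that point to a ball, and [positivity_spreads] fills the window.
    Hence [Lw + 1] and [T + 1], and [2 <= t0] so that the earlier time is still at least 1. *)
Lemma harnack M eta Lw T : 0 < M -> 0 < eta -> 0 <= Lw -> 0 <= T -> exists delta, 0 < delta /\
  forall U V t0 z0, bsol m M U V -> 2 <= t0 -> inO m z0 -> eta <= jw U z0 t0 ->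
  forall z t, inO m z -> Rabs (z 0%nat - z0 0%nat) <= Lw -> t0 + 1 <= t <= t0 + 1 + T -> delta <= jw U z t.
Proof.
  intros HM Heta HLw HT.
  destruct (reach_interior m Hm M eta HM Heta) as [q0 [Hq0 Hreach]].
  destruct (interior_modulus M q0 HM Hq0) as [r [C [Hr [HC Hmod]]]].
  pose proof (pos_INR N) as HNr.
  destruct (small_factor (1 + C * INR N) (Rmin r (eta / 4))) as [s [Hs Hs']].
  { assert (0 <= C * INR N) by (apply Rmult_le_pos; lra). lra. }
  { apply Rmin_glb_lt; lra. }
  pose proof (Rmin_l r (eta / 4)). pose proof (Rmin_r r (eta / 4)).
  assert (Hsc : 0 <= s * (C * INR N)) by (apply Rmult_le_pos; [lra|apply Rmult_le_pos; lra]).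
  destruct (positivity_spreads m Hm M (eta / 4) q0 ((s / 2) ^ 2) (Lw + 1) (T + 1)) as [delta [Hdel Hsp]]; try lra.
  { nra. }
  exists delta. split; auto. intros U V t0 z0 Hbs Ht0 Hz0 HU z t Hz Hx Ht.
  destruct (Hreach U V t0 z0 Hbs ltac:(lra) Hz0 HU) as [z1 [t1 [Ht1 [Hz1 [Hq1 [Hx1 HU1]]]]]].
  apply (Hsp U V t1 z1); auto; try lra.
  - intros z' Hz' Hd'. pose proof (near_of_dist2 N z1 z' 0 s Hs Hd') as Hn.
    assert (Hmm : jw U z1 t1 - C * sumk N (fun j => Rabs (z' j - z1 j)) <= jw U z' t1).
    { apply (Hmod U V); auto; try lra; [eapply clO_pt; eauto|eapply clO_pt; eauto|].
      intros j Hj. specialize (Hn j Hj). lra. }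
    assert (sumk N (fun j => Rabs (z' j - z1 j)) <= INR N * s).
    { rewrite <- sumk_const. apply sumk_le. intros j Hj. specialize (Hn j Hj). lra. }
    assert (C * sumk N (fun j => Rabs (z' j - z1 j)) <= C * (INR N * s)) by (apply Rmult_le_compat_l; lra). lra.
  - replace (z 0%nat - z1 0%nat) with ((z 0%nat - z0 0%nat) + (z0 0%nat - z1 0%nat)) by ring.
    eapply Rle_trans; [apply Rabs_triang|]. rewrite (Rabs_minus_sym (z0 0%nat)). lra.
Qed.

(** Nothing uniform is claimed, so plain continuity provides the ball; its centre is first moved
    inward because [z0] may lie on the boundary. *)
Lemma positive_later M U V t0 z0 : bsol m M U V -> 0 <= t0 -> inO m z0 -> 0 < jw U z0 t0 ->
  0 < jw U z0 (t0 + 2).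
Proof.
  intros Hbs Ht0 Hz0 HU. pose proof Hm as [HN2 [HD [Hd [HR [Hmu [Hnu [Hrho _]]]]]]].
  assert (HRq : 0 < Rq) by nra.
  pose proof Hbs as [[cU _] _].
  destruct (cU z0 t0 (conj Hz0 Ht0) (jw U z0 t0 / 2)) as [del [Hdel Hc]]; [lra|].
  destruct (dist_close N del Hdel) as [r [Hr Hcl]].
  set (d := radial (-1) N z0).
  destruct (ray_near N d (r / 2) ltac:(lra)) as [h0 [Hh0 Hray]].
  set (hh := h0 / 2). set (z1 := fun i => z0 i + hh * d i).
  assert (Hp1 : pt N z1).
  { intros i Hi. unfold z1, d, radial. rewrite (clO_pt _ _ _ Hz0 i Hi).
    destruct (Nat.ltb i 1); [ring|]. destruct (Nat.ltb_spec i N); [lia|ring]. }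
  assert (Hr1 : rad 1 N z1 <= (1 - hh) ^ 2 * Rq).
  { apply Rle_trans with ((1 - hh) ^ 2 * rad 1 N z0).
    - apply rad_ray. intros i Hi. unfold z1, d, radial. destruct (Nat.ltb_spec i 1); [lia|].
      destruct (Nat.ltb_spec i N); [|lia]. right. ring.
    - apply Rmult_le_compat_l; [apply pow2_ge_0|]. now destruct (rad_in m z0 Hz0). }
  assert (Hlt : (1 - hh) ^ 2 * Rq < Rq).
  { assert ((1 - hh) ^ 2 < 1) by (unfold hh; nra). nra. }
  destruct (positivity_spreads m Hm M (jw U z0 t0 / 2) _ ((r / 2 / 2) ^ 2) 0 1 ltac:(lra) Hlt ltac:(nra) ltac:(lra) ltac:(lra))
    as [delta [Hdelta Hsp]].
  apply Rlt_le_trans with delta; auto. apply (Hsp U V t0 z1); auto; try lra.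
  - intros z Hz Hd2. assert (Hn : forall j, (j < N)%nat -> Rabs (z j - z0 j) < r).
    { intros j Hj. pose proof (near_of_dist2 N z1 z 0 (r / 2) ltac:(lra) Hd2 j Hj) as H1.
      specialize (Hray j hh Hj ltac:(unfold hh; lra)).
      replace (z j - z0 j) with ((z j - z1 j) + hh * d j) by (unfold z1; ring).
      eapply Rle_lt_trans; [apply Rabs_triang|]. lra. }
    specialize (Hc z t0 (conj Hz Ht0) (Hcl _ _ Hn)).
    rewrite Rminus_diag, Rabs_R0 in Hc. specialize (Hc Hdel). apply Rabs_lt_between in Hc. lra.
  - unfold z1, d, radial. simpl. replace (z0 0%nat - (z0 0%nat + hh * 0)) with 0 by ring. rewrite Rabs_R0. lra.
Qed.

(** The expanding ball has to meet the cylinder by time 1, yet its squared radius must stay below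
    [q1 - R^2] for the normal derivative of the bump to have the favourable sign. With
    [s = |y1| > R] the centre's distance from the axis, both are possible because
    [(s - R)^2 < s^2 - R^2]. *)
Lemma exterior_reaches_boundary M U V z0 : bsol m M U V -> inE m z0 -> 0 < jw V z0 0 ->
  exists zb, mBd m zb /\ 0 < jw V zb 1.
Proof.
  intros Hbs Hz0 HV. pose proof Hm as [HN2 [HD [Hd [HR [Hmu [Hnu [Hrho _]]]]]]].
  assert (HN : (1 <= N)%nat) by lia. assert (HRq : 0 < Rq) by nra.
  pose proof Hbs as [[_ [cV _]] [bU bV]].
  destruct (cV z0 0 (conj Hz0 (Rle_refl 0)) (jw V z0 0 / 2)) as [del [Hdel Hc]]; [lra|].
  destruct (dist_close N del Hdel) as [r [Hr Hcl]].
  set (d := radial 1 N z0).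
  destruct (ray_near N d (r / 2) ltac:(lra)) as [h0 [Hh0 Hray]].
  set (hh := h0 / 2). set (z1 := fun i => z0 i + hh * d i).
  assert (Hp0 : pt N z0) by (eapply clE_pt; eauto).
  assert (Hp1 : pt N z1).
  { intros i Hi. unfold z1, d, radial. rewrite (Hp0 i Hi).
    destruct (Nat.ltb i 1); [ring|]. destruct (Nat.ltb_spec i N); [lia|ring]. }
  assert (Hr1 : Rq < rad 1 N z1).
  { assert (H0 : rad 1 N z0 <= / (1 + hh) ^ 2 * rad 1 N z1).
    { apply rad_ray. intros i Hi. unfold z1, d, radial. destruct (Nat.ltb_spec i 1); [lia|].
      destruct (Nat.ltb_spec i N); [|lia]. right. field. unfold hh. lra. }
    apply clE_iff in Hz0. destruct Hz0 as [_ Hz0].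
    assert (H1 : 1 < (1 + hh) ^ 2) by (unfold hh; nra).
    assert (H2 : (1 + hh) ^ 2 * rad 1 N z0 <= rad 1 N z1).
    { replace (rad 1 N z1) with ((1 + hh) ^ 2 * (/ (1 + hh) ^ 2 * rad 1 N z1)) by (field; unfold hh; lra).
      apply Rmult_le_compat_l; lra. } nra. }
  set (q1 := rad 1 N z1) in *. set (s := sqrt q1).
  assert (Hs2 : s * s = q1) by (apply sqrt_sqrt; lra).
  assert (Hs : radR m < s).
  { apply Rnot_le_lt. intros Hn. assert (s * s <= radR m * radR m) by (apply Rmult_le_compat; try lra; apply sqrt_pos). lra. }
  set (gap := (q1 - Rq - (s - radR m) ^ 2) / 2).
  assert (Hgap : 0 < gap).
  { unfold gap. replace (q1 - Rq - (s - radR m) ^ 2) with (2 * radR m * (s - radR m)) by (rewrite <- Hs2; ring).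
    assert (0 < radR m * (s - radR m)) by (apply Rmult_lt_0_compat; lra). lra. }
  set (Am := q1 - Rq - gap).
  assert (HAm : (s - radR m) ^ 2 < Am) by (unfold Am, gap in *; lra).
  assert (HAm0 : 0 < Am) by (pose proof (pow2_ge_0 (s - radR m)); lra).
  set (A := Rmin ((r / 2 / 2) ^ 2) (Am / 2)).
  assert (HA : 0 < A) by (apply Rmin_glb_lt; [nra|lra]).
  assert (HA1 : A <= (r / 2 / 2) ^ 2) by apply Rmin_l. assert (HA2 : A <= Am / 2) by apply Rmin_r.
  set (c := Am - A). assert (Hc0 : 0 <= c) by (unfold c; lra).
  pose proof (pos_INR N) as HNr.
  set (kk := c + 2 * INR N * difd m).
  assert (Hkk : 0 <= kk) by (unfold kk; assert (0 <= INR N * difd m) by (apply Rmult_le_pos; lra); lra).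
  set (b1 := kk / (2 * difd m * A)). set (b2 := 2 / A). set (b3 := exnu m * radR m / (difd m * gap)).
  assert (Hb1 : 0 <= b1) by (apply Rdiv_le_0_compat; auto; repeat apply Rmult_lt_0_compat; lra).
  assert (Hb2 : 0 < b2) by (apply Rdiv_lt_0_compat; lra).
  assert (Hb3 : 0 < b3) by (apply Rdiv_lt_0_compat; apply Rmult_lt_0_compat; lra).
  set (be := b1 + b2 + b3). assert (Hbe : 0 < be) by (unfold be; lra).
  assert (E1 : kk <= 2 * difd m * be * A).
  { replace kk with (2 * difd m * b1 * A) by (unfold b1; field; lra).
    apply Rmult_le_compat_r; [lra|]. apply Rmult_le_compat_l; [lra|]. unfold be. lra. }
  assert (E2 : 2 <= be * A).
  { replace 2 with (b2 * A) by (unfold b2; field; lra). apply Rmult_le_compat_r; [lra|]. unfold be. lra. }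
  assert (E3 : exnu m <= difd m * be * (gap / radR m)).
  { replace (exnu m) with (difd m * b3 * (gap / radR m)) by (unfold b3; field; lra).
    apply Rmult_le_compat_r; [apply Rlt_le, Rdiv_lt_0_compat; lra|]. apply Rmult_le_compat_l; [lra|]. unfold be. lra. }
  set (eta := jw V z0 0 / 2). assert (Heta : 0 < eta) by (unfold eta; lra).
  set (k := eta * exp (- (be * A))).
  assert (Hk : 0 < k) by (apply Rmult_lt_0_compat; [auto|apply exp_pos]).
  set (K := decay m + 2 * be * kk).
  assert (HK : 0 <= K) by (unfold K; assert (0 <= be * kk) by (apply Rmult_le_pos; lra); lra).
  set (J := jbar N z1 A c 0 K be k).
  assert (HexpA : forall x y, x <= y -> exp x <= exp y).
  { intros x y Hxy. destruct (Req_dec x y) as [-> |]; [lra|]. apply Rlt_le, exp_increasing. lra. }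
  (* The boundary point nearest to the centre [z1]. *)
  set (zb := fun i => if Nat.ltb i 1 then z1 i else radR m / s * z1 i).
  assert (Hzb : mBd m zb).
  { split.
    - intros i Hi. unfold zb. rewrite (Hp1 i Hi). destruct (Nat.ltb i 1); ring.
    - unfold rad. transitivity ((radR m / s) ^ 2 * q1).
      + unfold q1, rad. rewrite <- sumk_scal. apply sumk_ext. intros i _. unfold zb. destruct (Nat.ltb i 1); ring.
      + rewrite <- Hs2. field. lra. }
  exists zb. split; auto.
  destruct (sub_comparison m Hm M U V 0 1 full full (jconst (-1)) J (k * exp (be * Am))) as [_ C]; auto; try lra.
  - apply full_closed.
  - apply full_open.
  - apply creg_const.
  - apply jbar_creg.
  - simpl; intros. assert (0 < k * exp (be * Am)) by (apply Rmult_lt_0_compat; [auto|apply exp_pos]). lra.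
  - intros z t Hz _ Ht. unfold J. rewrite jbar_val, jball_val.
    pose proof (jdist2_nonneg N z1 z t). set (d2 := jw (jdist2 N z1) z t) in *.
    rewrite Rmult_assoc. apply Rmult_le_compat_l; [lra|].
    assert (Ha : exp (- K * (t - 0)) <= exp 0).
    { apply HexpA. assert (0 <= K * (t - 0)) by (apply Rmult_le_pos; lra). lra. } rewrite exp_0 in Ha.
    pose proof (exp_pos (- K * (t - 0))).
    assert (Hb : exp (be * (A + c * (t - 0) - d2)) <= exp (be * Am)).
    { apply HexpA. apply Rmult_le_compat_l; [lra|]. assert (c * (t - 0) <= c * 1) by (apply Rmult_le_compat_l; lra). unfold c in *. lra. }
    pose proof (exp_pos (be * (A + c * (t - 0) - d2))).
    apply Rle_trans with (exp (- K * (t - 0)) * exp (be * (A + c * (t - 0) - d2))).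
    { apply Rmult_le_compat_l; lra. }
    rewrite <- (Rmult_1_l (exp (be * Am))). apply Rmult_le_compat; lra.
  - intros z Hz _. specialize (bU z 0 Hz ltac:(lra)). simpl. lra.
  - intros z Hz _. specialize (bV z 0 Hz ltac:(lra)).
    destruct (Rle_lt_dec (jw J z 0) 0) as [Hn|Hp]; [lra|].
    pose proof (jbar_pos _ _ _ _ _ _ _ _ _ _ Hk Hbe Hp) as Hp2. rewrite jball_val in Hp2.
    rewrite Rminus_diag, Rmult_0_r, Rplus_0_r in Hp2.
    assert (HVz : eta <= jw V z 0).
    { assert (Hn : forall j, (j < N)%nat -> Rabs (z j - z0 j) < r).
      { intros j Hj. pose proof (near_of_dist2 N z1 z 0 (r / 2) ltac:(lra) ltac:(lra) j Hj) as H1.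
        specialize (Hray j hh Hj ltac:(unfold hh; lra)).
        replace (z j - z0 j) with ((z j - z1 j) + hh * d j) by (unfold z1; ring).
        eapply Rle_lt_trans; [apply Rabs_triang|]. lra. }
      specialize (Hc z 0 (conj Hz (Rle_refl 0)) (Hcl _ _ Hn)).
      rewrite Rminus_diag, Rabs_R0 in Hc. specialize (Hc Hdel). apply Rabs_lt_between in Hc. unfold eta. lra. }
    apply Rle_trans with (2 := HVz).
    unfold J. rewrite jbar_val, jball_val, Rminus_diag, !Rmult_0_r, exp_0, Rmult_1_r, Rplus_0_r.
    pose proof (jdist2_nonneg N z1 z 0). set (d2 := jw (jdist2 N z1) z 0) in *.
    assert (exp (be * (A - d2)) <= exp (be * A)) by (apply HexpA, Rmult_le_compat_l; lra).
    apply Rle_trans with (k * exp (be * A)); [apply Rmult_le_compat_l; lra|].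
    unfold k. rewrite Rmult_assoc, <- exp_plus, Rplus_opp_l, exp_0. lra.
  - simpl; intros; lra.
  - simpl; intros; lra.
  - intros z t Hz _ Ht Hpos.
    pose proof (jbar_pde N (difd m) (decay m) z1 A c 0 be k z t Hd ltac:(lra) Hc0 HA Hbe Hk ltac:(lra) E1 E2 Hpos) as Hpde.
    exact Hpde.
  - intros z t Hz _ Ht Hpos. apply Rle_trans with 0.
    2:{ apply Rmult_le_pos; [lra|]. specialize (bU z t (or_intror Hz) ltac:(lra)).
        apply Rle_trans with (2 := Rmax_l _ _). lra. }
    pose proof (jbar_pos _ _ _ _ _ _ _ _ _ _ Hk Hbe Hpos) as Hp.
    unfold J. rewrite jbar_dn by auto. rewrite jbar_val.
    pose proof (jball_val N z1 A c 0 z t) as HPv.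
    set (P := jw (jball N z1 A c 0) z t) in *. set (f := k * exp (- K * (t - 0))).
    assert (Hf : 0 < f) by (apply Rmult_lt_0_compat; [auto|apply exp_pos]).
    assert (Hct : c * (t - 0) <= c * 1) by (apply Rmult_le_compat_l; lra).
    pose proof (pow2_ge_0 (z 0%nat - z1 0%nat)) as Hx2.
    set (X := Rq - q1 + (jw (jdist2 N z1) z t - (z 0%nat - z1 0%nat) ^ 2)).
    change (Rq - rad 1 N z1 + (jw (jdist2 N z1) z t - (z 0%nat - z1 0%nat) ^ 2)) with X.
    assert (HX : X <= - gap) by (unfold X, c, Am in *; lra).
    pose proof (exp_pos (be * P)) as HE. set (E := exp (be * P)) in *.
    assert (HXr : gap / radR m <= - X / radR m).
    { apply Rmult_le_compat_r; [apply Rlt_le, Rinv_0_lt_compat; lra|]. lra. }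
    assert (difd m * be * (gap / radR m) <= difd m * be * (- X / radR m)).
    { apply Rmult_le_compat_l; [apply Rmult_le_pos; lra|lra]. }
    assert (0 <= f * E * (difd m * be * (- X / radR m) - exnu m)).
    { apply Rmult_le_pos; [apply Rmult_le_pos|]; lra. }
    assert (0 <= exnu m * f) by (apply Rmult_le_pos; lra).
    replace (- difd m * - (f * (be * E) * (X / radR m)) + exnu m * (f * (E - 1))) with
      (- (f * E * (difd m * be * (- X / radR m) - exnu m)) - exnu m * f) by (field; lra). lra.
  - specialize (C zb 1 (or_intror Hzb) I ltac:(lra)). apply Rlt_le_trans with (2 := C).
    unfold J. rewrite jbar_val, jball_val. apply Rmult_lt_0_compat.
    + apply Rmult_lt_0_compat; [auto|apply exp_pos].
    + assert (Hd2 : jw (jdist2 N z1) zb 1 = (s - radR m) ^ 2).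
      { cbn [jw jdist2]. transitivity ((1 - radR m / s) ^ 2 * q1).
        - unfold q1, rad. rewrite <- sumk_scal. apply sumk_ext. intros i _. unfold zb. destruct (Nat.ltb i 1); ring.
        - rewrite <- Hs2. field. lra. }
      rewrite Hd2. set (P := A + c * (1 - 0) - (s - radR m) ^ 2).
      assert (0 < P) by (unfold P, c; lra).
      assert (exp 0 < exp (be * P)) by (apply exp_increasing; now apply Rmult_lt_0_compat). rewrite exp_0 in H0. lra.
Qed.

(** A zero of [U] on the boundary is a minimum, so the outward normal derivative is nonpositive
    there, whereas the exchange condition makes it a positive multiple of [V]. *)
Lemma boundary_transfer M U V zb t : bsol m M U V -> 0 < t -> mBd m zb -> 0 < jw V zb t -> 0 < jw U zb t.
Proof.
  intros Hbs Ht Hzb HV. pose proof Hm as [HN2 [HD [Hd [HR [Hmu [Hnu [Hrho _]]]]]]].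
  destruct Hbs as [[cU [cV [rU [rV [eU [eV [eB _]]]]]]] [bU bV]].
  pose proof (bU zb t (or_intror Hzb) ltac:(lra)) as Hb.
  destruct (Rle_lt_or_eq_dec _ _ (proj1 Hb)) as [|H0]; auto. exfalso.
  assert (Hdn : mdn m U zb t <= 0).
  { apply (boundary_touch_in N (radR m) full 0 U zb t 1); auto; try lra.
    - intros; exact I.
    - apply reg_sub with (1 := rU); try lra; intros z [Hz _]; auto.
    - apply cont_on_subset with (1 := cU). intros z t' [[[Hz _]|[Hz _]] ->]; split; try lra; [now left|now right].
    - intros z' Hz' _. rewrite <- H0. apply bU; [now left|lra]. }
  destruct (eB zb t Hzb Ht) as [e1 _]. rewrite <- H0 in e1.
  assert (0 < exnu m * jw V zb t) by (apply Rmult_lt_0_compat; lra). nra.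
Qed.

Lemma becomes_positive M U V : bsol m M U V ->
  (exists z, inO m z /\ jw U z 0 <> 0) \/ (exists z, inE m z /\ jw V z 0 <> 0) ->
  exists z t, 2 <= t /\ inO m z /\ 0 < jw U z t.
Proof.
  intros Hbs [[z [Hz Hn]]|[z [Hz Hn]]].
  - exists z, (0 + 2). split; [lra|]. split; auto. apply (positive_later M U V); auto; try lra.
    destruct Hbs as [_ [bU _]]. specialize (bU z 0 Hz ltac:(lra)). lra.
  - destruct (exterior_reaches_boundary M U V z Hbs Hz) as [zb [Hzb HV]].
    + destruct Hbs as [_ [_ bV]]. specialize (bV z 0 Hz ltac:(lra)). lra.
    + exists zb, (1 + 2). split; [lra|]. split; [now right|]. apply (positive_later M U V); auto; try lra; [now right|].
      apply (boundary_transfer M U V); auto; lra.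
Qed.
End Harnack.

(** * Invasion and spreading speed *)

Section FiniteSpeed.
Context (m : model) (Hm : model_ok m).
Local Notation N := (dimN m).

Definition jwave s c : jet := jcomp exp exp exp (jadd (jscal (- s) (jcoord 0)) (jtime (fun t => c * t) (fun _ => c))).

(** The waves [exp(- s x + c t)] have zero normal derivative, so amplitudes in the ratio
    [exnu / exmu] satisfy the exchange conditions exactly; the two directions together give
    [Rabs x]. Only finiteness of the speed matters, hence the crude value of [c]. *)
Lemma finite_speed M U V r : bsol m M U V -> 0 < M ->
  (forall z, inO m z -> r < Rabs (z 0%nat) -> jw U z 0 = 0) ->
  (forall z, inE m z -> r < Rabs (z 0%nat) -> jw V z 0 = 0) ->
  exists A c, 0 < A /\ 0 < c /\ forall z t, inO m z -> 0 <= t ->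
    jw U z t <= A * exp (- (Rabs (z 0%nat) - c * t)).
Proof.
  intros Hbs HM HU HV. pose proof Hm as [HN2 [HD [Hd [HR [Hmu [Hnu [Hrho _]]]]]]].
  assert (HN : (1 <= N)%nat) by lia. pose proof (slope_pos m Hm) as Hgp.
  pose proof Hbs as [Hs [bU bV]].
  assert (Hk : 0 < exnu m / exmu m) by (apply Rdiv_lt_0_compat; lra).
  assert (Hk2 : 0 < exmu m / exnu m) by (apply Rdiv_lt_0_compat; lra).
  set (A := M * exp r * (1 + exmu m / exnu m)).
  assert (HMr : 0 < M * exp r) by (apply Rmult_lt_0_compat; [auto|apply exp_pos]).
  assert (HA : M * exp r <= A) by (unfold A; nra).
  assert (HA2 : M * exp r <= exnu m / exmu m * A).
  { unfold A. replace (exnu m / exmu m * (M * exp r * (1 + exmu m / exnu m))) with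
      (M * exp r + exnu m / exmu m * (M * exp r)) by (field; lra). nra. }
  set (c := difD m + slope m + difd m).
  assert (Hmain : forall s, s = 1 \/ s = -1 -> forall z t, inO m z -> 0 <= t ->
    jw U z t <= exnu m / exmu m * A * exp (- s * z 0%nat + c * t)).
  { intros s Hs1 z1 t1 Hz1 Ht1.
    set (S := jscal (exnu m / exmu m * A) (jwave s c)). set (T := jscal A (jwave s c)).
    assert (Hc : forall O B T0, creg N O B T0 (jwave s c)).
    { intros. apply creg_comp.
      - apply creg_add; [apply creg_scal, creg_coord; lia|]. apply creg_time. intros.
        apply is_derive_Reals. auto_derive; auto; ring.
      - intros. split; apply derivable_pt_lim_exp. }
    assert (HSv : forall z t, jw S z t = exnu m / exmu m * A * exp (- s * z 0%nat + c * t)) by reflexivity.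
    assert (HTv : forall z t, jw T z t = A * exp (- s * z 0%nat + c * t)) by reflexivity.
    assert (Hlap : forall z t, mlap m (jwave s c) z t = jw (jwave s c) z t).
    { intros. unfold jwave. rewrite lap_comp, lap_add, lap_scal, lap_coord, lap_time.
      rewrite gg_add, gg_time, gg_scal, gg_coord by lia. simpl. destruct Hs1; subst; ring. }
    assert (Hdn : forall z t, mdn m (jwave s c) z t = 0).
    { intros. unfold jwave. rewrite dn_comp, dn_add, dn_scal, dn_coord0, dn_time. ring. }
    assert (Hjt : forall z t, jt (jwave s c) z t = c * jw (jwave s c) z t).
    { intros. simpl. ring. }
    assert (HE : forall z t, 0 < jw (jwave s c) z t) by (intros; apply exp_pos).
    assert (Hinit : forall z w, 0 <= w <= M -> (r < Rabs (z 0%nat) -> w = 0) -> w <= M * exp r * exp (- s * z 0%nat + c * 0)).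
    { intros z w Hw Hr. pose proof (exp_pos (- s * z 0%nat + c * 0)).
      destruct (Rle_lt_dec (Rabs (z 0%nat)) r) as [Hl|Hl]; [|rewrite Hr by auto; apply Rmult_le_pos; lra].
      rewrite Rmult_assoc, <- exp_plus. apply Rabs_le_between in Hl.
      pose proof (exp_ineq1_le (r + (- s * z 0%nat + c * 0))).
      assert (0 <= r + (- s * z 0%nat + c * 0)) by (destruct Hs1; subst s; lra). nra. }
    destruct (super_comparison m Hm U V 0 t1 S T) as [C _]; auto; try lra.
    - apply creg_scal, Hc.
    - apply creg_scal, Hc.
    - intros. rewrite HSv. pose proof (exp_pos (- s * z 0%nat + c * t)). apply Rmult_le_pos; [apply Rmult_le_pos; lra|lra].
    - intros. rewrite HTv. pose proof (exp_pos (- s * z 0%nat + c * t)). apply Rmult_le_pos; lra.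
    - intros z Hz. rewrite HSv. pose proof (exp_pos (- s * z 0%nat + c * 0)).
      apply Rle_trans with (M * exp r * exp (- s * z 0%nat + c * 0)); [|apply Rmult_le_compat_r; lra].
      apply Hinit; [apply bU; auto; lra|auto].
    - intros z Hz. rewrite HTv. pose proof (exp_pos (- s * z 0%nat + c * 0)).
      apply Rle_trans with (M * exp r * exp (- s * z 0%nat + c * 0)); [|apply Rmult_le_compat_r; lra].
      apply Hinit; [apply bV; auto; lra|auto].
    - intros z t Hz Ht. assert (HSp : 0 <= jw S z t).
      { apply Rmult_le_pos; [apply Rmult_le_pos; lra|apply Rlt_le, HE]. }
      pose proof (reac_le_slope m Hm (jw S z t) HSp) as Hg. unfold S at 3. rewrite lap_scal, Hlap.
      change (jt S z t) with (exnu m / exmu m * A * jt (jwave s c) z t). rewrite Hjt.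
      change (jw S z t) with (exnu m / exmu m * A * jw (jwave s c) z t) in *.
      set (X := exnu m / exmu m * A * jw (jwave s c) z t) in *.
      replace (exnu m / exmu m * A * (c * jw (jwave s c) z t) - difD m * X)
        with ((c - difD m) * X) by (unfold X; ring).
      assert (0 <= difd m * X) by (apply Rmult_le_pos; lra). unfold c. lra.
    - intros z t Hz Ht. unfold S at 1. rewrite dn_scal, Hdn, HSv, HTv. right. field. lra.
    - intros z t Hz Ht. unfold T at 3. rewrite lap_scal, Hlap.
      change (jt T z t) with (A * jt (jwave s c) z t). rewrite Hjt.
      change (jw T z t) with (A * jw (jwave s c) z t). specialize (HE z t).
      assert (0 < A * jw (jwave s c) z t) by (apply Rmult_lt_0_compat; lra).
      set (X := A * jw (jwave s c) z t) in *.
      replace (A * (c * jw (jwave s c) z t) - difd m * X) with ((c - difd m) * X) by (unfold X; ring).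
      unfold c. assert (0 <= (difD m + slope m) * X) by (apply Rmult_le_pos; lra).
      assert (0 <= decay m * X) by (apply Rmult_le_pos; lra). lra.
    - intros z t Hz Ht. unfold T at 1. rewrite dn_scal, Hdn, HSv, HTv. right. field. lra.
    - specialize (C z1 t1 Hz1 ltac:(lra)). now rewrite HSv in C. }
  exists (exnu m / exmu m * A), c. split; [apply Rmult_lt_0_compat; lra|]. split; [unfold c; lra|].
  intros z t Hz Ht. unfold Rabs. destruct Rcase_abs.
  - eapply Rle_trans; [apply (Hmain (-1) (or_intror eq_refl) z t Hz Ht)|]. right. do 2 f_equal. ring.
  - eapply Rle_trans; [apply (Hmain 1 (or_introl eq_refl) z t Hz Ht)|]. right. do 2 f_equal. ring.
Qed.

(** Three contributions, each worth at most [eps / 3]: the boundary values, the initial values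
    decaying in time, and the cost [cc] of a parabola that equals [M] on the lateral faces and
    vanishes at [x = x0]. *)
Lemma exterior_small M eps : 0 < M -> 0 < eps -> exists T L e', 0 < T /\ 0 < L /\ 0 < e' /\
  forall U V t0 x0, bsol m M U V -> 0 <= t0 ->
    (forall z t, mBd m z -> strip x0 L z -> t0 <= t <= t0 + T -> jw U z t <= e') ->
    forall z, inE m z -> z 0%nat = x0 -> jw V z (t0 + T) <= eps.
Proof.
  intros HM He. pose proof Hm as [HN2 [HD [Hd [HR [Hmu [Hnu [Hrho _]]]]]]].
  assert (HN : (1 <= N)%nat) by lia.
  set (e' := exnu m / exmu m * (eps / 3)).
  assert (He' : 0 < e') by (repeat apply Rmult_lt_0_compat; try apply Rinv_0_lt_compat; lra).
  assert (He'2 : exmu m / exnu m * e' = eps / 3) by (unfold e'; field; lra).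
  destruct (small_factor (2 * difd m * M / decay m) (eps / 3)) as [l [Hl Hl']]; [|lra|].
  { apply Rdiv_le_0_compat; [repeat apply Rmult_le_pos|]; lra. }
  set (l1 := Rmin l 1). assert (Hl1 : 0 < l1 <= 1) by (unfold l1; split; [apply Rmin_glb_lt; lra|apply Rmin_r]).
  assert (Hl1l : l1 <= l) by apply Rmin_l.
  set (L := / l1). assert (HL : 0 < L) by (apply Rinv_0_lt_compat; lra).
  assert (HLl : L * l1 = 1) by (unfold L; field; lra).
  (* Chosen so that [kx * L^2 = M]. *)
  set (kx := M * (l1 * l1)). assert (Hkx : 0 < kx) by (unfold kx; repeat apply Rmult_lt_0_compat; lra).
  set (cc := 2 * difd m * kx / decay m).
  assert (Hcc0 : decay m * cc = 2 * difd m * kx) by (unfold cc; field; lra).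
  assert (Hcc1 : 0 <= cc) by (apply Rdiv_le_0_compat; [repeat apply Rmult_le_pos|]; lra).
  assert (Hcc : cc <= eps / 3).
  { apply Rle_trans with (2 := Hl'). unfold cc, kx. replace (2 * difd m * (M * (l1 * l1)) / decay m) with
      (l1 * l1 * (2 * difd m * M / decay m)) by (field; lra).
    apply Rmult_le_compat_r; [apply Rdiv_le_0_compat; [repeat apply Rmult_le_pos|]; lra|nra]. }
  set (T := Rmax 1 (ln (3 * M / eps) / decay m)).
  assert (HT1 : 1 <= T) by apply Rmax_l.
  assert (HT : M * exp (- decay m * T) <= eps / 3).
  { assert (H3 : 0 < 3 * M / eps) by (apply Rdiv_lt_0_compat; lra).
    assert (Hge : ln (3 * M / eps) <= decay m * T).
    { replace (ln (3 * M / eps)) with (decay m * (ln (3 * M / eps) / decay m)) by (field; lra).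
      apply Rmult_le_compat_l; [lra|apply Rmax_r]. }
    assert (exp (- decay m * T) <= / (3 * M / eps)).
    { rewrite <- (exp_ln _ H3), <- exp_Ropp. destruct (Req_dec (- decay m * T) (- ln (3 * M / eps))) as [-> |]; [lra|].
      apply Rlt_le, exp_increasing. lra. }
    apply Rle_trans with (M * / (3 * M / eps)); [apply Rmult_le_compat_l; lra|]. right; field; lra. }
  exists T, L, e'. split; [lra|]. split; [auto|]. split; [auto|]. intros U V t0 x0 Hbs Ht0 HU z1 Hz1 Hx1.
  destruct Hbs as [[cU [cV [rU [rV [eU [eV [eB _]]]]]]] [bU bV]].
  set (S := jadd (jconst (eps / 3 + cc)) (jadd (jtime (fun t => M * exp (- decay m * (t - t0))) (fun t => - decay m * (M * exp (- decay m * (t - t0)))))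
     (jscal kx (jcomp (fun x => (x - x0) ^ 2) (fun x => 2 * (x - x0)) (fun _ => 2) (jcoord 0))))).
  assert (HSv : forall z t, jw S z t = eps / 3 + cc + (M * exp (- decay m * (t - t0)) + kx * (z 0%nat - x0) ^ 2)) by reflexivity.
  assert (HSc : forall O B T, creg N O B T S).
  { intros. apply creg_add; [apply creg_const|]. apply creg_add.
    - apply creg_time. intros. apply is_derive_Reals. auto_derive; auto. unfold Rminus. ring.
    - apply creg_scal, creg_comp; [apply creg_coord; lia|]. intros; split; [apply derivable_sq|apply derivable_lin]. }
  assert (Hpos : forall z t, 0 <= M * exp (- decay m * (t - t0)) /\ 0 <= kx * (z 0%nat - x0) ^ 2).
  { intros. split; apply Rmult_le_pos; try lra; [apply Rlt_le, exp_pos|apply pow2_ge_0]. }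
  destruct (comparison N (difD m) (difd m) (radR m) (exmu m) (exnu m) 0 M t0 (t0 + T) (strip x0 L) (ostrip x0 L)
    (jconst 0) (jsub S V)) as [_ C]; auto; try lra.
  - apply strip_closed; auto.
  - unfold ostrip, strip. intros; lra.
  - intros; now apply ostrip_open.
  - exact (cont_on_const N _ 0).
  - apply jsub_cont.
    + apply (creg_cont _ _ _ _ _ _ (HSc (mExt m) (mBd m) (t0 - 1))). intros z t [[Hz _] Ht']. split; auto; lra.
    + apply cont_on_subset with (1 := cV). intros z t [[Hz _] Ht']; split; auto; lra.
  - apply creg_reg, creg_const.
  - apply reg_jsub; [apply creg_reg, HSc|]. apply reg_sub with (1 := rV); try lra; intros z [Hz _]; auto.
  - simpl; intros; lra.
  - intros z t Hz Hw Ht. rewrite jw_sub, HSv. specialize (bV z t Hz ltac:(lra)). destruct (Hpos z t). lra.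
  - simpl; intros; lra.
  - intros z Hz Hw. rewrite jw_sub, HSv. specialize (bV z t0 Hz Ht0). destruct (Hpos z t0).
    rewrite Rminus_diag, Rmult_0_r, exp_0. lra.
  - simpl; intros; lra.
  - intros z t Hz Hw Ht Hneg. rewrite jw_sub, HSv in Hneg. specialize (bV z t Hz ltac:(lra)). destruct (Hpos z t).
    unfold ostrip, strip in *. destruct (Rle_lt_or_eq_dec _ _ Hw) as [|Hq]; auto. exfalso.
    assert (kx * (z 0%nat - x0) ^ 2 = M).
    { rewrite <- (pow2_abs (z 0%nat - x0)), Hq. unfold kx.
      replace (M * (l1 * l1) * L ^ 2) with (M * ((L * l1) * (L * l1))) by ring. rewrite HLl. ring. } lra.
  - simpl; intros; lra.
  - simpl; intros; lra.
  - intros z t Hz Hw Ht Hneg. rewrite Rmult_0_l, jt_sub, lap_sub. specialize (eV z t Hz ltac:(lra)).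
    rewrite jw_sub, HSv in Hneg. destruct (Hpos z t) as [p1 p2].
    unfold S. rewrite !lap_add, lap_const, lap_time, lap_scal, lap_comp, gg_coord, lap_coord by lia.
    cbn [jt jadd jscal jcomp jconst jcoord jtime j1]. cbn [Nat.eqb].
    set (E := M * exp (- decay m * (t - t0))) in *.
    assert (HVb : decay m * (eps / 3 + cc + (E + kx * (z 0%nat - x0) ^ 2)) <= decay m * jw V z t) by (apply Rmult_le_compat_l; lra).
    assert (0 <= decay m * (kx * (z 0%nat - x0) ^ 2)) by (apply Rmult_le_pos; lra).
    assert (0 <= decay m * (eps / 3)) by (apply Rmult_le_pos; lra).
    match goal with |- 0 <= ?X => replace X with
      (- decay m * E - 2 * difd m * kx - (jt V z t - difd m * mlap m V z t)) by ring end.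
    rewrite eV. lra.
  - intros z t Hz Hw Ht Hneg. change (jw (jconst 0) z t) with 0. rewrite Rmin_left, Rmult_0_r by lra.
    rewrite dn_sub, jw_sub, HSv. destruct (eB z t Hz ltac:(lra)) as [_ e1]. destruct (Hpos z t).
    assert (HUz : jw U z t <= e') by (apply HU; auto; [unfold ostrip, strip in *; lra|lra]).
    unfold S. rewrite !dn_add, dn_const, dn_time, dn_scal, dn_comp, dn_coord0.
    assert (exnu m * (eps / 3) <= exnu m * (eps / 3 + cc + (M * exp (- decay m * (t - t0)) + kx * (z 0%nat - x0) ^ 2)))
      by (apply Rmult_le_compat_l; lra).
    assert (exmu m * jw U z t <= exnu m * (eps / 3)).
    { rewrite <- He'2. replace (exnu m * (exmu m / exnu m * e')) with (exmu m * e') by (field; lra).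
      apply Rmult_le_compat_l; lra. }
    lra.
  - specialize (C z1 (t0 + T) Hz1). rewrite jw_sub, HSv, Hx1 in C. unfold strip in C.
    rewrite Hx1, Rminus_diag, Rabs_R0 in C. specialize (C ltac:(lra) ltac:(lra)).
    replace (t0 + T - t0) with T in C by ring. lra.
Qed.
End FiniteSpeed.

(** * Uniform invasion and comparison with a reference solution *)

Section Spreading.
Context (m : model) (Hm : model_ok m).
Context (H : jet) (h psi psi1 psi2 : R -> R) (theta : R)
  (Hpr : profile m H h psi psi1 psi2 theta 0).
Local Notation N := (dimN m).
Local Notation Rq := (radR m ^ 2).
Local Notation hR := (h (radR m ^ 2)).
Local Notation V0 := (exmu m * h (radR m ^ 2) / (theta + exnu m)).
Local Notation Us z := (h (rad 1 N z)).
Local Notation Vs z := (V0 * psi (rad 1 N z)).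

(** [harnack] gives one lower bound on the window of half-width [Lx + w] during the time [T7], and
    [lower_limit] is then centred at each abscissa within [Lx]. The delay [T] is common to all
    solutions bounded by [M] that attain [delta]. *)
Lemma invasion M eta delta Lx : 0 < M -> 0 < eta -> 0 < delta -> 0 <= Lx -> exists T, 0 < T /\
  forall U V t0 z0, bsol m M U V -> 2 <= t0 -> inO m z0 -> delta <= jw U z0 t0 ->
  forall t, t0 + T <= t ->
    (forall z, inO m z -> Rabs (z 0%nat - z0 0%nat) <= Lx -> Us z - eta <= jw U z t) /\
    (forall z, inE m z -> Rabs (z 0%nat - z0 0%nat) <= Lx -> Vs z - eta <= jw V z t).
Proof.
  intros HM Heta Hdel HLx.
  destruct (lower_limit m Hm _ _ _ _ _ _ _ Hpr (Rle_refl 0) eta Heta) as [w [T7 [Hw [HT7 Hlow]]]].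
  destruct (harnack m Hm M delta (Lx + w) T7) as [d2 [Hd2 Hh]]; try lra.
  destruct (Hlow M d2 Hd2) as [T8 [HT8 Hl]].
  exists (1 + T8). split; [lra|]. intros U V t0 z0 Hbs Ht0 Hz0 HU t Ht.
  assert (Hx : forall x1, Rabs (x1 - z0 0%nat) <= Lx -> forall z s, inO m z -> strip x1 w z ->
     t0 + 1 <= s <= t0 + 1 + T7 -> d2 <= jw U z s).
  { intros x1 Hx1 z s Hz Hst Hs. apply (Hh U V t0 z0); auto. unfold strip in Hst.
    replace (z 0%nat - z0 0%nat) with ((z 0%nat - x1) + (x1 - z0 0%nat)) by ring.
    eapply Rle_trans; [apply Rabs_triang|]. lra. }
  split; intros z Hz Hzx.
  - destruct (Hl U V (t0 + 1) (z 0%nat) Hbs ltac:(lra) (Hx _ Hzx) t ltac:(lra)) as [H1 _]. now apply H1.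
  - destruct (Hl U V (t0 + 1) (z 0%nat) Hbs ltac:(lra) (Hx _ Hzx) t ltac:(lra)) as [_ H1]. now apply H1.
Qed.

Lemma local_convergence M U V : 0 < M -> bsol m M U V ->
  (exists z, inO m z /\ jw U z 0 <> 0) \/ (exists z, inE m z /\ jw V z 0 <> 0) ->
  forall r eps, 0 < eps -> exists T, 0 < T /\ forall t, T <= t ->
    (forall z, inO m z -> Rabs (z 0%nat) <= r -> Rabs (jw U z t - Us z) < eps) /\
    (forall z, inE m z -> Rabs (z 0%nat) <= r -> Rabs (jw V z t - Vs z) < eps).
Proof.
  intros HM Hbs Hnt r eps He.
  destruct (becomes_positive m Hm M U V Hbs Hnt) as [z0 [t0 [Ht0 [Hz0 HU]]]].
  destruct (invasion M (eps / 2) (jw U z0 t0) (Rabs r + Rabs (z0 0%nat))) as [T [HT Hinv]]; try lra.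
  { pose proof (Rabs_pos r). pose proof (Rabs_pos (z0 0%nat)). lra. }
  destruct (upper_limit m Hm _ _ _ _ _ _ _ Hpr (Rle_refl 0) M (eps / 2) ltac:(lra)) as [T2 [HT2 Hup]].
  exists (t0 + T + T2). split; [lra|]. intros t Ht.
  destruct (Hinv U V t0 z0 Hbs Ht0 Hz0 (Rle_refl _) t ltac:(lra)) as [L1 L2].
  destruct (Hup U V Hbs t ltac:(lra)) as [U1 U2].
  assert (Hx : forall z, Rabs (z 0%nat) <= r -> Rabs (z 0%nat - z0 0%nat) <= Rabs r + Rabs (z0 0%nat)).
  { intros z Hz. replace (z 0%nat - z0 0%nat) with (z 0%nat + - z0 0%nat) by ring.
    eapply Rle_trans; [apply Rabs_triang|]. rewrite Rabs_Ropp. pose proof (Rle_abs r). lra. }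
  split; intros z Hz Hzr.
  - specialize (L1 z Hz (Hx z Hzr)). specialize (U1 z Hz). apply Rabs_lt_between. lra.
  - specialize (L2 z Hz (Hx z Hzr)). specialize (U2 z Hz). apply Rabs_lt_between. lra.
Qed.

(** Outside, the support must also be bounded in y, since [psi] is bounded away from 0 only on
    bounded ranges of [q]. *)
Definition supported r (U V : jet) : Prop :=
  (forall z, inO m z -> jw U z 0 <> 0 -> Rabs (z 0%nat) <= r) /\
  (forall z, inE m z -> jw V z 0 <> 0 -> Rabs (z 0%nat) <= r /\ rad 1 N z <= r ^ 2).

(* A solution that is not small somewhere dominates, after a fixed delay, a fixed fraction of every
   translate or reflection of a given compactly supported solution. *)
Lemma domination M delta M1 U1 V1 r : 0 < M -> 0 < delta -> 0 < M1 -> bsol m M1 U1 V1 -> supported r U1 V1 ->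
  exists C0 k, 0 < C0 /\ 0 < k <= 1 /\ forall U V t0 z0 s, bsol m M U V -> 2 <= t0 -> inO m z0 ->
    delta <= jw U z0 t0 -> s = 1 \/ s = -1 -> forall z t, inO m z -> 0 <= t ->
    k * jw U1 z t <= jw U (xmap s (z0 0%nat) z) (t0 + C0 + t).
Proof.
  intros HM Hdel HM1 Hb1 [Hs1 Hs2].
  destruct (model_pos m Hm _ _ _ _ _ _ _ Hpr) as [HN [HD [Hd [HR [Hmu [Hnu [Hrho [HR2 Hth]]]]]]]].
  destruct (hR_range m Hm _ _ _ _ _ _ _ Hpr) as [HhR0 HhR1].
  assert (HV0 : 0 < V0) by (apply Rdiv_lt_0_compat; [apply Rmult_lt_0_compat|]; lra).
  assert (Hpm : exists pm, 0 < pm /\ forall q, Rq <= q -> q <= r ^ 2 -> pm <= psi q).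
  { destruct (Rle_lt_dec Rq (r ^ 2)) as [Hle|Hlt]; [|exists 1; split; [lra|intros; lra]].
    destruct (continuity_ab_min psi Rq (r ^ 2) Hle) as [q1 [Hq1 Hq2]].
    - intros q Hq. apply derivable_continuous_pt. eexists. apply (pr_psi1 _ _ _ _ _ _ _ _ Hpr). lra.
    - exists (psi q1). split; [apply (pr_psi_range _ _ _ _ _ _ _ _ Hpr); lra|]. intros; apply Hq1; lra. }
  destruct Hpm as [pm [Hpm Hpsi]].
  assert (HVp : 0 < V0 * pm) by (apply Rmult_lt_0_compat; lra).
  (* Half of a lower bound of the steady state on the support, in each phase: once within [eta] of
     the steady state, the solution is at least [eta] there. *)
  set (eta := Rmin (hR / 2) (V0 * pm / 2)). assert (Heta : 0 < eta) by (apply Rmin_glb_lt; lra).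
  assert (Heta1 : eta <= hR / 2) by apply Rmin_l. assert (Heta2 : eta <= V0 * pm / 2) by apply Rmin_r.
  destruct (invasion M eta delta (Rabs r) HM Heta Hdel (Rabs_pos r)) as [T [HT Hinv]].
  set (k := Rmin 1 (eta / M1)).
  assert (Hk0 : 0 < eta / M1) by (apply Rdiv_lt_0_compat; lra).
  assert (Hk : 0 < k <= 1) by (unfold k; split; [apply Rmin_glb_lt; lra|apply Rmin_l]).
  assert (HkM : k * M1 <= eta).
  { replace eta with (eta / M1 * M1) at 1 by (field; lra). apply Rmult_le_compat_r; [lra|apply Rmin_r]. }
  exists T, k. split; auto. split; auto. intros U V t0 z0 s Hbs Ht0 Hz0 HU Hs z t Hz Ht.
  destruct (Hinv U V t0 z0 Hbs Ht0 Hz0 HU (t0 + T) ltac:(lra)) as [L1 L2].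
  assert (Hx : forall z, Rabs (z 0%nat) <= r -> Rabs (xmap s (z0 0%nat) z 0%nat - z0 0%nat) <= Rabs r).
  { intros z' Hz'. change (xmap s (z0 0%nat) z' 0%nat) with (s * z' 0%nat + z0 0%nat).
    replace (s * z' 0%nat + z0 0%nat - z0 0%nat) with (s * z' 0%nat) by ring. rewrite Rabs_mult.
    assert (Rabs s = 1) by (destruct Hs; subst; unfold Rabs; destruct Rcase_abs; lra).
    pose proof (Rle_abs r). rewrite H0. lra. }
  pose proof Hbs as [_ [bU bV]]. pose proof Hb1 as [_ [bU1 bV1]].
  assert (HO : forall z, inO m z -> inO m (xmap s (z0 0%nat) z)).
  { intros z'. rewrite !clO_iff, xmap_rad. intros []; split; auto. apply xmap_pt; auto; lia. }
  assert (HE : forall z, inE m z -> inE m (xmap s (z0 0%nat) z)).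
  { intros z'. rewrite !clE_iff, xmap_rad. intros []; split; auto. apply xmap_pt; auto; lia. }
  pose proof (bsol_move m M U V s (z0 0%nat) (t0 + T) Hm Hbs Hs ltac:(lra)) as Hmv.
  destruct (bsol_scaled_comparison m Hm M M1 _ _ U1 V1 k Hmv Hb1 Hk) with (t := t) as [C _]; auto.
  - intros z' Hz'. cbn [jw jmove]. rewrite Rplus_0_r.
    destruct (Req_dec (jw U1 z' 0) 0) as [H0|H0].
    + rewrite H0, Rmult_0_r. apply bU; auto; lra.
    + specialize (L1 _ (HO z' Hz') (Hx z' (Hs1 z' Hz' H0))). rewrite xmap_rad in L1.
      specialize (bU1 z' 0 Hz' ltac:(lra)).
      assert (hR <= Us z') by (apply (pr_range _ _ _ _ _ _ _ _ Hpr); now apply rad_in).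
      assert (k * jw U1 z' 0 <= k * M1) by (apply Rmult_le_compat_l; lra). lra.
  - intros z' Hz'. cbn [jw jmove]. rewrite Rplus_0_r.
    destruct (Req_dec (jw V1 z' 0) 0) as [H0|H0].
    + rewrite H0, Rmult_0_r. apply bV; auto; lra.
    + destruct (Hs2 z' Hz' H0) as [Ha Hb]. specialize (L2 _ (HE z' Hz') (Hx z' Ha)). rewrite xmap_rad in L2.
      specialize (bV1 z' 0 Hz' ltac:(lra)). apply clE_iff in Hz'.
      specialize (Hpsi (rad 1 N z') ltac:(lra) Hb).
      assert (V0 * pm <= Vs z') by (apply Rmult_le_compat_l; lra).
      assert (k * jw V1 z' 0 <= k * M1) by (apply Rmult_le_compat_l; lra). lra.
Qed.

(** The whole cross-section has to be above the level. The level is half of the minimum [hR] of the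
    steady state, so [invasion] with tolerance [hR / 2] restores it. *)
Definition reached (U : jet) t x : Prop := forall z, inO m z -> z 0%nat = x -> hR / 2 <= jw U z t.

Definition axis x : nat -> R := fun i => if Nat.eqb i 0 then x else 0.
Lemma axis_in x : inO m (axis x) /\ axis x 0%nat = x.
Proof.
  destruct (model_pos m Hm _ _ _ _ _ _ _ Hpr) as [HN [HD [Hd [HR [Hmu [Hnu [Hrho [HR2 Hth]]]]]]]].
  split; [|reflexivity]. apply clO_iff. split.
  - intros j Hj. unfold axis. destruct (Nat.eqb_spec j 0); [lia|auto].
  - unfold rad. rewrite sumk_0; [lra|]. intros k Hk. unfold axis. destruct (Nat.ltb_spec k 1); auto.
    destruct (Nat.eqb_spec k 0); [lia|ring].
Qed.

Section Reference.
Context (M1 : R) (U1 V1 : jet) (r : R) (HM1 : 0 < M1) (Hb1 : bsol m M1 U1 V1) (Hsupp : supported r U1 V1)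
  (Hnt : (exists z, inO m z /\ jw U1 z 0 <> 0) \/ (exists z, inE m z /\ jw V1 z 0 <> 0)).

(** Arrival times are subadditive up to a constant: once [x0] is reached, a multiple of the
    translated or reflected [U1] lies below the later [U1] and repeats the journey to [xs], after
    which [invasion] lifts the multiple back to the threshold. [C1] is the price of one junction. *)
Lemma reference_step : exists C1, 0 < C1 /\ forall t0 x0 ts xs s, 2 <= t0 -> reached U1 t0 x0 -> 0 <= ts ->
  reached U1 ts xs -> s = 1 \/ s = -1 -> forall t, t0 + ts + C1 <= t -> reached U1 t (x0 + s * xs).
Proof.
  destruct (hR_range m Hm _ _ _ _ _ _ _ Hpr) as [HhR0 HhR1].
  destruct (domination M1 (hR / 2) M1 U1 V1 r HM1 ltac:(lra) HM1 Hb1 Hsupp) as [C0 [k [HC0 [Hk Hdom]]]].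
  destruct (invasion M1 (hR / 2) (k * (hR / 2)) 0 HM1 ltac:(lra) ltac:(nra) ltac:(lra)) as [T [HT Hinv]].
  exists (C0 + T). split; [lra|]. intros t0 x0 ts xs s Ht0 H0 Hts H1 Hs t Ht z Hz Hzx.
  destruct (axis_in x0) as [Ha0 Hx0]. destruct (axis_in xs) as [Ha1 Hx1].
  pose proof (Hdom U1 V1 t0 (axis x0) s Hb1 Ht0 Ha0 (H0 _ Ha0 Hx0) Hs (axis xs) ts Ha1 Hts) as Hd.
  specialize (H1 _ Ha1 Hx1). set (z1 := xmap s (axis x0 0%nat) (axis xs)) in *.
  assert (Hz1 : inO m z1).
  { unfold z1. apply clO_iff. rewrite xmap_rad. apply clO_iff in Ha1. destruct Ha1. split; auto. apply xmap_pt; auto.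
    destruct Hm; lia. }
  assert (Hz1x : z1 0%nat = x0 + s * xs).
  { unfold z1, xmap. simpl. unfold axis. simpl. ring. }
  assert (k * (hR / 2) <= k * jw U1 (axis xs) ts) by (apply Rmult_le_compat_l; lra).
  destruct (Hinv U1 V1 (t0 + C0 + ts) z1 Hb1 ltac:(lra) Hz1 ltac:(lra) t ltac:(lra)) as [L _].
  specialize (L z Hz). rewrite Hz1x, Hzx, Rminus_diag, Rabs_R0 in L. specialize (L (Rle_refl 0)).
  assert (hR <= Us z) by (apply (pr_range _ _ _ _ _ _ _ _ Hpr); now apply rad_in). lra.
Qed.

(** [finite_speed] makes the supremum finite. If [c] is smaller than it, some displacement [xs] in
    time [ts] satisfies [|xs| > c (ts + C1)], and repeating it with period [ts + C1] outruns [c]. *)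
Lemma reference_speed : exists cs, 0 < cs /\
  (forall c, 0 < c < cs -> exists T, 0 < T /\ forall t x, T <= t -> Rabs x <= c * t -> reached U1 t x) /\
  (exists C1, 0 < C1 /\ forall t x, 0 <= t -> reached U1 t x -> Rabs x <= cs * (t + C1)).
Proof.
  destruct (hR_range m Hm _ _ _ _ _ _ _ Hpr) as [HhR0 HhR1].
  destruct reference_step as [C1 [HC1 Hstep]].
  destruct (local_convergence M1 U1 V1 HM1 Hb1 Hnt 1 (hR / 2) ltac:(lra)) as [T1 [HT1 Hconv]].
  assert (Hcenter : forall t x, T1 <= t -> Rabs x <= 1 -> reached U1 t x).
  { intros t x Ht Hx z Hz Hzx. destruct (Hconv t Ht) as [Hc _]. rewrite <- Hzx in Hx. specialize (Hc z Hz Hx).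
    apply Rabs_lt_between in Hc. assert (hR <= Us z) by (apply (pr_range _ _ _ _ _ _ _ _ Hpr); now apply rad_in). lra. }
  destruct (finite_speed m Hm M1 U1 V1 (Rabs r) Hb1 HM1) as [A [c0 [HA [Hc0 Hfin]]]].
  { intros z Hz Hr. apply NNPP. intros Hn. destruct Hsupp as [Hs _]. specialize (Hs z Hz Hn). pose proof (Rle_abs r). lra. }
  { intros z Hz Hr. apply NNPP. intros Hn. destruct Hsupp as [_ Hs]. specialize (Hs z Hz Hn). pose proof (Rle_abs r). lra. }
  set (E := fun y => exists t x, 0 <= t /\ reached U1 t x /\ y = Rabs x / (t + C1)).
  set (lnA := ln (A / (hR / 2))).
  assert (HAh : 0 < A / (hR / 2)) by (apply Rdiv_lt_0_compat; lra).
  destruct (completeness E) as [cs [Hub Hlub]].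
  { exists (c0 + Rabs lnA / C1). intros y [t [x [Ht [Hr ->]]]].
    destruct (axis_in x) as [Ha Hx]. specialize (Hr _ Ha Hx). specialize (Hfin _ t Ha Ht). rewrite Hx in Hfin.
    assert (Hle : Rabs x - c0 * t <= lnA).
    { apply Rnot_lt_le. intros Hlt.
      assert (exp (- (Rabs x - c0 * t)) < / (A / (hR / 2))).
      { rewrite <- (exp_ln _ HAh), <- exp_Ropp. apply exp_increasing. fold lnA. lra. }
      assert (A * exp (- (Rabs x - c0 * t)) < A * / (A / (hR / 2))) by (apply Rmult_lt_compat_l; lra).
      replace (A * / (A / (hR / 2))) with (hR / 2) in H1 by (field; lra). lra. }
    apply Rmult_le_reg_r with (t + C1); [lra|]. replace (Rabs x / (t + C1) * (t + C1)) with (Rabs x) by (field; lra).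
    pose proof (Rle_abs lnA). pose proof (Rabs_pos lnA).
    assert (0 <= Rabs lnA / C1) by (apply Rdiv_le_0_compat; lra).
    assert (Rabs lnA = Rabs lnA / C1 * C1) by (field; lra).
    assert (0 <= Rabs lnA / C1 * t) by (apply Rmult_le_pos; lra).
    assert (0 <= c0 * C1) by (apply Rmult_le_pos; lra). lra. }
  { exists (Rabs 0 / (T1 + C1)), T1, 0. split; [lra|]. split; auto. apply Hcenter; [lra|]. rewrite Rabs_R0. lra. }
  assert (Hcs : 0 < cs).
  { apply Rlt_le_trans with (Rabs 1 / (T1 + C1)).
    - rewrite Rabs_R1. apply Rdiv_lt_0_compat; lra.
    - apply Hub. exists T1, 1. split; [lra|]. split; auto. apply Hcenter; [lra|]. rewrite Rabs_R1. lra. }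
  exists cs. split; auto. split.
  - intros c Hc.
    assert (Hex : exists ts xs, 0 <= ts /\ reached U1 ts xs /\ c < Rabs xs / (ts + C1)).
    { apply NNPP. intros Hno. assert (cs <= c); [|lra]. apply Hlub. intros y [t [x [Ht [Hr ->]]]].
      apply Rnot_lt_le. intros Hlt. apply Hno. exists t, x. auto. }
    destruct Hex as [ts [xs [Hts [Hrs Hcx]]]].
    set (tau := ts + C1) in *. assert (Htau : 0 < tau) by (unfold tau; lra).
    set (xi := Rabs xs) in *.
    assert (Hxc : c * tau < xi).
    { replace xi with (xi / tau * tau) by (field; lra). apply Rmult_lt_compat_r; auto. }
    assert (Hxi : 0 < xi) by (assert (0 < c * tau) by (apply Rmult_lt_0_compat; lra); lra).
    assert (Hxs : exists s, (s = 1 \/ s = -1) /\ xi = s * xs).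
    { unfold xi, Rabs. destruct Rcase_abs; [exists (-1)|exists 1]; split; auto; ring. }
    destruct Hxs as [s0 [Hs0 Hxis]].
    set (ts0 := T1 + 2).
    (* All multiples up to [k] are kept at once, because points reached after fewer journeys stay
       reached. *)
    assert (Hgrid : forall k i sg, (i <= k)%nat -> sg = 1 \/ sg = -1 -> forall t, ts0 + INR k * tau <= t ->
       reached U1 t (sg * (INR i * xi))).
    { induction k; intros i sg Hi Hsg t Ht.
      - replace i with 0%nat by lia. simpl. rewrite Rmult_0_l, Rmult_0_r. simpl in Ht. apply Hcenter; [unfold ts0 in *; lra|].
        rewrite Rabs_R0. lra.
      - rewrite S_INR in Ht. pose proof (pos_INR k). assert (0 <= INR k * tau) by (apply Rmult_le_pos; lra).
        destruct (Nat.eq_dec i (S k)) as [->|Hne].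
        + rewrite S_INR. replace (sg * ((INR k + 1) * xi)) with (sg * (INR k * xi) + sg * s0 * xs) by (rewrite Hxis; ring).
          apply (Hstep (ts0 + INR k * tau) _ ts xs (sg * s0)); auto.
          * unfold ts0. lra.
          * apply IHk; auto. lra.
          * destruct Hsg, Hs0; subst; [left|right|right|left]; ring.
          * unfold tau in *. lra.
        + apply IHk; [lia|auto|]. lra. }
    destruct (invasion M1 (hR / 2) (hR / 2) xi HM1 ltac:(lra) ltac:(lra) ltac:(lra)) as [T' [HT' Hinv]].
    (* One further delay fills the gaps of length [xi] between grid points. *)
    assert (Hfill : forall k t x, ts0 + INR k * tau + T' <= t -> Rabs x <= INR k * xi -> reached U1 t x).
    { intros k t x Ht Hx z Hz Hzx.
      destruct (nfloor_ex (Rabs x / xi)) as [i [Hi1 Hi2]]; [apply Rdiv_le_0_compat; [apply Rabs_pos|auto]|].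
      assert (Hxx : Rabs x = Rabs x / xi * xi) by (field; lra).
      assert (Hi3 : INR i * xi <= Rabs x < (INR i + 1) * xi).
      { rewrite Hxx. split; [apply Rmult_le_compat_r; lra|apply Rmult_lt_compat_r; lra]. }
      assert (Hik : (i <= k)%nat).
      { apply INR_le. apply Rmult_le_reg_r with xi; auto. lra. }
      assert (Hsx : exists sg, (sg = 1 \/ sg = -1) /\ x = sg * Rabs x).
      { unfold Rabs. destruct Rcase_abs; [exists (-1)|exists 1]; split; auto; ring. }
      destruct Hsx as [sg [Hsg Hsx]].
      pose proof (pos_INR k). assert (0 <= INR k * tau) by (apply Rmult_le_pos; lra).
      pose proof (Hgrid k i sg Hik Hsg (ts0 + INR k * tau) (Rle_refl _)) as Hr.
      destruct (axis_in (sg * (INR i * xi))) as [Ha Hxa]. specialize (Hr _ Ha Hxa).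
      destruct (Hinv U1 V1 (ts0 + INR k * tau) _ Hb1 ltac:(unfold ts0; lra) Ha Hr t ltac:(lra)) as [L _].
      specialize (L z Hz). rewrite Hxa, Hzx in L.
      assert (Hab : Rabs (x - sg * (INR i * xi)) <= xi).
      { rewrite Hsx at 1. replace (sg * Rabs x - sg * (INR i * xi)) with (sg * (Rabs x - INR i * xi)) by ring.
        rewrite Rabs_mult. assert (Hsa : Rabs sg = 1) by (destruct Hsg; subst; unfold Rabs; destruct Rcase_abs; lra).
        rewrite Hsa, Rabs_right by lra. lra. }
      specialize (L Hab). assert (hR <= Us z) by (apply (pr_range _ _ _ _ _ _ _ _ Hpr); now apply rad_in). lra. }
    (* Beyond this time the surplus [xi - c * tau] gained per period outweighs the initial delays
       and the rounding down of the number of periods. *)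
    set (K := (ts0 + T' + tau) * xi / (xi - c * tau)).
    exists (Rmax (ts0 + T') K). split; [apply Rlt_le_trans with (ts0 + T'); [unfold ts0; lra|apply Rmax_l]|].
    intros t x Ht Hx.
    assert (Ht1 : ts0 + T' <= t) by (eapply Rle_trans; [apply Rmax_l|exact Ht]).
    assert (Ht2 : K <= t) by (eapply Rle_trans; [apply Rmax_r|exact Ht]).
    destruct (nfloor_ex ((t - (ts0 + T')) / tau)) as [k [Hk1 Hk2]]; [apply Rdiv_le_0_compat; lra|].
    assert (Hkt : t - (ts0 + T') = (t - (ts0 + T')) / tau * tau) by (field; lra).
    assert (Hk3 : INR k * tau <= t - (ts0 + T')) by (rewrite Hkt; apply Rmult_le_compat_r; lra).
    assert (Hk4 : t - (ts0 + T') < (INR k + 1) * tau) by (rewrite Hkt; apply Rmult_lt_compat_r; lra).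
    apply (Hfill k); [lra|]. apply Rle_trans with (1 := Hx).
    assert (HKK : (ts0 + T' + tau) * xi <= t * (xi - c * tau)).
    { replace ((ts0 + T' + tau) * xi) with (K * (xi - c * tau)) by (unfold K; field; lra).
      apply Rmult_le_compat_r; lra. }
    apply Rmult_le_reg_r with tau; auto.
    assert (xi * (t - (ts0 + T')) <= xi * ((INR k + 1) * tau)) by (apply Rmult_le_compat_l; lra). lra.
  - exists C1. split; auto. intros t x Ht Hr.
    assert (Rabs x / (t + C1) <= cs) by (apply Hub; exists t, x; auto).
    replace (Rabs x) with (Rabs x / (t + C1) * (t + C1)) by (field; lra). apply Rmult_le_compat_r; lra.
Qed.

(** [domination] is used with both assignments of roles. A value [eps] of [U] far out would let [U1]
    reach nearly the same abscissa after a fixed delay, which bounds the front of [U]; conversely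
    [U] arrives, up to a fixed delay and shift, wherever [U1] has arrived. Fixed delays and shifts
    do not change the speed. *)
Lemma speed_exists : exists cs, 0 < cs /\ forall M U V r', 0 < M -> bsol m M U V -> supported r' U V ->
  (exists z, inO m z /\ jw U z 0 <> 0) \/ (exists z, inE m z /\ jw V z 0 <> 0) ->
  (forall c, cs < c -> forall eps, 0 < eps -> exists T, forall t, T <= t ->
     (forall z, inO m z -> c * t <= Rabs (z 0%nat) -> jw U z t < eps) /\
     (forall z, inE m z -> c * t <= Rabs (z 0%nat) -> jw V z t < eps)) /\
  (forall c, 0 < c < cs -> forall eps, 0 < eps -> exists T, forall t, T <= t ->
     (forall z, inO m z -> Rabs (z 0%nat) <= c * t -> Rabs (jw U z t - Us z) < eps) /\
     (forall z, inE m z -> Rabs (z 0%nat) <= c * t -> Rabs (jw V z t - Vs z) < eps)).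
Proof.
  destruct (hR_range m Hm _ _ _ _ _ _ _ Hpr) as [HhR0 HhR1].
  destruct reference_speed as [cs [Hcs [Hin [C1 [HC1 Hout]]]]].
  exists cs. split; auto. intros M U V r' HM Hbs Hsp Hntu.
  destruct (becomes_positive m Hm M1 U1 V1 Hb1 Hnt) as [z1 [t1 [Ht1 [Hz1 HU1]]]].
  destruct (becomes_positive m Hm M U V Hbs Hntu) as [z0 [t0 [Ht0 [Hz0 HU0]]]].
  split.
  - assert (HoutU : forall c, cs < c -> forall eps, 0 < eps -> exists T, forall t, T <= t -> 0 <= t ->
      (forall z, inO m z -> c * t <= Rabs (z 0%nat) -> jw U z t < eps)).
    { intros c Hc eps He.
      destruct (domination M1 (jw U1 z1 t1) M U V r' HM1 HU1 HM Hbs Hsp) as [C0 [k [HC0 [Hk Hdom]]]].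
      destruct (invasion M1 (hR / 2) (k * eps) 0 HM1 ltac:(lra) ltac:(nra) ltac:(lra)) as [T2 [HT2 Hinv]].
      set (cst := cs * (t1 + C0 + T2 + C1) + Rabs (z1 0%nat)).
      assert (Hcst : 0 <= cst).
      { unfold cst. pose proof (Rabs_pos (z1 0%nat)). assert (0 <= cs * (t1 + C0 + T2 + C1)) by (apply Rmult_le_pos; lra). lra. }
      exists (cst / (c - cs) + 1). intros t Ht Ht0' z Hz Hzx. apply Rnot_le_lt. intros Hge.
      pose proof (Hdom U1 V1 t1 z1 1 Hb1 Ht1 Hz1 (Rle_refl _) (or_introl eq_refl) z t Hz Ht0') as Hd.
      assert (Hz2 : inO m (xmap 1 (z1 0%nat) z)).
      { apply clO_iff. rewrite xmap_rad. apply clO_iff in Hz. destruct Hz. split; auto. apply xmap_pt; auto. destruct Hm; lia. }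
      assert (k * eps <= k * jw U z t) by (apply Rmult_le_compat_l; lra).
      destruct (Hinv U1 V1 (t1 + C0 + t) _ Hb1 ltac:(lra) Hz2 ltac:(lra) (t1 + C0 + t + T2) (Rle_refl _)) as [L _].
      assert (Hre : reached U1 (t1 + C0 + t + T2) (xmap 1 (z1 0%nat) z 0%nat)).
      { intros z' Hz' Hx'. specialize (L z' Hz'). rewrite Hx', Rminus_diag, Rabs_R0 in L. specialize (L (Rle_refl 0)).
        assert (hR <= Us z') by (apply (pr_range _ _ _ _ _ _ _ _ Hpr); now apply rad_in). lra. }
      apply Hout in Hre; [|lra]. change (xmap 1 (z1 0%nat) z 0%nat) with (1 * z 0%nat + z1 0%nat) in Hre.
      rewrite Rmult_1_l in Hre.
      assert (Hab : Rabs (z 0%nat) <= Rabs (z 0%nat + z1 0%nat) + Rabs (z1 0%nat)).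
      { replace (z 0%nat) with ((z 0%nat + z1 0%nat) + - z1 0%nat) at 1 by ring.
        eapply Rle_trans; [apply Rabs_triang|]. rewrite Rabs_Ropp. lra. }
      assert (H3 : (c - cs) * t <= cst) by (unfold cst; lra).
      assert (Hfin : (c - cs) * (cst / (c - cs) + 1) <= (c - cs) * t) by (apply Rmult_le_compat_l; lra).
      replace ((c - cs) * (cst / (c - cs) + 1)) with (cst + (c - cs)) in Hfin by (field; lra). lra. }
    (* The intermediate speed leaves room for the window of half-width [L] in [exterior_small]. *)
    intros c Hc eps He. set (c' := (c + cs) / 2).
    destruct (exterior_small m Hm M (eps / 2) HM ltac:(lra)) as [T3 [L [e' [HT3 [HL [He' Hext]]]]]].
    destruct (HoutU c Hc eps He) as [Ta Ha]. destruct (HoutU c' ltac:(unfold c'; lra) e' He') as [Tb Hb].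
    exists (Rmax 0 Ta + Rmax 0 Tb + T3 + 2 * L / (c - cs)). intros t Ht.
    pose proof (Rmax_l 0 Ta). pose proof (Rmax_r 0 Ta). pose proof (Rmax_l 0 Tb). pose proof (Rmax_r 0 Tb).
    assert (HLc : 0 < 2 * L / (c - cs)) by (apply Rdiv_lt_0_compat; lra).
    split.
    + apply Ha; lra.
    + intros z Hz Hzx. apply Rle_lt_trans with (eps / 2); [|lra].
      replace t with (t - T3 + T3) by ring. apply (Hext U V (t - T3) (z 0%nat)); auto; [lra|].
      intros z' s Hz' Hst Hs. apply Rlt_le, Hb; [lra|lra|now right|].
      unfold strip in Hst.
      assert (Rabs (z 0%nat) <= Rabs (z' 0%nat) + L).
      { replace (z 0%nat) with (z' 0%nat + - (z' 0%nat - z 0%nat)) by ring.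
        eapply Rle_trans; [apply Rabs_triang|]. rewrite Rabs_Ropp. lra. }
      assert (c' * s <= c' * t) by (apply Rmult_le_compat_l; [unfold c'; lra|lra]).
      assert (Hfin : (c - cs) * (2 * L / (c - cs)) <= (c - cs) * t) by (apply Rmult_le_compat_l; lra).
      replace ((c - cs) * (2 * L / (c - cs))) with (2 * L) in Hfin by (field; lra). unfold c' in *. lra.
  - intros c Hc eps He. set (c' := (c + cs) / 2).
    destruct (Hin c' ltac:(unfold c'; lra)) as [Ta [HTa Ha]].
    destruct (domination M (jw U z0 t0) M1 U1 V1 r HM HU0 HM1 Hb1 Hsupp) as [C0 [k [HC0 [Hk Hdom]]]].
    destruct (invasion M (eps / 2) (k * (hR / 2)) 0 HM ltac:(lra) ltac:(nra) ltac:(lra)) as [T2 [HT2 Hinv]].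
    destruct (upper_limit m Hm _ _ _ _ _ _ _ Hpr (Rle_refl 0) M (eps / 2) ltac:(lra)) as [T3 [HT3 Hup]].
    set (dl := t0 + C0 + T2). set (cst := c' * dl + Rabs (z0 0%nat)).
    assert (Hcst : 0 <= cst).
    { unfold cst, dl. pose proof (Rabs_pos (z0 0%nat)). assert (0 <= c' * (t0 + C0 + T2)) by (apply Rmult_le_pos; [unfold c'|]; lra). lra. }
    exists (Ta + dl + T3 + cst / (c' - c)). intros t Ht.
    assert (Hcc : 0 < c' - c) by (unfold c'; lra).
    assert (H0 : 0 <= cst / (c' - c)) by (apply Rdiv_le_0_compat; lra).
    destruct (Hup U V Hbs t ltac:(unfold dl in *; lra)) as [UU UV].
    assert (Hreach : forall x, Rabs x <= c * t -> exists z2, inO m z2 /\ z2 0%nat = x /\ k * (hR / 2) <= jw U z2 (t - T2)).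
    { intros x Hx.
      assert (Hx2 : Rabs (x - z0 0%nat) <= c' * (t - dl)).
      { replace (x - z0 0%nat) with (x + - z0 0%nat) by ring. eapply Rle_trans; [apply Rabs_triang|]. rewrite Rabs_Ropp.
        assert ((c' - c) * (cst / (c' - c)) <= (c' - c) * t).
        { apply Rmult_le_compat_l; [lra|]. unfold dl in Ht. lra. }
        replace ((c' - c) * (cst / (c' - c))) with cst in H1 by (field; lra). unfold cst in H1. lra. }
      destruct (axis_in (x - z0 0%nat)) as [Hax Hax2].
      pose proof (Ha (t - dl) _ ltac:(lra) Hx2 _ Hax Hax2) as Hr.
      pose proof (Hdom U V t0 z0 1 Hbs Ht0 Hz0 (Rle_refl _) (or_introl eq_refl) _ (t - dl) Hax ltac:(lra)) as Hd.
      exists (xmap 1 (z0 0%nat) (axis (x - z0 0%nat))). split; [|split].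
      - apply clO_iff. rewrite xmap_rad. apply clO_iff in Hax. destruct Hax. split; auto. apply xmap_pt; auto. destruct Hm; lia.
      - unfold xmap, axis. simpl. ring.
      - replace (t - T2) with (t0 + C0 + (t - dl)) by (unfold dl; ring).
        assert (k * (hR / 2) <= k * jw U1 (axis (x - z0 0%nat)) (t - dl)) by (apply Rmult_le_compat_l; lra). lra. }
    split; intros z Hz Hzx; destruct (Hreach _ Hzx) as [z2 [Hz2 [Hx2 Hv2]]];
      destruct (Hinv U V (t - T2) z2 Hbs ltac:(unfold dl in *; lra) Hz2 Hv2 t ltac:(lra)) as [L1 L2].
    + specialize (L1 z Hz). rewrite Hx2, Rminus_diag, Rabs_R0 in L1. specialize (L1 (Rle_refl 0)).
      specialize (UU z Hz). apply Rabs_lt_between. lra.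
    + specialize (L2 z Hz). rewrite Hx2, Rminus_diag, Rabs_R0 in L2. specialize (L2 (Rle_refl 0)).
      specialize (UV z Hz). apply Rabs_lt_between. lra.
Qed.
End Reference.
End Spreading.

(** * The exterior profile and the Bessel functions *)

Definition bes a z t : R := exp (- z * cosh t) * cosh (a * t).

Lemma cosh_ge_1 t : 1 <= cosh t.
Proof.
  unfold cosh. pose proof (exp_ineq1_le t). pose proof (exp_ineq1_le (- t)). lra.
Qed.

Lemma bes_pos a z t : 0 < bes a z t.
Proof. apply Rmult_lt_0_compat; [apply exp_pos|]. pose proof (cosh_ge_1 (a * t)). lra. Qed.

Lemma bes_continuous a z t : continuous (bes a z) t.
Proof. apply (ex_derive_continuous (bes a z)). unfold bes, cosh. auto_derive. auto. Qed.

Lemma bes_ex_RInt a z x y : ex_RInt (bes a z) x y.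
Proof. apply (ex_RInt_continuous (bes a z)). intros; apply bes_continuous. Qed.

Lemma exp_le_compat x y : x <= y -> exp x <= exp y.
Proof. intros [H| ->]; [apply Rlt_le, exp_increasing; auto|lra]. Qed.

(** [cosh t >= t^2 / 8] puts a negative quadratic into the exponent; completing the square against
    [(Rabs a + 1) t] leaves the integrable factor [exp (- t)]. *)
Lemma bes_bound a z t : 0 < z -> 0 <= t -> bes a z t <= exp (2 * (Rabs a + 1) ^ 2 / z) * exp (- t).
Proof.
  intros Hz Ht. set (k := Rabs a + 1). assert (Hk : 1 <= k) by (unfold k; pose proof (Rabs_pos a); lra).
  assert (Hc : cosh (a * t) <= exp (Rabs a * t)).
  { unfold cosh. pose proof (Rle_abs a). pose proof (Rle_abs (- a)). rewrite Rabs_Ropp in H0.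
    assert (exp (a * t) <= exp (Rabs a * t)) by (apply exp_le_compat; nra).
    assert (exp (- (a * t)) <= exp (Rabs a * t)) by (apply exp_le_compat; nra). lra. }
  assert (Hch : t ^ 2 / 8 <= cosh t).
  { unfold cosh. assert (H1 : 1 + t / 2 <= exp (t / 2)) by apply exp_ineq1_le.
    assert (H2 : exp t = exp (t / 2) * exp (t / 2)) by (rewrite <- exp_plus; f_equal; field).
    pose proof (exp_pos (- t)). nra. }
  apply Rle_trans with (exp (- z * cosh t) * exp (Rabs a * t)).
  { apply Rmult_le_compat_l; [apply Rlt_le, exp_pos|auto]. }
  rewrite <- !exp_plus. apply exp_le_compat.
  assert (Hq : - z * (t ^ 2 / 8) + k * t <= 2 * k ^ 2 / z).
  { apply Rmult_le_reg_l with z; auto. replace (z * (2 * k ^ 2 / z)) with (2 * k ^ 2) by (field; lra).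
    assert (0 <= (z * t - 4 * k) ^ 2) by apply pow2_ge_0. nra. }
  assert (z * (t ^ 2 / 8) <= z * cosh t) by (apply Rmult_le_compat_l; lra).
  unfold k in *. lra.
Qed.

Lemma ex_RInt_cont (f : R -> R) x y : (forall t, continuous f t) -> ex_RInt f x y.
Proof. intros. apply (ex_RInt_continuous f). auto. Qed.

Lemma RInt_scal_R (f : R -> R) a b c : ex_RInt f a b -> RInt (fun t => c * f t) a b = c * RInt f a b.
Proof. intros H. exact (RInt_scal f a b c H). Qed.

Lemma RInt_plus_R (f g : R -> R) a b : ex_RInt f a b -> ex_RInt g a b ->
  RInt (fun t => f t + g t) a b = RInt f a b + RInt g a b.
Proof. intros Hf Hg. exact (RInt_plus f g a b Hf Hg). Qed.

Definition improper (f : R -> R) (l : R) := is_lim (fun M => RInt f 0 M) p_infty (Finite l).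

Lemma RInt_monotone (f : R -> R) M M' : (forall t, continuous f t) -> (forall t, 0 <= f t) -> 0 <= M <= M' ->
  RInt f 0 M <= RInt f 0 M'.
Proof.
  intros Hc Hp HM. assert (Hex : forall x y, ex_RInt f x y) by (intros; apply ex_RInt_cont; auto).
  rewrite <- (RInt_Chasles f 0 M M') by auto. unfold plus; simpl.
  assert (0 <= RInt f M M') by (apply RInt_ge_0; auto; lra). lra.
Qed.

Lemma RInt_exp_tail M : 0 <= M -> RInt (fun t => exp (- t)) 0 M <= 1.
Proof.
  intros HM. assert (H : is_RInt (fun t => exp (- t)) 0 M (minus (- exp (- M)) (- exp (- 0)))).
  { apply (is_RInt_derive (fun t => - exp (- t))).
    - intros. auto_derive; auto. ring.
    - intros. apply (ex_derive_continuous (fun t => exp (- t))). auto_derive. auto. }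
  rewrite (is_RInt_unique _ _ _ _ H). unfold minus, plus, opp; simpl. rewrite Ropp_0, exp_0.
  pose proof (exp_pos (- M)). lra.
Qed.

Lemma bes_RInt_bound a z M : 0 < z -> 0 <= M -> RInt (bes a z) 0 M <= exp (2 * (Rabs a + 1) ^ 2 / z).
Proof.
  intros Hz HM. set (C := exp (2 * (Rabs a + 1) ^ 2 / z)).
  apply Rle_trans with (RInt (fun t => C * exp (- t)) 0 M).
  - apply RInt_le; auto; [apply bes_ex_RInt| |].
    + apply (ex_RInt_continuous (fun t => C * exp (- t))). intros.
      apply (ex_derive_continuous (fun t => C * exp (- t))). auto_derive. auto.
    + intros. apply bes_bound; auto; lra.
  - rewrite (RInt_scal_R (fun t => exp (- t)) 0 M C).
    + pose proof (RInt_exp_tail M HM).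
      assert (0 < C) by apply exp_pos. nra.
    + apply (ex_RInt_continuous (fun t => exp (- t))). intros.
      apply (ex_derive_continuous (fun t => exp (- t))). auto_derive. auto.
Qed.

Lemma bes_improper a z : 0 < z -> exists l, improper (bes a z) l.
Proof.
  intros Hz. destruct (completeness (fun y => exists M, 0 <= M /\ y = RInt (bes a z) 0 M)) as [l [Hub Hlub]].
  - exists (exp (2 * (Rabs a + 1) ^ 2 / z)). intros y [M [HM ->]]. now apply bes_RInt_bound.
  - exists (RInt (bes a z) 0 0), 0. split; [lra|auto].
  - exists l. apply is_lim_spec. intros eps. pose proof (cond_pos eps) as He.
    assert (Hex : exists M, 0 <= M /\ l - eps < RInt (bes a z) 0 M).
    { apply NNPP. intros Hn. assert (l <= l - eps); [|lra]. apply Hlub. intros y [M [HM ->]].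
      apply Rnot_lt_le. intros Hlt. apply Hn. now exists M. }
    destruct Hex as [M [HM HMl]]. exists M. intros x Hx.
    assert (RInt (bes a z) 0 M <= RInt (bes a z) 0 x).
    { apply RInt_monotone; [intros; apply bes_continuous|intros; apply Rlt_le, bes_pos|lra]. }
    assert (RInt (bes a z) 0 x <= l) by (apply Hub; exists x; split; auto; lra).
    apply Rabs_lt_between. lra.
Qed.

(** Defined through a total limit operator; for [0 < z] the value is the integral, by
    [BesK_improper]. *)
Definition BesK a z : R := real (Lim (fun M => RInt (bes a z) 0 M) p_infty).

Lemma BesK_improper a z : 0 < z -> improper (bes a z) (BesK a z).
Proof.
  intros Hz. destruct (bes_improper a z Hz) as [l Hl]. unfold BesK.
  rewrite (is_lim_unique _ _ _ Hl). exact Hl.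
Qed.

Lemma improper_unique f l l' : improper f l -> improper f l' -> l = l'.
Proof.
  intros H H'. apply is_lim_unique in H. apply is_lim_unique in H'. rewrite H in H'. now injection H'.
Qed.

Lemma improper_lin (f g : R -> R) l l' c c' : (forall t, continuous f t) -> (forall t, continuous g t) ->
  improper f l -> improper g l' -> improper (fun t => c * f t + c' * g t) (c * l + c' * l').
Proof.
  intros Hf Hg H H'.
  assert (E1 : forall M, ex_RInt f 0 M) by (intros; apply ex_RInt_cont; auto).
  assert (E2 : forall M, ex_RInt g 0 M) by (intros; apply ex_RInt_cont; auto).
  apply is_lim_ext with (fun M => c * RInt f 0 M + c' * RInt g 0 M).
  - intros M. rewrite (RInt_plus_R (fun t => c * f t) (fun t => c' * g t)).
    + rewrite !RInt_scal_R; auto.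
    + apply (ex_RInt_scal f); auto.
    + apply (ex_RInt_scal g); auto.
  - apply (is_lim_plus _ _ _ (c * l) (c' * l')); [| |reflexivity].
    + apply (is_lim_scal_l _ c p_infty l H).
    + apply (is_lim_scal_l _ c' p_infty l' H').
Qed.

Lemma improper_ext f g l : (forall t, f t = g t) -> improper f l -> improper g l.
Proof. intros He. apply is_lim_ext. intros M. apply RInt_ext. intros; apply He. Qed.

Lemma improper_le (f g : R -> R) l l' : (forall t, continuous f t) -> (forall t, continuous g t) ->
  improper f l -> improper g l' -> (forall t, f t <= g t) -> l <= l'.
Proof.
  intros Hf Hg H H' Hle.
  assert (Rbar_le l l'); [|auto].
  apply (is_lim_le_loc (fun M => RInt f 0 M) (fun M => RInt g 0 M) p_infty l l'); auto. exists 0. intros M HM.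
  apply RInt_le; auto; try lra; apply ex_RInt_cont; auto.
Qed.

Lemma BesK_pos a z : 0 < z -> 0 < BesK a z.
Proof.
  intros Hz. apply Rlt_le_trans with (RInt (bes a z) 0 1).
  - apply RInt_gt_0; [lra|intros; apply bes_pos|intros; apply bes_continuous].
  - assert (Rbar_le (RInt (bes a z) 0 1) (BesK a z)); [|auto].
    apply (is_lim_le_loc (fun _ => RInt (bes a z) 0 1) (fun M => RInt (bes a z) 0 M) p_infty).
    + exists 1. intros M HM. apply RInt_monotone; [intros; apply bes_continuous|intros; apply Rlt_le, bes_pos|lra].
    + apply is_lim_const.
    + now apply BesK_improper.
Qed.

Lemma BesselK_val_unique tau z k : 0 < z -> BesselK_val tau z k -> k = BesK tau z.
Proof.
  intros Hz Hk. apply (improper_unique (bes tau z)); [|now apply BesK_improper].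
  apply is_lim_spec. intros eps. destruct (Hk eps (cond_pos eps)) as [M0 HM]. exists M0. intros x Hx.
  destruct (HM x ltac:(lra)) as [pr Hpr]. now rewrite <- RInt_Reals in Hpr.
Qed.

Lemma cosh_mult a b : cosh a * cosh b = / 2 * cosh (b + a) + / 2 * cosh (b - a).
Proof.
  unfold cosh. replace (- (b + a)) with (- b + - a) by ring. replace (b - a) with (b + - a) by ring.
  replace (- (b + - a)) with (- b + a) by ring. rewrite !exp_plus. field.
Qed.

Lemma bes_cosh a z t : cosh t * bes a z t = / 2 * bes (a + 1) z t + / 2 * bes (a - 1) z t.
Proof.
  unfold bes. replace ((a + 1) * t) with (a * t + t) by ring. replace ((a - 1) * t) with (a * t - t) by ring.
  replace (cosh t * (exp (- z * cosh t) * cosh (a * t))) with (exp (- z * cosh t) * (cosh t * cosh (a * t))) by ring.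
  rewrite cosh_mult. ring.
Qed.

Lemma exp_taylor x : 0 <= exp (- x) - 1 + x <= x ^ 2 * exp (Rabs x).
Proof.
  pose proof (exp_ineq1_le (- x)). pose proof (exp_ineq1_le x).
  assert (He : exp x * exp (- x) = 1) by (rewrite <- exp_plus, Rplus_opp_r; apply exp_0).
  pose proof (exp_pos x). pose proof (exp_pos (- x)). split; [lra|].
  assert (H3 : exp (- x) - 1 + x <= x * (1 - exp (- x))) by nra.
  apply Rle_trans with (1 := H3). unfold Rabs. destruct Rcase_abs.
  - assert (exp (- x) - 1 <= - x * exp (- x)) by nra. nra.
  - assert (1 - exp (- x) <= x) by lra. nra.
Qed.

(** Differentiation under the integral by a direct estimate: for [Rabs hh < z / 2] the first-order
    Taylor remainder of the integrand is at most [hh^2 cosh^2 t] times the integrand at [z / 2].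
    That majorant has a finite integral because multiplication by [cosh t] only shifts the index. *)
Lemma BesK_derive a z : 0 < z ->
  derivable_pt_lim (BesK a) z (- (/ 2 * BesK (a + 1) z + / 2 * BesK (a - 1) z)).
Proof.
  intros Hz. set (D := - (/ 2 * BesK (a + 1) z + / 2 * BesK (a - 1) z)).
  set (f2 := fun t => cosh t * (cosh t * bes a (z / 2) t)).
  set (b1 := fun t => / 2 * bes (a + 1 + 1) (z / 2) t + / 2 * bes (a + 1 - 1) (z / 2) t).
  set (b2 := fun t => / 2 * bes (a - 1 + 1) (z / 2) t + / 2 * bes (a - 1 - 1) (z / 2) t).
  assert (Hz2 : 0 < z / 2) by lra.
  assert (Hcb1 : forall t, continuous b1 t).
  { intros. apply (ex_derive_continuous b1). unfold b1, bes, cosh. auto_derive. auto. }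
  assert (Hcb2 : forall t, continuous b2 t).
  { intros. apply (ex_derive_continuous b2). unfold b2, bes, cosh. auto_derive. auto. }
  destruct (bes_improper (a + 1 + 1) (z / 2) Hz2) as [l1 I1].
  destruct (bes_improper (a + 1 - 1) (z / 2) Hz2) as [l2 I2].
  destruct (bes_improper (a - 1 + 1) (z / 2) Hz2) as [l3 I3].
  destruct (bes_improper (a - 1 - 1) (z / 2) Hz2) as [l4 I4].
  pose proof (improper_lin _ _ _ _ (/ 2) (/ 2) (bes_continuous _ _) (bes_continuous _ _) I1 I2) as I12.
  pose proof (improper_lin _ _ _ _ (/ 2) (/ 2) (bes_continuous _ _) (bes_continuous _ _) I3 I4) as I34.
  pose proof (improper_lin _ _ _ _ (/ 2) (/ 2) Hcb1 Hcb2 I12 I34) as I5.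
  set (L := / 2 * (/ 2 * l1 + / 2 * l2) + / 2 * (/ 2 * l3 + / 2 * l4)) in *.
  assert (If2 : improper f2 L).
  { eapply improper_ext; [|exact I5]. intros t. unfold f2. rewrite bes_cosh.
    rewrite Rmult_plus_distr_l. replace (cosh t * (/ 2 * bes (a + 1) (z / 2) t)) with (/ 2 * (cosh t * bes (a + 1) (z / 2) t)) by ring.
    replace (cosh t * (/ 2 * bes (a - 1) (z / 2) t)) with (/ 2 * (cosh t * bes (a - 1) (z / 2) t)) by ring.
    rewrite !bes_cosh. reflexivity. }
  assert (Hcf2 : forall t, continuous f2 t).
  { intros. apply (ex_derive_continuous f2). unfold f2, bes, cosh. auto_derive. auto. }
  assert (Hest : forall hh, Rabs hh < z / 2 -> Rabs (BesK a (z + hh) - BesK a z - hh * D) <= hh ^ 2 * L).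
  { intros hh Hh. apply Rabs_lt_between in Hh.
    set (g := fun t => bes a (z + hh) t + (-1) * (bes a z t + (- hh) * (cosh t * bes a z t))).
    assert (Ic : improper (fun t => cosh t * bes a z t) (- D)).
    { unfold D. rewrite Ropp_involutive. eapply improper_ext; [intros t; symmetry; apply bes_cosh|].
      apply improper_lin; [apply bes_continuous|apply bes_continuous| |]; now apply BesK_improper. }
    assert (Hcc : forall t, continuous (fun t => cosh t * bes a z t) t).
    { intros. apply (ex_derive_continuous (fun t => cosh t * bes a z t)). unfold bes, cosh. auto_derive. auto. }
    assert (Ig : improper g (BesK a (z + hh) - BesK a z - hh * D)).
    { pose proof (improper_lin _ _ _ _ 1 (- hh) (bes_continuous a z) Hcc (BesK_improper a z Hz) Ic) as K1.
      assert (Hck : forall t, continuous (fun t => 1 * bes a z t + - hh * (cosh t * bes a z t)) t).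
      { intros. apply (ex_derive_continuous (fun t => 1 * bes a z t + - hh * (cosh t * bes a z t))). unfold bes, cosh. auto_derive. auto. }
      pose proof (improper_lin _ _ _ _ 1 (-1) (bes_continuous a (z + hh)) Hck (BesK_improper a (z + hh) ltac:(lra)) K1) as K2.
      replace (BesK a (z + hh) - BesK a z - hh * D) with (1 * BesK a (z + hh) + -1 * (1 * BesK a z + - hh * - D)) by ring.
      eapply improper_ext; [|exact K2]. intros. unfold g. ring. }
    assert (Hcg : forall t, continuous g t).
    { intros. apply (ex_derive_continuous g). unfold g, bes, cosh. auto_derive. auto. }
    assert (Hpt : forall t, 0 <= g t <= hh ^ 2 * f2 t + 0 * f2 t).
    { intros t. unfold g, f2, bes. set (c := cosh t). assert (Hc : 1 <= c) by apply cosh_ge_1.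
      assert (Ha : 1 <= cosh (a * t)) by apply cosh_ge_1. set (w := cosh (a * t)) in *.
      assert (E1 : exp (- (z + hh) * c) = exp (- z * c) * exp (- (hh * c))) by (rewrite <- exp_plus; f_equal; ring).
      rewrite E1. pose proof (exp_taylor (hh * c)) as Ht. pose proof (exp_pos (- z * c)) as Hp.
      set (X := exp (- (hh * c)) - 1 + hh * c) in *.
      replace (exp (- z * c) * exp (- (hh * c)) * w + -1 * (exp (- z * c) * w + - hh * (c * (exp (- z * c) * w))))
        with (exp (- z * c) * w * X) by (unfold X; ring).
      assert (Hew : 0 < exp (- z * c) * w) by (apply Rmult_lt_0_compat; lra).
      split; [apply Rmult_le_pos; lra|].
      apply Rle_trans with (exp (- z * c) * w * ((hh * c) ^ 2 * exp (Rabs (hh * c)))).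
      { apply Rmult_le_compat_l; lra. }
      assert (E2 : exp (- z * c) * exp (Rabs (hh * c)) <= exp (- (z / 2) * c)).
      { rewrite <- exp_plus. apply exp_le_compat. rewrite Rabs_mult, (Rabs_right c) by lra.
        assert (Rabs hh <= z / 2) by (apply Rabs_le; lra). nra. }
      replace (exp (- z * c) * w * ((hh * c) ^ 2 * exp (Rabs (hh * c)))) with
        (((hh * c) ^ 2 * w) * (exp (- z * c) * exp (Rabs (hh * c)))) by ring.
      apply Rle_trans with (((hh * c) ^ 2 * w) * exp (- (z / 2) * c)); [|right; ring].
      apply Rmult_le_compat_l; auto. apply Rmult_le_pos; [apply pow2_ge_0|lra]. }
    pose proof (improper_lin _ _ _ _ (hh ^ 2) 0 Hcf2 Hcf2 If2 If2) as K3.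
    assert (Hu : BesK a (z + hh) - BesK a z - hh * D <= hh ^ 2 * L + 0 * L).
    { apply (improper_le g (fun t => hh ^ 2 * f2 t + 0 * f2 t)); auto; [|intros; apply Hpt].
      intros. apply (ex_derive_continuous (fun t => hh ^ 2 * f2 t + 0 * f2 t)). unfold f2, bes, cosh. auto_derive. auto. }
    assert (Hl : 0 * L + 0 * L <= BesK a (z + hh) - BesK a z - hh * D).
    { apply (improper_le (fun t => 0 * f2 t + 0 * f2 t) g); auto.
      - intros. apply (ex_derive_continuous (fun t => 0 * f2 t + 0 * f2 t)). unfold f2, bes, cosh. auto_derive. auto.
      - now apply improper_lin.
      - intros t. rewrite !Rmult_0_l, Rplus_0_l. apply Hpt. }
    rewrite Rabs_right; lra. }
  assert (HL : 0 <= L).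
  { specialize (Hest (z / 4)). rewrite Rabs_right in Hest by lra. specialize (Hest ltac:(lra)).
    pose proof (Rabs_pos (BesK a (z + z / 4) - BesK a z - z / 4 * D)).
    apply Rmult_le_reg_l with ((z / 4) ^ 2); nra. }
  intros eps He. assert (Hdel : 0 < Rmin (z / 2) (eps / (L + 1))).
  { apply Rmin_glb_lt; [lra|apply Rdiv_lt_0_compat; lra]. }
  exists (mkposreal _ Hdel). intros hh Hh0 Hh. simpl in Hh.
  pose proof (Rmin_l (z / 2) (eps / (L + 1))). pose proof (Rmin_r (z / 2) (eps / (L + 1))).
  specialize (Hest hh ltac:(lra)).
  assert (Hah : 0 < Rabs hh) by now apply Rabs_pos_lt.
  replace ((BesK a (z + hh) - BesK a z) / hh - D) with ((BesK a (z + hh) - BesK a z - hh * D) / hh) by (field; auto).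
  rewrite Rabs_div by auto. apply Rmult_lt_reg_r with (Rabs hh); auto.
  replace (Rabs (BesK a (z + hh) - BesK a z - hh * D) / Rabs hh * Rabs hh) with
    (Rabs (BesK a (z + hh) - BesK a z - hh * D)) by (field; lra).
  apply Rle_lt_trans with (1 := Hest). rewrite <- (pow2_abs hh).
  assert (Rabs hh * (L + 1) < eps).
  { replace eps with (eps / (L + 1) * (L + 1)) by (field; lra). apply Rmult_lt_compat_r; lra. }
  nra.
Qed.

(** Half the difference of the two sides is the integral of the derivative of
    [- exp(- z cosh t) sinh(a t)], which vanishes at 0 and at infinity. *)
Lemma BesK_recurrence a z : 0 < z -> z * (BesK (a + 1) z - BesK (a - 1) z) = 2 * a * BesK a z.
Proof.
  intros Hz.
  set (g := fun t => (z / 2) * (1 * bes (a + 1) z t + (-1) * bes (a - 1) z t) + (- a) * bes a z t).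
  assert (Hc1 : forall t, continuous (fun t => 1 * bes (a + 1) z t + (-1) * bes (a - 1) z t) t).
  { intros. apply (ex_derive_continuous (fun t => 1 * bes (a + 1) z t + (-1) * bes (a - 1) z t)). unfold bes, cosh. auto_derive. auto. }
  assert (Hcg : forall t, continuous g t).
  { intros. apply (ex_derive_continuous g). unfold g, bes, cosh. auto_derive. auto. }
  pose proof (improper_lin _ _ _ _ 1 (-1) (bes_continuous _ _) (bes_continuous _ _)
     (BesK_improper (a + 1) z Hz) (BesK_improper (a - 1) z Hz)) as I1.
  pose proof (improper_lin _ _ _ _ (z / 2) (- a) Hc1 (bes_continuous _ _) I1 (BesK_improper a z Hz)) as I2.
  assert (I3 : improper g 0).
  { set (G := fun t => - (exp (- z * cosh t) * sinh (a * t))).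
    assert (HG : forall M, RInt g 0 M = G M).
    { intros M. assert (HI : is_RInt g 0 M (minus (G M) (G 0))).
      { apply (is_RInt_derive G); [|intros; apply Hcg]. intros t _. unfold G, g, bes, sinh, cosh.
        auto_derive; auto. replace ((a + 1) * t) with (a * t + t) by ring. replace ((a - 1) * t) with (a * t + - t) by ring.
        replace (- (a * t + t)) with (- (a * t) + - t) by ring. replace (- (a * t + - t)) with (- (a * t) + t) by ring.
        rewrite !exp_plus. unfold Rdiv. field. }
      rewrite (is_RInt_unique _ _ _ _ HI). unfold minus, plus, opp; simpl. unfold G at 2. rewrite Rmult_0_r, sinh_0. ring. }
    apply is_lim_ext with G; [intros; symmetry; apply HG|].
    set (C := exp (2 * (Rabs a + 1) ^ 2 / z)).
    assert (HCb : forall M, 0 <= M -> Rabs (G M) <= C * exp (- M)).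
    { intros M HM. apply Rle_trans with (bes a z M); [|now apply bes_bound].
      unfold G, bes. rewrite Rabs_Ropp, Rabs_mult, (Rabs_right (exp _)) by (apply Rle_ge, Rlt_le, exp_pos).
      apply Rmult_le_compat_l; [apply Rlt_le, exp_pos|]. unfold sinh, cosh.
      pose proof (exp_pos (a * M)). pose proof (exp_pos (- (a * M))). apply Rabs_le. lra. }
    apply is_lim_spec. intros eps. assert (HC : 0 < C) by apply exp_pos.
    exists (Rmax 0 (ln (C / eps))). intros M HM. pose proof (cond_pos eps) as He.
    pose proof (Rmax_l 0 (ln (C / eps))). pose proof (Rmax_r 0 (ln (C / eps))).
    rewrite Rminus_0_r. apply Rle_lt_trans with (1 := HCb M ltac:(lra)).
    assert (HCe : 0 < C / eps) by (apply Rdiv_lt_0_compat; lra).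
    assert (exp (- M) < / (C / eps)).
    { rewrite <- (exp_ln _ HCe), <- exp_Ropp. apply exp_increasing. lra. }
    apply Rlt_le_trans with (C * / (C / eps)); [apply Rmult_lt_compat_l; lra|]. right; field; lra. }
  pose proof (improper_unique _ _ _ I2 I3) as E. lra.
Qed.

Lemma BesK_derive' a z : 0 < z -> derivable_pt_lim (BesK a) z (- BesK (a + 1) z + a / z * BesK a z).
Proof.
  intros Hz. eapply derivable_pt_lim_eq; [now apply BesK_derive|].
  pose proof (BesK_recurrence a z Hz) as E.
  replace (a / z * BesK a z) with (2 * a * BesK a z * / (2 * z)) by (field; lra). rewrite <- E. field. lra.
Qed.

(** This is [q^(-s/2) K_s(k sqrt q)]. The power makes differentiation in [q] a pure index shift, by
    the rule [(x^(-s) K_s)' = - x^(-s) K_(s+1)]. *)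
Definition bq k s q : R := exp (- (s / 2) * ln q) * BesK s (k * sqrt q).

Lemma bq_pos k s q : 0 < k -> 0 < q -> 0 < bq k s q.
Proof.
  intros Hk Hq. apply Rmult_lt_0_compat; [apply exp_pos|]. apply BesK_pos.
  apply Rmult_lt_0_compat; auto. now apply sqrt_lt_R0.
Qed.

Lemma exp_half_ln q : 0 < q -> exp (/ 2 * ln q) = sqrt q.
Proof.
  intros Hq. assert (Hs : 0 < sqrt q) by now apply sqrt_lt_R0.
  rewrite <- (sqrt_sqrt q) at 1 by lra. rewrite ln_mult by auto.
  replace (/ 2 * (ln (sqrt q) + ln (sqrt q))) with (ln (sqrt q)) by field. now apply exp_ln.
Qed.

Lemma bq_derive k s q : 0 < k -> 0 < q -> derivable_pt_lim (bq k s) q (- (k / 2) * bq k (s + 1) q).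
Proof.
  intros Hk Hq. assert (Hs : 0 < sqrt q) by now apply sqrt_lt_R0.
  assert (Hks : 0 < k * sqrt q) by now apply Rmult_lt_0_compat.
  pose proof (BesK_derive' s (k * sqrt q) Hks) as Hd. apply is_derive_Reals in Hd.
  assert (H1 : is_derive (fun q => k * sqrt q) q (k * / (2 * sqrt q))).
  { auto_derive; auto. field. lra. }
  pose proof (is_derive_comp (BesK s) (fun q => k * sqrt q) q _ _ Hd H1) as H2.
  assert (H3 : is_derive (fun q => exp (- (s / 2) * ln q)) q (exp (- (s / 2) * ln q) * (- (s / 2) / q))).
  { auto_derive; auto. field. lra. }
  pose proof (is_derive_mult _ _ q _ _ H3 H2 Rmult_comm) as H4.
  apply is_derive_Reals in H4. eapply derivable_pt_lim_eq; [exact H4|].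
  unfold plus, mult, scal; simpl; unfold mult; simpl. unfold bq.
  replace (- ((s + 1) / 2) * ln q) with (- (s / 2) * ln q + - (/ 2 * ln q)) by field.
  rewrite exp_plus, exp_Ropp, exp_half_ln by auto.
  pose proof (sqrt_sqrt q ltac:(lra)) as Hr. set (E := exp (- (s / 2) * ln q)).
  set (r := sqrt q) in *. set (B0 := BesK s (k * r)). set (B1 := BesK (s + 1) (k * r)).
  rewrite <- Hr. field. lra.
Qed.

Lemma bq_recurrence k s q : 0 < k -> 0 < q -> q * bq k (s + 1 + 1) q = bq k s q + 2 * (s + 1) / k * bq k (s + 1) q.
Proof.
  intros Hk Hq. assert (Hs : 0 < sqrt q) by now apply sqrt_lt_R0.
  assert (Hks : 0 < k * sqrt q) by now apply Rmult_lt_0_compat.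
  pose proof (BesK_recurrence (s + 1) (k * sqrt q) Hks) as E.
  replace (s + 1 - 1) with s in E by ring.
  assert (E2 : BesK (s + 1 + 1) (k * sqrt q) = BesK s (k * sqrt q) + 2 * (s + 1) / (k * sqrt q) * BesK (s + 1) (k * sqrt q)).
  { apply Rmult_eq_reg_l with (k * sqrt q); [|lra]. field_simplify; [|lra]. lra. }
  unfold bq. rewrite E2.
  replace (- ((s + 1 + 1) / 2) * ln q) with (- (s / 2) * ln q + - (/ 2 * ln q) + - (/ 2 * ln q)) by field.
  replace (- ((s + 1) / 2) * ln q) with (- (s / 2) * ln q + - (/ 2 * ln q)) by field.
  rewrite !exp_plus, exp_Ropp, exp_half_ln by auto.
  pose proof (sqrt_sqrt q ltac:(lra)) as Hr. set (E3 := exp (- (s / 2) * ln q)).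
  set (r := sqrt q) in *. set (B0 := BesK s (k * r)). set (B1 := BesK (s + 1) (k * r)).
  rewrite <- Hr. field. lra.
Qed.

(** For [s = (N - 3) / 2] one has [2 (s + 1) = N - 1], which turns the three-term recurrence into
    the radial equation. The bound [psi <= 1] is monotonicity, and the boundary flux is the number
    [theta] with [kappa = mu theta / (nu + theta)]. *)
Lemma exterior_profile (N : nat) d Rd rho K0 K1 : (2 <= N)%nat -> 0 < d -> 0 < Rd -> 0 < rho ->
  BesselK_val ((INR N - 3) / 2) (sqrt (rho / d) * Rd) K0 ->
  BesselK_val ((INR N - 3) / 2 + 1) (sqrt (rho / d) * Rd) K1 ->
  0 < K0 /\ 0 < K1 /\
  exists psi psi1 psi2,
    (forall q, 0 < q -> derivable_pt_lim psi q (psi1 q)) /\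
    (forall q, 0 < q -> derivable_pt_lim psi1 q (psi2 q)) /\
    (forall q, 0 < q -> continuity_pt psi2 q) /\
    (forall q, 0 < q -> d * (4 * q * psi2 q + 2 * INR (N - 1) * psi1 q) = rho * psi q) /\
    psi (Rd ^ 2) = 1 /\ (forall q, Rd ^ 2 <= q -> 0 < psi q <= 1) /\
    - d * (psi1 (Rd ^ 2) * (2 * Rd)) = sqrt (d * rho) * K1 / K0.
Proof.
  intros HN Hd HR Hrho HK0 HK1.
  set (tau := (INR N - 3) / 2) in *. set (k := sqrt (rho / d)) in *.
  assert (Hrd : 0 < rho / d) by (apply Rdiv_lt_0_compat; auto).
  assert (Hk : 0 < k) by now apply sqrt_lt_R0.
  assert (Hk2 : k * k = rho / d) by (apply sqrt_sqrt; lra).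
  assert (HkR : 0 < k * Rd) by now apply Rmult_lt_0_compat.
  apply BesselK_val_unique in HK0; auto. apply BesselK_val_unique in HK1; auto.
  assert (P0 : 0 < K0) by (rewrite HK0; now apply BesK_pos).
  assert (P1 : 0 < K1) by (rewrite HK1; now apply BesK_pos).
  split; auto. split; auto.
  assert (HR2 : 0 < Rd ^ 2) by nra.
  set (m0 := bq k tau (Rd ^ 2)). assert (Hm0 : 0 < m0) by now apply bq_pos.
  assert (Hm1 : bq k (tau + 1) (Rd ^ 2) / m0 = K1 / K0 / Rd).
  { unfold m0, bq. replace (sqrt (Rd ^ 2)) with Rd by (symmetry; apply sqrt_pow2; lra). rewrite <- HK0, <- HK1.
    replace (- ((tau + 1) / 2) * ln (Rd ^ 2)) with (- (tau / 2) * ln (Rd ^ 2) + - (/ 2 * ln (Rd ^ 2))) by field.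
    rewrite exp_plus, exp_Ropp, exp_half_ln by auto.
    replace (sqrt (Rd ^ 2)) with Rd by (symmetry; apply sqrt_pow2; lra).
    pose proof (exp_pos (- (tau / 2) * ln (Rd ^ 2))). field. lra. }
  assert (Hn : 2 * (tau + 1) = INR (N - 1)) by (unfold tau; rewrite minus_INR by lia; simpl; field).
  exists (fun q => / m0 * bq k tau q), (fun q => / m0 * (- (k / 2) * bq k (tau + 1) q)),
    (fun q => / m0 * (- (k / 2) * (- (k / 2) * bq k (tau + 1 + 1) q))).
  assert (D1 : forall q, 0 < q -> derivable_pt_lim (fun q => / m0 * bq k tau q) q (/ m0 * (- (k / 2) * bq k (tau + 1) q))).
  { intros. apply derivable_pt_lim_scal. now apply bq_derive. }
  split; [exact D1|]. split; [|split; [|split; [|split; [|split]]]].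
  - intros. apply derivable_pt_lim_scal, derivable_pt_lim_scal. now apply bq_derive.
  - intros. apply continuity_pt_scal, continuity_pt_scal, continuity_pt_scal.
    apply derivable_continuous_pt. eexists. now apply bq_derive.
  - intros q Hq. pose proof (bq_recurrence k tau q Hk Hq) as E.
    transitivity (d * / m0 * (k * k * (q * bq k (tau + 1 + 1) q) - k * INR (N - 1) * bq k (tau + 1) q)); [field; lra|].
    rewrite E, <- Hn. replace rho with (d * (k * k)) by (rewrite Hk2; field; lra). field. lra.
  - fold m0. field. lra.
  - intros q Hq. split; [apply Rmult_lt_0_compat; [now apply Rinv_0_lt_compat|apply bq_pos; lra]|].
    destruct Hq as [Hq|<-]; [|fold m0; right; field; lra].
    destruct (MVT_cor2 (fun q => / m0 * bq k tau q) (fun q => / m0 * (- (k / 2) * bq k (tau + 1) q)) (Rd ^ 2) q Hq) as [c [E Hc]].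
    + intros c Hc. apply D1. lra.
    + fold m0 in E. rewrite Rinv_l in E by lra.
      assert (0 < / m0 * (k / 2 * bq k (tau + 1) c)).
      { apply Rmult_lt_0_compat; [now apply Rinv_0_lt_compat|]. apply Rmult_lt_0_compat; [lra|apply bq_pos; lra]. }
      nra.
  - replace (- d * (/ m0 * (- (k / 2) * bq k (tau + 1) (Rd ^ 2)) * (2 * Rd))) with
      (d * k * Rd * (bq k (tau + 1) (Rd ^ 2) / m0)) by (field; lra).
    rewrite Hm1. replace (sqrt (d * rho)) with (d * k); [field; lra|].
    symmetry. apply sqrt_lem_1; [nra| |].
    + apply Rmult_le_pos; lra.
    + replace (d * k * (d * k)) with (d * d * (k * k)) by ring. rewrite Hk2. field. lra.
Qed.

(** * The radial initial value problem *)

(** The intervals of radius [2 B / 2^k] about [u k] are nested. The explicit rate is what the later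
    estimates use. *)
Lemma geometric_limit (u : nat -> R) B : (forall k, Rabs (u (S k) - u k) <= B / 2 ^ k) ->
  exists l, forall k, Rabs (u k - l) <= 2 * B / 2 ^ k.
Proof.
  intros Hu. set (e := fun k => 2 * B / 2 ^ k).
  assert (He : forall k, e (S k) = e k - B / 2 ^ k).
  { intros. unfold e. simpl. assert (2 ^ k <> 0) by (apply pow_nonzero; lra). field. auto. }
  assert (He0 : forall k, 0 <= B / 2 ^ k) by (intros k; eapply Rle_trans; [apply Rabs_pos|apply Hu]).
  assert (Hx : forall k j, u k - e k <= u (k + j)%nat - e (k + j)%nat).
  { intros k. induction j; [rewrite Nat.add_0_r; lra|]. rewrite Nat.add_succ_r, He.
    specialize (Hu (k + j)%nat). apply Rabs_le_between in Hu. lra. }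
  assert (Hy : forall k j, u (k + j)%nat + e (k + j)%nat <= u k + e k).
  { intros k. induction j; [rewrite Nat.add_0_r; lra|]. rewrite Nat.add_succ_r, He.
    specialize (Hu (k + j)%nat). apply Rabs_le_between in Hu. lra. }
  assert (Hep : forall k, 0 <= e k).
  { intros k. unfold e. replace (2 * B / 2 ^ k) with (2 * (B / 2 ^ k)) by (unfold Rdiv; ring). specialize (He0 k). lra. }
  assert (Hxy : forall k j, u k - e k <= u j + e j).
  { intros k j. specialize (Hx k j). specialize (Hy j k). rewrite Nat.add_comm in Hy. specialize (Hep (k + j)%nat). lra. }
  destruct (completeness (fun y => exists k, y = u k - e k)) as [l [Hub Hlub]].
  - exists (u 0%nat + e 0%nat). intros y [k ->]. apply Hxy.
  - exists (u 0%nat - e 0%nat), 0%nat. auto.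
  - exists l. intros k. fold (e k).
    assert (u k - e k <= l) by (apply Hub; now exists k).
    assert (l <= u k + e k) by (apply Hlub; intros y [j ->]; apply Hxy).
    apply Rabs_le. lra.
Qed.

Lemma Rabs_RInt_le (f : R -> R) B q : 0 <= q -> (forall p, continuous f p) -> (forall p, 0 <= p <= q -> Rabs (f p) <= B) ->
  Rabs (RInt f 0 q) <= q * B.
Proof.
  intros Hq Hc Hf. replace (q * B) with ((q - 0) * B) by ring.
  apply abs_RInt_le_const; auto. apply ex_RInt_cont; auto.
Qed.

(** The estimate behind the exponentially weighted norm: integration of [exp(K p)] gains a factor
    [1 / K]. *)
Lemma Rabs_RInt_exp (f : R -> R) B K q : 0 < K -> 0 <= q -> (forall p, continuous f p) ->
  (forall p, 0 <= p <= q -> Rabs (f p) <= B * exp (K * p)) -> 0 <= B -> Rabs (RInt f 0 q) <= B / K * exp (K * q).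
Proof.
  intros HK Hq Hc Hf HB.
  assert (H : is_RInt (fun p => B * exp (K * p)) 0 q (minus (B / K * exp (K * q)) (B / K * exp (K * 0)))).
  { apply (is_RInt_derive (fun p => B / K * exp (K * p))).
    - intros. auto_derive; auto. field. lra.
    - intros. apply (ex_derive_continuous (fun p => B * exp (K * p))). auto_derive. auto. }
  apply Rle_trans with (RInt (fun p => B * exp (K * p)) 0 q).
  - apply Rle_trans with (RInt (fun p => Rabs (f p)) 0 q).
    + apply abs_RInt_le; auto. apply ex_RInt_cont; auto.
    + apply RInt_le; auto.
      * apply ex_RInt_cont. intros. apply (continuous_comp f Rabs); auto. apply continuous_Rabs.
      * eexists; exact H.
      * intros. apply Hf. lra.
  - rewrite (is_RInt_unique _ _ _ _ H). unfold minus, plus, opp; simpl. rewrite Rmult_0_r, exp_0.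
    assert (0 <= B / K) by (apply Rdiv_le_0_compat; lra). lra.
Qed.

Lemma lipschitz_continuous (f : R -> R) K x : (forall a b, Rabs (f a - f b) <= K * Rabs (a - b)) -> continuous f x.
Proof.
  intros Hf. apply continuity_pt_filterlim. intros eps He.
  exists (eps / (Rabs K + 1)). pose proof (Rabs_pos K). split; [apply Rdiv_lt_0_compat; lra|].
  intros y [_ Hy]. simpl in *. unfold R_dist in *. apply Rle_lt_trans with (1 := Hf y x).
  apply Rle_lt_trans with ((Rabs K + 1) * Rabs (y - x)).
  - apply Rmult_le_compat_r; [apply Rabs_pos|]. pose proof (Rle_abs K). lra.
  - apply Rlt_le_trans with ((Rabs K + 1) * (eps / (Rabs K + 1))); [apply Rmult_lt_compat_l; lra|]. right; field; lra.
Qed.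

(** * Picard iteration on the whole half-line *)

Section IVP.
Context (n : nat) (c L Gm : R) (G : R -> R) (Hc : 0 < c) (HL : 0 <= L)
  (HG : forall a b, Rabs (G a - G b) <= L * Rabs (a - b)) (HGm : forall s, Rabs (G s) <= Gm).

(* [r^-(n+1) int_0^r s^n G(h(s^2)) ds] at [q = r^2], rescaled to the unit interval so that [q = 0] is harmless. *)
Definition avg (h : R -> R) q : R := RInt (fun s => s ^ n * G (h (Rmax q 0 * s ^ 2))) 0 1.

Definition Lip (h : R -> R) : Prop := forall a b, Rabs (h a - h b) <= c * Gm * Rabs (a - b).

Lemma Gm_pos : 0 <= Gm.
Proof. eapply Rle_trans; [apply Rabs_pos|apply (HGm 0)]. Qed.

Lemma avg_integrand_cont h q : Lip h -> forall s, continuous (fun s => s ^ n * G (h (Rmax q 0 * s ^ 2))) s.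
Proof.
  intros Hh s. apply (continuous_mult (fun s => s ^ n) (fun s => G (h (Rmax q 0 * s ^ 2)))).
  - apply (ex_derive_continuous (fun s => s ^ n)). auto_derive. auto.
  - apply (continuous_comp (fun s => h (Rmax q 0 * s ^ 2)) G); [|eapply lipschitz_continuous; exact HG].
    apply (continuous_comp (fun s => Rmax q 0 * s ^ 2) h); [|eapply lipschitz_continuous; exact Hh].
    apply (ex_derive_continuous (fun s => Rmax q 0 * s ^ 2)). auto_derive. auto.
Qed.

Lemma pow_unit s : 0 <= s <= 1 -> 0 <= s ^ n <= 1.
Proof. intros Hs. split; [apply pow_le; lra|]. rewrite <- (pow1 n). apply pow_incr. lra. Qed.

Lemma avg_bound h q : Lip h -> Rabs (avg h q) <= Gm.
Proof.
  intros Hh. replace Gm with (1 * Gm) by ring. apply Rabs_RInt_le; [lra|now apply avg_integrand_cont|].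
  intros s Hs. pose proof (pow_unit s Hs). rewrite Rabs_mult, (Rabs_right (s ^ n)) by lra.
  pose proof (HGm (h (Rmax q 0 * s ^ 2))). pose proof (Rabs_pos (G (h (Rmax q 0 * s ^ 2)))). nra.
Qed.

Lemma avg_diff h h' q q' B : Lip h -> Lip h' ->
  (forall s, 0 <= s <= 1 -> Rabs (h (Rmax q 0 * s ^ 2) - h' (Rmax q' 0 * s ^ 2)) <= B) ->
  Rabs (avg h q - avg h' q') <= L * B.
Proof.
  intros Hh Hh' HB.
  assert (E : avg h q - avg h' q' = RInt (fun s => s ^ n * G (h (Rmax q 0 * s ^ 2)) + (-1) * (s ^ n * G (h' (Rmax q' 0 * s ^ 2)))) 0 1).
  { rewrite (RInt_plus_R (fun s => s ^ n * G (h (Rmax q 0 * s ^ 2))) (fun s => (-1) * (s ^ n * G (h' (Rmax q' 0 * s ^ 2))))).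
    - rewrite RInt_scal_R; [unfold avg; ring|apply ex_RInt_cont; now apply avg_integrand_cont].
    - apply ex_RInt_cont; now apply avg_integrand_cont.
    - apply (ex_RInt_scal (fun s => s ^ n * G (h' (Rmax q' 0 * s ^ 2)))). apply ex_RInt_cont; now apply avg_integrand_cont. }
  rewrite E. replace (L * B) with (1 * (L * B)) by ring. apply Rabs_RInt_le; [lra| |].
  - intros s. apply (continuous_plus (fun s => s ^ n * G (h (Rmax q 0 * s ^ 2))) (fun s => (-1) * (s ^ n * G (h' (Rmax q' 0 * s ^ 2))))).
    + now apply avg_integrand_cont.
    + apply (continuous_scal_r (-1) (fun s => s ^ n * G (h' (Rmax q' 0 * s ^ 2)))). now apply avg_integrand_cont.
  - intros s Hs. pose proof (pow_unit s Hs).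
    replace (s ^ n * G (h (Rmax q 0 * s ^ 2)) + (-1) * (s ^ n * G (h' (Rmax q' 0 * s ^ 2)))) with
      (s ^ n * (G (h (Rmax q 0 * s ^ 2)) - G (h' (Rmax q' 0 * s ^ 2)))) by ring.
    rewrite Rabs_mult, (Rabs_right (s ^ n)) by lra.
    pose proof (HG (h (Rmax q 0 * s ^ 2)) (h' (Rmax q' 0 * s ^ 2))) as H1. specialize (HB s Hs).
    set (X := Rabs (G (h (Rmax q 0 * s ^ 2)) - G (h' (Rmax q' 0 * s ^ 2)))) in *.
    assert (0 <= X) by apply Rabs_pos.
    assert (L * Rabs (h (Rmax q 0 * s ^ 2) - h' (Rmax q' 0 * s ^ 2)) <= L * B) by (apply Rmult_le_compat_l; lra). nra.
Qed.

Lemma Rmax_lip a b : Rabs (Rmax a 0 - Rmax b 0) <= Rabs (a - b).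
Proof. unfold Rmax. destruct (Rle_dec a 0), (Rle_dec b 0); unfold Rabs; repeat destruct Rcase_abs; lra. Qed.

Lemma avg_cont h : Lip h -> forall q, continuous (avg h) q.
Proof.
  intros Hh q. apply (lipschitz_continuous _ (L * (c * Gm))). intros a b. pose proof Gm_pos.
  rewrite Rmult_assoc. apply avg_diff; auto. intros s Hs.
  apply Rle_trans with (1 := Hh _ _). apply Rmult_le_compat_l; [nra|].
  replace (Rmax a 0 * s ^ 2 - Rmax b 0 * s ^ 2) with ((Rmax a 0 - Rmax b 0) * s ^ 2) by ring.
  rewrite Rabs_mult, (Rabs_right (s ^ 2)) by (apply Rle_ge, pow2_ge_0). pose proof (Rmax_lip a b).
  pose proof (Rabs_pos (Rmax a 0 - Rmax b 0)). assert (0 <= s ^ 2 <= 1) by nra. nra.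
Qed.

(** The integrated form of [h' = - c avg h], [h(0) = a], which is the radial equation after one
    integration; it is used with [c = 1 / (2 D)] and [n = N - 2]. *)
Definition picard a (h : R -> R) q : R := a - c * RInt (avg h) 0 q.

Lemma picard_derive a h q : Lip h -> is_derive (picard a h) q (- c * avg h q).
Proof.
  intros Hh. unfold picard.
  assert (H1 : is_derive (fun q => RInt (avg h) 0 q) q (avg h q)).
  { apply (is_derive_RInt (avg h) (fun q => RInt (avg h) 0 q) 0 q).
    - exists (mkposreal 1 Rlt_0_1). intros y _. apply (RInt_correct (avg h)). apply ex_RInt_cont. now apply avg_cont.
    - now apply avg_cont. }
  evar_last.
  - apply (is_derive_minus (fun _ => a) (fun q => c * RInt (avg h) 0 q)); [apply is_derive_const|].
    apply (is_derive_scal (fun q => RInt (avg h) 0 q) q c _ H1).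
  - unfold minus, plus, opp, zero, scal; simpl; unfold mult; simpl. ring.
Qed.

Lemma picard_lip a h : Lip h -> Lip (picard a h).
Proof.
  intros Hh x y. unfold picard.
  replace (a - c * RInt (avg h) 0 x - (a - c * RInt (avg h) 0 y)) with (- c * (RInt (avg h) 0 x - RInt (avg h) 0 y)) by ring.
  assert (E : RInt (avg h) 0 x - RInt (avg h) 0 y = RInt (avg h) y x).
  { assert (Hex : forall u v, ex_RInt (avg h) u v) by (intros; apply ex_RInt_cont; now apply avg_cont).
    rewrite <- (RInt_Chasles (avg h) 0 y x) by auto. unfold plus; simpl. ring. }
  rewrite E, Rabs_mult, Rabs_Ropp, (Rabs_right c), Rmult_assoc by lra. apply Rmult_le_compat_l; [lra|].
  assert (Hgen : forall u v, u <= v -> Rabs (RInt (avg h) u v) <= (v - u) * Gm).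
  { intros u v Huv. apply abs_RInt_le_const; auto; [apply ex_RInt_cont; now apply avg_cont|].
    intros; now apply avg_bound. }
  destruct (Rle_lt_dec y x).
  - rewrite (Rabs_right (x - y)) by lra. rewrite Rmult_comm. now apply Hgen.
  - rewrite <- opp_RInt_swap by (apply ex_RInt_cont; now apply avg_cont). unfold opp; simpl.
    rewrite Rabs_Ropp, (Rabs_left (x - y)) by lra. specialize (Hgen x y ltac:(lra)). lra.
Qed.

Fixpoint iter_picard a (k : nat) : R -> R :=
  match k with O => (fun _ => a) | S k => picard a (iter_picard a k) end.

Lemma iter_lip a k : Lip (iter_picard a k).
Proof.
  induction k; simpl; [|now apply picard_lip]. intros x y. rewrite Rminus_diag, Rabs_R0.
  pose proof Gm_pos. apply Rmult_le_pos; [nra|apply Rabs_pos].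
Qed.

(** The rate of the weight: relative to [exp(K q)] one Picard step contracts by [c L / K <= 1 / 2],
    on the whole half-line at once. *)
Let K := 2 * c * L + 1.

Lemma picard_contract a b h h' B q : Lip h -> Lip h' -> 0 <= B -> 0 <= q ->
  (forall p, 0 <= p -> Rabs (h p - h' p) <= B * exp (K * p)) ->
  Rabs (picard a h q - picard b h' q) <= Rabs (a - b) + B / 2 * exp (K * q).
Proof.
  intros Hh Hh' HB Hq Hd.
  assert (HK : 0 < K) by (unfold K; nra).
  assert (Hex : forall h q, Lip h -> ex_RInt (avg h) 0 q) by (intros; apply ex_RInt_cont; now apply avg_cont).
  set (f := fun p => avg h p + (-1) * avg h' p).
  assert (E : picard a h q - picard b h' q = (a - b) + - c * RInt f 0 q).
  { unfold f. rewrite (RInt_plus_R (avg h) (fun p => (-1) * avg h' p)), RInt_scal_R; auto; [unfold picard; ring|].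
    apply (ex_RInt_scal (avg h')); auto. }
  rewrite E. eapply Rle_trans; [apply Rabs_triang|]. apply Rplus_le_compat_l.
  rewrite Rabs_mult, Rabs_Ropp, (Rabs_right c) by lra.
  assert (HfI : Rabs (RInt f 0 q) <= L * B / K * exp (K * q)).
  { apply Rabs_RInt_exp; auto; [| |nra].
    - intros. apply (continuous_plus (avg h) (fun p => (-1) * avg h' p)); [now apply avg_cont|].
      apply (continuous_scal_r (-1) (avg h')). now apply avg_cont.
    - intros p Hp. unfold f. replace (avg h p + (-1) * avg h' p) with (avg h p - avg h' p) by ring.
      rewrite Rmult_assoc. apply avg_diff; auto. intros s Hs. rewrite Rmax_left by lra.
      assert (0 <= s ^ 2 <= 1) by nra.
      apply Rle_trans with (1 := Hd (p * s ^ 2) ltac:(nra)). apply Rmult_le_compat_l; auto.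
      apply exp_le_compat. apply Rmult_le_compat_l; nra. }
  apply Rle_trans with (c * (L * B / K * exp (K * q))); [apply Rmult_le_compat_l; lra|].
  replace (c * (L * B / K * exp (K * q))) with (c * L / K * (B * exp (K * q))) by (field; lra).
  replace (B / 2 * exp (K * q)) with (/ 2 * (B * exp (K * q))) by field.
  apply Rmult_le_compat_r; [apply Rmult_le_pos; auto; apply Rlt_le, exp_pos|].
  apply Rmult_le_reg_r with K; auto. replace (c * L / K * K) with (c * L) by (field; lra). unfold K. lra.
Qed.

Lemma iter_step a q : 0 <= q -> forall k,
  Rabs (iter_picard a (S k) q - iter_picard a k q) <= c * Gm * exp (K * q) / 2 ^ k.
Proof.
  intros Hq k. assert (HK : 1 <= K) by (unfold K; nra). pose proof Gm_pos.
  assert (Hmain : forall k q, 0 <= q -> Rabs (iter_picard a (S k) q - iter_picard a k q) <= (c * Gm / 2 ^ k) * exp (K * q)).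
  { clear q Hq k. induction k; intros q Hq.
    - simpl iter_picard at 2. simpl. unfold picard.
      replace (a - c * RInt (avg (fun _ => a)) 0 q - a) with (- c * RInt (avg (fun _ => a)) 0 q) by ring.
      rewrite Rabs_mult, Rabs_Ropp, (Rabs_right c) by lra.
      assert (Rabs (RInt (avg (fun _ => a)) 0 q) <= q * Gm).
      { apply Rabs_RInt_le; auto; [intros; apply avg_cont, (iter_lip a 0)|intros; apply avg_bound, (iter_lip a 0)]. }
      pose proof (exp_ineq1_le (K * q)). assert (q <= exp (K * q)) by nra.
      apply Rle_trans with (c * (q * Gm)); [apply Rmult_le_compat_l; lra|].
      replace (c * Gm / 1 * exp (K * q)) with (c * (exp (K * q) * Gm)) by field.
      apply Rmult_le_compat_l; [lra|]. apply Rmult_le_compat_r; lra.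
    - assert (H2 : 0 < 2 ^ k) by (apply pow_lt; lra).
      assert (HB : 0 <= c * Gm / 2 ^ k) by (apply Rdiv_le_0_compat; [apply Rmult_le_pos; lra|auto]).
      pose proof (picard_contract a a _ _ _ q (iter_lip a (S k)) (iter_lip a k) HB Hq IHk) as Hp.
      rewrite Rminus_diag, Rabs_R0, Rplus_0_l in Hp.
      replace (c * Gm / 2 ^ S k) with (c * Gm / 2 ^ k / 2) by (simpl; field; lra). exact Hp. }
  specialize (Hmain k q Hq). replace (c * Gm * exp (K * q) / 2 ^ k) with (c * Gm / 2 ^ k * exp (K * q)); auto.
  assert (2 ^ k <> 0) by (apply pow_nonzero; lra). field. auto.
Qed.

Lemma iter_limit a q : exists l, forall k, 0 <= q -> Rabs (iter_picard a k q - l) <= 2 * (c * Gm * exp (K * q)) / 2 ^ k.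
Proof.
  destruct (Rle_lt_dec 0 q) as [Hq|Hq].
  - destruct (geometric_limit (fun k => iter_picard a k q) (c * Gm * exp (K * q))) as [l Hl].
    + intros k. now apply iter_step.
    + exists l. auto.
  - exists 0. intros; lra.
Qed.

Definition ivp_core a q : R := proj1_sig (constructive_indefinite_description _ (iter_limit a (Rmax q 0))).

Lemma ivp_core_approx a q k : 0 <= q -> Rabs (iter_picard a k q - ivp_core a q) <= 2 * (c * Gm * exp (K * q)) / 2 ^ k.
Proof.
  intros Hq. unfold ivp_core. destruct constructive_indefinite_description as [l Hl]. simpl.
  rewrite Rmax_left in Hl by lra. auto.
Qed.

Lemma le_of_geometric x y B : (forall k, x <= y + B / 2 ^ k) -> x <= y.
Proof.
  intros H. apply Rnot_lt_le. intros Hlt.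
  assert (HB : 0 < B). { specialize (H 0%nat). simpl in H. lra. }
  destruct (pow_lt_1_zero (/ 2) ltac:(rewrite Rabs_right; lra) ((x - y) / B)) as [k Hk]; [apply Rdiv_lt_0_compat; lra|].
  specialize (Hk k (le_n k)). rewrite Rabs_right in Hk by (apply Rle_ge, pow_le; lra).
  specialize (H k). assert (B / 2 ^ k < x - y); [|lra].
  unfold Rdiv. rewrite <- pow_inv. replace (x - y) with (B * ((x - y) / B)) by (field; lra).
  now apply Rmult_lt_compat_l.
Qed.

Lemma ivp_core_lip a : Lip (ivp_core a).
Proof.
  intros x y. assert (Hc0 : forall x, ivp_core a x = ivp_core a (Rmax x 0)).
  { intros. unfold ivp_core. rewrite (Rmax_left (Rmax x0 0) 0) by apply Rmax_r. reflexivity. }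
  rewrite (Hc0 x), (Hc0 y). pose proof Gm_pos.
  apply Rle_trans with (c * Gm * Rabs (Rmax x 0 - Rmax y 0)).
  2:{ apply Rmult_le_compat_l; [nra|apply Rmax_lip]. }
  set (u := Rmax x 0). set (v := Rmax y 0).
  assert (Hu : 0 <= u) by apply Rmax_r. assert (Hv : 0 <= v) by apply Rmax_r.
  apply (le_of_geometric _ _ (2 * (c * Gm * exp (K * u)) + 2 * (c * Gm * exp (K * v)))). intros k.
  pose proof (ivp_core_approx a u k Hu) as H1. pose proof (ivp_core_approx a v k Hv) as H2.
  pose proof (iter_lip a k u v) as H3.
  replace (ivp_core a u - ivp_core a v) with (- (iter_picard a k u - ivp_core a u) +
    ((iter_picard a k u - iter_picard a k v) + (iter_picard a k v - ivp_core a v))) by ring.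
  eapply Rle_trans; [apply Rabs_triang|]. rewrite Rabs_Ropp.
  pose proof (Rabs_triang (iter_picard a k u - iter_picard a k v) (iter_picard a k v - ivp_core a v)).
  unfold Rdiv in *. rewrite Rmult_plus_distr_r. lra.
Qed.

(** One more Picard step turns the limit into a function differentiable on all of R. For [0 <= q] it
    coincides with [ivp_core], which is frozen for negative [q] and so far only known to be
    Lipschitz. *)
Definition ivp a q : R := picard a (ivp_core a) q.

Lemma ivp_eq_core a q : 0 <= q -> ivp a q = ivp_core a q.
Proof.
  intros Hq. assert (Rabs (ivp a q - ivp_core a q) <= 0).
  { apply (le_of_geometric _ _ (2 * (2 * (c * Gm * exp (K * q))))). intros k. pose proof Gm_pos.
    assert (H2 : 0 < 2 ^ k) by (apply pow_lt; lra).
    assert (HB : 0 <= 2 * (c * Gm) / 2 ^ k) by (apply Rdiv_le_0_compat; [nra|auto]).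
    pose proof (picard_contract a a (iter_picard a k) (ivp_core a) (2 * (c * Gm) / 2 ^ k) q (iter_lip a k) (ivp_core_lip a) HB Hq) as H1.
    rewrite Rminus_diag, Rabs_R0, Rplus_0_l in H1.
    assert (Hd : forall p, 0 <= p -> Rabs (iter_picard a k p - ivp_core a p) <= 2 * (c * Gm) / 2 ^ k * exp (K * p)).
    { intros p Hp. eapply Rle_trans; [now apply ivp_core_approx|]. right. field. lra. }
    specialize (H1 Hd). pose proof (ivp_core_approx a q (S k) Hq) as H3. simpl iter_picard in H3.
    unfold ivp. replace (picard a (ivp_core a) q - ivp_core a q) with
      (- (picard a (iter_picard a k) q - picard a (ivp_core a) q) + (picard a (iter_picard a k) q - ivp_core a q)) by ring.
    eapply Rle_trans; [apply Rabs_triang|]. rewrite Rabs_Ropp.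
    replace (2 * (c * Gm * exp (K * q)) / 2 ^ S k) with (c * Gm * exp (K * q) / 2 ^ k) in H3 by (simpl; field; lra).
    replace (2 * (c * Gm) / 2 ^ k / 2 * exp (K * q)) with (c * Gm * exp (K * q) / 2 ^ k) in H1 by (field; lra).
    replace (0 + 2 * (2 * (c * Gm * exp (K * q))) / 2 ^ k) with (4 * (c * Gm * exp (K * q) / 2 ^ k)) by (field; lra).
    assert (0 <= c * Gm * exp (K * q) / 2 ^ k).
    { apply Rdiv_le_0_compat; auto. apply Rmult_le_pos; [nra|apply Rlt_le, exp_pos]. } lra. }
  pose proof (Rabs_pos (ivp a q - ivp_core a q)).
  assert (Rabs (ivp a q - ivp_core a q) = 0) by lra. apply Rabs_eq_0 in H1. lra.
Qed.

Definition ivp_avg a q : R := avg (ivp_core a) q.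

Lemma ivp_derive a q : derivable_pt_lim (ivp a) q (- c * ivp_avg a q).
Proof. apply is_derive_Reals. apply picard_derive, ivp_core_lip. Qed.

Lemma ivp_avg_cont a q : continuity_pt (ivp_avg a) q.
Proof. apply continuity_pt_filterlim. apply avg_cont, ivp_core_lip. Qed.

Lemma ivp_0 a : ivp a 0 = a.
Proof. unfold ivp, picard. rewrite RInt_point. unfold zero; simpl. ring. Qed.

(** The bound [2 |a - b| exp(K q)] is inherited by each iterate: the Picard step halves it, and the
    initial values add [|a - b|]. *)
Lemma ivp_diff a b q : 0 <= q -> Rabs (ivp a q - ivp b q) <= 2 * Rabs (a - b) * exp (K * q).
Proof.
  assert (HK : 1 <= K) by (unfold K; nra).
  assert (Hit : forall k q, 0 <= q -> Rabs (iter_picard a k q - iter_picard b k q) <= 2 * Rabs (a - b) * exp (K * q)).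
  { induction k; intros p Hp; pose proof (Rabs_pos (a - b));
      assert (He : 1 <= exp (K * p)) by (pose proof (exp_ineq1_le (K * p)); assert (0 <= K * p) by (apply Rmult_le_pos; lra); lra).
    - change (Rabs (a - b) <= 2 * Rabs (a - b) * exp (K * p)). rewrite Rmult_assoc. nra.
    - pose proof (picard_contract a b _ _ (2 * Rabs (a - b)) p (iter_lip a k) (iter_lip b k) ltac:(lra) Hp IHk) as H1.
      apply Rle_trans with (1 := H1). assert (Rabs (a - b) * 1 <= Rabs (a - b) * exp (K * p)) by (apply Rmult_le_compat_l; lra). lra. }
  intros Hq. rewrite !ivp_eq_core by auto.
  apply (le_of_geometric _ _ (2 * (2 * (c * Gm * exp (K * q))))). intros k.
  pose proof (ivp_core_approx a q k Hq) as H1. pose proof (ivp_core_approx b q k Hq) as H2.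
  pose proof (Hit k q Hq) as H3.
  replace (ivp_core a q - ivp_core b q) with (- (iter_picard a k q - ivp_core a q) +
    ((iter_picard a k q - iter_picard b k q) + (iter_picard b k q - ivp_core b q))) by ring.
  eapply Rle_trans; [apply Rabs_triang|]. rewrite Rabs_Ropp.
  pose proof (Rabs_triang (iter_picard a k q - iter_picard b k q) (iter_picard b k q - ivp_core b q)).
  unfold Rdiv in *. lra.
Qed.

Lemma ivp_avg_diff a b q : 0 <= q -> Rabs (ivp_avg a q - ivp_avg b q) <= L * (2 * Rabs (a - b) * exp (K * q)).
Proof.
  intros Hq. assert (HK : 1 <= K) by (unfold K; nra).
  apply avg_diff; [apply ivp_core_lip|apply ivp_core_lip|]. intros s Hs. rewrite Rmax_left by lra.
  assert (0 <= s ^ 2 <= 1) by nra. assert (Hqs : 0 <= q * s ^ 2 <= q) by nra.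
  rewrite <- !ivp_eq_core by lra. eapply Rle_trans; [apply ivp_diff; lra|].
  apply Rmult_le_compat_l; [pose proof (Rabs_pos (a - b)); lra|]. apply exp_le_compat. apply Rmult_le_compat_l; lra.
Qed.

Lemma ivp_const a : G a = 0 -> forall q, 0 <= q -> ivp a q = a.
Proof.
  intros Ha q Hq. assert (Hit : forall k q, iter_picard a k q = a).
  { induction k; intros p; auto. simpl. unfold picard.
    assert (E : RInt (avg (iter_picard a k)) 0 p = 0).
    { rewrite (RInt_ext _ (fun _ => 0)); [rewrite RInt_const; unfold scal; simpl; unfold mult; simpl; ring|].
      intros x _. unfold avg. rewrite (RInt_ext _ (fun _ => 0)); [rewrite RInt_const; unfold scal; simpl; unfold mult; simpl; ring|].
      intros s _. rewrite IHk, Ha. apply Rmult_0_r. }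
    rewrite E. ring. }
  rewrite ivp_eq_core by auto. assert (Rabs (a - ivp_core a q) <= 0).
  { apply (le_of_geometric _ _ (2 * (c * Gm * exp (K * q)))). intros k.
    pose proof (ivp_core_approx a q k Hq). rewrite Hit in H. lra. }
  pose proof (Rabs_pos (a - ivp_core a q)). assert (H1 : Rabs (a - ivp_core a q) = 0) by lra. apply Rabs_eq_0 in H1. lra.
Qed.

Lemma ivp_avg_0 a : (INR n + 1) * ivp_avg a 0 = G a.
Proof.
  unfold ivp_avg, avg. pose proof (pos_INR n).
  assert (H1 : is_RInt (fun s => s ^ n * G a) 0 1 (minus (/ (INR n + 1) * 1 ^ (S n) * G a) (/ (INR n + 1) * 0 ^ (S n) * G a))).
  { apply (is_RInt_derive (fun s => / (INR n + 1) * s ^ (S n) * G a)).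
    - intros. auto_derive; auto. change (match n with O => 1 | S _ => INR n + 1 end) with (INR (S n)); rewrite S_INR. simpl pred. field. lra.
    - intros. apply (ex_derive_continuous (fun s => s ^ n * G a)). auto_derive. auto. }
  rewrite (RInt_ext _ (fun s => s ^ n * G a)).
  - rewrite (is_RInt_unique _ _ _ _ H1). unfold minus, plus, opp; simpl. rewrite pow1. field. lra.
  - intros s _. rewrite Rmax_left, Rmult_0_l by lra. rewrite <- ivp_eq_core, ivp_0 by lra. reflexivity.
Qed.

(** Undoing the rescaling, the average at [q = r^2] is [r^-(n+1)] times an integral over [[0, r]],
    which can be differentiated away from [q = 0]. *)
Lemma ivp_avg_derive a q : 0 < q ->
  derivable_pt_lim (ivp_avg a) q ((G (ivp a q) - (INR n + 1) * ivp_avg a q) / (2 * q)).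
Proof.
  intros Hq. set (f := fun s => s ^ n * G (ivp_core a (s ^ 2))).
  assert (Hcf : forall s, continuous f s).
  { intros s. unfold f. apply (continuous_mult (fun s => s ^ n) (fun s => G (ivp_core a (s ^ 2)))).
    - apply (ex_derive_continuous (fun s => s ^ n)). auto_derive. auto.
    - apply (continuous_comp (fun s => ivp_core a (s ^ 2)) G); [|eapply lipschitz_continuous; exact HG].
      apply (continuous_comp (fun s => s ^ 2) (ivp_core a)); [|eapply lipschitz_continuous; apply ivp_core_lip].
      apply (ex_derive_continuous (fun s => s ^ 2)). auto_derive. auto. }
  assert (E : forall p, 0 < p -> ivp_avg a p = RInt f 0 (sqrt p) * / (sqrt p) ^ (S n)).
  { intros p Hp. set (r := sqrt p). assert (Hr : 0 < r) by now apply sqrt_lt_R0.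
    assert (Hr2 : r * r = p) by (apply sqrt_sqrt; lra).
    assert (H1 : RInt f (r * 0 + 0) (r * 1 + 0) = RInt (fun s => r ^ (S n) * (s ^ n * G (ivp_core a (Rmax p 0 * s ^ 2)))) 0 1).
    { rewrite <- (RInt_comp_lin f r 0 0 1) by (apply ex_RInt_cont; auto).
      apply RInt_ext. intros s _. unfold scal; simpl; unfold mult; simpl. unfold f.
      rewrite Rplus_0_r, Rpow_mult_distr, Rmax_left by lra. rewrite <- Hr2.
      replace ((r * s) ^ 2) with (r * r * (s * (s * 1))) by ring. ring. }
    rewrite RInt_scal_R in H1 by (apply ex_RInt_cont, avg_integrand_cont, ivp_core_lip).
    rewrite Rmult_0_r, Rmult_1_r, !Rplus_0_r in H1. rewrite H1. fold (avg (ivp_core a) p). fold (ivp_avg a p).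
    change (ivp_avg a p = r ^ (S n) * ivp_avg a p * / r ^ (S n) :> R). field. apply pow_nonzero; lra. }
  set (r := sqrt q). assert (Hr : 0 < r) by now apply sqrt_lt_R0.
  assert (Hr2 : r * r = q) by (apply sqrt_sqrt; lra).
  apply is_derive_Reals.
  apply is_derive_ext_loc with (fun p => RInt f 0 (sqrt p) * / (sqrt p) ^ (S n)).
  { exists (mkposreal q Hq). intros y Hy. symmetry. apply E.
    unfold ball in Hy; simpl in Hy; unfold AbsRing_ball, abs, minus, plus, opp in Hy; simpl in Hy.
    apply Rabs_lt_between in Hy. lra. }
  assert (H1 : is_derive (fun r => RInt f 0 r) r (f r)).
  { apply (is_derive_RInt f (fun r => RInt f 0 r) 0 r).
    - exists (mkposreal 1 Rlt_0_1). intros y _. apply (RInt_correct f). now apply ex_RInt_cont.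
    - apply Hcf. }
  assert (H2 : is_derive (fun r => / r ^ (S n)) r (- (INR n + 1) * / r ^ (S (S n)))).
  { auto_derive; [apply (pow_nonzero r (S n)); lra|]. change (match n with O => 1 | S _ => INR n + 1 end) with (INR (S n)); rewrite <- S_INR. simpl pred.
    rewrite <- !tech_pow_Rmult. field. split; [apply pow_nonzero|]; lra. }
  pose proof (is_derive_mult (fun r => RInt f 0 r) (fun r => / r ^ (S n)) r _ _ H1 H2 Rmult_comm) as H3.
  assert (H4 : is_derive sqrt q (/ (2 * r))).
  { apply is_derive_Reals. apply derivable_pt_lim_sqrt. auto. }
  pose proof (is_derive_comp (fun r => mult (RInt f 0 r) (/ r ^ (S n))) sqrt q _ _ H3 H4) as H5.
  evar_last; [exact H5|].
  unfold scal, plus, mult; simpl; unfold mult; simpl. rewrite E by auto. fold r.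
  unfold f at 1. replace (r ^ 2) with q by (rewrite <- Hr2; ring). rewrite ivp_eq_core by lra.
  simpl pow. rewrite <- Hr2. field. split; [apply pow_nonzero|]; lra.
Qed.

Lemma ivp_avg_nonneg a q : (forall s, 0 <= G s) -> 0 <= ivp_avg a q.
Proof.
  intros HG0. unfold ivp_avg, avg. apply RInt_ge_0; [lra| |].
  - apply ex_RInt_cont, avg_integrand_cont, ivp_core_lip.
  - intros s Hs. apply Rmult_le_pos; [apply pow_le; lra|apply HG0].
Qed.

(** Near [s = 0] the solution is close to [a], so the nonnegative integrand is positive on a small
    interval. *)
Lemma ivp_avg_pos a q : (forall s, 0 <= G s) -> 0 < G a -> 0 <= q -> 0 < ivp_avg a q.
Proof.
  intros HG0 Ha Hq. set (f := fun s => s ^ n * G (ivp_core a (Rmax q 0 * s ^ 2))).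
  assert (Hcf : forall s, continuous f s) by (apply avg_integrand_cont, ivp_core_lip).
  assert (Hc0 : continuous (fun s => G (ivp_core a (Rmax q 0 * s ^ 2))) 0).
  { apply (continuous_comp (fun s => ivp_core a (Rmax q 0 * s ^ 2)) G); [|eapply lipschitz_continuous; exact HG].
    apply (continuous_comp (fun s => Rmax q 0 * s ^ 2) (ivp_core a)); [|eapply lipschitz_continuous; apply ivp_core_lip].
    apply (ex_derive_continuous (fun s => Rmax q 0 * s ^ 2)). auto_derive. auto. }
  destruct (Hc0 (fun y => 0 < y)) as [del Hdel].
  { rewrite (pow_i 2), Rmult_0_r by lia. rewrite <- ivp_eq_core, ivp_0 by lra. exists (mkposreal _ Ha).
    intros y Hy. unfold ball in Hy; simpl in Hy; unfold AbsRing_ball, abs, minus, plus, opp in Hy; simpl in Hy.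
    apply Rabs_lt_between in Hy. lra. }
  set (x := Rmin (del / 2) (1 / 2)). pose proof (cond_pos del).
  assert (Hx : 0 < x) by (apply Rmin_glb_lt; lra). assert (Hx1 : x <= del / 2) by apply Rmin_l.
  assert (Hx2 : x <= 1 / 2) by apply Rmin_r.
  assert (Hex : forall u v, ex_RInt f u v) by (intros; apply ex_RInt_cont; auto).
  change (0 < RInt f 0 1). rewrite <- (RInt_Chasles f 0 x 1) by auto. unfold plus; simpl.
  assert (0 < RInt f 0 x).
  { apply RInt_gt_0; auto. intros s Hs. apply Rmult_lt_0_compat; [apply pow_lt; lra|]. apply (Hdel s).
    unfold ball; simpl; unfold AbsRing_ball, abs, minus, plus, opp; simpl. apply Rabs_lt_between. lra. }
  assert (0 <= RInt f x 1).
  { apply RInt_ge_0; [lra|auto|]. intros s Hs. apply Rmult_le_pos; [apply pow_le; lra|apply HG0]. }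
  lra.
Qed.
End IVP.

(** * Shooting for the Robin condition *)

(** Freezing the reaction outside [[0, 1]] makes it globally Lipschitz and bounded, as the initial
    value problem requires; the profiles finally retained have values in [[0, 1]]. *)
Definition clamp (s : R) : R := Rmin 1 (Rmax 0 s).

Lemma clamp_range s : 0 <= clamp s <= 1.
Proof. unfold clamp, Rmin, Rmax. destruct (Rle_dec 0 s), (Rle_dec 1 _); lra. Qed.

Lemma clamp_id s : 0 <= s <= 1 -> clamp s = s.
Proof. intros. unfold clamp. rewrite Rmax_right, Rmin_right; lra. Qed.

Lemma clamp_lip a b : Rabs (clamp a - clamp b) <= Rabs (a - b).
Proof.
  unfold clamp, Rmin, Rmax. destruct (Rle_dec 0 a), (Rle_dec 0 b);
    repeat destruct (Rle_dec 1 _); unfold Rabs; repeat destruct Rcase_abs; lra.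
Qed.

(** [h a] is the radial solution starting at [a], and [A a] its rescaled flux: [h' = - A / (2 D)],
    so that [D] times the outward normal derivative at the boundary is [- R A(R^2)]. *)
Record radial_family (m : model) (h A : R -> R -> R) : Prop := {
  rf_0 : forall a, h a 0 = a;
  rf_derive : forall a q, derivable_pt_lim (h a) q (- / (2 * difD m) * A a q);
  rf_cont : forall a q, continuity_pt (A a) q;
  rf_derive2 : forall a q, 0 < q -> derivable_pt_lim (A a) q
    ((reac m (clamp (h a q)) - INR (dimN m - 1) * A a q) / (2 * q));
  rf_A0 : forall a, INR (dimN m - 1) * A a 0 = reac m (clamp a);
  rf_lip : forall q, 0 <= q -> exists B, 0 <= B /\ forall a b,
    Rabs (h a q - h b q) <= B * Rabs (a - b) /\ Rabs (A a q - A b q) <= B * Rabs (a - b);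
  rf_one : forall q, 0 <= q -> h 1 q = 1;
  rf_nonneg : forall a q, 0 <= A a q;
  rf_pos : forall a q, 0 < a < 1 -> 0 <= q -> 0 < A a q }.

Lemma radial_family_exists m : model_ok m -> exists h A, radial_family m h A.
Proof.
  intros Hm. pose proof Hm as [HN [HD _]].
  destruct (reac_lipschitz m Hm 1) as [L [HL HLip]].
  set (G := fun s => reac m (clamp s)).
  assert (HG : forall a b, Rabs (G a - G b) <= L * Rabs (a - b)).
  { intros a b. pose proof (clamp_range a). pose proof (clamp_range b).
    eapply Rle_trans; [apply HLip; lra|]. apply Rmult_le_compat_l; auto. apply clamp_lip. }
  assert (HGm : forall s, Rabs (G s) <= L).
  { intros s. pose proof (clamp_range s). pose proof (HLip (clamp s) 0 ltac:(lra) ltac:(lra)) as H1.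
    rewrite (reac_0 m Hm), !Rminus_0_r, (Rabs_right (clamp s)) in H1 by lra. unfold G.
    eapply Rle_trans; [exact H1|]. nra. }
  assert (Hg0 : forall s, 0 <= s <= 1 -> 0 <= reac m s).
  { intros s Hs. destruct (Req_dec s 0) as [->|H0]; [rewrite (reac_0 m Hm); lra|].
    destruct (Req_dec s 1) as [->|H1]; [|apply Rlt_le, reac_pos; auto; lra].
    destruct (model_KPP m Hm) as [[_ [_ [_ [-> _]]]] _]. lra. }
  assert (HG0 : forall s, 0 <= G s) by (intros s; apply Hg0, clamp_range).
  assert (Hc : 0 < / (2 * difD m)) by (apply Rinv_0_lt_compat; lra).
  assert (En : INR (dimN m - 1) = INR (dimN m - 2) + 1).
  { rewrite <- S_INR. f_equal. lia. }
  exists (ivp (dimN m - 2) (/ (2 * difD m)) L L G Hc HL HG HGm), (ivp_avg (dimN m - 2) (/ (2 * difD m)) L L G Hc HL HG HGm).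
  split; intros.
  - apply ivp_0.
  - apply ivp_derive.
  - apply ivp_avg_cont.
  - rewrite En. exact (ivp_avg_derive _ _ _ _ G _ _ _ _ a q H).
  - rewrite En. exact (ivp_avg_0 _ _ _ _ G _ _ _ _ a).
  - set (e := exp ((2 * / (2 * difD m) * L + 1) * q)). assert (0 < e) by apply exp_pos.
    exists (2 * e + L * (2 * e)). split; [nra|]. intros a b. pose proof (Rabs_pos (a - b)).
    split.
    + eapply Rle_trans; [apply ivp_diff; auto|]. fold e. assert (0 <= L * (2 * e) * Rabs (a - b)) by (apply Rmult_le_pos; nra). nra.
    + eapply Rle_trans; [apply ivp_avg_diff; auto|]. fold e. assert (0 <= 2 * e * Rabs (a - b)) by (apply Rmult_le_pos; nra). nra.
  - apply ivp_const; auto. unfold G. rewrite clamp_id by lra.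
    apply (model_KPP m Hm).
  - apply ivp_avg_nonneg; auto.
  - apply ivp_avg_pos; auto. unfold G. rewrite clamp_id by lra. apply reac_pos; auto.
Qed.

(** Continuity of [f] is enough at 0. This supplies the second derivatives at [y = 0], where [A] is
    only known to be continuous. *)
Lemma derivable_id_mul f : continuity_pt f 0 -> derivable_pt_lim (fun s => s * f s) 0 (f 0).
Proof.
  intros Hf eps He. destruct (Hf eps He) as [del [Hd H]]. exists (mkposreal del Hd). simpl.
  intros s Hs Hsd. replace (((0 + s) * f (0 + s) - 0 * f 0) / s - f 0) with (f s - f 0) by (rewrite Rplus_0_l; field; auto).
  apply (H s). split; [split; [exact I|auto]|]. simpl. unfold R_dist. now rewrite Rminus_0_r.
Qed.

(** * Radial solutions as functions on the cylinder *)

Section RadialJet.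
Context (m : model) (Hm : model_ok m) (h A : R -> R -> R) (HF : radial_family m h A).
Local Notation N := (dimN m).
Let c := / (2 * difD m).
(** For [q > 0] this is [2 q] times the derivative of [A a]. It vanishes at [q = 0], which
    compensates the factor [z_k^2 / q] in the second derivatives. *)
Let defect a q := reac m (clamp (h a q)) - INR (N - 1) * A a q.

Definition jrad (a : R) : jet :=
  mkjet (fun z _ => h a (rad 1 N z)) (fun _ _ => 0)
    (fun k z _ => if Nat.ltb k 1 then 0 else z k * (-2 * c * A a (rad 1 N z)))
    (fun k z _ => if Nat.ltb k 1 then 0 else
       -2 * c * A a (rad 1 N z) + -2 * c * (z k ^ 2 / rad 1 N z * defect a (rad 1 N z))).

Lemma h_cont a q : continuity_pt (h a) q.
Proof. apply derivable_continuous_pt. eexists. apply (rf_derive _ _ _ HF). Qed.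

Lemma clamp_cont s : continuity_pt clamp s.
Proof.
  intros eps He. exists eps. split; auto. intros y [_ Hy]. simpl in *. unfold R_dist in *.
  eapply Rle_lt_trans; [apply clamp_lip|auto].
Qed.

Lemma defect_cont a q : continuity_pt (defect a) q.
Proof.
  unfold defect. apply continuity_pt_minus.
  - apply (continuity_pt_comp (fun q => clamp (h a q)) (reac m)); [|now apply reac_continuous].
    apply (continuity_pt_comp (h a) clamp); [apply h_cont|apply clamp_cont].
  - apply continuity_pt_mult; [apply continuity_pt_const; red; auto|apply (rf_cont _ _ _ HF)].
Qed.

Lemma defect_0 a : defect a 0 = 0.
Proof. unfold defect. rewrite (rf_0 _ _ _ HF), (rf_A0 _ _ _ HF). ring. Qed.

Lemma djet_rad a z t : djet N (jrad a) z t.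
Proof.
  split; [apply derivable_pt_lim_const|]. intros k Hk. destruct (djet_q N z t) as [_ Hq].
  destruct (Hq k Hk) as [Hq1 _]. cbn [jw j1 jq] in Hq1. cbn [jw j1 j2 jrad].
  destruct (Nat.ltb_spec k 1) as [Hk1|Hk1].
  - split; [|apply derivable_pt_lim_const]. eapply derivable_pt_lim_eq.
    + apply (derivable_pt_lim_comp (fun s => rad 1 N (setc z k s)) (h a)); [exact Hq1|apply (rf_derive _ _ _ HF)].
    + ring.
  - split.
    + eapply derivable_pt_lim_eq.
      * apply (derivable_pt_lim_comp (fun s => rad 1 N (setc z k s)) (h a)); [exact Hq1|apply (rf_derive _ _ _ HF)].
      * rewrite setc_same. unfold c. ring.
    + apply derivable_pt_lim_ext with (fun s => s * (-2 * c * A a (rad 1 N (setc z k s)))).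
      { intros. now rewrite setc_at. }
      pose proof (rad_nonneg 1 N z) as H0. pose proof (coord_sq_le_rad N z k ltac:(lia)) as Hz.
      destruct (Rle_lt_or_eq_dec _ _ H0) as [Hp|Hp].
      * eapply derivable_pt_lim_eq.
        -- apply (derivable_pt_lim_mult (fun s => s) (fun s => -2 * c * A a (rad 1 N (setc z k s)))); [apply derivable_pt_lim_id|].
           apply derivable_pt_lim_scal.
           apply (derivable_pt_lim_comp (fun s => rad 1 N (setc z k s)) (A a)); [exact Hq1|].
           rewrite setc_same. now apply (rf_derive2 _ _ _ HF).
        -- cbv beta. rewrite setc_same. unfold defect. field. lra.
      * assert (Hzk : z k = 0) by nra. rewrite <- Hp, Hzk.
        replace (-2 * c * A a 0 + -2 * c * (0 ^ 2 / 0 * defect a 0)) with (-2 * c * A a (rad 1 N (setc z k 0))).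
        2:{ rewrite <- Hzk, setc_same, <- Hp, Hzk. unfold Rdiv. ring. }
        apply (derivable_id_mul (fun s => -2 * c * A a (rad 1 N (setc z k s)))).
        apply continuity_pt_mult; [apply continuity_pt_const; red; auto|].
        apply (continuity_pt_comp (fun s => rad 1 N (setc z k s)) (A a)); [|apply (rf_cont _ _ _ HF)].
        rewrite <- Hzk. apply derivable_continuous_pt. eexists. exact Hq1.
Qed.

Lemma cont_on_radial S (f : R -> R) : (forall q, continuity_pt f q) -> cont_on N S (fun z _ => f (rad 1 N z)).
Proof. intros Hf. apply (cont_on_comp N S (fun z _ => rad 1 N z) f); auto. apply cont_on_rad. Qed.

Lemma creg_rad O B T0 a : creg N O B T0 (jrad a).
Proof.
  split; [intros; apply djet_rad|]. split; [apply cont_on_radial, h_cont|].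
  intros k Hk. cbn [j1 jrad]. destruct (Nat.ltb k 1); [apply cont_on_const|].
  apply cont_on_mult; [now apply cont_on_coord|]. apply cont_on_scal, cont_on_radial, (rf_cont _ _ _ HF).
Qed.

(** Off the axis every factor is continuous. At the axis, [z_k^2 / q] stays in [[0, 1]] nearby while
    [defect] tends to 0. *)
Lemma jrad_2_cont S a k : (k < N)%nat -> cont_on N S (j2 (jrad a) k).
Proof.
  intros Hk. cbn [j2 jrad]. destruct (Nat.ltb_spec k 1); [apply cont_on_const|].
  apply cont_on_plus; [apply cont_on_scal, cont_on_radial, (rf_cont _ _ _ HF)|]. apply cont_on_scal.
  intros z t Hs eps He. pose proof (rad_nonneg 1 N z) as H0.
  destruct (Rle_lt_or_eq_dec _ _ H0) as [Hp|Hp].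
  - assert (Hc : cont_on N (fun z t => S z t /\ 0 < rad 1 N z) (fun z _ => z k ^ 2 / rad 1 N z * defect a (rad 1 N z))).
    { apply cont_on_mult; [|apply cont_on_radial, defect_cont]. apply cont_on_mult.
      - apply cont_on_mult; [now apply cont_on_coord|]. apply cont_on_mult; [now apply cont_on_coord|apply cont_on_const].
      - apply (cont_on_comp N _ (fun z _ => rad 1 N z) (fun q => / q)); [apply cont_on_rad|].
        intros z' t' [_ Hz']. apply (continuity_pt_inv (fun q => q)); [apply derivable_continuous_pt, derivable_pt_id|lra]. }
    destruct (Hc z t (conj Hs Hp) eps He) as [d1 [Hd1 H1]].
    destruct (cont_on_rad 1 N (fun _ _ => True) z t I _ Hp) as [d2 [Hd2 H2]].
    exists (Rmin d1 d2). split; [now apply Rmin_glb_lt|]. intros z' t' Hs' Hdz Hdt.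
    pose proof (Rmin_l d1 d2). pose proof (Rmin_r d1 d2).
    apply (H1 z' t'); [|lra|lra]. split; auto. specialize (H2 z' t' I ltac:(lra) ltac:(lra)).
    apply Rabs_lt_between in H2. lra.
  - destruct (cont_on_radial S (defect a) (defect_cont a) z t Hs eps He) as [del [Hd H1]].
    exists del. split; auto. intros z' t' Hs' Hdz Hdt. specialize (H1 z' t' Hs' Hdz Hdt).
    rewrite <- Hp, defect_0 in *. rewrite Rmult_0_r, Rminus_0_r in *.
    apply Rle_lt_trans with (2 := H1). rewrite Rabs_mult.
    pose proof (rad_nonneg 1 N z') as H0'. pose proof (coord_sq_le_rad N z' k ltac:(lia)) as Hz.
    pose proof (Rabs_pos (defect a (rad 1 N z'))).
    destruct (Rle_lt_or_eq_dec _ _ H0') as [Hp'|Hp'].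
    + assert (0 <= z' k ^ 2 / rad 1 N z' <= 1).
      { split; [apply Rdiv_le_0_compat; auto; apply pow2_ge_0|].
        apply Rmult_le_reg_r with (rad 1 N z'); auto. unfold Rdiv. rewrite Rmult_assoc, Rinv_l by lra. lra. }
      rewrite (Rabs_right (z' k ^ 2 / rad 1 N z')) by lra. nra.
    + rewrite <- Hp', defect_0, Rabs_R0, Rmult_0_r. lra.
Qed.

Lemma lap_rad a z t : - difD m * mlap m (jrad a) z t = reac m (clamp (h a (rad 1 N z))).
Proof.
  pose proof Hm as [HN [HD _]].
  assert (E : mlap m (jrad a) z t = INR (N - 1) * (-2 * c * A a (rad 1 N z)) + -2 * c * (rad 1 N z / rad 1 N z * defect a (rad 1 N z))).
  { unfold lap, jrad. cbn [j2].
    set (B := -2 * c * A a (rad 1 N z)). set (C := -2 * c * (/ rad 1 N z * defect a (rad 1 N z))).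
    transitivity (sumk N (fun k => B * (if Nat.ltb k 1 then 0 else 1) + C * (if Nat.ltb k 1 then 0 else z k ^ 2))).
    - apply sumk_ext. intros k _. destruct (Nat.ltb k 1); [ring|]. unfold C, Rdiv. ring.
    - rewrite sumk_plus, !sumk_scal. fold (rad 1 N z).
      replace (sumk N (fun k => if Nat.ltb k 1 then 0 else 1)) with (INR (N - 1)).
      + unfold C, Rdiv. ring.
      + clear -HN. destruct N as [|n]; [lia|]. rewrite sumk_shift. cbn [Nat.ltb Nat.leb].
        rewrite sumk_const. replace (S n - 1)%nat with n by lia. ring. }
  rewrite E. unfold c. pose proof (rad_nonneg 1 N z) as H0.
  destruct (Rle_lt_or_eq_dec _ _ H0) as [Hp|Hp].
  - unfold defect. field. lra.
  - rewrite <- Hp, defect_0, (rf_0 _ _ _ HF), <- (rf_A0 _ _ _ HF). rewrite Rmult_0_r. field. lra.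
Qed.

Lemma dn_rad a z t : mBd m z -> difD m * mdn m (jrad a) z t = - radR m * A a (radR m ^ 2).
Proof.
  pose proof Hm as [HN [HD [_ [HR _]]]]. intros [_ Hz].
  assert (E : mdn m (jrad a) z t = -2 * c * A a (radR m ^ 2) / radR m * rad 1 N z).
  { unfold dn, rad. rewrite <- sumk_scal. apply sumk_ext. intros k _. cbn [j1 jrad]. rewrite Hz.
    destruct (Nat.ltb k 1); [ring|]. field. lra. }
  rewrite E, Hz. unfold c. field. lra.
Qed.

Lemma h_decreasing a p q : p <= q -> h a q <= h a p.
Proof.
  pose proof Hm as [_ [HD _]]. intros Hpq. destruct (Rle_lt_or_eq_dec _ _ Hpq) as [Hlt|<-]; [|lra].
  destruct (MVT_cor2 (h a) (fun q => - / (2 * difD m) * A a q) p q Hlt) as [x [Hx _]]; [intros; apply (rf_derive _ _ _ HF)|].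
  pose proof (rf_nonneg _ _ _ HF a x). assert (0 < / (2 * difD m)) by (apply Rinv_0_lt_compat; lra).
  assert (0 <= / (2 * difD m) * A a x * (q - p)) by (apply Rmult_le_pos; [apply Rmult_le_pos|]; lra). nra.
Qed.

(* [D d_n + kap] applied to [jrad a] on the boundary. *)
Definition robin kap a := - radR m * A a (radR m ^ 2) + kap * h a (radR m ^ 2).

Lemma robin_cont kap a : continuity_pt (robin kap) a.
Proof.
  destruct (rf_lip _ _ _ HF (radR m ^ 2) (pow2_ge_0 _)) as [B [HB H]].
  apply continuity_pt_filterlim. apply (lipschitz_continuous (robin kap) ((radR m + Rabs kap) * B)).
  intros x y. destruct (H x y) as [H1 H2]. pose proof Hm as [_ [_ [_ [HR _]]]].
  unfold robin. replace (- radR m * A x (radR m ^ 2) + kap * h x (radR m ^ 2) - (- radR m * A y (radR m ^ 2) + kap * h y (radR m ^ 2)))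
    with (- radR m * (A x (radR m ^ 2) - A y (radR m ^ 2)) + kap * (h x (radR m ^ 2) - h y (radR m ^ 2))) by ring.
  eapply Rle_trans; [apply Rabs_triang|]. rewrite !Rabs_mult, Rabs_Ropp, (Rabs_right (radR m)) by lra.
  rewrite Rmult_plus_distr_r, Rmult_plus_distr_r, !Rmult_assoc.
  apply Rplus_le_compat; apply Rmult_le_compat_l; auto; [lra|apply Rabs_pos].
Qed.

Lemma robin_one kap : robin kap 1 = kap.
Proof.
  unfold robin. pose proof Hm as [_ [HD _]]. rewrite (rf_one _ _ _ HF) by apply pow2_ge_0.
  assert (E : A 1 (radR m ^ 2) = 0); [|rewrite E; ring].
  (* [h 1] is constant to the right of the point, and its derivative there is a multiple of [A 1] *)
  apply NNPP. intros Hne. pose proof (rf_nonneg _ _ _ HF 1 (radR m ^ 2)) as H0.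
  destruct (derivable_sign_right (h 1) (radR m ^ 2) _ 1 (rf_derive _ _ _ HF 1 (radR m ^ 2))) as [s [Hs H1]]; [|lra|].
  - assert (0 < / (2 * difD m)) by (apply Rinv_0_lt_compat; lra). assert (0 < A 1 (radR m ^ 2)) by lra. nra.
  - pose proof (pow2_ge_0 (radR m)). specialize (H1 s ltac:(lra)). rewrite !(rf_one _ _ _ HF) in H1 by lra. lra.
Qed.

(** A shooting solution may well become negative before the boundary. A nonnegative Robin value
    excludes this, since for [a < 1] it gives [kap h(R^2) >= R A(R^2) > 0]. *)
Lemma h_pos kap a : 0 < kap -> 0 < a <= 1 -> 0 <= robin kap a -> 0 < h a (radR m ^ 2).
Proof.
  intros Hk Ha HFa. pose proof Hm as [_ [_ [_ [HR _]]]].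
  destruct (Req_dec a 1) as [->|H1]; [rewrite (rf_one _ _ _ HF) by apply pow2_ge_0; lra|].
  pose proof (rf_pos _ _ _ HF a (radR m ^ 2) ltac:(lra) (pow2_ge_0 _)) as HA. unfold robin in HFa.
  assert (0 < radR m * A a (radR m ^ 2)) by (apply Rmult_lt_0_compat; lra). nra.
Qed.

Lemma h_range a q : 0 <= q <= radR m ^ 2 -> h a (radR m ^ 2) <= h a q <= a.
Proof.
  intros Hq. split; [apply h_decreasing; lra|]. rewrite <- (rf_0 _ _ _ HF a) at 2. apply h_decreasing; lra.
Qed.
End RadialJet.

(** * The cross-section eigenfunction lifted to the cylinder *)

Definition tl (z : nat -> R) : nat -> R := fun j => z (S j).

Lemma tl_pt n z : pt (S n) z -> pt n (tl z).
Proof. intros H j Hj. apply H. lia. Qed.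
Lemma tl_rad n z : rad 0 n (tl z) = rad 1 (S n) z.
Proof. unfold rad. rewrite sumk_shift. cbn [Nat.ltb Nat.leb]. rewrite Rplus_0_l. reflexivity. Qed.

Lemma tl_dist n z z' : dist n (tl z) (tl z') <= dist (S n) z z'.
Proof.
  unfold dist. apply sqrt_le_1_alt. rewrite sumk_shift. pose proof (pow2_ge_0 (z 0%nat - z' 0%nat)).
  unfold tl. lra.
Qed.

Lemma tl_cont n (S0 S' : (nat -> R) -> R -> Prop) F : cont_on n S0 F ->
  (forall z t, S' z t -> S0 (tl z) t) -> cont_on (S n) S' (fun z t => F (tl z) t).
Proof.
  intros HF HS z t Hz eps He. destruct (HF _ _ (HS z t Hz) eps He) as [del [Hd H]].
  exists del. split; auto. intros z' t' Hz' Hdz Hdt. apply H; auto.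
  eapply Rle_lt_trans; [apply tl_dist|auto].
Qed.

Definition jcyl (phi : (nat -> R) -> R) (p1 p2 : nat -> (nat -> R) -> R -> R) : jet :=
  mkjet (fun z _ => phi (tl z)) (fun _ _ => 0)
    (fun k z t => match k with O => 0 | S k => p1 k (tl z) t end)
    (fun k z t => match k with O => 0 | S k => p2 k (tl z) t end).

Lemma tl_Om n Rd z : Om (S n) Rd z -> Ball n Rd (tl z).
Proof. intros [H1 H2]. split; [now apply tl_pt|now rewrite tl_rad]. Qed.
Lemma tl_Bd n Rd z : Bd (S n) Rd z -> Sph n Rd (tl z).
Proof. intros [H1 H2]. split; [now apply tl_pt|now rewrite tl_rad]. Qed.
Lemma tl_clO n Rd z : clO (S n) Rd z -> Ball n Rd (tl z) \/ Sph n Rd (tl z).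
Proof. intros [H|H]; [left; now apply tl_Om|right; now apply tl_Bd]. Qed.

Lemma jcyl_creg n Rd phi p1 p2 :
  classical n (Ball n Rd) (Sph n Rd) (fun z _ => phi z) (fun _ _ => 0) p1 p2 ->
  creg (S n) (Om (S n) Rd) (Bd (S n) Rd) 0 (jcyl phi p1 p2).
Proof.
  intros [c0 [_ [cd [_ c2]]]]. split; [|split].
  - intros z t Hz Ht. destruct (cd (tl z) t (tl_Om _ _ _ Hz) Ht) as [_ H].
    split; [apply derivable_pt_lim_const|]. intros [|k] Hk; cbn [jw j1 j2 jcyl].
    + split; [exact (derivable_pt_lim_const (phi (tl z)) (z 0%nat))|apply derivable_pt_lim_const].
    + apply H. lia.
  - apply (tl_cont n _ _ (fun z _ => phi z) c0). intros z t [Hz Ht]. split; [now apply tl_clO|lra].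
  - intros [|k] Hk; cbn [j1 jcyl]; [apply cont_on_const|].
    apply (tl_cont n _ _ (p1 k) (proj1 (c2 k ltac:(lia)))). intros z t [Hz Ht]. split; [now apply tl_clO|lra].
Qed.

Lemma jcyl_lap n phi p1 p2 z t : jlap (S n) (jcyl phi p1 p2) z t = lap n p2 (tl z) t.
Proof. unfold lap. rewrite sumk_shift. cbn [j2 jcyl]. apply Rplus_0_l. Qed.

Lemma jcyl_dn n Rd phi p1 p2 z t : jdn (S n) Rd (jcyl phi p1 p2) z t = dn 0 n Rd p1 (tl z) t.
Proof. unfold dn. rewrite sumk_shift. cbn [Nat.ltb Nat.leb]. rewrite Rplus_0_l. reflexivity. Qed.

(** Points of the closed ball with values tending to 0 would accumulate at a zero of the
    function. *)
Lemma positive_min n Rd phi : contz_on n (fun z => Ball n Rd z \/ Sph n Rd z) phi ->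
  (forall z, Ball n Rd z \/ Sph n Rd z -> 0 < phi z) ->
  exists b, 0 < b /\ forall z, Ball n Rd z \/ Sph n Rd z -> b <= phi z.
Proof.
  intros Hc Hp. apply NNPP. intros Hno.
  assert (Hz : forall k, exists z, (Ball n Rd z \/ Sph n Rd z) /\ phi z < / (INR k + 1)).
  { intros k. apply NNPP. intros Hk. apply Hno. exists (/ (INR k + 1)). pose proof (pos_INR k).
    split; [apply Rinv_0_lt_compat; lra|]. intros z Hz. apply Rnot_lt_le. intros Hlt. apply Hk. eauto. }
  set (zs := fun k => proj1_sig (constructive_indefinite_description _ (Hz k))).
  assert (Hzs : forall k, (Ball n Rd (zs k) \/ Sph n Rd (zs k)) /\ phi (zs k) < / (INR k + 1)).
  { intros k. exact (proj2_sig (constructive_indefinite_description _ (Hz k))). }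
  assert (Hiff : forall z, (Ball n Rd z \/ Sph n Rd z) <-> pt n z /\ rad 0 n z <= Rd ^ 2).
  { intros z. unfold Ball, Sph. split; [intros [[]|[]]; split; auto; lra|].
    intros [H1 H2]. destruct (Rle_lt_or_eq_dec _ _ H2); auto. }
  destruct (bolzano_weierstrass n zs (Rabs Rd)) as [l [f [Hl [Hf Hcv]]]].
  { intros k j Hj. destruct (Hzs k) as [H1 _]. apply Hiff in H1. destruct H1 as [_ H1].
    assert (zs k j ^ 2 <= rad 0 n (zs k)).
    { unfold rad.       apply (sumk_term n (fun i => zs k i ^ 2) j); auto. intros. apply pow2_ge_0. }
    apply Rsqr_le_abs_0. unfold Rsqr. lra. }
  assert (Hd : forall eps, 0 < eps -> exists M, forall k, (M <= k)%nat -> dist n l (zs (f k)) < eps).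
  { intros eps He. destruct (dist_close n eps He) as [r [Hr H]]. destruct (Hcv r Hr) as [M HM].
    exists M. intros k Hk. apply H. intros j Hj. now apply HM. }
  assert (HlB : Ball n Rd l \/ Sph n Rd l).
  { apply Hiff. split; auto. apply Rnot_lt_le. intros Hlt.
    destruct (cont_on_rad 0 n (fun _ _ => True) l 0 I (rad 0 n l - Rd ^ 2) ltac:(lra)) as [del [Hdel H]].
    destruct (Hd del Hdel) as [M HM]. specialize (H (zs (f M)) 0 I (HM M (le_n M)) ltac:(rewrite Rminus_diag, Rabs_R0; lra)).
    destruct (Hzs (f M)) as [H1 _]. apply Hiff in H1. apply Rabs_lt_between in H. lra. }
  specialize (Hp l HlB). destruct (Hc l HlB (phi l / 2) ltac:(lra)) as [del [Hdel H]].
  destruct (Hd del Hdel) as [M HM].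
  destruct (archimed_cor1 (phi l / 2)) as [K [HK HK0]]; [lra|].
  set (k := (M + K)%nat). destruct (Hzs (f k)) as [H1 H2].
  specialize (H (zs (f k)) H1 (HM k ltac:(lia))). apply Rabs_lt_between in H.
  assert (/ (INR (f k) + 1) <= / INR K).
  { apply Rinv_le_contravar; [now apply lt_0_INR|]. pose proof (Hf k).
    assert (INR K <= INR (f k)) by (apply le_INR; lia). lra. }
  lra.
Qed.

(* The exterior component of [comparison] is taken to be zero. *)
Lemma robin_comparison N D Rd kap C M T P : (1 <= N)%nat -> 0 < D -> 0 < Rd -> 0 < kap -> 0 <= C ->
  creg N (Om N Rd) (Bd N Rd) 0 P ->
  cont_on N (fun z t => clO N Rd z /\ 0 <= t) (jw P) ->
  (forall z t, clO N Rd z -> 0 <= t <= T -> - M <= jw P z t) ->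
  (forall z, clO N Rd z -> 0 <= jw P z 0) ->
  (forall z t, Om N Rd z -> 0 < t -> jw P z t < 0 -> C * jw P z t <= jt P z t - D * jlap N P z t) ->
  (forall z t, Bd N Rd z -> 0 < t -> 0 <= D * jdn N Rd P z t + kap * jw P z t) ->
  forall z t, clO N Rd z -> 0 <= t <= T -> 0 <= jw P z t.
Proof.
  intros HN HD HR Hk HC Hcr Hct Hlow H0 Hin Hbd.
  assert (Hc0 : forall O B, creg N O B 0 (jconst 0)) by (intros; apply creg_const).
  destruct (comparison N D 1 Rd kap 1 C (Rmax M 0) 0 T full full P (jconst 0)) as [H1 _]; auto; try lra.
  - apply full_closed.
  - apply full_open.
  - apply cont_on_subset with (1 := Hct). intros z t [[Hz _] Ht]. split; auto; lra.
  - exact (cont_on_const N _ 0).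
  - apply creg_reg in Hcr. apply reg_sub with (1 := Hcr); try lra; intros z [Hz _]; auto.
  - apply creg_reg, Hc0.
  - intros z t Hz _ Ht. specialize (Hlow z t Hz Ht). pose proof (Rmax_l M 0). lra.
  - intros z t Hz _ Ht. simpl. pose proof (Rmax_r M 0). lra.
  - simpl. intros; lra.
  - intros z t Hz _ Ht. apply Hin; auto; lra.
  - intros z t Hz _ Ht _. simpl. rewrite Rmin_left by lra. rewrite Rmult_0_r. apply Hbd; auto; lra.
  - simpl. intros; lra.
  - simpl. intros; lra.
  - intros z t Hz Ht. apply H1; auto. exact I.
Qed.

Lemma exp_unbounded g B : 0 < g -> exists t, 0 < t /\ B < exp (g * t).
Proof.
  intros Hg. exists ((Rabs B + 1) / g). pose proof (Rabs_pos B). split; [apply Rdiv_lt_0_compat; lra|].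
  replace (g * ((Rabs B + 1) / g)) with (Rabs B + 1) by (field; lra).
  pose proof (exp_ineq1_le (Rabs B + 1)). pose proof (Rle_abs B). lra.
Qed.

Definition jexp g del : jet := jtime (fun t => del * exp (g * t)) (fun t => g * (del * exp (g * t))).

Lemma creg_exp n O B T0 g del : creg n O B T0 (jexp g del).
Proof. apply creg_time. intros t _. apply is_derive_Reals. auto_derive; auto. ring. Qed.

Section Eigen.
Context (m : model) (Hm : model_ok m) (h A : R -> R -> R) (HF : radial_family m h A).
Context (kap beta2 : R) (Hk : 0 < kap) (HE : principal_eig (dimN m - 1) (difD m) (radR m) kap beta2).
Local Notation N := (dimN m).

Lemma cylinder_eigenfunction : exists J Mp b, 0 < b /\
  creg N (mOm m) (mBd m) 0 J /\ cont_on N (fun z t => inO m z /\ 0 <= t) (jw J) /\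
  (forall z t, inO m z -> b <= jw J z t <= Mp) /\ (forall z t, jt J z t = 0) /\
  (forall z t, jw J z t = jw J z 0) /\
  (forall z t, mOm m z -> 0 < t -> - mlap m J z t = beta2 * jw J z t) /\
  (forall z t, mBd m z -> 0 < t -> difD m * mdn m J z t + kap * jw J z t = 0).
Proof.
  destruct HE as [phi [p1 [p2 [Hcl [Hpos [Heq Hbd]]]]]].
  pose proof Hm as [HN _]. destruct N as [|n] eqn:EN; [lia|].
  replace (S n - 1)%nat with n in * by lia.
  destruct Hcl as [c0 [cb Hcl']]. pose proof (conj c0 (conj cb Hcl')) as Hcl. clear Hcl'.
  destruct (positive_min n (radR m) phi) as [b [Hb Hmin]]; auto.
  { intros z Hz eps He. destruct (c0 z 0 (conj Hz (Rle_refl 0)) eps He) as [del [Hd H]].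
    exists del. split; auto. intros z' Hz' Hdz. apply (H z' 0); auto; [split; auto; lra|].
    rewrite Rminus_diag, Rabs_R0; auto. }
  destruct (cb 0) as [Mp HMp].
  exists (jcyl phi p1 p2), Mp, b.
  split; [exact Hb|]. split; [now apply jcyl_creg|].
  split; [|split; [|split; [|split; [|split]]]]; auto.
  - apply (tl_cont n _ _ (fun z _ => phi z) c0). intros z t [Hz Ht]. split; [now apply tl_clO|lra].
  - intros z t Hz. split; [now apply Hmin, tl_clO|].
    apply Rle_trans with (1 := Rle_abs _). apply (HMp (tl z) 0); [now apply tl_clO|lra].
  - intros z t Hz Ht. rewrite jcyl_lap. apply Heq; auto. now apply tl_Om.
  - intros z t Hz Ht. rewrite jcyl_dn. apply Hbd; auto. now apply tl_Bd.
Qed.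

Lemma origin_in : inO m (fun _ => 0).
Proof.
  apply clO_iff. split; [intros j _; auto|]. unfold rad. rewrite sumk_0; [apply pow2_ge_0|].
  intros k _. destruct (Nat.ltb k 1); [auto|ring].
Qed.

Lemma origin_rad : rad 1 N (fun _ => 0) = 0.
Proof. unfold rad. apply sumk_0. intros k _. destruct (Nat.ltb k 1); [auto|ring]. Qed.

Lemma slope_approx e : 0 < e -> exists a, 0 < a < 1 /\ forall s, 0 < s <= a -> (slope m - e) * s <= reac m s.
Proof.
  intros He. destruct (model_KPP m Hm) as [[_ [Hd _]] _]. destruct (Hd e He) as [del H].
  pose proof (cond_pos del) as Hdel. exists (Rmin (1 / 2) (del / 2)).
  pose proof (Rmin_l (1 / 2) (del / 2)). pose proof (Rmin_r (1 / 2) (del / 2)).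
  assert (0 < Rmin (1 / 2) (del / 2)) by (apply Rmin_glb_lt; lra). split; [lra|].
  intros s Hs. specialize (H s ltac:(lra) ltac:(rewrite Rabs_right; lra)).
  rewrite Rplus_0_l, (reac_0 m Hm), Rminus_0_r in H. apply Rabs_lt_between in H.
  replace (reac m s) with (reac m s / s * s) by (field; lra). apply Rmult_le_compat_r; lra.
Qed.

(* For small [a] a nonnegative Robin defect would make [jrad a] a bounded supersolution lying above
   the exponentially growing subsolution [del e^(g t) phi]. *)
Lemma robin_nonpos_small : beta2 < slope m / difD m -> exists a, 0 < a < 1 /\ robin m h A kap a <= 0.
Proof.
  intros Hb. pose proof Hm as [HN [HD [_ [HR _]]]].
  assert (Hb' : difD m * beta2 < slope m).
  { replace (slope m) with (difD m * (slope m / difD m)) by (field; lra). now apply Rmult_lt_compat_l. }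
  (* Half of the spectral gap is lost in linearizing the reaction, the other half is the growth
     rate: [g + D beta2 = slope - g]. *)
  set (g := (slope m - difD m * beta2) / 2). assert (Hg : 0 < g) by (unfold g; lra).
  destruct (slope_approx g Hg) as [a [Ha Hsl]]. exists a. split; auto. apply Rnot_lt_le. intros HFa.
  destruct cylinder_eigenfunction as [J [Mp [b [Hb0 [Jc [Jc0 [Jr [Jt [Js [Je Jb]]]]]]]]]].
  pose proof (h_pos m Hm h A HF kap a Hk ltac:(lra) ltac:(lra)) as HhR.
  pose proof (Jr _ 0 origin_in) as Jr0. assert (HMp : 0 < Mp) by lra.
  (* The growing subsolution starts below the minimum [h a (R^2)] of the radial solution. *)
  set (del := h a (radR m ^ 2) / Mp). assert (Hdel : 0 < del) by (apply Rdiv_lt_0_compat; auto).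
  set (P := jsub (jrad m h A a) (jmul (jexp g del) J)).
  assert (HPw : forall z t, jw P z t = h a (rad 1 N z) - del * exp (g * t) * jw J z t) by (intros; unfold P; rewrite jw_sub; reflexivity).
  assert (Hrange : forall z, inO m z -> h a (radR m ^ 2) <= h a (rad 1 N z) <= a).
  { intros z Hz. apply (h_range m Hm h A HF). now apply rad_in. }
  (* By this time the subsolution exceeds [a], the value of the radial solution at the origin. *)
  destruct (exp_unbounded g (a / (del * b)) Hg) as [T [HT HTb]].
  assert (HP : 0 <= jw P (fun _ => 0) T).
  { apply (robin_comparison N (difD m) (radR m) kap (Rabs (slope m - g)) (del * exp (g * T) * Mp) T P); auto.
    - lia.
    - apply Rabs_pos.
    - apply creg_jsub; [apply (creg_rad m h A HF)|]. apply creg_mul; [apply creg_exp|exact Jc].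
    - apply jsub_cont; [apply (creg_cont _ _ _ _ _ _ (creg_rad m h A HF (mOm m) (mBd m) (-1) a)); intros z t [Hz Ht]; split; auto; lra|].
      apply (cont_on_mult N _ (fun _ t => del * exp (g * t)) (jw J)); [|exact Jc0].
      apply (creg_cont _ _ _ _ _ _ (creg_exp N (mOm m) (mBd m) (-1) g del)). intros z t [Hz Ht]; split; auto; lra.
    - intros z t Hz Ht. rewrite HPw. specialize (Hrange z Hz). specialize (Jr z t Hz).
      assert (exp (g * t) <= exp (g * T)) by (apply exp_le_compat, Rmult_le_compat_l; lra).
      pose proof (exp_pos (g * t)).
      assert (del * exp (g * t) * jw J z t <= del * exp (g * T) * Mp).
      { apply Rmult_le_compat; try lra; [apply Rmult_le_pos; lra|]. apply Rmult_le_compat_l; lra. }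
      lra.
    - intros z Hz. rewrite HPw, Rmult_0_r, exp_0, Rmult_1_r. specialize (Hrange z Hz). specialize (Jr z 0 Hz).
      assert (del * jw J z 0 <= del * Mp) by (apply Rmult_le_compat_l; lra).
      assert (del * Mp = h a (radR m ^ 2)) by (unfold del; field; lra). lra.
    - intros z t Hz Ht HPn. specialize (Hrange z (or_introl Hz)).
      assert (E : jt P z t - difD m * jlap N P z t =
        reac m (h a (rad 1 N z)) - (g + difD m * beta2) * (del * exp (g * t) * jw J z t)).
      { unfold P. rewrite jt_sub, lap_sub, lap_mul. unfold jexp at 2 3. rewrite lap_time, gg_time.
        pose proof (lap_rad m Hm h A HF a z t) as H1. rewrite clamp_id in H1 by lra.
        specialize (Je z t Hz Ht). simpl jt. rewrite Jt. simpl jw.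
        replace (jlap N J z t) with (- (beta2 * jw J z t)) by lra. rewrite <- H1. ring. }
      rewrite E. replace (g + difD m * beta2) with (slope m - g) by (unfold g; lra).
      specialize (Hsl (h a (rad 1 N z)) ltac:(lra)).
      apply Rle_trans with ((slope m - g) * jw P z t); [|rewrite HPw; lra].
      pose proof (Rle_abs (slope m - g)). nra.
    - intros z t Hz Ht. unfold P. rewrite jw_sub, dn_sub, dn_mul. unfold jexp at 1. rewrite dn_time.
      specialize (Jb z t Hz Ht). pose proof (dn_rad m Hm h A a z t Hz) as H1.
      assert (E : difD m * (mdn m (jrad m h A a) z t - (0 * jw J z t + jw (jexp g del) z t * mdn m J z t)) +
        kap * (jw (jrad m h A a) z t - jw (jmul (jexp g del) J) z t) =
        difD m * mdn m (jrad m h A a) z t + kap * jw (jrad m h A a) z t - jw (jexp g del) z t * (difD m * mdn m J z t + kap * jw J z t)).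
      { simpl jw. ring. }
      rewrite E, Jb, H1. simpl jw. destruct Hz as [_ ->]. unfold robin in HFa. lra.
    - apply origin_in.
    - lra. }
  rewrite HPw in HP. rewrite origin_rad, (rf_0 _ _ _ HF) in HP. pose proof (Jr _ T origin_in) as JT.
  assert (a < del * exp (g * T) * b).
  { replace a with (a / (del * b) * (del * b)) by (field; lra).
    replace (del * exp (g * T) * b) with (exp (g * T) * (del * b)) by ring. apply Rmult_lt_compat_r; auto. nra. }
  assert (del * exp (g * T) * b <= del * exp (g * T) * jw J (fun _ => 0) T).
  { apply Rmult_le_compat_l; [|lra]. pose proof (exp_pos (g * T)). nra. }
  lra.
Qed.

(** At 1 the Robin value is [kap > 0], because [h 1] is constant; continuity in [a] then gives a
    zero. *)
Lemma robin_root a : 0 < a < 1 -> robin m h A kap a <= 0 -> exists b, 0 < b < 1 /\ robin m h A kap b = 0.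
Proof.
  intros Ha HFa. pose proof (robin_one m Hm h A HF kap) as H1.
  destruct (IVT_cor (robin m h A kap) a 1) as [b [Hb Hb0]]; [intros x; now apply (robin_cont m Hm h A HF)|lra|nra|].
  exists b. split; auto. assert (b <> 1) by (intros ->; lra). lra.
Qed.

(* A root of the Robin function is a steady state [U]; since [g(U)/U] stays below [slope], a multiple of
   [e^(g t) U] is a growing subsolution of the problem for which the eigenfunction is a supersolution. *)
Lemma robin_pos : ~ beta2 < slope m / difD m -> forall a, 0 < a <= 1 -> 0 < robin m h A kap a.
Proof.
  intros Hb a0 Ha0. pose proof Hm as [HN [HD [_ [HR _]]]].
  assert (Hb' : slope m <= difD m * beta2).
  { replace (slope m) with (difD m * (slope m / difD m)) by (field; lra). apply Rmult_le_compat_l; lra. }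
  apply Rnot_le_lt. intros HFa0.
  assert (Ha1 : a0 <> 1) by (intros ->; rewrite (robin_one m Hm h A HF) in HFa0; lra).
  destruct (robin_root a0 ltac:(lra) HFa0) as [a [Ha HFa]]. clear a0 Ha0 HFa0 Ha1.
  destruct cylinder_eigenfunction as [J [Mp [b [Hb0 [Jc [Jc0 [Jr [Jt [Js [Je Jb]]]]]]]]]].
  pose proof (h_pos m Hm h A HF kap a Hk ltac:(lra) ltac:(lra)) as HhR. set (s0 := h a (radR m ^ 2)) in *.
  assert (Hrange : forall z, inO m z -> s0 <= h a (rad 1 N z) <= a).
  { intros z Hz. apply (h_range m Hm h A HF). now apply rad_in. }
  pose proof (Hrange _ origin_in) as Hr0. rewrite origin_rad, (rf_0 _ _ _ HF) in Hr0.
  (* With this rate [g * s + reac m s <= slope m * s] on the range of the profile, because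
     [reac m s / s] is largest at the minimum [s0]. *)
  set (g := slope m - reac m s0 / s0).
  assert (Hg : 0 < g).
  { pose proof (reac_ratio m Hm (s0 / 2) s0 ltac:(lra) ltac:(lra)) as H1.
    pose proof (reac_le_slope m Hm (s0 / 2) ltac:(lra)) as H2.
    assert (reac m (s0 / 2) / (s0 / 2) <= slope m); [|unfold g; lra].
    apply Rmult_le_reg_r with (s0 / 2); [lra|]. unfold Rdiv at 1. rewrite Rmult_assoc, Rinv_l by lra. lra. }
  set (P := jsub J (jmul (jexp g b) (jrad m h A a))).
  assert (HPw : forall z t, jw P z t = jw J z t - b * exp (g * t) * h a (rad 1 N z)) by (intros; unfold P; rewrite jw_sub; reflexivity).
  destruct (exp_unbounded g (Mp / (b * a)) Hg) as [T [HT HTb]].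
  assert (HP : 0 <= jw P (fun _ => 0) T).
  { apply (robin_comparison N (difD m) (radR m) kap (slope m) (b * exp (g * T)) T P); auto.
    - lia.
    - apply Rlt_le, (slope_pos m Hm).
    - apply creg_jsub; [exact Jc|]. apply creg_mul; [apply creg_exp|apply (creg_rad m h A HF)].
    - apply jsub_cont; [exact Jc0|].
      apply (cont_on_mult N _ (fun _ t => b * exp (g * t)) (jw (jrad m h A a))).
      + apply (creg_cont _ _ _ _ _ _ (creg_exp N (mOm m) (mBd m) (-1) g b)). intros z t [Hz Ht]; split; auto; lra.
      + apply (creg_cont _ _ _ _ _ _ (creg_rad m h A HF (mOm m) (mBd m) (-1) a)); intros z t [Hz Ht]; split; auto; lra.
    - intros z t Hz Ht. rewrite HPw. specialize (Hrange z Hz). specialize (Jr z t Hz).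
      assert (exp (g * t) <= exp (g * T)) by (apply exp_le_compat, Rmult_le_compat_l; lra).
      pose proof (exp_pos (g * t)).
      assert (b * exp (g * t) * h a (rad 1 N z) <= b * exp (g * T) * 1).
      { apply Rmult_le_compat; try lra; [apply Rmult_le_pos; lra|]. apply Rmult_le_compat_l; lra. }
      lra.
    - intros z Hz. rewrite HPw, Rmult_0_r, exp_0, Rmult_1_r. specialize (Hrange z Hz). specialize (Jr z 0 Hz).
      assert (b * h a (rad 1 N z) <= b * 1) by (apply Rmult_le_compat_l; lra). lra.
    - intros z t Hz Ht HPn. specialize (Hrange z (or_introl Hz)). specialize (Jr z t (or_introl Hz)).
      set (s := h a (rad 1 N z)) in *.
      assert (E : jt P z t - difD m * jlap N P z t =
        difD m * beta2 * jw J z t - b * exp (g * t) * (g * s + reac m s)).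
      { unfold P. rewrite jt_sub, lap_sub, lap_mul. unfold jexp at 2 3. rewrite lap_time, gg_time.
        pose proof (lap_rad m Hm h A HF a z t) as H1. fold s in H1. rewrite clamp_id in H1 by lra.
        specialize (Je z t Hz Ht). rewrite Jt. simpl jt. simpl jw. fold s.
        replace (jlap N J z t) with (- (beta2 * jw J z t)) by lra. rewrite <- H1. ring. }
      rewrite E.
      assert (Hrs : reac m s <= reac m s0 / s0 * s).
      { destruct (Req_dec s s0) as [->|Hne]; [right; field; lra|].
        pose proof (reac_ratio m Hm s0 s ltac:(lra) ltac:(lra)) as H1.
        replace (reac m s) with (reac m s / s * s) by (field; lra). apply Rmult_le_compat_r; lra. }
      assert (Hgs : g * s + reac m s <= slope m * s) by (unfold g; lra).
      assert (0 < b * exp (g * t)) by (apply Rmult_lt_0_compat; auto; apply exp_pos).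
      assert (b * exp (g * t) * (g * s + reac m s) <= b * exp (g * t) * (slope m * s)) by (apply Rmult_le_compat_l; lra).
      assert (slope m * jw J z t <= difD m * beta2 * jw J z t) by (apply Rmult_le_compat_r; lra).
      rewrite HPw. fold s. lra.
    - intros z t Hz Ht. unfold P. rewrite jw_sub, dn_sub, dn_mul. unfold jexp at 1. rewrite dn_time.
      specialize (Jb z t Hz Ht). pose proof (dn_rad m Hm h A a z t Hz) as H1.
      assert (E : difD m * (mdn m J z t - (0 * jw (jrad m h A a) z t + jw (jexp g b) z t * mdn m (jrad m h A a) z t)) +
        kap * (jw J z t - jw (jmul (jexp g b) (jrad m h A a)) z t) =
        difD m * mdn m J z t + kap * jw J z t - jw (jexp g b) z t * (difD m * mdn m (jrad m h A a) z t + kap * jw (jrad m h A a) z t)).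
      { simpl jw. ring. }
      rewrite E, Jb, H1. simpl jw. destruct Hz as [_ ->]. unfold robin in HFa. rewrite HFa. lra.
    - apply origin_in.
    - lra. }
  rewrite HPw in HP. rewrite origin_rad, (rf_0 _ _ _ HF) in HP. pose proof (Jr _ T origin_in) as JT.
  assert (Mp < b * exp (g * T) * a); [|lra].
  replace Mp with (Mp / (b * a) * (b * a)) by (field; lra).
  replace (b * exp (g * T) * a) with (exp (g * T) * (b * a)) by ring. apply Rmult_lt_compat_r; auto. nra.
Qed.
End Eigen.

Lemma radial_profile m h A psi psi1 psi2 theta a : model_ok m -> radial_family m h A -> 0 < theta -> 0 < a <= 1 ->
  let kap := exmu m * theta / (exnu m + theta) in 0 <= robin m h A kap a ->
  (forall q, 0 < q -> derivable_pt_lim psi q (psi1 q)) ->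
  (forall q, 0 < q -> derivable_pt_lim psi1 q (psi2 q)) ->
  (forall q, 0 < q -> difd m * (4 * q * psi2 q + 2 * INR (dimN m - 1) * psi1 q) = decay m * psi q) ->
  psi (radR m ^ 2) = 1 -> (forall q, radR m ^ 2 <= q -> 0 < psi q <= 1) ->
  - difd m * (psi1 (radR m ^ 2) * (2 * radR m)) = theta ->
  profile m (jrad m h A a) (h a) psi psi1 psi2 theta (robin m h A kap a).
Proof.
  intros Hm HF Hth Ha kap HFa H1 H2 H3 H4 H5 H6.
  assert (Hk : 0 < kap).
  { pose proof Hm as [_ [_ [_ [_ [Hmu [Hnu _]]]]]]. apply Rdiv_lt_0_compat; [apply Rmult_lt_0_compat|]; lra. }
  pose proof (h_pos m Hm h A HF kap a Hk Ha HFa) as HhR.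
  pose proof (h_range m Hm h A HF a) as Hr.
  split; auto.
  - intros T0. apply (creg_rad m h A HF).
  - intros z t Hz. rewrite (lap_rad m Hm h A HF). rewrite clamp_id; auto.
    specialize (Hr _ (rad_in m z (or_introl Hz))). lra.
  - intros z t Hz. rewrite (dn_rad m Hm h A); auto.
  - intros q Hq. specialize (Hr q Hq). lra.
Qed.

(** * Extinction, persistence and spreading *)

Lemma rad_split N z : (1 <= N)%nat -> rad 0 N z = z 0%nat ^ 2 + rad 1 N z.
Proof.
  intros HN. destruct N as [|n]; [lia|]. unfold rad. rewrite !sumk_shift. cbn [Nat.ltb Nat.leb]. ring.
Qed.

Lemma ball_bounds N z r : (1 <= N)%nat -> rad 0 N z <= r ^ 2 -> Rabs (z 0%nat) <= Rabs r /\ rad 1 N z <= Rabs r ^ 2.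
Proof.
  intros HN Hz. rewrite rad_split in Hz by auto. pose proof (rad_nonneg 1 N z). pose proof (pow2_ge_0 (z 0%nat)).
  split; [apply Rsqr_le_abs_0; unfold Rsqr; lra|]. rewrite pow2_abs. lra.
Qed.

Definition nontrivial (m : model) (U V : jet) : Prop :=
  (exists z, inO m z /\ jw U z 0 <> 0) \/ (exists z, inE m z /\ jw V z 0 <> 0).

Section Main.
Context (N : nat) (D d Rd mu nu rho : R) (g : R -> R) (gp0 K0 K1 beta2 : R).
Context (HN : (2 <= N)%nat) (HD : 0 < D) (Hd : 0 < d) (HR : 0 < Rd) (Hmu : 0 < mu) (Hnu : 0 < nu) (Hrho : 0 < rho)
  (Hg : KPP g gp0) (Hsg : sKPP g).
Let m := Model N D d Rd mu nu rho g gp0.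

Lemma main_ok : model_ok m.
Proof. unfold model_ok, m; simpl. tauto. Qed.

Lemma solM_bsol u0 v0 u v : init_ok N Rd u0 v0 -> solM N D d Rd mu nu rho g u0 v0 u v ->
  exists M U V, 0 < M /\ bsol m M U V /\ jw U = u /\ jw V = v /\ nontrivial m U V /\
    (compact_supp N u0 v0 -> exists r, supported m r U V).
Proof.
  intros [_ [_ [P1 [P2 [[B [B1 B2]] Hnt]]]]] Hs.
  destruct (solM_sol N D d Rd mu nu rho g gp0 u0 v0 u v Hs) as [U [V [Hsol [EU [EV [I1 I2]]]]]].
  fold m in Hsol. change (forall z, inO m z -> u z 0 = u0 z) in I1. change (forall z, inE m z -> v z 0 = v0 z) in I2.
  destruct (sol_bounded m main_ok U V B Hsol) as [M [HM Hb]].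
  { intros z Hz. rewrite EU, I1 by auto. split; [now apply P1|now apply B1]. }
  { intros z Hz. rewrite EV, I2 by auto. split; [now apply P2|now apply B2]. }
  exists M, U, V. repeat (split; auto).
  - destruct Hnt as [[z [Hz H]]|[z [Hz H]]]; [left|right]; exists z; split; auto.
    + rewrite EU, I1; auto.
    + rewrite EV, I2; auto.
  - intros [r Hr]. exists (Rabs r).
    assert (Hin : forall z, pt N z -> u0 z <> 0 \/ v0 z <> 0 -> Rabs (z 0%nat) <= Rabs r /\ rad 1 N z <= Rabs r ^ 2).
    { intros z Hz H. apply ball_bounds; [lia|]. apply Rnot_lt_le. intros Hlt. destruct (Hr z Hz Hlt). tauto. }
    split; intros z Hz H.
    + apply Hin; [apply clO_iff in Hz; tauto|]. left. now rewrite <- I1, <- EU.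
    + apply Hin; [apply clE_iff in Hz; tauto|]. right. now rewrite <- I2, <- EV.
Qed.

Section Steady.
Context (H : jet) (h psi psi1 psi2 : R -> R) (theta : R) (Hpr : profile m H h psi psi1 psi2 theta 0)
  (H2c : forall k, (k < N)%nat -> cont_on N (fun z t => Om N Rd z /\ 0 < t) (j2 H k))
  (Hp2 : forall q, 0 < q -> continuity_pt psi2 q).
Let V0 := mu * h (Rd ^ 2) / (theta + nu).

Lemma V0_pos : 0 < V0.
Proof.
  pose proof (pr_pos _ _ _ _ _ _ _ _ Hpr) as H1. pose proof (pr_theta _ _ _ _ _ _ _ _ Hpr). change (0 < h (Rd ^ 2)) in H1.
  apply Rdiv_lt_0_compat; [apply Rmult_lt_0_compat|]; lra.
Qed.

Lemma profile_steady : pos_ss N D d Rd mu nu rho g (fun z => h (rad 1 N z)) (fun z => V0 * psi (rad 1 N z)).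
Proof.
  pose proof V0_pos as HV0. pose proof (pr_theta _ _ _ _ _ _ _ _ Hpr) as Hth.
  pose proof (pr_pos _ _ _ _ _ _ _ _ Hpr) as HhR. change (0 < h (Rd ^ 2)) in HhR.
  assert (HRr : forall z, clO N Rd z -> h (Rd ^ 2) <= h (rad 1 N z) <= 1).
  { intros z Hz. apply (pr_range _ _ _ _ _ _ _ _ Hpr). now apply (rad_in m). }
  assert (Hpsi : forall z, clE N Rd z -> 0 < psi (rad 1 N z) <= 1).
  { intros z Hz. apply (pr_psi_range _ _ _ _ _ _ _ _ Hpr). apply clE_iff in Hz. apply Hz. }
  assert (HRd2 : 0 < Rd ^ 2) by (apply pow_lt; auto).
  assert (Hjw : jw H = fun z _ => h (rad 1 N z)).
  { apply functional_extensionality. intros z. apply functional_extensionality. intros t. apply (pr_val _ _ _ _ _ _ _ _ Hpr). }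
  pose proof (fun T => pr_creg _ _ _ _ _ _ _ _ Hpr T) as HcU.
  set (W := jscal V0 (jpsi m psi psi1 psi2)).
  assert (HcV : forall T, creg N (Ext N Rd) (Bd N Rd) T W).
  { intros T. apply creg_scal. apply (jpsi_creg m main_ok _ _ _ _ _ _ _ Hpr). }
  split; [|split].
  - exists (fun _ _ => 0), (j1 H), (j2 H), (fun _ _ => 0), (j1 W), (j2 W).
    repeat split.
    + rewrite <- Hjw. apply (creg_cont _ _ _ _ _ _ (HcU (-1))). intros z t [Hz Ht]. split; auto; lra.
    + intros T. exists 1. intros z t Hz _. specialize (HRr z Hz). rewrite Rabs_right; lra.
    + apply derivable_pt_lim_const.
    + destruct (HcU 0) as [Hj _]. destruct (Hj z t H0 H1) as [_ Hk]. rewrite Hjw in Hk. now apply Hk.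
    + destruct (HcU 0) as [Hj _]. destruct (Hj z t H0 H1) as [_ Hk]. now apply Hk.
    + apply cont_on_const.
    + apply (HcU 0); auto.
    + now apply H2c.
    + apply (creg_cont _ _ _ _ _ _ (HcV (-1))). intros z t [Hz Ht]. split; auto; lra.
    + intros T. exists V0. intros z t Hz _. specialize (Hpsi z Hz). rewrite Rabs_right; nra.
    + apply derivable_pt_lim_const.
    + destruct (HcV 0) as [Hj _]. destruct (Hj z t H0 H1) as [_ Hk]. now apply Hk.
    + destruct (HcV 0) as [Hj _]. destruct (Hj z t H0 H1) as [_ Hk]. now apply Hk.
    + apply cont_on_const.
    + apply (HcV 0); auto.
    + assert (Hrad : forall z, Ext N Rd z -> 0 < rad 1 N z) by (intros z [_ Hz]; lra).
      apply (cont_on_scal N _ V0). cbn [j2 jpsi jcomp].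
      assert (Hj1 : cont_on N (fun z t => Ext N Rd z /\ 0 < t) (j1 (jq N) k)).
      { destruct (creg_q N (Ext N Rd) (Bd N Rd) 0) as [_ [_ Hc]]. apply cont_on_subset with (1 := Hc k H0). tauto. }
      apply cont_on_plus; apply cont_on_mult.
      * apply (cont_on_comp N _ (jw (jq N)) psi2); [apply cont_on_rad|]. intros z t [Hz _]. now apply Hp2, Hrad.
      * now apply cont_on_mult.
      * apply (cont_on_comp N _ (jw (jq N)) psi1); [apply cont_on_rad|]. intros z t [Hz _].
        apply derivable_continuous_pt. eexists. now apply (pr_psi2 _ _ _ _ _ _ _ _ Hpr), Hrad.
      * cbn [j2 jq]. destruct (Nat.ltb k 1); apply cont_on_const.
    + intros z t Hz _. pose proof (pr_eq _ _ _ _ _ _ _ _ Hpr z t Hz) as E.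
      change (- D * lap N (j2 H) z t = g (h (rad 1 N z))) in E. lra.
    + intros z t Hz _. pose proof (jpsi_lap m main_ok _ _ _ _ _ _ _ Hpr z t Hz) as E.
      change (d * jlap N (jpsi m psi psi1 psi2) z t = rho * psi (rad 1 N z)) in E. unfold W. rewrite lap_scal.
      transitivity (- V0 * (d * jlap N (jpsi m psi psi1 psi2) z t)); [ring|rewrite E; ring].
    + pose proof (pr_bd _ _ _ _ _ _ _ _ Hpr z t H0) as E.
      change (D * jdn N Rd H z t + mu * theta / (nu + theta) * h (Rd ^ 2) = 0) in E. destruct H0 as [_ ->].
      pose proof (pr_psi_R _ _ _ _ _ _ _ _ Hpr) as EP. change (psi (Rd ^ 2) = 1) in EP. rewrite EP. unfold V0.
      replace (nu * (mu * h (Rd ^ 2) / (theta + nu) * 1) - mu * h (Rd ^ 2)) with (- (mu * theta / (nu + theta) * h (Rd ^ 2))) by (field; lra).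
      lra.
    + pose proof (jpsi_dn m main_ok _ _ _ _ _ _ _ Hpr z t H0) as E.
      change (- d * jdn N Rd (jpsi m psi psi1 psi2) z t = theta) in E.
      destruct H0 as [_ Hz]. rewrite Hz. pose proof (pr_psi_R _ _ _ _ _ _ _ _ Hpr) as EP. change (psi (Rd ^ 2) = 1) in EP. rewrite EP.
      unfold W. rewrite dn_scal. replace (- d * (V0 * jdn N Rd (jpsi m psi psi1 psi2) z t)) with (V0 * theta) by (rewrite <- E; ring).
      unfold V0. field. lra.
  - intros z Hz. specialize (HRr z (or_introl Hz)). lra.
  - intros z Hz. specialize (Hpsi z (or_introl Hz)). nra.
Qed.

Lemma profile_conv_loc M U V : 0 < M -> bsol m M U V -> nontrivial m U V ->
  conv_loc N Rd (jw U) (jw V) (fun z => h (rad 1 N z)) (fun z => V0 * psi (rad 1 N z)).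
Proof.
  intros HM Hb Hnt r eps He.
  destruct (local_convergence m main_ok H h psi psi1 psi2 theta Hpr M U V HM Hb Hnt (Rabs r) eps He) as [T [_ HT]].
  exists T. intros t z Ht Hz. destruct (ball_bounds N z r ltac:(lia) Hz) as [Hx _].
  destruct (HT t Ht) as [H1 H2]. split; intros Hz'; [now apply H1|now apply H2].
Qed.
End Steady.

(** A solution may be given with some positive steady limit of its own; uniqueness of limits
    identifies it with the constructed profile. *)
Lemma conv_loc_unique u v U V U' V' : conv_loc N Rd u v U V -> conv_loc N Rd u v U' V' ->
  (forall z, clO N Rd z -> U z = U' z) /\ (forall z, clE N Rd z -> V z = V' z).
Proof.
  intros H1 H2.
  assert (Hz : forall z eps, 0 < eps -> exists t, 
    (clO N Rd z -> Rabs (u z t - U z) < eps /\ Rabs (u z t - U' z) < eps) /\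
    (clE N Rd z -> Rabs (v z t - V z) < eps /\ Rabs (v z t - V' z) < eps)).
  { intros z eps He. pose proof (rad_nonneg 0 N z) as Hr.
    assert (Hz : rad 0 N z <= sqrt (rad 0 N z) ^ 2) by (rewrite pow2_sqrt; lra).
    destruct (H1 (sqrt (rad 0 N z)) eps He) as [T1 HT1]. destruct (H2 (sqrt (rad 0 N z)) eps He) as [T2 HT2].
    exists (Rmax T1 T2). specialize (HT1 _ z (Rmax_l T1 T2) Hz). specialize (HT2 _ z (Rmax_r T1 T2) Hz).
    split; intros Hc; [split; [apply HT1|apply HT2]|split; [apply HT1|apply HT2]]; auto. }
  split; intros z Hc; apply cond_eq; intros eps He; destruct (Hz z (eps / 2) ltac:(lra)) as [t [H3 H4]].
  - destruct (H3 Hc) as [H5 H6]. apply Rabs_lt_between in H5. apply Rabs_lt_between in H6. apply Rabs_lt_between. lra.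
  - destruct (H4 Hc) as [H5 H6]. apply Rabs_lt_between in H5. apply Rabs_lt_between in H6. apply Rabs_lt_between. lra.
Qed.

Context (HK0 : BesselK_val ((INR N - 3) / 2) (sqrt (rho / d) * Rd) K0)
  (HK1 : BesselK_val ((INR N - 3) / 2 + 1) (sqrt (rho / d) * Rd) K1)
  (HE : principal_eig (N - 1) D Rd (kappa d rho mu nu K0 K1) beta2).

Lemma radial_setup : exists h A psi psi1 psi2 theta, radial_family m h A /\ 0 < theta /\
  principal_eig (N - 1) D Rd (mu * theta / (nu + theta)) beta2 /\
  (forall q, 0 < q -> continuity_pt psi2 q) /\
  (forall q, Rd ^ 2 <= q -> 0 < psi q <= 1) /\
  forall a, 0 < a <= 1 -> 0 <= robin m h A (mu * theta / (nu + theta)) a ->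
    profile m (jrad m h A a) (h a) psi psi1 psi2 theta (robin m h A (mu * theta / (nu + theta)) a).
Proof.
  destruct (radial_family_exists m main_ok) as [h [A HF]].
  destruct (exterior_profile N d Rd rho K0 K1 HN Hd HR Hrho HK0 HK1) as [H0 [H1 [psi [psi1 [psi2 [P1 [P2 [Pc [P3 [P4 [P5 P6]]]]]]]]]]].
  set (theta := sqrt (d * rho) * K1 / K0) in *.
  assert (Hs : 0 < sqrt (d * rho)) by (apply sqrt_lt_R0; apply Rmult_lt_0_compat; auto).
  assert (Hth : 0 < theta) by (apply Rdiv_lt_0_compat; auto; apply Rmult_lt_0_compat; auto).
  assert (0 < sqrt (d * rho) * K1) by (apply Rmult_lt_0_compat; auto).
  assert (0 < nu * K0) by (apply Rmult_lt_0_compat; auto).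
  assert (Ek : kappa d rho mu nu K0 K1 = mu * theta / (nu + theta)).
  { unfold kappa, theta. field. lra. }
  exists h, A, psi, psi1, psi2, theta. rewrite <- Ek at 1. repeat (split; [assumption|]).
  intros a Ha HFa. now apply (radial_profile m h A psi psi1 psi2 theta a main_ok).
Qed.

Lemma persistent_profile : beta2 < gp0 / D -> exists H h psi psi1 psi2 theta,
  profile m H h psi psi1 psi2 theta 0 /\
  (forall k, (k < N)%nat -> cont_on N (fun z t => Om N Rd z /\ 0 < t) (j2 H k)) /\
  (forall q, 0 < q -> continuity_pt psi2 q).
Proof.
  intros Hb. destruct radial_setup as [h [A [psi [psi1 [psi2 [theta [HF [Hth [HE' [Hc [_ Hp]]]]]]]]]]].
  assert (Hk : 0 < mu * theta / (nu + theta)) by (apply Rdiv_lt_0_compat; [apply Rmult_lt_0_compat|]; lra).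
  destruct (robin_nonpos_small m main_ok h A HF _ beta2 Hk HE' Hb) as [a0 [Ha0 H0]].
  destruct (robin_root m main_ok h A HF _ Hk a0 Ha0 H0) as [a [Ha HFa]].
  exists (jrad m h A a), (h a), psi, psi1, psi2, theta. split; [|split; auto].
  - rewrite <- HFa. apply Hp; lra.
  - intros k Hk'. now apply (jrad_2_cont m main_ok h A HF).
Qed.

Lemma extinction M U V : ~ beta2 < gp0 / D -> bsol m M U V -> conv0 N Rd (jw U) (jw V).
Proof.
  intros Hb [Hs [bU bV]] eps He. destruct radial_setup as [h [A [psi [psi1 [psi2 [theta [HF [Hth [HE' [Hc [Hpsi Hp]]]]]]]]]]].
  assert (Hk : 0 < mu * theta / (nu + theta)) by (apply Rdiv_lt_0_compat; [apply Rmult_lt_0_compat|]; lra).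
  set (r := mu / (theta + nu)). assert (Hr : 0 < r) by (apply Rdiv_lt_0_compat; lra).
  (* The limiting bounds, at most [a] inside and [r * a] outside, are then both at most
     [eps / 2]. *)
  set (a := Rmin 1 (eps / (2 * (1 + r)))).
  assert (He2 : 0 < eps / (2 * (1 + r))) by (apply Rdiv_lt_0_compat; lra).
  assert (Ha : 0 < a <= 1) by (split; [apply Rmin_glb_lt; lra|apply Rmin_l]).
  assert (Hae : (1 + r) * a <= eps / 2).
  { assert (a <= eps / (2 * (1 + r))) by apply Rmin_r.
    replace (eps / 2) with ((1 + r) * (eps / (2 * (1 + r)))) by (field; lra). apply Rmult_le_compat_l; lra. }
  pose proof (robin_pos m main_ok h A HF _ beta2 Hk HE' Hb a Ha) as HFa.
  specialize (Hp a Ha ltac:(lra)).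
  destruct (upper_limit m main_ok _ _ _ _ _ _ _ Hp ltac:(lra) M (eps / 4) ltac:(lra)) as [T [HT HU]].
  destruct (HU U V (conj Hs (conj bU bV)) T (Rle_refl T)) as [_ _].
  exists T. intros t z Ht. destruct (HU U V (conj Hs (conj bU bV)) t Ht) as [H1 H2].
  pose proof (h_range m main_ok h A HF a) as Hrange.
  split; intros Hz.
  - specialize (H1 z Hz). specialize (bU z t Hz ltac:(lra)). specialize (Hrange _ (rad_in m z Hz)). simpl dimN in *.
    rewrite Rabs_right by lra. assert (0 < r * a) by (apply Rmult_lt_0_compat; lra). lra.
  - specialize (H2 z Hz). specialize (bV z t Hz ltac:(lra)). simpl in H2. rewrite Rabs_right by lra.
    specialize (Hpsi (rad 1 N z)). assert (Hz' : Rd ^ 2 <= rad 1 N z) by (apply clE_iff in Hz; apply Hz). specialize (Hpsi Hz').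
    pose proof (pr_pos _ _ _ _ _ _ _ _ Hp) as Hh. simpl radR in Hh.
    specialize (Hrange (Rd ^ 2)). simpl radR in Hrange. specialize (Hrange ltac:(split; [apply pow2_ge_0|lra])).
    replace (mu * h a (Rd * (Rd * 1)) / (theta + nu)) with (r * h a (Rd ^ 2)) in H2 by (unfold r; simpl; field; lra).
    assert (r * h a (Rd ^ 2) * psi (rad 1 N z) <= r * h a (Rd ^ 2) * 1) by (apply Rmult_le_compat_l; [apply Rmult_le_pos|]; lra).
    assert (r * h a (Rd ^ 2) <= r * a) by (apply Rmult_le_compat_l; lra). lra.
Qed.

(** For the forward implication, convergence to a positive steady state and extinction contradict
    each other at the origin. *)
Lemma persistence_iff u0 v0 u v : init_ok N Rd u0 v0 -> solM N D d Rd mu nu rho g u0 v0 u v ->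
  ((exists U V, pos_ss N D d Rd mu nu rho g U V /\ conv_loc N Rd u v U V) <-> beta2 < gp0 / D) /\
  (~ (beta2 < gp0 / D) -> conv0 N Rd u v).
Proof.
  intros Hi Hs. destruct (solM_bsol u0 v0 u v Hi Hs) as [M [U [V [HM [Hb [<- [<- [Hnt _]]]]]]]].
  split; [split|].
  - intros [U' [V' [[_ [HU' _]] Hcv]]]. apply NNPP. intros Hno.
    pose proof (extinction M U V Hno Hb) as H0.
    assert (Hz : Om N Rd (fun _ => 0)).
    { split; [intros j _; auto|]. pose proof (origin_rad m) as E. simpl in E. rewrite E. apply pow_lt; auto. }
    specialize (HU' _ Hz).
    destruct (H0 (U' (fun _ => 0) / 2) ltac:(lra)) as [T1 HT1].
    destruct (Hcv 0 (U' (fun _ => 0) / 2) ltac:(lra)) as [T2 HT2].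
    specialize (HT1 (Rmax T1 T2) (fun _ => 0) (Rmax_l _ _)). specialize (HT2 (Rmax T1 T2) (fun _ => 0) (Rmax_r _ _)).
    destruct HT1 as [HT1 _]. specialize (HT1 (or_introl Hz)).
    destruct HT2 as [HT2 _].
    { rewrite rad_split by lia. pose proof (origin_rad m) as E. simpl in E. rewrite E. lra. }
    specialize (HT2 (or_introl Hz)). apply Rabs_lt_between in HT1. apply Rabs_lt_between in HT2. lra.
  - intros Hlt. destruct (persistent_profile Hlt) as [H [h [psi [psi1 [psi2 [theta [Hpr [H2c Hp2]]]]]]]].
    eexists _, _. split; [apply (profile_steady H h psi psi1 psi2 theta Hpr H2c Hp2)|].
    now apply (profile_conv_loc H h psi psi1 psi2 theta Hpr M).
  - intros Hno. now apply (extinction M).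
Qed.

(** The speed has to be chosen before any datum. If a nontrivial bounded solution with compactly
    supported datum exists, it serves as the reference; if there is none, no solution has to be
    tested and any positive number will do. *)
Lemma spreading_speed : beta2 < gp0 / D -> exists cs, 0 < cs /\
  forall u0 v0, init_ok N Rd u0 v0 -> compact_supp N u0 v0 ->
  forall u v, solM N D d Rd mu nu rho g u0 v0 u v ->
  forall U V, pos_ss N D d Rd mu nu rho g U V -> conv_loc N Rd u v U V ->
    (forall c, cs < c -> spread_out N Rd c u v) /\ (forall c, 0 < c < cs -> spread_in N Rd c u v U V).
Proof.
  intros Hlt. destruct (persistent_profile Hlt) as [H [h [psi [psi1 [psi2 [theta [Hpr [H2c Hp2]]]]]]]].
  destruct (classic (exists M1 U1 V1 r, 0 < M1 /\ bsol m M1 U1 V1 /\ supported m r U1 V1 /\ nontrivial m U1 V1))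
    as [[M1 [U1 [V1 [r [HM1 [Hb1 [Hs1 Hnt1]]]]]]]|Hno].
  - destruct (speed_exists m main_ok H h psi psi1 psi2 theta Hpr M1 U1 V1 r HM1 Hb1 Hs1 Hnt1) as [cs [Hcs Hall]].
    exists cs. split; auto. intros u0 v0 Hi Hcp u v Hs U' V' _ Hcv.
    destruct (solM_bsol u0 v0 u v Hi Hs) as [M [U [V [HM [Hb [<- [<- [Hnt Hsp]]]]]]]].
    destruct (Hsp Hcp) as [r' Hr']. destruct (Hall M U V r' HM Hb Hr' Hnt) as [Hout Hin].
    destruct (conv_loc_unique _ _ _ _ _ _ Hcv (profile_conv_loc H h psi psi1 psi2 theta Hpr M U V HM Hb Hnt)) as [EU EV].
    destruct Hb as [_ [bU bV]].
    split.
    + intros c Hc eps He. destruct (Hout c Hc eps He) as [T HT]. exists (Rmax T 0). intros t z Ht Hz.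
      pose proof (Rmax_l T 0). pose proof (Rmax_r T 0). destruct (HT t ltac:(lra)) as [HTu HTv].
      split; intros Hz'; [specialize (HTu z Hz' Hz); specialize (bU z t Hz' ltac:(lra))|specialize (HTv z Hz' Hz); specialize (bV z t Hz' ltac:(lra))];
        rewrite Rabs_right; lra.
    + intros c Hc r0 eps He. destruct (Hin c Hc eps He) as [T HT]. exists T. intros t z Ht Hz _.
      destruct (HT t Ht) as [H1 H2]. split; intros Hz'; [rewrite EU by auto; now apply H1|rewrite EV by auto; now apply H2].
  - exists 1. split; [lra|]. intros u0 v0 Hi Hcp u v Hs. exfalso. apply Hno.
    destruct (solM_bsol u0 v0 u v Hi Hs) as [M [U [V [HM [Hb [_ [_ [Hnt Hsp]]]]]]]].
    destruct (Hsp Hcp) as [r' Hr']. now exists M, U, V, r'.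
Qed.
End Main.

Theorem theorem1p3 (N : nat) (D d Rd mu nu rho : R) (g : R -> R) (gp0 : R)
  (K0 K1 beta2 : R) :
  (2 <= N)%nat -> 0 < D -> 0 < d -> 0 < Rd -> 0 < mu -> 0 < nu -> 0 < rho ->
  KPP g gp0 -> sKPP g ->
  BesselK_val ((INR N - 3) / 2) (sqrt (rho / d) * Rd) K0 ->
  BesselK_val ((INR N - 3) / 2 + 1) (sqrt (rho / d) * Rd) K1 ->
  principal_eig (N - 1) D Rd (kappa d rho mu nu K0 K1) beta2 ->
  (forall u0 v0, init_ok N Rd u0 v0 ->
   forall u v, solM N D d Rd mu nu rho g u0 v0 u v ->
     ((exists U V, pos_ss N D d Rd mu nu rho g U V /\ conv_loc N Rd u v U V)
        <-> beta2 < gp0 / D) /\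
     (~ (beta2 < gp0 / D) -> conv0 N Rd u v)) /\
  (beta2 < gp0 / D -> (D < d -> (N <= 5)%nat) ->
   exists cs, 0 < cs /\
     forall u0 v0, init_ok N Rd u0 v0 -> compact_supp N u0 v0 ->
     forall u v, solM N D d Rd mu nu rho g u0 v0 u v ->
     forall U V, pos_ss N D d Rd mu nu rho g U V -> conv_loc N Rd u v U V ->
       (forall c, cs < c -> spread_out N Rd c u v) /\
       (forall c, 0 < c < cs -> spread_in N Rd c u v U V)).
Proof.
  intros HN HD Hd HR Hmu Hnu Hrho Hg Hsg HK0 HK1 HE. split.
  - intros u0 v0 Hi u v Hs.
    now apply (persistence_iff N D d Rd mu nu rho g gp0 K0 K1 beta2 HN HD Hd HR Hmu Hnu Hrho Hg Hsg HK0 HK1 HE u0 v0).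
  - intros Hlt _.
    exact (spreading_speed N D d Rd mu nu rho g gp0 K0 K1 beta2 HN HD Hd HR Hmu Hnu Hrho Hg Hsg HK0 HK1 HE Hlt).
Qed.
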